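(* Let $X\subset\mathbb{P}^n$ be a standard determinantal scheme of codimension $c\ge2$ associated to a $t\times(t+c-1)$ homogeneous matrix $\mathcal{A}$, $t\ge2$, whose entries are general forms of positive degree. Let $I=I(X)=I_t(\mathcal{A})$, $A=R/I$, let $M$ be the cokernel of the graded morphism $\varphi:F\to G$ defined by $\mathcal{A}$, and let $$\cdots\to\bigoplus_jR(-n_{2j})\to\bigoplus_iR(-n_{1i})\to R\to A\to0$$ be the Eagon–Northcott (minimal free) resolution of $A$. For $-1\le i\le c-1$ put $\mathcal{N}_X(\mathcal{M}^i):=\mathcal{H}om_{\mathcal{O}_X}(\mathcal{I}_X/\mathcal{I}_X^2,\widetilde{S_iM})$. Assume $n\ge2c$ and $\max_j\{n_{2j}\}<2\cdot\min_i\{n_{1i}\}$. Then, for every $-1\le i\le c-1$, $$\operatorname{Hom}_{\mathcal{O}_X}\big(\mathcal{N}_X(\mathcal{M}^i),\mathcal{N}_X(\mathcal{M}^i)\big)\cong{}_0\!\operatorname{Hom}_A(I/I^2,I/I^2)\cong K.$$ In particular, the normal sheaf $\mathcal{N}_X$ and the sheaves $\mathcal{N}_X(\mathcal{M}^i)$ are simple, and thus indecomposable.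
   Context: $K$ is an algebraically closed field of characteristic $0$, $R=K[x_0,\dots,x_n]$ with its standard grading, $\mathbb{P}^n=\operatorname{Proj}(R)$, $I(X)$ is the saturated homogeneous ideal and $\mathcal{I}_X$ the ideal sheaf of $X$; $\mathcal{N}_X=\mathcal{H}om_{\mathcal{O}_X}(\mathcal{I}_X/\mathcal{I}_X^2,\mathcal{O}_X)=\mathcal{N}_X(\mathcal{M}^0)$. For a homogeneous matrix $\mathcal{A}$, $I_j(\mathcal{A})$ is the ideal of $R$ generated by its $j\times j$ minors. A codimension $c$ subscheme $X\subset\mathbb{P}^n$ is standard determinantal if $I(X)=I_t(\mathcal{A})$ for some $t\times(t+c-1)$ homogeneous matrix $\mathcal{A}$; $\mathcal{A}$ represents a graded (degree $0$) morphism $\varphi:F=\bigoplus_{j=1}^{t+c-1}R(-a_j)\to G=\bigoplus_{i=1}^tR(-b_i)$, so the $(i,j)$ entry has degree $a_j-b_i$. ''General forms'' means that the matrix belongs to a suitable non-empty Zariski open subset of the space of matrices with the given entry degrees. $S_iM$ is the $i$-th symmetric power of the $A$-module $M$, $S_0M=A$, $S_{-1}M:=\operatorname{Hom}_A(M,A)$. ${}_0\!\operatorname{Hom}_A$ is the degree-$0$ part of the graded Hom module. A sheaf $\mathcal{E}$ is simple if $\operatorname{Hom}(\mathcal{E},\mathcal{E})\cong K$. *)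

(* Defs.v *)
From HB Require Import structures.
From mathcomp Require Import all_boot all_order all_algebra perm.
From mathcomp Require Import boolp mpoly ring.

Set Implicit Arguments.
Unset Strict Implicit.
Unset Printing Implicit Defensive.

Import GRing.Theory Num.Theory.
Local Open Scope ring_scope.
Local Open Scope quotient_scope.

Record submod (R : pzRingType) (V : lmodType R) := Submod {
  in_submod :> V -> Prop;
  submod0 : in_submod 0;
  submodD : forall x y, in_submod x -> in_submod y -> in_submod (x + y);
  submodZ : forall a x, in_submod x -> in_submod (a *: x) }.

Section SubmodTheory.
Variables (R : pzRingType) (V : lmodType R).

Lemma submodN (W : submod V) x : W x -> W (- x).
Proof. by move=> Wx; rewrite -scaleN1r; apply: submodZ. Qed.

Lemma submodB (W : submod V) x y : W x -> W y -> W (x - y).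
Proof. by move=> Wx Wy; apply: submodD => //; apply: submodN. Qed.

Definition span_pred (E : V -> Prop) (v : V) : Prop :=
  forall W : submod V, (forall x, E x -> W x) -> W v.

Fact span_subproof0 E : span_pred E 0.
Proof. by move=> W _; apply: submod0. Qed.
Fact span_subproofD E x y :
  span_pred E x -> span_pred E y -> span_pred E (x + y).
Proof. by move=> Ex Ey W EW; apply: submodD; [apply: Ex|apply: Ey]. Qed.
Fact span_subproofZ E a x : span_pred E x -> span_pred E (a *: x).
Proof. by move=> Ex W EW; apply: submodZ; apply: Ex. Qed.

Definition span (E : V -> Prop) : submod V :=
  Submod (@span_subproof0 E) (@span_subproofD E) (@span_subproofZ E).

Lemma span_gen (E : V -> Prop) x : E x -> span E x.
Proof. by move=> Ex W; apply. Qed.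

End SubmodTheory.

Section SubModule.
Variables (R : pzRingType) (V : lmodType R) (W : submod V).

Definition subpred : pred V := fun x => `[< W x >].

Fact subpred_submod_closed : submod_closed subpred.
Proof.
split; first by apply/asboolP; apply: submod0.
move=> a x y /asboolP Wx /asboolP Wy; apply/asboolP.
by apply: submodD => //; apply: submodZ.
Qed.
HB.instance Definition _ :=
  GRing.isSubmodClosed.Build R V subpred subpred_submod_closed.

Record submod_type := SubmodElt { sm_val :> V; sm_valP : sm_val \in subpred }.
HB.instance Definition _ := [isSub for sm_val].
HB.instance Definition _ := [Choice of submod_type by <:].
HB.instance Definition _ := [SubChoice_isSubLmodule of submod_type by <:].

Lemma sm_valW (x : submod_type) : W x.
Proof. by case: x => x /= /asboolP. Qed.

End SubModule.

Section QuotientModule.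
Variables (R : pzRingType) (V : lmodType R) (W : submod V).

Definition quot_rel (x y : V) : bool := `[< W (x - y) >].

Fact quot_rel_refl : reflexive quot_rel.
Proof. by move=> x; apply/asboolP; rewrite subrr; apply: submod0. Qed.
Fact quot_rel_sym : ssrbool.symmetric quot_rel.
Proof.
by move=> x y; apply/asboolP/asboolP => /submodN; rewrite opprB.
Qed.
Fact quot_rel_trans : transitive quot_rel.
Proof.
move=> y x z /asboolP h1 /asboolP h2; apply/asboolP.
by rewrite -(subrK y x) -addrA; apply: submodD.
Qed.
Canonical quot_equiv := EquivRel quot_rel quot_rel_refl quot_rel_sym
  quot_rel_trans.

Definition quot := {eq_quot quot_equiv}.
HB.instance Definition _ := Choice.on quot.
HB.instance Definition _ := EqQuotient.on quot.

Definition quot_pi (x : V) : quot := \pi_quot x.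

Lemma quot_piP x y : quot_pi x = quot_pi y <-> W (x - y).
Proof.
split=> [/eqmodP /asboolP//|h]; apply/eqmodP; exact/asboolP.
Qed.

Lemma quot_piE (q : quot) : quot_pi (repr q) = q.
Proof. exact: reprK. Qed.

Lemma quot_ind (P : quot -> Prop) : (forall x, P (quot_pi x)) -> forall q, P q.
Proof. by move=> h q; rewrite -(quot_piE q). Qed.

Definition quot_add (x y : quot) : quot := quot_pi (repr x + repr y).
Definition quot_opp (x : quot) : quot := quot_pi (- repr x).
Definition quot_scale (a : R) (x : quot) : quot := quot_pi (a *: repr x).

Lemma quot_reprB x : W (repr (quot_pi x) - x).
Proof. by apply/quot_piP; rewrite quot_piE. Qed.

Lemma quot_addE x y : quot_add (quot_pi x) (quot_pi y) = quot_pi (x + y).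
Proof.
by apply/quot_piP; rewrite opprD addrACA; apply: submodD; apply: quot_reprB.
Qed.
Lemma quot_oppE x : quot_opp (quot_pi x) = quot_pi (- x).
Proof. by apply/quot_piP; rewrite -opprD; apply/submodN/quot_reprB. Qed.
Lemma quot_scaleE a x : quot_scale a (quot_pi x) = quot_pi (a *: x).
Proof. by apply/quot_piP; rewrite -scalerBr; apply/submodZ/quot_reprB. Qed.

Fact quot_addA : associative quot_add.
Proof.
elim/quot_ind=> x; elim/quot_ind=> y; elim/quot_ind=> z.
by rewrite !quot_addE addrA.
Qed.
Fact quot_addC : commutative quot_add.
Proof. by elim/quot_ind=> x; elim/quot_ind=> y; rewrite !quot_addE addrC. Qed.
Fact quot_add0 : left_id (quot_pi 0) quot_add.
Proof. by elim/quot_ind=> x; rewrite quot_addE add0r. Qed.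
Fact quot_addN : left_inverse (quot_pi 0) quot_opp quot_add.
Proof. by elim/quot_ind=> x; rewrite quot_oppE quot_addE addNr. Qed.
HB.instance Definition _ :=
  GRing.isZmodule.Build quot quot_addA quot_addC quot_add0 quot_addN.

Fact quot_scaleA a b v :
  quot_scale a (quot_scale b v) = quot_scale (a * b) v.
Proof. by elim/quot_ind: v => x; rewrite !quot_scaleE scalerA. Qed.
Fact quot_scale1 : left_id 1 quot_scale.
Proof. by elim/quot_ind=> x; rewrite quot_scaleE scale1r. Qed.
Fact quot_scaleDr : right_distributive quot_scale +%R.
Proof.
move=> a; elim/quot_ind=> x; elim/quot_ind=> y.
by rewrite [_ + _]quot_addE !quot_scaleE scalerDr [RHS]quot_addE.
Qed.
Fact quot_scaleDl v : {morph quot_scale^~ v : a b / a + b}.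
Proof.
by elim/quot_ind: v => x a b; rewrite !quot_scaleE scalerDl [RHS]quot_addE.
Qed.
HB.instance Definition _ := GRing.Zmodule_isLmodule.Build R quot
  quot_scaleA quot_scale1 quot_scaleDr quot_scaleDl.

Lemma quot_pi_linear : linear quot_pi.
Proof.
move=> a x y.
by rewrite [a *: quot_pi x]quot_scaleE [RHS]quot_addE.
Qed.
HB.instance Definition _ := GRing.isLinear.Build R V quot *:%R quot_pi
  quot_pi_linear.

End QuotientModule.

Notation ideal R := (submod R^o).

Section QuotientRing.
Variables (R : comPzRingType) (I : ideal R).

Definition qring := quot I.
HB.instance Definition _ := GRing.Zmodule.on qring.

Definition qring_pi (x : R) : qring := quot_pi I (x : R^o).
Definition qring_mul (x y : qring) : qring := qring_pi (repr x * repr y).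

Lemma qring_mulE x y : qring_mul (qring_pi x) (qring_pi y) = qring_pi (x * y).
Proof.
apply/quot_piP.
set x' := repr _; set y' := repr _.
have -> : (x' * y' : R) - x * y = (x' * (y' - y) + y * (x' - x) : R).
  by rewrite !mulrBr (mulrC y x') (mulrC y x) [RHS]addrA subrK.
by apply: submodD; apply: submodZ; apply: quot_reprB.
Qed.

Lemma qring_ind (P : qring -> Prop) :
  (forall x, P (qring_pi x)) -> forall q, P q.
Proof. by move=> h q; apply: (@quot_ind R R^o I P). Qed.

Lemma qring_piB : {morph qring_pi : x y / x - y}.
Proof. by move=> x y; rewrite /qring_pi (raddfB (quot_pi I)). Qed.

Lemma qring_piD : {morph qring_pi : x y / x + y}.
Proof. by move=> x y; rewrite /qring_pi (raddfD (quot_pi I)). Qed.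

Fact qring_mulA : associative qring_mul.
Proof.
elim/qring_ind=> x; elim/qring_ind=> y; elim/qring_ind=> z.
by rewrite !qring_mulE mulrA.
Qed.
Fact qring_mulC : commutative qring_mul.
Proof.
by elim/qring_ind=> x; elim/qring_ind=> y; rewrite !qring_mulE mulrC.
Qed.
Fact qring_mul1 : left_id (qring_pi 1) qring_mul.
Proof. by elim/qring_ind=> x; rewrite qring_mulE mul1r. Qed.
Fact qring_mulDl : left_distributive qring_mul +%R.
Proof.
elim/qring_ind=> x; elim/qring_ind=> y; elim/qring_ind=> z.
by rewrite -qring_piD !qring_mulE mulrDl qring_piD.
Qed.
HB.instance Definition _ := GRing.Zmodule_isComPzRing.Build qring
  qring_mulA qring_mulC qring_mul1 qring_mulDl.

Fact qring_pi_zmod_morphism : zmod_morphism qring_pi.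
Proof. exact: qring_piB. Qed.
HB.instance Definition _ := GRing.isZmodMorphism.Build R qring qring_pi
  qring_pi_zmod_morphism.
Fact qring_pi_monoid_morphism : monoid_morphism qring_pi.
Proof. by split=> // x y; rewrite -qring_mulE. Qed.
HB.instance Definition _ := GRing.isMonoidMorphism.Build R qring qring_pi
  qring_pi_monoid_morphism.

End QuotientRing.

(* An R-module killed by I, seen as a module over R/I. *)
Section Descent.
Variables (R : comPzRingType) (I : ideal R) (V : lmodType R).
Definition killed_by := forall (a : R) (v : V), I a -> a *: v = 0.
Hypothesis IV : killed_by.

Definition descent of killed_by : Type := V.
HB.instance Definition _ := GRing.Zmodule.on (descent IV).

Definition descent_scale (a : qring I) (v : descent IV) : descent IV :=
  (repr a : R) *: (v : V).

Lemma descent_scaleE (a : R) (v : V) :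
  descent_scale (qring_pi I a) v = a *: v :> V.
Proof.
apply/eqP; rewrite -subr_eq0 -scalerBl; apply/eqP; apply: IV.
exact: quot_reprB.
Qed.

Fact descent_scaleA a b v :
  descent_scale a (descent_scale b v) = descent_scale (a * b) v.
Proof.
elim/qring_ind: a => a; elim/qring_ind: b => b.
by rewrite -rmorphM !descent_scaleE scalerA.
Qed.
Fact descent_scale1 : left_id 1 descent_scale.
Proof. by move=> v; rewrite -(rmorph1 (qring_pi I)) descent_scaleE scale1r. Qed.
Fact descent_scaleDr : right_distributive descent_scale +%R.
Proof. by move=> a v w; rewrite /descent_scale scalerDr. Qed.
Fact descent_scaleDl v : {morph descent_scale^~ v : a b / a + b}.
Proof.
elim/qring_ind => a; elim/qring_ind => b.
by rewrite -rmorphD !descent_scaleE scalerDl.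
Qed.
HB.instance Definition _ := GRing.Zmodule_isLmodule.Build (qring I) (descent IV)
  descent_scaleA descent_scale1 descent_scaleDr descent_scaleDl.
End Descent.

Section RestrictScalars.
Variables (K S : pzRingType) (f : {rmorphism K -> S}) (V : lmodType S).
Definition restr of {rmorphism K -> S} : Type := V.
HB.instance Definition _ := GRing.Zmodule.on (restr f).
Definition restr_scale (a : K) (v : restr f) : restr f := f a *: (v : V).
Fact restr_scaleA a b v : restr_scale a (restr_scale b v) = restr_scale (a * b) v.
Proof. by rewrite /restr_scale scalerA rmorphM. Qed.
Fact restr_scale1 : left_id 1 restr_scale.
Proof. by move=> v; rewrite /restr_scale rmorph1 scale1r. Qed.
Fact restr_scaleDr : right_distributive restr_scale +%R.
Proof. by move=> a v w; rewrite /restr_scale scalerDr. Qed.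
Fact restr_scaleDl v : {morph restr_scale^~ v : a b / a + b}.
Proof. by move=> a b; rewrite /restr_scale rmorphD scalerDl. Qed.
HB.instance Definition _ := GRing.Zmodule_isLmodule.Build K (restr f)
  restr_scaleA restr_scale1 restr_scaleDr restr_scaleDl.
End RestrictScalars.

Section DepFun.
Variables (R : pzRingType) (T : Type) (V : T -> lmodType R).
Definition depfun := forall t, V t.
HB.instance Definition _ := gen_eqMixin depfun.
HB.instance Definition _ := gen_choiceMixin depfun.
Definition depfun_add (f g : depfun) : depfun := fun t => f t + g t.
Definition depfun_opp (f : depfun) : depfun := fun t => - f t.
Definition depfun_zero : depfun := fun t => 0.
Definition depfun_scale (a : R) (f : depfun) : depfun := fun t => a *: f t.

Fact depfun_addA : associative depfun_add.
Proof. by move=> f g h; apply: functional_extensionality_dep => t; apply: addrA. Qed.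
Fact depfun_addC : commutative depfun_add.
Proof. by move=> f g; apply: functional_extensionality_dep => t; apply: addrC. Qed.
Fact depfun_add0 : left_id depfun_zero depfun_add.
Proof. by move=> f; apply: functional_extensionality_dep => t; apply: add0r. Qed.
Fact depfun_addN : left_inverse depfun_zero depfun_opp depfun_add.
Proof. by move=> f; apply: functional_extensionality_dep => t; apply: addNr. Qed.
HB.instance Definition _ := GRing.isZmodule.Build depfun
  depfun_addA depfun_addC depfun_add0 depfun_addN.

Fact depfun_scaleA a b v :
  depfun_scale a (depfun_scale b v) = depfun_scale (a * b) v.
Proof. by apply: functional_extensionality_dep => t; apply: scalerA. Qed.
Fact depfun_scale1 : left_id 1 depfun_scale.
Proof. by move=> v; apply: functional_extensionality_dep => t; apply: scale1r. Qed.
Fact depfun_scaleDr : right_distributive depfun_scale +%R.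
Proof.
by move=> a v w; apply: functional_extensionality_dep => t; apply: scalerDr.
Qed.
Fact depfun_scaleDl v : {morph depfun_scale^~ v : a b / a + b}.
Proof.
by move=> a b; apply: functional_extensionality_dep => t; apply: scalerDl.
Qed.
HB.instance Definition _ := GRing.Zmodule_isLmodule.Build R depfun
  depfun_scaleA depfun_scale1 depfun_scaleDr depfun_scaleDl.
End DepFun.

Section HomModule.
Variables (S : comPzRingType) (U V : lmodType S).

Local Notation funs := (depfun (fun _ : U => V)).

Fact hom_subproof0 : linear (0 : funs).
Proof. by move=> a x y; rewrite /= [LHS](_ : _ = 0) // scaler0 addr0. Qed.
Fact hom_subproofD (f g : funs) : linear f -> linear g -> linear (f + g : funs).
Proof.
move=> lf lg a x y; change (f (a *: x + y) + g (a *: x + y) =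
  a *: (f x + g x) + (f y + g y)).
by rewrite lf lg scalerDr addrACA.
Qed.
Fact hom_subproofZ b (f : funs) : linear f -> linear (b *: f : funs).
Proof.
move=> lf a x y; change (b *: f (a *: x + y) = a *: (b *: f x) + b *: f y).
by rewrite lf scalerDr !scalerA mulrC.
Qed.
Definition hom_submod : submod funs :=
  @Submod S funs (fun f : funs => linear f) hom_subproof0 hom_subproofD hom_subproofZ.
Definition hom := submod_type hom_submod.
HB.instance Definition _ := GRing.Lmodule.on hom.

Definition hom_fun (f : hom) : U -> V := sm_val f.
End HomModule.

Section FreeModule.
Variables (S : pzRingType) (X : eqType).
Local Notation funs := (depfun (fun _ : X => S^o)).
Definition finsupp (f : funs) : Prop :=
  exists s : seq X, forall x, x \notin s -> f x = 0.
Fact finsupp0 : finsupp 0. Proof. by exists [::]. Qed.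
Fact finsuppD f g : finsupp f -> finsupp g -> finsupp (f + g).
Proof.
move=> [s fs] [r gr]; exists (s ++ r) => x.
rewrite mem_cat negb_or => /andP[/fs fx /gr gx].
by rewrite [LHS](_ : _ = f x + g x) // fx gx addr0.
Qed.
Fact finsuppZ a f : finsupp f -> finsupp (a *: f).
Proof.
move=> [s fs]; exists s => x /fs fx.
by rewrite [LHS](_ : _ = a *: f x) // fx scaler0.
Qed.
Definition free_mod := submod_type (Submod finsupp0 finsuppD finsuppZ).
HB.instance Definition _ := GRing.Lmodule.on free_mod.

Fact basis_subproof (x : X) :
  ((fun y => (y == x)%:R) : funs) \in
    subpred (Submod finsupp0 finsuppD finsuppZ).
Proof.
apply/asboolP; exists [:: x] => y /=.
by rewrite inE => /negbTE ->.
Qed.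
Definition basis_elt (x : X) : free_mod := SubmodElt (basis_subproof x).
End FreeModule.

(* The i-th symmetric power of M over S: the free S-module on the symbols
   v_1 ... v_i modulo multilinearity and symmetry. *)
Section SymmetricPower.
Variables (S : comPzRingType) (M : lmodType S) (i : nat).
Local Notation word := {ffun 'I_i -> M}.

Definition put (v : word) (k : 'I_i) (x : M) : word :=
  [ffun l => if l == k then x else v l].

Definition sym_relator (r : free_mod S word) : Prop :=
  (exists (v : word) (k : 'I_i) (a : S) (x y : M),
     r = basis_elt S (put v k (a *: x + y))
         - (a *: basis_elt S (put v k x) + basis_elt S (put v k y)))
  \/ (exists (v : word) (s : {perm 'I_i}),
     r = basis_elt S [ffun k => v (s k)] - basis_elt S v).

Definition sympow := quot (span sym_relator).
HB.instance Definition _ := GRing.Lmodule.on sympow.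

Definition sym_mon (v : word) : sympow :=
  quot_pi (span sym_relator) (basis_elt S v).
End SymmetricPower.

(* A graded object is carried with its homogeneous pieces; the existence and
   uniqueness of the decomposition into homogeneous components plays no role
   in the constructions below. *)
Record gralg (K : pzRingType) := Gralg {
  ga_ring :> comPzRingType;
  ga_scal : {rmorphism K -> ga_ring};
  ga_deg : int -> ga_ring -> Prop;
  ga_deg0 : forall d, ga_deg d 0;
  ga_degB : forall d x y, ga_deg d x -> ga_deg d y -> ga_deg d (x - y);
  ga_degM : forall d e x y, ga_deg d x -> ga_deg e y -> ga_deg (d + e) (x * y);
  ga_deg_scal : forall k, ga_deg 0 (ga_scal k) }.
Arguments ga_scal {K} g.
Arguments ga_deg {K g} d x.

Record grmod (K : pzRingType) (S : gralg K) := Grmod {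
  gm_mod :> lmodType S;
  gm_deg : int -> gm_mod -> Prop;
  gm_deg0 : forall d, gm_deg d 0;
  gm_degB : forall d x y, gm_deg d x -> gm_deg d y -> gm_deg d (x - y);
  gm_degZ : forall d e a x, ga_deg d a -> gm_deg e x -> gm_deg (d + e) (a *: x) }.
Arguments gm_deg {K S g} d x.

Section GradedTheory.
Variables (K : pzRingType) (S : gralg K).

Lemma ga_deg1 : ga_deg 0 (1 : S).
Proof. by rewrite -(rmorph1 (ga_scal S)); apply: ga_deg_scal. Qed.

Lemma gm_degN (M : grmod S) d (x : M) : gm_deg d x -> gm_deg d (- x).
Proof. by move=> hx; rewrite -sub0r; apply: gm_degB => //; apply: gm_deg0. Qed.

Lemma gm_degD (M : grmod S) d (x y : M) :
  gm_deg d x -> gm_deg d y -> gm_deg d (x + y).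
Proof. by move=> hx hy; rewrite -[y]opprK; apply: gm_degB => //; apply: gm_degN. Qed.

Definition gself : grmod S :=
  @Grmod K S S^o (@ga_deg K S) (@ga_deg0 K S) (@ga_degB K S) (@ga_degM K S).

(* Hom_S(M, N); a homomorphism of degree d raises degrees by d. *)
Section GradedHom.
Variables M N : grmod S.
Definition ghom_deg (d : int) (f : hom M N) : Prop :=
  forall e x, gm_deg e x -> gm_deg (d + e) (hom_fun f x).
Fact ghom_deg0 d : ghom_deg d 0.
Proof. by move=> e x _; apply: gm_deg0. Qed.
Fact ghom_degB d f g : ghom_deg d f -> ghom_deg d g -> ghom_deg d (f - g).
Proof. by move=> hf hg e x hx; apply: gm_degB; [apply: hf|apply: hg]. Qed.
Fact ghom_degZ d e a f :
  ga_deg d a -> ghom_deg e f -> ghom_deg (d + e) (a *: f).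
Proof. by move=> ha hf e' x hx; rewrite -addrA; apply: gm_degZ => //; apply: hf. Qed.
Definition ghom : grmod S := Grmod ghom_deg0 ghom_degB ghom_degZ.

Let homK : lmodType K := restr (hom M N) (ga_scal S).
Fact hom0_subproofD (f g : homK) :
  ghom_deg 0 f -> ghom_deg 0 g -> ghom_deg 0 (f + g).
Proof. exact: (@gm_degD ghom). Qed.
Fact hom0_subproofZ k (f : homK) : ghom_deg 0 f -> ghom_deg 0 (k *: f).
Proof.
by move=> hf; have := ghom_degZ (ga_deg_scal S k) hf; rewrite addr0.
Qed.
Definition hom0_submod : submod homK :=
  @Submod K homK (ghom_deg 0) (ghom_deg0 0) hom0_subproofD hom0_subproofZ.
Definition hom0 := submod_type hom0_submod.
HB.instance Definition _ := GRing.Lmodule.on hom0.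
End GradedHom.

(* The piece of degree d of the i-th symmetric power is the additive group
   spanned by the a v_1 ... v_i with homogeneous factors of total degree d. *)
Section GradedSympow.
Variables (M : grmod S) (i : nat).

Definition hom_mon (d : int) (w : sympow M i) : Prop :=
  exists (e : int) (a : S) (f : 'I_i -> int) (v : {ffun 'I_i -> M}),
    [/\ ga_deg e a, forall k, gm_deg (f k) (v k), e + \sum_k f k = d
      & w = a *: sym_mon v].

Definition sympow_deg (d : int) (w : sympow M i) : Prop :=
  exists s : seq (sympow M i),
    (forall x, x \in s -> hom_mon d x) /\ w = \sum_(x <- s) x.

Fact sympow_deg0 d : sympow_deg d 0.
Proof. by exists [::]; rewrite big_nil. Qed.
Fact sympow_degB d x y :
  sympow_deg d x -> sympow_deg d y -> sympow_deg d (x - y).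
Proof.
move=> [s [hs ->]] [r [hr ->]]; exists (s ++ [seq - z | z <- r]); split.
  move=> z; rewrite mem_cat => /orP[/hs//|/mapP[u /hr hu ->]].
  case: hu => e [a [f [v [ha hv hd ->]]]].
  exists e, (- a), f, v; split=> //; last by rewrite scaleNr.
  by rewrite -sub0r; apply: ga_degB => //; apply: ga_deg0.
by rewrite big_cat big_map /= sumrN.
Qed.
Fact sympow_degZ d e a x :
  ga_deg d a -> sympow_deg e x -> sympow_deg (d + e) (a *: x).
Proof.
move=> ha [s [hs ->]]; exists [seq a *: z | z <- s]; split.
  move=> z /mapP[u /hs hu ->].
  case: hu => e' [b [f [v [hb hv hd ->]]]].
  exists (d + e'), (a * b), f, v; split=> //; last by rewrite scalerA.
  - exact: ga_degM.
  - by rewrite -addrA hd.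
by rewrite big_map scaler_sumr.
Qed.
Definition gsympow : grmod S := Grmod sympow_deg0 sympow_degB sympow_degZ.
End GradedSympow.

(* S_i M, where S_0 M is S and S_{-1} M is the dual of M (i >= -1). *)
Definition sym_pow (M : grmod S) (i : int) : grmod S :=
  match i with
  | Posz 0 => gself
  | Posz k => gsympow M k
  | Negz _ => ghom M gself
  end.

End GradedTheory.

Section Proj.
Variables (K : pzRingType) (S : gralg K).

Definition homogeneous (x : S) : Prop := exists d, ga_deg d x.

Record proj_point := ProjPoint {
  pt_ideal :> ideal S;
  pt_proper : ~ pt_ideal 1;
  pt_prime : forall x y : S, pt_ideal (x * y) -> pt_ideal x \/ pt_ideal y;
  pt_homog : forall x : S, pt_ideal x ->
    span (fun y : S^o => pt_ideal y /\ homogeneous y) x;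
  pt_relevant : exists (d : int) (x : S), [/\ 0 < d, ga_deg d x & ~ pt_ideal x] }.

Definition zariski (U : proj_point -> Prop) : Prop :=
  exists E : S -> Prop, (forall f, E f -> homogeneous f) /\
    forall p : proj_point, U p <-> exists f, E f /\ ~ p f.

Record popen := Popen { po_pred :> proj_point -> Prop; po_open : zariski po_pred }.

Definition psub (V U : popen) : Prop := forall p, V p -> U p.

Lemma psub_refl U : psub U U. Proof. by []. Qed.
Lemma psub_trans W V U : psub W V -> psub V U -> psub W U.
Proof. by move=> h1 h2 p /h1 /h2. Qed.

Fact whole_subproof : zariski (fun _ => True).
Proof.
exists (fun f => f = 1); split=> [f ->|p]; first by exists 0; apply: ga_deg1.
by split=> // _; exists 1; split=> //; apply: pt_proper.
Qed.
Definition whole : popen := Popen whole_subproof.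

Fact pcap_subproof (U V : popen) : zariski (fun p => U p /\ V p).
Proof.
case: (po_open U) => E [hE UE]; case: (po_open V) => F [hF VF].
exists (fun f => exists g h, [/\ E g, F h & f = g * h]); split.
  move=> _ [g [h [/hE [d hd] /hF [e he] ->]]].
  by exists (d + e); apply: ga_degM.
move=> p; rewrite UE VF; split.
  move=> [[g [Eg pg]] [h [Fh ph]]]; exists (g * h); split; first by exists g, h.
  by case/pt_prime.
move=> [_ [[g [h [Eg Fh ->]]] pgh]]; split.
  by exists g; split=> // pg; apply: pgh; rewrite mulrC; apply: (submodZ (s := p)).
by exists h; split=> // ph; apply: pgh; apply: (submodZ (s := p)).
Qed.
Definition pcap (U V : popen) : popen := Popen (pcap_subproof U V).
Lemma pcapl U V : psub (pcap U V) U. Proof. by move=> p []. Qed.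
Lemma pcapr U V : psub (pcap U V) V. Proof. by move=> p []. Qed.

Section Localisation.
Variables (M : grmod S) (p : proj_point).

Record frac := Frac {
  fr_deg : int; fr_num : M; fr_den : S;
  fr_numP : gm_deg fr_deg fr_num;
  fr_denP : ga_deg fr_deg fr_den;
  fr_den_out : ~ p fr_den }.
HB.instance Definition _ := gen_eqMixin frac.
HB.instance Definition _ := gen_choiceMixin frac.

Definition frac_rel (x y : frac) : bool :=
  `[< exists u, [/\ homogeneous u, ~ p u &
        u *: (fr_den y *: fr_num x) = u *: (fr_den x *: fr_num y)] >].

Lemma out_mul (x y : S) : ~ p x -> ~ p y -> ~ p (x * y).
Proof. by move=> hx hy /pt_prime []. Qed.
Lemma homogM (x y : S) : homogeneous x -> homogeneous y -> homogeneous (x * y).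
Proof. by move=> [d hd] [e he]; exists (d + e); apply: ga_degM. Qed.
Lemma homog1 : homogeneous 1. Proof. by exists 0; apply: ga_deg1. Qed.

Fact frac_refl : reflexive frac_rel.
Proof. by move=> x; apply/asboolP; exists 1; split=> //; [apply: homog1|apply: pt_proper]. Qed.
Fact frac_sym : ssrbool.symmetric frac_rel.
Proof. by move=> x y; apply/asboolP/asboolP => -[u [h1 h2 h3]]; exists u. Qed.
Fact frac_trans : transitive frac_rel.
Proof.
move=> y x z /asboolP [u [hu pu e1]] /asboolP [v [hv pv e2]]; apply/asboolP.
exists (u * v * fr_den y); split.
- by apply: homogM; [exact: homogM|exists (fr_deg y); apply: fr_denP].
- by apply: out_mul; [exact: out_mul|exact: fr_den_out].
have := congr1 (fun w => (v * fr_den z) *: w) e1.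
have := congr1 (fun w => (u * fr_den x) *: w) e2.
rewrite !scalerA => e2' e1'.
transitivity ((v * fr_den z * u * fr_den y) *: fr_num x).
  by congr (_ *: _); ring.
rewrite e1'; transitivity ((u * fr_den x * v * fr_den z) *: fr_num y).
  by congr (_ *: _); ring.
by rewrite e2'; congr (_ *: _); ring.
Qed.
Canonical frac_equiv := EquivRel frac_rel frac_refl frac_sym frac_trans.

Definition loc := {eq_quot frac_equiv}.
HB.instance Definition _ := Choice.on loc.

Definition loc_pi (x : frac) : loc := \pi_loc x.

Lemma loc_piP x y : loc_pi x = loc_pi y <->
  exists u, [/\ homogeneous u, ~ p u &
        u *: (fr_den y *: fr_num x) = u *: (fr_den x *: fr_num y)].
Proof.
split=> [/eqmodP /asboolP//|h]; apply/eqmodP; exact/asboolP.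
Qed.
Lemma loc_piE x : loc_pi (repr x) = x. Proof. exact: reprK. Qed.
Lemma loc_ind (P : loc -> Prop) : (forall x, P (loc_pi x)) -> forall q, P q.
Proof. by move=> h q; rewrite -(loc_piE q). Qed.
Lemma loc_repr x : exists u, [/\ homogeneous u, ~ p u &
  u *: (fr_den x *: fr_num (repr (loc_pi x))) =
  u *: (fr_den (repr (loc_pi x)) *: fr_num x)].
Proof. by apply/loc_piP; rewrite loc_piE. Qed.

Fact frac_addP1 (x y : frac) : gm_deg (fr_deg x + fr_deg y)
  (fr_den y *: fr_num x + fr_den x *: fr_num y).
Proof.
apply: gm_degD.
  by rewrite addrC; apply: gm_degZ; [apply: fr_denP|apply: fr_numP].
by apply: gm_degZ; [apply: fr_denP|apply: fr_numP].
Qed.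
Fact frac_addP2 (x y : frac) :
  ga_deg (fr_deg x + fr_deg y) (fr_den x * fr_den y).
Proof. by apply: ga_degM; apply: fr_denP. Qed.
Fact frac_addP3 (x y : frac) : ~ p (fr_den x * fr_den y).
Proof. by apply: out_mul; apply: fr_den_out. Qed.
Definition frac_add (x y : frac) : frac :=
  Frac (frac_addP1 x y) (frac_addP2 x y) (@frac_addP3 x y).
Definition frac_opp (x : frac) : frac :=
  Frac (gm_degN (fr_numP x)) (fr_denP x) (@fr_den_out x).
Definition frac_zero : frac := Frac (gm_deg0 M 0) (ga_deg1 S) (@pt_proper p).

Definition loc_add (x y : loc) : loc := loc_pi (frac_add (repr x) (repr y)).
Definition loc_opp (x : loc) : loc := loc_pi (frac_opp (repr x)).

Lemma loc_addE x y : loc_add (loc_pi x) (loc_pi y) = loc_pi (frac_add x y).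
Proof.
apply/loc_piP => /=.
case: (loc_repr x) (loc_repr y); set x' := repr _; set y' := repr _.
move=> u [hu pu e1] [v [hv pv e2]]; exists (u * v); split.
- exact: homogM.
- exact: out_mul.
have e1' := congr1 (fun w => (v * fr_den y * fr_den y') *: w) e1.
have e2' := congr1 (fun w => (u * fr_den x * fr_den x') *: w) e2.
rewrite !scalerDr !scalerA in e1' e2' *; congr (_ + _).
  transitivity ((v * fr_den y * fr_den y' * u * fr_den x) *: fr_num x').
    by congr (_ *: _); ring.
  rewrite -!scalerA in e1' *; rewrite e1'.
  by rewrite !scalerA; congr (_ *: _); ring.
transitivity ((u * fr_den x * fr_den x' * v * fr_den y) *: fr_num y').
  by congr (_ *: _); ring.
rewrite -!scalerA in e2' *; rewrite e2'.
by rewrite !scalerA; congr (_ *: _); ring.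
Qed.
Lemma loc_oppE x : loc_opp (loc_pi x) = loc_pi (frac_opp x).
Proof.
apply/loc_piP => /=; case: (loc_repr x) => u [hu pu e]; exists u; split=> //.
by rewrite !scalerN e.
Qed.

Lemma loc_eq x y : fr_den y *: fr_num x = fr_den x *: fr_num y ->
  loc_pi x = loc_pi y.
Proof.
move=> e; apply/loc_piP; exists 1; split; [exact: homog1|exact: pt_proper|].
by rewrite e.
Qed.

Fact loc_addA : associative loc_add.
Proof.
elim/loc_ind=> x; elim/loc_ind=> y; elim/loc_ind=> z.
rewrite !loc_addE; apply: loc_eq => /=; rewrite !scalerDr !scalerA addrA.
by congr (_ *: _ + _ *: _ + _ *: _); ring.
Qed.
Fact loc_addC : commutative loc_add.
Proof.
elim/loc_ind=> x; elim/loc_ind=> y; rewrite !loc_addE; apply: loc_eq => /=.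
by rewrite addrC mulrC.
Qed.
Fact loc_add0 : left_id (loc_pi frac_zero) loc_add.
Proof.
elim/loc_ind=> x; rewrite loc_addE; apply: loc_eq => /=.
by rewrite scaler0 add0r scale1r mul1r.
Qed.
Fact loc_addN : left_inverse (loc_pi frac_zero) loc_opp loc_add.
Proof.
elim/loc_ind=> x; rewrite loc_oppE loc_addE; apply: loc_eq => /=.
by rewrite scalerN addNr !scaler0.
Qed.
HB.instance Definition _ :=
  GRing.isZmodule.Build loc loc_addA loc_addC loc_add0 loc_addN.

End Localisation.

Section LocalRing.
Variable p : proj_point.

Definition local_ring := loc (gself S) p.
HB.instance Definition _ := GRing.Zmodule.on local_ring.

Section LocalAction.
Variable M : grmod S.

Fact frac_scaleP1 (a : frac (gself S) p) (x : frac M p) :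
  gm_deg (fr_deg a + fr_deg x) ((fr_num a : S) *: fr_num x).
Proof. by apply: gm_degZ; [apply: (fr_numP a)|apply: fr_numP]. Qed.
Fact frac_scaleP2 (a : frac (gself S) p) (x : frac M p) :
  ga_deg (fr_deg a + fr_deg x) (fr_den a * fr_den x).
Proof. by apply: ga_degM; apply: fr_denP. Qed.
Fact frac_scaleP3 (a : frac (gself S) p) (x : frac M p) :
  ~ p (fr_den a * fr_den x).
Proof. by apply: out_mul; apply: fr_den_out. Qed.
Definition frac_scale (a : frac (gself S) p) (x : frac M p) : frac M p :=
  Frac (frac_scaleP1 a x) (frac_scaleP2 a x) (@frac_scaleP3 a x).

Definition loc_scale (a : local_ring) (x : loc M p) : loc M p :=
  loc_pi (frac_scale (repr a) (repr x)).

Lemma loc_scaleE a x : loc_scale (loc_pi a) (loc_pi x) = loc_pi (frac_scale a x).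
Proof.
apply/loc_piP => /=.
case: (loc_repr a) (loc_repr x); set a' := repr _; set x' := repr _.
move=> u [hu pu e1] [v [hv pv e2]]; exists (u * v); split.
- exact: homogM.
- exact: out_mul.
have e1' : u * (fr_den a * fr_num a') = u * (fr_den a' * fr_num a) := e1.
rewrite !scalerA in e2 *.
transitivity ((u * (fr_den a * fr_num a')) *: ((v * fr_den x) *: fr_num x')).
  by rewrite scalerA; congr (_ *: _); ring.
rewrite e2 e1' scalerA; congr (_ *: _); ring.
Qed.

End LocalAction.

Definition local_mul (a b : local_ring) : local_ring := @loc_scale (gself S) a b.
Definition local_one : local_ring :=
  @loc_pi (gself S) p
    (@Frac (gself S) p 0 (1 : S^o) 1 (ga_deg1 S) (ga_deg1 S) (@pt_proper p)).

Section LocalAxioms.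
Variable M : grmod S.
Implicit Types (a b : local_ring) (x y : loc M p).

Fact loc_scaleA a b x : loc_scale a (loc_scale b x) = loc_scale (local_mul a b) x.
Proof.
elim/loc_ind: a => a; elim/loc_ind: b => b; elim/loc_ind: x => x.
rewrite /local_mul !loc_scaleE; apply: loc_eq => /=.
rewrite !scalerA; congr (_ *: _); rewrite -[_ *: fr_num b]/(_ * _); ring.
Qed.
Fact loc_scale1 x : loc_scale local_one x = x.
Proof.
elim/loc_ind: x => x; rewrite loc_scaleE; apply: loc_eq => /=.
by rewrite scale1r mul1r.
Qed.
Fact loc_scaleDr a x y : loc_scale a (x + y) = loc_scale a x + loc_scale a y.
Proof.
elim/loc_ind: a => a; elim/loc_ind: x => x; elim/loc_ind: y => y.
rewrite [x in loc_scale _ x]loc_addE !loc_scaleE [RHS]loc_addE.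
apply: loc_eq => /=; rewrite !scalerDr !scalerA.
by congr (_ *: _ + _ *: _); ring.
Qed.
Fact loc_scaleDl x : {morph (@loc_scale M)^~ x : a b / a + b}.
Proof.
elim/loc_ind: x => x; elim/loc_ind => a; elim/loc_ind => b.
rewrite [x in loc_scale x _]loc_addE !loc_scaleE [RHS]loc_addE.
apply: loc_eq => /=; rewrite !scalerDr !scalerA -scalerDl.
congr (_ *: _).
rewrite -[fr_den b *: fr_num a]/(_ * _) -[fr_den a *: fr_num b]/(_ * _); ring.
Qed.
End LocalAxioms.

Fact local_mulC : commutative local_mul.
Proof.
elim/loc_ind=> a; elim/loc_ind=> b; rewrite /local_mul !loc_scaleE.
apply: loc_eq => /=.
rewrite -[fr_num a *: fr_num b]/(_ * _) -[fr_num b *: fr_num a]/(_ * _).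
by congr (_ * _); apply: mulrC.
Qed.
Fact local_mulA : associative local_mul.
Proof. by move=> a b c; apply: loc_scaleA. Qed.
Fact local_mul1 : left_id local_one local_mul.
Proof. by move=> a; apply: loc_scale1. Qed.
Fact local_mulDl : left_distributive local_mul +%R.
Proof. by move=> a b c; apply: (loc_scaleDl c a b). Qed.
HB.instance Definition _ := GRing.Zmodule_isComPzRing.Build local_ring
  local_mulA local_mulC local_mul1 local_mulDl.

HB.instance Definition _ (M : grmod S) :=
  GRing.Zmodule_isLmodule.Build local_ring (loc M p)
    (@loc_scaleA M) (@loc_scale1 M) (@loc_scaleDr M) (@loc_scaleDl M).

End LocalRing.

End Proj.

Section Sheaves.
Variables (K : pzRingType) (S : gralg K).
Local Notation point := (proj_point S).
Local Notation popen := (popen S).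

(* Sections of the sheaf associated with M: functions p |-> s(p) in M_(p) that
   are locally a quotient m/f with m, f homogeneous of the same degree. *)
Section Sections.
Variables (M : grmod S) (U : popen).

Definition stalks := forall p : point, U p -> loc M p.

Definition locally_frac (s : stalks) : Prop :=
  forall p, U p -> exists (V : popen) (VU : psub V U) (d : int) (m : M) (f : S)
    (hm : gm_deg d m) (hf : ga_deg d f) (fV : forall q, V q -> ~ q f),
    V p /\ forall q (Vq : V q), s q (VU q Vq) = loc_pi (Frac hm hf (fV q Vq)).

Record sec := Sec { sec_val : stalks; sec_valP : locally_frac sec_val }.
HB.instance Definition _ := gen_eqMixin sec.
HB.instance Definition _ := gen_choiceMixin sec.

Lemma sec_ext (s t : sec) :
  (forall p Up, @sec_val s p Up = @sec_val t p Up) -> s = t.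
Proof.
case: s t => [s hs] [t ht] /= e.
have est : s = t.
  by apply: functional_extensionality_dep => p;
     apply: functional_extensionality_dep => Up; apply: e.
by case: _ / est ht => ht; congr Sec; apply: Prop_irrelevance.
Qed.

Lemma sec_irr (s : sec) p (Up Up' : U p) : sec_val s Up = sec_val s Up'.
Proof. by rewrite (Prop_irrelevance Up Up'). Qed.

Lemma loc_pi_eq p d e (m n : M) (f g : S) hm hf hp hn hg hq :
  m = n -> f = g ->
  loc_pi (@Frac _ _ M p d m f hm hf hp) = loc_pi (@Frac _ _ M p e n g hn hg hq).
Proof. by move=> e1 e2; apply: loc_eq => /=; rewrite e1 e2. Qed.

Fact sec_add_subproof (s t : sec) :
  locally_frac (fun p Up => sec_val s Up + sec_val t Up).
Proof.
move=> p Up.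
case: (sec_valP s Up) => V [VU [d [m [f [hm [hf [fV [Vp sV]]]]]]]].
case: (sec_valP t Up) => W [WU [e [n [g [hn [hg [gW [Wp tW]]]]]]]].
have hVU : psub (pcap V W) U by move=> q [/VU].
have h1 : gm_deg (d + e) (g *: m + f *: n).
  by apply: gm_degD; [rewrite addrC; apply: gm_degZ|apply: gm_degZ].
have h2 := ga_degM hf hg.
have h3 q : pcap V W q -> ~ q (f * g).
  by move=> [Vq Wq]; apply: out_mul; [exact: (fV q Vq)|exact: (gW q Wq)].
exists (pcap V W), hVU, (d + e), (g *: m + f *: n), (f * g), h1, h2, h3.
split=> // q [Vq Wq].
rewrite (Prop_irrelevance (hVU q _) (VU q Vq)) sV.
rewrite (Prop_irrelevance (VU q Vq) (WU q Wq)) tW.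
by rewrite [LHS]loc_addE; apply: loc_pi_eq.
Qed.
Definition sec_add s t := Sec (sec_add_subproof s t).

Fact sec_opp_subproof (s : sec) : locally_frac (fun p Up => - sec_val s Up).
Proof.
move=> p Up.
case: (sec_valP s Up) => V [VU [d [m [f [hm [hf [fV [Vp sV]]]]]]]].
exists V, VU, d, (- m), f, (gm_degN hm), hf, fV; split=> // q Vq.
by rewrite sV [LHS]loc_oppE; apply: loc_pi_eq.
Qed.
Definition sec_opp s := Sec (sec_opp_subproof s).

Fact sec_zero_subproof : locally_frac (fun p Up => 0).
Proof.
move=> p Up.
exists U, (@psub_refl _ _ U), 0, 0, 1, (gm_deg0 M 0), (ga_deg1 S),
  (fun q _ => @pt_proper _ _ q).
by split=> // q Uq; apply: loc_pi_eq.
Qed.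
Definition sec_zero := Sec sec_zero_subproof.

Fact sec_addA : associative sec_add.
Proof. by move=> s t u; apply: sec_ext => p Up; apply: addrA. Qed.
Fact sec_addC : commutative sec_add.
Proof. by move=> s t; apply: sec_ext => p Up; apply: addrC. Qed.
Fact sec_add0 : left_id sec_zero sec_add.
Proof. by move=> s; apply: sec_ext => p Up; apply: add0r. Qed.
Fact sec_addN : left_inverse sec_zero sec_opp sec_add.
Proof. by move=> s; apply: sec_ext => p Up; apply: addNr. Qed.
HB.instance Definition _ :=
  GRing.isZmodule.Build sec sec_addA sec_addC sec_add0 sec_addN.

End Sections.

Section StructureRing.
Variable U : popen.

Definition oring := sec (gself S) U.
HB.instance Definition _ := GRing.Zmodule.on oring.

Definition oring_val (a : oring) p (Up : U p) : local_ring p := sec_val a Up.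

Section Action.
Variable M : grmod S.
Fact sec_scale_subproof (a : oring) (s : sec M U) :
  locally_frac (fun p Up => oring_val a Up *: sec_val s Up).
Proof.
move=> p Up.
case: (sec_valP a Up) => V [VU [d [m [f [hm [hf [fV [Vp sV]]]]]]]].
case: (sec_valP s Up) => W [WU [e [n [g [hn [hg [gW [Wp tW]]]]]]]].
have hVU : psub (pcap V W) U by move=> q [/VU].
have h1 : gm_deg (d + e) ((m : S) *: n) by apply: gm_degZ.
have h2 := ga_degM hf hg.
have h3 q : pcap V W q -> ~ q (f * g).
  by move=> [Vq Wq]; apply: out_mul; [exact: (fV q Vq)|exact: (gW q Wq)].
exists (pcap V W), hVU, (d + e), ((m : S) *: n), (f * g), h1, h2, h3.
split=> // q [Vq Wq].
rewrite (Prop_irrelevance (hVU q _) (VU q Vq)) /oring_val sV.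
rewrite (Prop_irrelevance (VU q Vq) (WU q Wq)) tW.
by rewrite [LHS]loc_scaleE; apply: loc_pi_eq.
Qed.
Definition sec_scale (a : oring) (s : sec M U) : sec M U :=
  Sec (sec_scale_subproof a s).
End Action.

Definition oring_mul (a b : oring) : oring := @sec_scale (gself S) a b.

Fact oring_const_subproof k : @locally_frac (gself S) U (fun p Up =>
  @loc_pi _ _ (gself S) p (@Frac _ _ (gself S) p 0 (ga_scal S k : S^o) 1
    (ga_deg_scal S k) (ga_deg1 S) (@pt_proper _ _ p))).
Proof.
move=> p Up.
exists U, (@psub_refl _ _ U), 0, (ga_scal S k), 1, (ga_deg_scal S k), (ga_deg1 S),
  (fun q _ => @pt_proper _ _ q).
by split=> // q Uq; apply: loc_pi_eq.
Qed.
Definition oring_const (k : K) : oring := Sec (oring_const_subproof k).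

Lemma oring_const1 p (Up : U p) : oring_val (oring_const 1) Up = 1.
Proof. by apply: loc_pi_eq => //; apply: rmorph1. Qed.

Section ActionAxioms.
Variable M : grmod S.
Fact sec_scaleA (a b : oring) (s : sec M U) :
  sec_scale a (sec_scale b s) = sec_scale (oring_mul a b) s.
Proof. by apply: sec_ext => p Up; apply: scalerA. Qed.
Fact sec_scale1 : left_id (oring_const 1) (@sec_scale M).
Proof.
move=> s; apply: sec_ext => p Up.
by rewrite [LHS](_ : _ = oring_val (oring_const 1) Up *: sec_val s Up) //
  oring_const1 scale1r.
Qed.
Fact sec_scaleDr : right_distributive (@sec_scale M) +%R.
Proof. by move=> a s t; apply: sec_ext => p Up; apply: scalerDr. Qed.
Fact sec_scaleDl s : {morph (@sec_scale M)^~ s : a b / a + b}.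
Proof. by move=> a b; apply: sec_ext => p Up; apply: scalerDl. Qed.
End ActionAxioms.

Fact oring_mulA : associative oring_mul.
Proof. by move=> a b c; apply: sec_scaleA. Qed.
Fact oring_mulC : commutative oring_mul.
Proof.
by move=> a b; apply: sec_ext => p Up; apply: (@mulrC (local_ring p)).
Qed.
Fact oring_mul1 : left_id (oring_const 1) oring_mul.
Proof. by move=> a; apply: (@sec_scale1 (gself S)). Qed.
Fact oring_mulDl : left_distributive oring_mul +%R.
Proof. by move=> a b c; apply: (@sec_scaleDl (gself S) c a b). Qed.
HB.instance Definition _ := GRing.Zmodule_isComPzRing.Build oring
  oring_mulA oring_mulC oring_mul1 oring_mulDl.

HB.instance Definition _ (M : grmod S) :=
  GRing.Zmodule_isLmodule.Build oring (sec M U)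
    (@sec_scaleA M) (@sec_scale1 M) (@sec_scaleDr M) (@sec_scaleDl M).

Fact oring_const_zmod_morphism : zmod_morphism oring_const.
Proof.
move=> k l; apply: sec_ext => p Up.
apply: etrans (esym (congr2 _ (erefl _) (loc_oppE _))) => /=.
rewrite [RHS]loc_addE; apply: loc_eq => /=.
by rewrite !scale1r mulr1 scale1r rmorphB.
Qed.
HB.instance Definition _ := GRing.isZmodMorphism.Build K oring oring_const
  oring_const_zmod_morphism.
Fact oring_const_monoid_morphism : monoid_morphism oring_const.
Proof.
split=> // k l; apply: sec_ext => p Up.
rewrite [RHS]loc_scaleE; apply: loc_eq => /=.
by rewrite mulr1 !scale1r rmorphM.
Qed.
HB.instance Definition _ := GRing.isMonoidMorphism.Build K oring oring_const
  oring_const_monoid_morphism.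

End StructureRing.

Fact sec_res_subproof (M : grmod S) (U V : popen) (h : psub V U) (s : sec M U) :
  @locally_frac M V (fun p Vp => sec_val s (h p Vp)).
Proof.
move=> p Vp.
case: (sec_valP s (h p Vp)) => W [WU [d [m [f [hm [hf [fW [Wp sW]]]]]]]].
have h3 q : pcap V W q -> ~ q f by move=> [_ Wq]; exact: (fW q Wq).
exists (pcap V W), (@pcapl _ _ V W), d, m, f, hm, hf, h3; split=> // q [Vq Wq].
rewrite (Prop_irrelevance (h q _) (WU q Wq)) sW.
exact: loc_pi_eq.
Qed.
Definition sec_res (M : grmod S) (U V : popen) (h : psub V U) (s : sec M U) :
  sec M V := Sec (sec_res_subproof h s).
Definition oring_res (U V : popen) (h : psub V U) (a : oring U) : oring V :=
  @sec_res (gself S) U V h a.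

Record sheaf := Sheaf {
  sh_sec :> forall U : popen, lmodType (oring U);
  sh_res : forall U V : popen, psub V U -> sh_sec U -> sh_sec V;
  sh_res_lin : forall (U V : popen) (h : psub V U) (a : oring U)
    (x y : sh_sec U),
    sh_res h (a *: x + y) = oring_res h a *: sh_res h x + sh_res h y;
  sh_res_id : forall (U : popen) (h : psub U U) (x : sh_sec U), sh_res h x = x;
  sh_res_comp : forall (U V W : popen) (h : psub V U) (k : psub W V)
    (x : sh_sec U), sh_res k (sh_res h x) = sh_res (psub_trans k h) x;
  sh_sep : forall (U : popen) (I : Type) (V : I -> popen)
    (h : forall i, psub (V i) U), (forall p, U p -> exists i, V i p) ->
    forall x y : sh_sec U,
      (forall i, sh_res (h i) x = sh_res (h i) y) -> x = y;
  sh_glue : forall (U : popen) (I : Type) (V : I -> popen)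
    (h : forall i, psub (V i) U), (forall p, U p -> exists i, V i p) ->
    forall x : forall i, sh_sec (V i),
      (forall i j, sh_res (@pcapl _ _ (V i) (V j)) (x i)
                 = sh_res (@pcapr _ _ (V i) (V j)) (x j)) ->
      exists y : sh_sec U, forall i, sh_res (h i) y = x i }.

Lemma sh_resE (F : sheaf) (U V W : popen) (h : psub V U) (k : psub W V)
  (l : psub W U) (x : F U) : sh_res k (sh_res h x) = sh_res l x.
Proof. by rewrite sh_res_comp; congr sh_res; apply: Prop_irrelevance. Qed.

Lemma sh_resD (F : sheaf) (U V : popen) (h : psub V U) (x y : F U) :
  sh_res h (x + y) = sh_res h x + sh_res h y.
Proof.
have := sh_res_lin h 1 x y; rewrite scale1r => ->; congr (_ + _).
have -> : oring_res h 1 = 1 by apply: sec_ext.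
by rewrite scale1r.
Qed.
Lemma sh_res0 (F : sheaf) (U V : popen) (h : psub V U) : sh_res h (0 : F U) = 0.
Proof. by apply: (addrI (sh_res h 0)); rewrite -sh_resD !addr0. Qed.
Lemma sh_resZ (F : sheaf) (U V : popen) (h : psub V U) a (x : F U) :
  sh_res h (a *: x) = oring_res h a *: sh_res h x.
Proof. by rewrite -[a *: x]addr0 sh_res_lin sh_res0 addr0. Qed.

Section Tilde.
Variable M : grmod S.

Fact tilde_res_lin (U V : popen) (h : psub V U) (a : oring U) (x y : sec M U) :
  sec_res h (a *: x + y) = oring_res h a *: sec_res h x + sec_res h y.
Proof. exact: sec_ext. Qed.
Fact tilde_res_id (U : popen) (h : psub U U) (x : sec M U) : sec_res h x = x.
Proof.
by apply: sec_ext => p Up /=; congr sec_val; apply: Prop_irrelevance.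
Qed.
Fact tilde_res_comp (U V W : popen) (h : psub V U) (k : psub W V) (x : sec M U) :
  sec_res k (sec_res h x) = sec_res (psub_trans k h) x.
Proof.
by apply: sec_ext => p Up /=; congr sec_val; apply: Prop_irrelevance.
Qed.
Fact tilde_sep (U : popen) (I : Type) (V : I -> popen)
    (h : forall i, psub (V i) U) : (forall p, U p -> exists i, V i p) ->
    forall x y : sec M U,
      (forall i, sec_res (h i) x = sec_res (h i) y) -> x = y.
Proof.
move=> cov x y e; apply: sec_ext => p Up; case: (cov p Up) => i Vp.
rewrite (Prop_irrelevance Up (h i p Vp)).
exact: (congr1 (fun s => sec_val s Vp) (e i)).
Qed.
Fact tilde_glue (U : popen) (I : Type) (V : I -> popen)
    (h : forall i, psub (V i) U) : (forall p, U p -> exists i, V i p) ->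
    forall x : forall i, sec M (V i),
      (forall i j, sec_res (@pcapl _ _ (V i) (V j)) (x i)
                 = sec_res (@pcapr _ _ (V i) (V j)) (x j)) ->
      exists y : sec M U, forall i, sec_res (h i) y = x i.
Proof.
move=> cov x e.
pose y p (Up : U p) : loc M p :=
  sec_val (x (sval (cid (cov p Up)))) (svalP (cid (cov p Up))).
have ey i p (Vp : V i p) (Up : U p) : y p Up = sec_val (x i) Vp.
  rewrite /y; case: (cid _) => j Vj /=.
  have c : pcap (V j) (V i) p by split.
  have e' : sec_val (x j) (pcapl c) = sec_val (x i) (pcapr c) :=
    congr1 (fun s => sec_val s c) (e j i).
  by rewrite (sec_irr (x j) _ (pcapl c)) e'; apply: sec_irr.
have yloc : locally_frac y.
  move=> p Up; case: (cov p Up) => i Vp.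
  case: (sec_valP (x i) Vp) => W [WU [d [m [f [hm [hf [fW [Wp sW]]]]]]]].
  exists W, (psub_trans WU (h i)), d, m, f, hm, hf, fW; split=> // q Wq.
  by rewrite (ey i q (WU q Wq)) sW.
by exists (Sec yloc) => i; apply: sec_ext => p Vp /=; apply: ey.
Qed.

Definition tilde : sheaf :=
  @Sheaf (fun U => sec M U) (@sec_res M) tilde_res_lin tilde_res_id
    tilde_res_comp tilde_sep tilde_glue.
End Tilde.

Definition structure_sheaf : sheaf := tilde (gself S).

(** The sheaf Hom(F, G): its sections over U are the morphisms of
    O_U-modules from F|U to G|U. *)
Section SheafHom.
Variables F G : sheaf.

Section OverU.
Variable U : popen.

Record shmor := Shmor {
  sm_fun : forall V : popen, psub V U -> F V -> G V;
  sm_lin : forall (V : popen) (h : psub V U), linear (sm_fun h);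
  sm_nat : forall (V W : popen) (h : psub V U) (k : psub W V) (x : F V),
    sh_res k (sm_fun h x) = sm_fun (psub_trans k h) (sh_res k x) }.
HB.instance Definition _ := gen_eqMixin shmor.
HB.instance Definition _ := gen_choiceMixin shmor.

Lemma sm_irr (f : shmor) (V : popen) (h h' : psub V U) (x : F V) :
  sm_fun f h x = sm_fun f h' x.
Proof. by rewrite (Prop_irrelevance h h'). Qed.

Lemma shmor_ext (f g : shmor) :
  (forall V (h : psub V U) x, sm_fun f h x = sm_fun g h x) -> f = g.
Proof.
case: f g => [f f1 f2] [g g1 g2] /= e.
have efg : f = g.
  apply: functional_extensionality_dep => V.
  apply: functional_extensionality_dep => h.
  by apply: functional_extensionality_dep => x.
by case: _ / efg g1 g2 => g1 g2; congr Shmor; apply: Prop_irrelevance.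
Qed.

Fact shmor_add1 (f g : shmor) V (h : psub V U) :
  linear (fun x => sm_fun f h x + sm_fun g h x).
Proof. by move=> a x y; rewrite !sm_lin scalerDr addrACA. Qed.
Fact shmor_add2 (f g : shmor) V W (h : psub V U) (k : psub W V) (x : F V) :
  sh_res k (sm_fun f h x + sm_fun g h x) =
  sm_fun f (psub_trans k h) (sh_res k x) + sm_fun g (psub_trans k h) (sh_res k x).
Proof. by rewrite sh_resD !sm_nat. Qed.
Definition shmor_add (f g : shmor) : shmor :=
  Shmor (shmor_add1 f g) (shmor_add2 f g).

Fact shmor_zero1 V (h : psub V U) : linear (fun x : F V => 0 : G V).
Proof. by move=> a x y; rewrite scaler0 addr0. Qed.
Fact shmor_zero2 V W (h : psub V U) (k : psub W V) (x : F V) :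
  sh_res k (0 : G V) = 0.
Proof. exact: sh_res0. Qed.
Definition shmor_zero : shmor := Shmor shmor_zero1 shmor_zero2.

Fact shmor_scale1 a (f : shmor) V (h : psub V U) :
  linear (fun x => oring_res h a *: sm_fun f h x).
Proof. by move=> b x y; rewrite !sm_lin scalerDr !scalerA mulrC. Qed.
Fact shmor_scale2 a (f : shmor) V W (h : psub V U) (k : psub W V) (x : F V) :
  sh_res k (oring_res h a *: sm_fun f h x) =
  oring_res (psub_trans k h) a *: sm_fun f (psub_trans k h) (sh_res k x).
Proof.
by rewrite sh_resZ sm_nat; congr (_ *: _); apply: (tilde_res_comp h k).
Qed.
Definition shmor_scale (a : oring U) (f : shmor) : shmor :=
  Shmor (@shmor_scale1 a f) (@shmor_scale2 a f).

Definition shmor_opp := shmor_scale (-1).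

Lemma oring_resB V (h : psub V U) a b :
  oring_res h (a - b) = oring_res h a - oring_res h b.
Proof. exact: sec_ext. Qed.
Lemma oring_resD V (h : psub V U) a b :
  oring_res h (a + b) = oring_res h a + oring_res h b.
Proof. exact: sec_ext. Qed.
Lemma oring_resM V (h : psub V U) a b :
  oring_res h (a * b) = oring_res h a * oring_res h b.
Proof. exact: sec_ext. Qed.
Lemma oring_res1 V (h : psub V U) : oring_res h 1 = 1.
Proof. exact: sec_ext. Qed.
Lemma oring_resN V (h : psub V U) a : oring_res h (- a) = - oring_res h a.
Proof. exact: sec_ext. Qed.

Fact shmor_addA : associative shmor_add.
Proof. by move=> f g k; apply: shmor_ext => V h x; apply: addrA. Qed.
Fact shmor_addC : commutative shmor_add.
Proof. by move=> f g; apply: shmor_ext => V h x; apply: addrC. Qed.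
Fact shmor_add0 : left_id shmor_zero shmor_add.
Proof. by move=> f; apply: shmor_ext => V h x; apply: add0r. Qed.
Fact shmor_addN : left_inverse shmor_zero shmor_opp shmor_add.
Proof.
move=> f; apply: shmor_ext => V h x /=.
by rewrite oring_resN oring_res1 scaleN1r addNr.
Qed.
HB.instance Definition _ :=
  GRing.isZmodule.Build shmor shmor_addA shmor_addC shmor_add0 shmor_addN.

Fact shmor_scaleA a b f :
  shmor_scale a (shmor_scale b f) = shmor_scale (a * b) f.
Proof.
by apply: shmor_ext => V h x /=; rewrite scalerA oring_resM.
Qed.
Fact shmor_scale1r : left_id 1 shmor_scale.
Proof. by move=> f; apply: shmor_ext => V h x /=; rewrite oring_res1 scale1r. Qed.
Fact shmor_scaleDr : right_distributive shmor_scale +%R.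
Proof. by move=> a f g; apply: shmor_ext => V h x; apply: scalerDr. Qed.
Fact shmor_scaleDl f : {morph shmor_scale^~ f : a b / a + b}.
Proof.
by move=> a b; apply: shmor_ext => V h x /=; rewrite oring_resD scalerDl.
Qed.
HB.instance Definition _ := GRing.Zmodule_isLmodule.Build (oring U) shmor
  shmor_scaleA shmor_scale1r shmor_scaleDr shmor_scaleDl.
End OverU.

Fact shmor_res_nat (U V : popen) (h : psub V U) (f : shmor U) (W W' : popen)
    (k : psub W V) (l : psub W' W) (x : F W) :
  sh_res l (sm_fun f (psub_trans k h) x) =
  sm_fun f (psub_trans (psub_trans l k) h) (sh_res l x).
Proof. by rewrite sm_nat; apply: sm_irr. Qed.

Definition shmor_res (U V : popen) (h : psub V U) (f : shmor U) : shmor V :=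
  @Shmor V (fun W k => sm_fun f (psub_trans k h))
    (fun W k => sm_lin f (psub_trans k h))
    (@shmor_res_nat U V h f).

Fact shmor_res_lin (U V : popen) (h : psub V U) a (f g : shmor U) :
  shmor_res h (a *: f + g) = oring_res h a *: shmor_res h f + shmor_res h g.
Proof.
apply: shmor_ext => W k x.
change (oring_res (psub_trans k h) a *: sm_fun f (psub_trans k h) x
  + sm_fun g (psub_trans k h) x =
  oring_res k (oring_res h a) *: sm_fun f (psub_trans k h) x
  + sm_fun g (psub_trans k h) x).
by rewrite [oring_res k _](tilde_res_comp h k).
Qed.
Fact shmor_res_id (U : popen) (h : psub U U) (f : shmor U) : shmor_res h f = f.
Proof.
by apply: shmor_ext => W k x; exact: (sm_irr f (psub_trans k h) k).
Qed.
Fact shmor_res_comp (U V W : popen) (h : psub V U) (k : psub W V) (f : shmor U) :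
  shmor_res k (shmor_res h f) = shmor_res (psub_trans k h) f.
Proof. by apply: shmor_ext => Z l x; exact: (sm_irr f). Qed.

Lemma cover_cap (U W : popen) (I : Type) (V : I -> popen) :
  (forall p, U p -> exists i, V i p) -> psub W U ->
  forall p, W p -> exists i, pcap W (V i) p.
Proof. by move=> cov WU p Wp; case: (cov p (WU p Wp)) => i Vp; exists i. Qed.

Fact shmor_sep (U : popen) (I : Type) (V : I -> popen)
    (h : forall i, psub (V i) U) : (forall p, U p -> exists i, V i p) ->
    forall f g : shmor U,
      (forall i, shmor_res (h i) f = shmor_res (h i) g) -> f = g.
Proof.
move=> cov f g e; apply: shmor_ext => W k x.
apply: (@sh_sep G W I _ (fun i => @pcapl _ _ W (V i)) (cover_cap cov k)) => i.
rewrite !sm_nat.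
rewrite (Prop_irrelevance (psub_trans _ k)
  (psub_trans (@pcapr _ _ W (V i)) (h i))).
exact: (congr1 (fun f : shmor (V i) => sm_fun f (@pcapr _ _ W (V i)) _) (e i)).
Qed.

Section Glue.
Variables (U : popen) (I : Type) (V : I -> popen) (h : forall i, psub (V i) U).
Hypothesis cov : forall p, U p -> exists i, V i p.
Variable f : forall i, shmor (V i).
Hypothesis compat : forall i j, shmor_res (@pcapl _ _ (V i) (V j)) (f i)
                 = shmor_res (@pcapr _ _ (V i) (V j)) (f j).

Definition glue_spec (W : popen) (x : F W) (y : G W) : Prop :=
  forall i, sh_res (@pcapl _ _ W (V i)) y
    = sm_fun (f i) (@pcapr _ _ W (V i)) (sh_res (@pcapl _ _ W (V i)) x).

Lemma glue_uniq (W : popen) (k : psub W U) (x : F W) (y z : G W) :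
  glue_spec x y -> glue_spec x z -> y = z.
Proof.
move=> hy hz.
apply: (@sh_sep G W I _ (fun i => @pcapl _ _ W (V i)) (cover_cap cov k)) => i.
by rewrite hy hz.
Qed.

Lemma f_agree i j (W : popen) (k : psub W (V i)) (l : psub W (V j)) (x : F W) :
  sm_fun (f i) k x = sm_fun (f j) l x.
Proof.
have kl : psub W (pcap (V i) (V j)) by move=> p Wp; split; [apply: k|apply: l].
have := congr1 (fun g : shmor _ => sm_fun g kl x) (compat i j).
rewrite /= => e.
rewrite (Prop_irrelevance k (psub_trans kl (@pcapl _ _ (V i) (V j)))) e.
by apply: sm_irr.
Qed.

Lemma glue_ex (W : popen) (k : psub W U) (x : F W) : exists y : G W, glue_spec x y.
Proof.
apply: (sh_glue (fun i => @pcapl _ _ W (V i)) (cover_cap cov k)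
  (x := fun i => sm_fun (f i) (@pcapr _ _ W (V i))
                   (sh_res (@pcapl _ _ W (V i)) x))) => i j.
rewrite !sm_nat.
set Z := pcap (pcap W (V i)) (pcap W (V j)).
have ZW : psub Z W by move=> p [[]].
rewrite (sh_resE _ _ ZW) (sh_resE _ _ ZW).
exact: f_agree.
Qed.

Definition glue_fun (W : popen) (k : psub W U) (x : F W) : G W :=
  sval (cid (glue_ex k x)).
Lemma glue_funP (W : popen) (k : psub W U) (x : F W) : glue_spec x (glue_fun k x).
Proof. exact: svalP (cid (glue_ex k x)). Qed.

Fact glue_lin (W : popen) (k : psub W U) : linear (glue_fun k).
Proof.
move=> a x y; apply: (glue_uniq k (glue_funP _ _)) => i.
by rewrite !sh_res_lin sm_lin !glue_funP.
Qed.
Fact glue_nat (W Z : popen) (k : psub W U) (l : psub Z W) (x : F W) :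
  sh_res l (glue_fun k x) = glue_fun (psub_trans l k) (sh_res l x).
Proof.
apply: (glue_uniq (psub_trans l k) _ (glue_funP _ _)) => i.
have ZW : psub (pcap Z (V i)) (pcap W (V i)) by move=> p [/l ? ?].
have ZW' : psub (pcap Z (V i)) W by move=> p [/l].
rewrite !(sh_resE _ _ ZW').
rewrite -(sh_resE (@pcapl _ _ W (V i)) ZW ZW') glue_funP sm_nat.
rewrite (sh_resE (@pcapl _ _ W (V i)) ZW ZW').
by apply: sm_irr.
Qed.
Definition glued : shmor U := Shmor glue_lin glue_nat.

Lemma gluedP i : shmor_res (@h i) glued = f i.
Proof.
apply: shmor_ext => W k x /=.
apply: (glue_uniq (psub_trans k (@h i)) (glue_funP _ _)) => j.
rewrite sm_nat; exact: f_agree.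
Qed.
End Glue.

Fact shmor_glue (U : popen) (I : Type) (V : I -> popen)
    (h : forall i, psub (V i) U) : (forall p, U p -> exists i, V i p) ->
    forall f : forall i, shmor (V i),
      (forall i j, shmor_res (@pcapl _ _ (V i) (V j)) (f i)
                 = shmor_res (@pcapr _ _ (V i) (V j)) (f j)) ->
      exists g : shmor U, forall i, shmor_res (h i) g = f i.
Proof. by move=> cov f e; exists (glued cov e) => i; apply: gluedP. Qed.

Definition sheaf_hom : sheaf :=
  @Sheaf (fun U => shmor U) shmor_res shmor_res_lin shmor_res_id
    shmor_res_comp shmor_sep shmor_glue.

(* Hom(F, G) is the space of global sections of the sheaf Hom; K acts through
   the constant sections of the structure sheaf. *)
Definition global_hom : lmodType K :=
  restr (shmor (whole S)) (@oring_const (whole S)).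

Definition sheaf_iso : Prop :=
  exists f : shmor (whole S), forall (U : popen) (h : psub U (whole S)),
    bijective (sm_fun f h).

End SheafHom.

Section DirectSum.
Variables F G : sheaf.
Definition dsum_res (U V : popen) (h : psub V U) (x : (F U * G U)%type) :
  (F V * G V)%type := (sh_res h x.1, sh_res h x.2).
Fact dsum_res_lin (U V : popen) (h : psub V U) (a : oring U)
    (x y : (F U * G U)%type) :
  dsum_res h (a *: x + y) = oring_res h a *: dsum_res h x + dsum_res h y.
Proof. by rewrite /dsum_res !sh_res_lin. Qed.
Fact dsum_res_id (U : popen) (h : psub U U) (x : (F U * G U)%type) :
  dsum_res h x = x.
Proof. by case: x => x y; rewrite /dsum_res !sh_res_id. Qed.
Fact dsum_res_comp (U V W : popen) (h : psub V U) (k : psub W V)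
    (x : (F U * G U)%type) :
  dsum_res k (dsum_res h x) = dsum_res (psub_trans k h) x.
Proof. by rewrite /dsum_res !sh_res_comp. Qed.
Fact dsum_sep (U : popen) (I : Type) (V : I -> popen)
    (h : forall i, psub (V i) U) : (forall p, U p -> exists i, V i p) ->
    forall x y : (F U * G U)%type,
      (forall i, dsum_res (h i) x = dsum_res (h i) y) -> x = y.
Proof.
move=> cov [x1 x2] [y1 y2] e; congr (_, _).
  by apply: (@sh_sep F U I V h cov) => i; exact: (congr1 fst (e i)).
by apply: (@sh_sep G U I V h cov) => i; exact: (congr1 snd (e i)).
Qed.
Fact dsum_glue (U : popen) (I : Type) (V : I -> popen)
    (h : forall i, psub (V i) U) : (forall p, U p -> exists i, V i p) ->
    forall x : forall i, (F (V i) * G (V i))%type,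
      (forall i j, dsum_res (@pcapl _ _ (V i) (V j)) (x i)
                 = dsum_res (@pcapr _ _ (V i) (V j)) (x j)) ->
      exists y : (F U * G U)%type, forall i, dsum_res (h i) y = x i.
Proof.
move=> cov x e.
have [y1 h1] := @sh_glue F U I V h cov (fun i => (x i).1)
  (fun i j => congr1 fst (e i j)).
have [y2 h2] := @sh_glue G U I V h cov (fun i => (x i).2)
  (fun i j => congr1 snd (e i j)).
by exists (y1, y2) => i; rewrite /dsum_res h1 h2 -surjective_pairing.
Qed.
Definition dsum : sheaf :=
  @Sheaf (fun U => (F U * G U)%type) dsum_res dsum_res_lin dsum_res_id
    dsum_res_comp dsum_sep dsum_glue.
End DirectSum.

Definition sheaf_zero (F : sheaf) : Prop := forall (U : popen) (x : F U), x = 0.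

Definition indecomposable (F : sheaf) : Prop :=
  ~ sheaf_zero F /\
  forall E G : sheaf, sheaf_iso F (dsum E G) -> sheaf_zero E \/ sheaf_zero G.

End Sheaves.

Definition Kiso (K : pzRingType) (V W : lmodType K) : Prop :=
  exists f : {linear V -> W}, bijective f.

Definition simple_sheaf (K : comPzRingType) (S : gralg K) (F : sheaf S) : Prop :=
  Kiso (global_hom F F) K^o.

Section GradedQuotient.
Variables (K : pzRingType) (S : gralg K).

Section Sub.
Variables (M : grmod S) (W : submod M).
Definition sub_deg (d : int) (x : submod_type W) : Prop := gm_deg d (sm_val x).
Fact sub_deg0 d : sub_deg d 0. Proof. exact: gm_deg0. Qed.
Fact sub_degB d x y : sub_deg d x -> sub_deg d y -> sub_deg d (x - y).
Proof. exact: gm_degB. Qed.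
Fact sub_degZ d e (a : S) x :
  ga_deg d a -> sub_deg e x -> sub_deg (d + e) (a *: x).
Proof. exact: gm_degZ. Qed.
Definition gsub : grmod S := Grmod sub_deg0 sub_degB sub_degZ.
End Sub.

Section Quotient.
Variables (M : grmod S) (W : submod M).
Definition quot_deg (d : int) (x : quot W) : Prop :=
  exists y : M, gm_deg d y /\ x = quot_pi W y.
Fact quot_deg0 d : quot_deg d 0.
Proof. by exists 0; split; [apply: gm_deg0|rewrite raddf0]. Qed.
Fact quot_degB d x y : quot_deg d x -> quot_deg d y -> quot_deg d (x - y).
Proof.
move=> [x' [hx ->]] [y' [hy ->]]; exists (x' - y').
by split; [apply: gm_degB|rewrite raddfB].
Qed.
Fact quot_degZ d e (a : S) x :
  ga_deg d a -> quot_deg e x -> quot_deg (d + e) (a *: x).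
Proof.
move=> ha [x' [hx ->]]; exists (a *: x').
by split; [apply: gm_degZ|rewrite linearZ].
Qed.
Definition gquotmod : grmod S := Grmod quot_deg0 quot_degB quot_degZ.
End Quotient.

Variable I : ideal S.

Section Algebra.
Definition qring_scal : {rmorphism K -> qring I} := qring_pi I \o ga_scal S.
Definition qring_deg (d : int) (x : qring I) : Prop :=
  exists y : S, ga_deg d y /\ x = qring_pi I y.
Fact qring_deg0 d : qring_deg d 0.
Proof. by exists 0; split; [apply: ga_deg0|rewrite rmorph0]. Qed.
Fact qring_degB d x y : qring_deg d x -> qring_deg d y -> qring_deg d (x - y).
Proof.
move=> [x' [hx ->]] [y' [hy ->]]; exists (x' - y').
by split; [apply: ga_degB|rewrite rmorphB].
Qed.
Fact qring_degM d e x y :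
  qring_deg d x -> qring_deg e y -> qring_deg (d + e) (x * y).
Proof.
move=> [x' [hx ->]] [y' [hy ->]]; exists (x' * y').
by split; [apply: ga_degM|rewrite rmorphM].
Qed.
Fact qring_deg_scal k : qring_deg 0 (qring_scal k).
Proof. by exists (ga_scal S k); split=> //; apply: ga_deg_scal. Qed.
Definition gquot : gralg K :=
  @Gralg K (qring I) qring_scal qring_deg qring_deg0 qring_degB qring_degM
    qring_deg_scal.
End Algebra.

Section GradedDescent.
Variables (M : grmod S) (IM : killed_by I M).
Definition descent_deg (d : int) (x : descent IM) : Prop := gm_deg d (x : M).
Fact descent_deg0 d : descent_deg d 0. Proof. exact: gm_deg0. Qed.
Fact descent_degB d x y :
  descent_deg d x -> descent_deg d y -> descent_deg d (x - y).
Proof. exact: gm_degB. Qed.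
Fact descent_degZ d e (a : gquot) x :
  ga_deg d a -> descent_deg e x -> descent_deg (d + e) (a *: x).
Proof.
move=> [a' [ha ->]] hx.
by rewrite /descent_deg [X in gm_deg _ X](descent_scaleE IM); apply: gm_degZ.
Qed.
Definition gdescent : grmod gquot :=
  @Grmod K gquot (descent IM) descent_deg descent_deg0 descent_degB descent_degZ.
End GradedDescent.

Lemma quot_pi0 (V : lmodType S) (W : submod V) v : W v -> quot_pi W v = 0.
Proof. by move=> Wv; rewrite -(raddf0 (quot_pi W)); apply/quot_piP; rewrite subr0. Qed.

Definition ideal_mul (V : lmodType S) : submod V :=
  span (fun v => exists (a : S) (w : V), I a /\ v = a *: w).

(* I/I^2 is I modulo I I, as a module over S/I. *)
Definition conormal_base : grmod S :=
  gquotmod (ideal_mul (gsub (I : submod (gself S)))).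
Fact conormal_killed : killed_by I conormal_base.
Proof.
move=> a v Ia; elim/quot_ind: v => v; rewrite -linearZ; apply: quot_pi0.
by apply: span_gen; exists a, v.
Qed.
Definition conormal : grmod gquot := gdescent conormal_killed.

End GradedQuotient.

(* The free module S(-b_0) + ... + S(-b_{t-1}), as column vectors. *)
Section GradedFree.
Variables (K : pzRingType) (S : gralg K) (t : nat) (b : 'I_t -> int).
Definition free_deg (d : int) (x : 'cV[S]_t) : Prop :=
  forall i, ga_deg (d - b i) (x i 0).
Fact free_deg0 d : free_deg d 0.
Proof. by move=> i; rewrite mxE; apply: ga_deg0. Qed.
Fact free_degB d x y : free_deg d x -> free_deg d y -> free_deg d (x - y).
Proof. by move=> hx hy i; rewrite !mxE; apply: ga_degB. Qed.
Fact free_degZ d e (a : S) x :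
  ga_deg d a -> free_deg e x -> free_deg (d + e) (a *: x).
Proof. by move=> ha hx i; rewrite mxE -addrA; apply: ga_degM. Qed.
Definition gfree : grmod S := Grmod free_deg0 free_degB free_degZ.
End GradedFree.

Section PolynomialRing.
Variables (K : fieldType) (n : nat).
Local Notation R := {mpoly K[n]}.

Definition poly_deg (d : int) (p : R) : Prop :=
  match d with Posz k => p \is k.-homog | Negz _ => p = 0 end.
Fact poly_deg0 d : poly_deg d 0.
Proof. by case: d => //= k; apply: dhomog0. Qed.
Fact poly_degB d x y : poly_deg d x -> poly_deg d y -> poly_deg d (x - y).
Proof.
by case: d => /= [k hx hy|_ -> ->]; [rewrite rpredB|rewrite subrr].
Qed.
Fact poly_degM d e x y : poly_deg d x -> poly_deg e y -> poly_deg (d + e) (x * y).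
Proof.
case: d e => [k|k] [l|l] //=; first exact: dhomogM.
- by move=> _ ->; rewrite mulr0; apply: poly_deg0.
- by move=> -> _; rewrite mul0r; apply: poly_deg0.
- by move=> -> _; rewrite mul0r.
Qed.
Fact poly_deg_scal k : poly_deg 0 (@mpolyC n K k).
Proof. by rewrite /= -[k%:MP]mulr1 mul_mpolyC; apply/dhomogZ/dhomog1. Qed.
Definition poly_gralg : gralg K :=
  @Gralg K R (@mpolyC n K) poly_deg poly_deg0 poly_degB poly_degM poly_deg_scal.

(* I(X) = I for the subscheme X of Proj defined by I. *)
Definition saturated (I : ideal R) : Prop :=
  forall f : R,
    (exists N : nat, forall m : 'X_{1..n}, mdeg m = N -> I ('X_[m] * f)) -> I f.

End PolynomialRing.

(* The codimension in Proj S of the closed subset V(I) of Proj S: the infimum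
   over the points p of V(I) of the lengths of chains of irreducible closed
   subsets starting at the closure of p, that is, of chains of points ending
   at p. *)
Section Codimension.
Variables (K : pzRingType) (S : gralg K).
Definition chain_at (p : proj_point S) (h : nat) : Prop :=
  exists q : nat -> proj_point S, q h = p /\
    forall k, (k < h)%N ->
      (forall x : S, q k x -> q k.+1 x) /\ (exists x : S, q k.+1 x /\ ~ q k x).
Definition codim_eq (I : ideal S) (c : nat) : Prop :=
  (forall p : proj_point S, (forall x : S, I x -> p x) -> chain_at p c) /\
  (exists p : proj_point S, (forall x : S, I x -> p x) /\ ~ chain_at p c.+1).
End Codimension.

Section Minors.
Variables (R : comPzRingType) (t m : nat) (A : 'M[R]_(t, m)).

(* Index maps that are not increasing only contribute 0 or a minor up to sign. *)
Definition minors (j : nat) : ideal R :=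
  span (fun r : R^o => exists (f : 'I_j -> 'I_t) (g : 'I_j -> 'I_m),
    r = \det (mxsub f g A)).

Fact mx_image0 : exists y : 'cV[R]_m, (0 : 'cV[R]_t) = A *m y.
Proof. by exists 0; rewrite mulmx0. Qed.
Fact mx_imageD (x y : 'cV[R]_t) : (exists z : 'cV[R]_m, x = A *m z) ->
  (exists z : 'cV[R]_m, y = A *m z) -> exists z : 'cV[R]_m, x + y = A *m z.
Proof. by move=> [z ->] [w ->]; exists (z + w); rewrite mulmxDr. Qed.
Fact mx_imageZ a (x : 'cV[R]_t) : (exists z : 'cV[R]_m, x = A *m z) ->
  exists z : 'cV[R]_m, a *: x = A *m z.
Proof. by move=> [z ->]; exists (a *: z); rewrite scalemxAr. Qed.
Definition mx_image : submod 'cV[R]_t := Submod mx_image0 mx_imageD mx_imageZ.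

Lemma mx_image_minor (r : R) (x : 'cV[R]_t) : minors t r -> mx_image (r *: x).
Proof.
pose W := @Submod R R^o (fun r => mx_image (r *: x)).
have W0 : mx_image ((0 : R) *: x) by rewrite scale0r; apply: submod0.
have WD (a b : R^o) : mx_image ((a : R) *: x) -> mx_image ((b : R) *: x) ->
    mx_image ((a + b : R) *: x) by rewrite scalerDl; apply: submodD.
have WZ (a : R) (b : R^o) : mx_image ((b : R) *: x) -> mx_image ((a *: b : R^o) *: x).
  by move=> h; rewrite -[a *: b]/(a * b) -scalerA; exact: (submodZ a h).
move/(_ (W W0 WD WZ)); apply=> _ [f [g ->]] /=.
have -> : mxsub f g A = rowsub f 1%:M *m colsub g A.
  by rewrite mul_rowsub_mx mul1mx; apply/matrixP => i j; rewrite !mxE.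
rewrite det_mulmx -scalerA.
suff h : mx_image (\det (colsub g A) *: x) by apply: (submodZ (s := mx_image)).
exists (colsub g 1%:M *m (\adj (colsub g A) *m x)).
have e : A *m colsub g 1%:M = colsub g A by rewrite mulmx_colsub mulmx1.
transitivity (colsub g A *m (\adj (colsub g A) *m x)).
  by rewrite mulmxA mul_mx_adj mul_scalar_mx.
by rewrite -{1}e -mulmxA.
Qed.
End Minors.

Section Determinantal.
Variables (K : fieldType) (n t m : nat) (a : 'I_m -> int) (b : 'I_t -> int).
Local Notation R := {mpoly K[n.+1]}.
Local Notation S := (poly_gralg K n.+1).

(* A represents a degree 0 map from the sum of the R(-a_j) to the sum of the
   R(-b_i). *)
Definition homogeneous_mx (A : 'M[R]_(t, m)) : Prop :=
  forall i j, poly_deg (a j - b i) (A i j).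

(* Polynomials in the coefficients of the entries. Only the coefficients of
   degree a_j - b_i matter: the others vanish on homogeneous matrices. *)
Definition coef_polynomial (phi : 'M[R]_(t, m) -> K) : Prop :=
  exists (N : nat) (idx : 'I_N -> 'I_t * 'I_m * 'X_{1..n.+1}) (f : {mpoly K[N]}),
    forall A, phi A = f.@[fun k => (A (idx k).1.1 (idx k).1.2)@_((idx k).2)].

Definition zariski_open_mx (U : 'M[R]_(t, m) -> Prop) : Prop :=
  exists E : ('M[R]_(t, m) -> K) -> Prop,
    (forall phi, E phi -> coef_polynomial phi) /\
    forall A, homogeneous_mx A -> (U A <-> exists phi, E phi /\ phi A != 0).

(* P holds for a matrix of general forms of degrees a_j - b_i. *)
Definition general_mx (P : 'M[R]_(t, m) -> Prop) : Prop :=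
  exists U : 'M[R]_(t, m) -> Prop,
    [/\ zariski_open_mx U, exists A, homogeneous_mx A /\ U A
      & forall A, homogeneous_mx A -> U A -> P A].

(* The p-th term (p > 0) of the Eagon-Northcott complex is
   wedge^(t+p-1) F (x) S_(p-1)(G)^* (x) wedge^t G^*; it has a basis indexed by a
   set J of t+p-1 columns and a monomial u of degree p-1 in the basis of G, and
   the corresponding summand is R(-d) with d as below. *)
Definition EN_twist (p : nat) (d : int) : Prop :=
  exists (J : {set 'I_m}) (u : 'X_{1..t}),
    [/\ #|J| = (t + p - 1)%N, mdeg u = (p - 1)%N
      & d = \sum_(j in J) a j - \sum_i b i - \sum_i b i *+ u i].

Variable A : 'M[R]_(t, m).

Definition det_ideal : ideal S := minors A t.

Definition standard_determinantal (c : nat) : Prop :=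
  codim_eq det_ideal c /\ saturated det_ideal.

Definition coord_ring : gralg K := gquot det_ideal.

Definition cokernel_base : grmod S := gquotmod (mx_image A : submod (gfree S b)).
Fact cokernel_killed : killed_by det_ideal cokernel_base.
Proof.
move=> r v Ir; elim/quot_ind: v => v; rewrite -linearZ; apply: quot_pi0.
exact: mx_image_minor.
Qed.
Definition cokernel_mod : grmod coord_ring := gdescent cokernel_killed.

Definition conormal_mod : grmod coord_ring := conormal det_ideal.

(* N_X(M^i) and N_X on X = Proj (R/I); the conormal sheaf I_X/I_X^2 is the
   sheaf associated with I/I^2. *)
Definition normal_sheaf_sym (i : int) : sheaf coord_ring :=
  sheaf_hom (tilde conormal_mod) (tilde (sym_pow cokernel_mod i)).
Definition normal_sheaf : sheaf coord_ring :=
  sheaf_hom (tilde conormal_mod) (structure_sheaf coord_ring).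

End Determinantal.

(* Main.v *)
Require Import Defs.
From HB Require Import structures.
From mathcomp Require Import all_boot all_order all_algebra.
From mathcomp Require Import perm boolp mpoly ring zify.
From mathcomp Require classical_sets.
Import Defs.
Set Implicit Arguments.
Unset Strict Implicit.
Unset Printing Implicit Defensive.
Import Order.TTheory GRing.Theory Num.Theory.
Local Open Scope ring_scope.

(* Write phi for the t x m matrix, I for its ideal of maximal minors and J for
   its ideal of (t-1)-minors. For general phi a power of x_p lies in the ideal
   of maximal minors of the first t + p columns modulo (x_{p+1}, ..), and a power
   of x_e lies in J modulo (x_{e+1}, ..); this makes x_c, x_{c+1}, .. a regular
   sequence on R/I, on the exterior algebra modulo the columns of phi and, with a
   shift by i, on S_i M. Hence elements of J of the form x_e^N + .. are
   nonzerodivisors, two consecutive ones allow one to glue local data to global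
   data, and it is enough to argue where a (t-1)-minor is invertible.

   There every f in I satisfies f Id = phi h_f, and f |-> h_f mod I identifies
   the conormal module with the matrices h subject to linear relations. A degree
   0 endomorphism lifts to an element of the exterior algebra annihilated by the
   rows of phi; the degree hypothesis leaves room only for scalar multiples of
   the product of the rows. An endomorphism Theta of Hom(I/I^2, S_i M) acts
   locally by a matrix on the entries of h_f; these matrices glue to a matrix P
   over R with phi P = Q phi, and comparing covectors orthogonal to the columns
   shows that P is a scalar modulo the relations.

   Genericity is an open condition because it is the solvability of linear
   systems in the coefficients; it holds at an explicit matrix A0. *)

(** Depth is never computed homologically. The variables are removed from the last one down, and a
    form that is a power of x_p modulo the later variables behaves like x_p. Each passage to a
    cokernel costs one variable, and this fixes the constants: the exterior quotients are regular
    from index c on, the row module loses one more index, each further symmetric power another one,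
    and gluing needs two consecutive indices. Hence the forms [sJ e] for c <= e <= 2c, and n >= 2c,
    which makes x_{2c} available; c >= 2 gives c + 2 <= 2c for the gluing of rows.

    The subalgebra generated by the columns treats coker phi (degree 1) and R/I (degree t) in a
    single induction on the number of columns; its degree t - 1 takes care of covectors.

    On Proj the obstacle is that stalks contain only fractions of degree 0. A linear form that does
    not vanish at the point balances all degrees, and sheaves are left as early as possible: an
    identity between germs becomes an identity over R after multiplication by a power of a form, and
    regularity cancels that form. *)

Definition preim_submod (R : pzRingType) (U V : lmodType R) (f : {linear U -> V})
    (W : submod V) : submod U.
Proof.
exists (fun x => W (f x)).
- by rewrite raddf0; apply: submod0.
- by move=> x y; rewrite raddfD; apply: submodD.
- by move=> a x; rewrite linearZ; apply: submodZ.
Defined.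

(** * Exterior algebra of a free module *)

Section Exterior.
Variable C : comNzRingType.
Implicit Types (u v : nat -> C).

(** A pair [(z.1, z.2)] stands for z.1 + e ∧ z.2, where e is the last basis vector; the signs in
    [wedge], [contr] and [mul] come from moving vectors past e. Below, [bar] is the sign involution
    (-1)^deg, [gr p] the projection to degree p, and [top] the coefficient of the top element.
    Recursion on pairs replaces bases indexed by subsets. *)
Fixpoint ext (t : nat) : lmodType C :=
  match t with 0 => C^o | t'.+1 => (ext t' * ext t')%type end.

Fixpoint wedge t v : ext t -> ext t :=
  match t with
  | 0 => fun _ => 0
  | t'.+1 => fun z : ext t' * ext t' =>
      (wedge v z.1, v t' *: z.1 - wedge v z.2)
  end.

Fixpoint contr t u : ext t -> ext t :=
  match t with
  | 0 => fun _ => 0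
  | t'.+1 => fun z : ext t' * ext t' =>
      (contr u z.1 + u t' *: z.2, - contr u z.2)
  end.

Fixpoint top t : ext t -> C :=
  match t with
  | 0 => fun z => z
  | t'.+1 => fun z : ext t' * ext t' => top z.2
  end.

Fixpoint one t : ext t :=
  match t with 0 => 1 : C | t'.+1 => (one t', 0 : ext t') end.

Fixpoint Top t : ext t :=
  match t with 0 => 1 : C | t'.+1 => (0 : ext t', Top t') end.

Fixpoint bar t : ext t -> ext t :=
  match t with
  | 0 => fun z => z
  | t'.+1 => fun z : ext t' * ext t' => (bar z.1, - bar z.2)
  end.

Fixpoint mul t : ext t -> ext t -> ext t :=
  match t with
  | 0 => fun y z => (y : C) * (z : C)
  | t'.+1 => fun y z : ext t' * ext t' =>
      (mul y.1 z.1, mul y.2 z.1 + mul (bar y.1) z.2)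
  end.

Fixpoint gr t (p : nat) : ext t -> ext t :=
  match t with
  | 0 => fun z => if p is 0 then z else 0
  | t'.+1 => fun z : ext t' * ext t' =>
      (gr p z.1, if p is p'.+1 then gr p' z.2 else 0 : ext t')
  end.

Fixpoint allext t (P : C -> Prop) : ext t -> Prop :=
  match t with
  | 0 => fun z => P z
  | t'.+1 => fun z : ext t' * ext t' => allext P z.1 /\ allext P z.2
  end.

Definition dot t u v : C := \sum_(i < t) u i * v i.

Lemma wedge_is_linear t v : linear (@wedge t v).
Proof.
elim: t => [|t IH] a y z /=; first by rewrite scaler0 addr0.
congr (_, _); rewrite /= !IH // scalerDr !scalerA scalerBr scalerA opprD.
by rewrite (mulrC (v t)) addrACA.
Qed.
HB.instance Definition _ t v :=
  GRing.isLinear.Build C (ext t) (ext t) *:%R (@wedge t v) (@wedge_is_linear t v).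

Lemma contr_is_linear t u : linear (@contr t u).
Proof.
elim: t => [|t IH] a y z /=; first by rewrite scaler0 addr0.
congr (_, _); rewrite /= !IH ?scalerDr ?scalerN ?opprD // !scalerA (mulrC (u t)).
by rewrite addrACA.
Qed.
HB.instance Definition _ t u :=
  GRing.isLinear.Build C (ext t) (ext t) *:%R (@contr t u) (@contr_is_linear t u).

Lemma top_is_linear t : linear (@top t : ext t -> C^o).
Proof. by elim: t => [|t IH] a y z //=; rewrite IH. Qed.
HB.instance Definition _ t :=
  GRing.isLinear.Build C (ext t) C^o *:%R (@top t) (@top_is_linear t).

Lemma topZ t a (z : ext t) : top (a *: z) = a * top z.
Proof. exact: linearZ. Qed.
Lemma topB t (y z : ext t) : top (y - z) = top y - top z.
Proof. exact: linearB. Qed.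
Lemma topN t (z : ext t) : top (- z) = - top z.
Proof. exact: linearN. Qed.

Lemma wedgeZr t v a (z : ext t) : wedge v (a *: z) = a *: wedge v z.
Proof. exact: linearZ. Qed.
Lemma wedgeBr t v (y z : ext t) : wedge v (y - z) = wedge v y - wedge v z.
Proof. exact: linearB. Qed.
Lemma contrZr t u a (z : ext t) : contr u (a *: z) = a *: contr u z.
Proof. exact: linearZ. Qed.
Lemma contrBr t u (y z : ext t) : contr u (y - z) = contr u y - contr u z.
Proof. exact: linearB. Qed.

Lemma wedge_sum t v (I : Type) (r : seq I) (F : I -> ext t) :
  wedge v (\sum_(i <- r) F i) = \sum_(i <- r) wedge v (F i).
Proof. exact: linear_sum. Qed.
Lemma contr_sum t v (I : Type) (r : seq I) (F : I -> ext t) :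
  contr v (\sum_(i <- r) F i) = \sum_(i <- r) contr v (F i).
Proof. exact: linear_sum. Qed.
Lemma top_sum t (I : Type) (r : seq I) (F : I -> ext t) :
  top (\sum_(i <- r) F i) = \sum_(i <- r) top (F i).
Proof. exact: (raddf_sum (@top t : {additive ext t -> C^o})). Qed.

Lemma gr_is_linear t p : linear (@gr t p).
Proof.
elim: t p => [|t IH] [|p] a y z //=; rewrite ?scaler0 ?addr0 //.
  by congr (_, _); rewrite /= ?IH ?scaler0 ?addr0.
by congr (_, _); rewrite /= !IH.
Qed.
HB.instance Definition _ t p :=
  GRing.isLinear.Build C (ext t) (ext t) *:%R (@gr t p) (@gr_is_linear t p).

Lemma bar_is_linear t : linear (@bar t).
Proof.
elim: t => [|t IH] a y z //=; congr (_, _); rewrite /= ?IH // opprD scalerN //.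
Qed.
HB.instance Definition _ t :=
  GRing.isLinear.Build C (ext t) (ext t) *:%R (@bar t) (@bar_is_linear t).

Lemma ext_eta t (z : ext t.+1) : (z.1, z.2) = z :> ext t.+1.
Proof. exact: esym (surjective_pairing z). Qed.

Lemma barK t : involutive (@bar t).
Proof.
elim: t => [|t IH] z //=.
by rewrite linearN /= !IH opprK ext_eta.
Qed.

Lemma mul_is_linear t y : linear (@mul t y).
Proof.
elim: t y => [|t IH] y a x z /=; first by rewrite mulrDr -[a *: x]/(a * x) mulrCA.
by congr (_, _); rewrite /= !IH // scalerDr addrACA.
Qed.
HB.instance Definition _ t y :=
  GRing.isLinear.Build C (ext t) (ext t) *:%R (@mul t y) (@mul_is_linear t y).

Lemma mulDl t (x y z : ext t) : mul (x + y) z = mul x z + mul y z.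
Proof.
elim: t x y z => [|t IH] x y z /=; first by rewrite mulrDl.
by congr (_, _); rewrite /= ?raddfD ?IH // addrACA.
Qed.

Lemma mulZl t a (y z : ext t) : mul (a *: y) z = a *: mul y z.
Proof.
elim: t y z => [|t IH] y z /=; first by rewrite -[LHS]/(a * y * z) -mulrA.
by congr (_, _); rewrite /= ?linearZ ?IH // scalerDr.
Qed.

Lemma mulNl t (y z : ext t) : mul (- y) z = - mul y z.
Proof. by rewrite -scaleN1r mulZl scaleN1r. Qed.

Lemma mul0l t (z : ext t) : mul 0 z = 0.
Proof. by have := mulZl 0 0 z; rewrite !scale0r. Qed.

Lemma mul1l t (z : ext t) : mul (one t) z = z.
Proof.
elim: t z => [|t IH] z /=; first by rewrite mul1r.
have e : bar (one t) = one t.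
  by elim: t {IH z} => [|t IH] //=; rewrite IH raddf0 oppr0.
by rewrite e mul0l !IH add0r ext_eta.
Qed.

Lemma wedge_eq t v w (z : ext t) : (forall i, (i < t)%N -> v i = w i) ->
  wedge v z = wedge w z.
Proof.
elim: t z => [|t IH] z //= h; rewrite h // !IH // => i it; apply: h; exact: ltnW.
Qed.

Lemma wedgeDl t v w (z : ext t) :
  wedge (fun i => v i + w i) z = wedge v z + wedge w z.
Proof.
elim: t z => [|t IH] z /=; first by rewrite addr0.
by congr (_, _); rewrite /= ?IH // scalerDl opprD addrACA.
Qed.

Lemma wedgeZl t a v (z : ext t) : wedge (fun i => a * v i) z = a *: wedge v z.
Proof.
elim: t z => [|t IH] z /=; first by rewrite scaler0.
by congr (_, _); rewrite /= ?IH // -scalerA scalerBr.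
Qed.

Lemma wedge0l t (z : ext t) : wedge (fun=> 0) z = 0.
Proof.
have := wedgeZl 0 (fun=> 0) z; rewrite scale0r => <-.
by apply: wedge_eq => i _; rewrite mul0r.
Qed.

Lemma wedgeK t v (z : ext t) : wedge v (wedge v z) = 0.
Proof.
elim: t z => [|t IH] z //=; rewrite IH linearB linearZ /= IH subr0.
by rewrite subrr.
Qed.

Lemma wedgeC t v w (z : ext t) : wedge v (wedge w z) = - wedge w (wedge v z).
Proof.
apply/eqP; rewrite -addr_eq0; apply/eqP.
have := wedgeK (fun i => v i + w i) z.
by rewrite !wedgeDl !linearD /= !wedgeK add0r addr0 addrC.
Qed.

(** Contraction is an antiderivation (Cartan's formula). It converts products that vanish for
    reasons of degree into linear relations. *)
Lemma contr_wedge t u v (z : ext t) :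
  contr u (wedge v z) = dot t u v *: z - wedge v (contr u z).
Proof.
rewrite /dot; elim: t z => [|t IH] z /=.
  by rewrite big_ord0 scale0r subr0.
have eD (p q r q' : ext t) : p - q + (r - q') = p + r - (q + q').
  by rewrite opprD addrACA.
rewrite big_ord_recr /=; congr (_, _); rewrite /=.
  rewrite IH [wedge v (_ + _)]linearD /= [wedge v (_ *: _)]linearZ /=.
  by rewrite scalerBr scalerA scalerDl eD.
rewrite [contr u (_ - _)]linearB /= [contr u (_ *: _)]linearZ /= IH linearN /=.
rewrite scalerDr scalerDl scalerA opprB opprD opprK (mulrC (v t)).
set d := wedge v (contr u z.2); set p := _ *: z.2.
set X := (u t * v t) *: z.2; set Y := v t *: _.
by rewrite -!addrA opprD (addrA X) (addrC X) subrK (addrC (- d)).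
Qed.

Lemma mul_wedge t v (y z : ext t) : mul (wedge v y) z = wedge v (mul y z).
Proof.
elim: t y z => [|t IH] y z /=; first by rewrite mul0r.
have e (x : ext t) : bar (wedge v x) = - wedge v (bar x).
  elim: t x {IH y z} => [|t IH] x /=; first by rewrite oppr0.
  by congr (_, _); rewrite /= ?linearN ?linearB ?linearZ /= !IH // !opprK opprD.
congr (_, _); rewrite /= ?IH // e mulDl mulZl !mulNl !IH linearD /= opprD.
by rewrite addrA.
Qed.

(** The pairing of complementary degrees is perfect: each coordinate of [z] is, up to sign, the top
    coefficient of its product with a complementary basis element. *)
Lemma nondeg t (P : C -> Prop) (z : ext t) :
  (forall y, P (top (mul y z))) -> allext P z.
Proof.
elim: t z => [|t IH] z /= h; first by have := h 1; rewrite mul1r.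
split; apply: IH => y.
  by have := h (0, y); rewrite /= raddf0 mul0l addr0.
by have := h (bar y, 0); rewrite /= mul0l add0r barK.
Qed.

Lemma allextP t (P : C -> Prop) (z : ext t) : allext P z -> P (top z).
Proof. by elim: t z => [|t IH] z //= [_ /IH]. Qed.

Definition lo t (a : ext t) : ext t.+1 := (a, 0).
Definition hi t (b : ext t) : ext t.+1 := (0, b).

Lemma lo_is_linear t : linear (@lo t).
Proof. by move=> a x y; congr (_, _); rewrite /= scaler0 addr0. Qed.
HB.instance Definition _ t :=
  GRing.isLinear.Build C (ext t) (ext t.+1) *:%R (@lo t) (@lo_is_linear t).

Lemma hi_is_linear t : linear (@hi t).
Proof. by move=> a x y; congr (_, _); rewrite /= scaler0 addr0. Qed.
HB.instance Definition _ t :=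
  GRing.isLinear.Build C (ext t) (ext t.+1) *:%R (@hi t) (@hi_is_linear t).

Lemma loZ t a (x : ext t) : lo (a *: x) = a *: lo x.
Proof. exact: linearZ. Qed.
Lemma hiZ t a (x : ext t) : hi (a *: x) = a *: hi x.
Proof. exact: linearZ. Qed.

Lemma lo_hi t (z : ext t.+1) : lo z.1 + hi z.2 = z.
Proof. by rewrite -[RHS]ext_eta; congr (_, _); rewrite /= ?addr0 ?add0r. Qed.

Lemma contr_eq t u w (z : ext t) : (forall i, (i < t)%N -> u i = w i) ->
  contr u z = contr w z.
Proof.
elim: t z => [|t IH] z //= h; rewrite h // !IH // => i it; apply: h; exact: ltnW.
Qed.

Lemma contr0l t (z : ext t) : contr (fun=> 0) z = 0.
Proof. by elim: t z => [|t IH] z //=; rewrite !IH scale0r addr0 oppr0. Qed.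

Definition below t (v : nat -> C) i := if (i < t)%N then v i else 0.

Lemma wedge_lo t v (x : ext t) : wedge (below t v) (lo x) = lo (wedge v x).
Proof.
rewrite /lo /= /below ltnn scale0r raddf0 subr0; congr (_, _).
by apply: wedge_eq => i ->.
Qed.

Lemma wedge_lo_top t (x : ext t) : wedge (fun i => (i == t)%:R) (lo x) = hi x.
Proof.
rewrite /lo /hi /= eqxx scale1r raddf0 subr0; congr (_, _).
by rewrite -[RHS](wedge0l x); apply: wedge_eq => i it; rewrite ltn_eqF.
Qed.

Lemma contr_hi t v (x : ext t) : contr (below t v) (hi x) = hi (- contr v x).
Proof.
have e : contr (below t v) x = contr v x by apply: contr_eq => i; rewrite /below => ->.
by rewrite /hi /= e raddf0 add0r /below ltnn scale0r.
Qed.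

Lemma contr_hi_top t (x : ext t) : contr (fun i => (i == t)%:R) (hi x) = lo x.
Proof.
have e : contr (fun i => (i == t)%:R) x = 0.
  by rewrite -(contr0l x); apply: contr_eq => i it; rewrite ltn_eqF.
by rewrite /hi /lo /= e raddf0 add0r eqxx scale1r oppr0.
Qed.

Lemma contrDl t u w (z : ext t) :
  contr (fun i => u i + w i) z = contr u z + contr w z.
Proof.
elim: t z => [|t IH] z /=; first by rewrite addr0.
by congr (_, _); rewrite /= ?IH ?opprD // scalerDl addrACA.
Qed.

Lemma contrZl t a u (z : ext t) : contr (fun i => a * u i) z = a *: contr u z.
Proof.
elim: t z => [|t IH] z /=; first by rewrite scaler0.
by congr (_, _); rewrite /= ?IH ?scalerN // scalerDr scalerA.
Qed.

Definition delta (i : nat) : nat -> C := fun j => (j == i)%:R.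

Lemma contr_coord t u (z : ext t) : contr u z = \sum_(i < t) u i *: contr (delta i) z.
Proof.
suff h n : contr (fun j => \sum_(i < n) u i * delta i j) z =
    \sum_(i < n) u i *: contr (delta i) z.
  rewrite -h; apply: contr_eq => j jt; rewrite (bigD1 (Ordinal jt)) //= /delta eqxx mulr1.
  by rewrite big1 ?addr0 // => k /negbTE; rewrite -val_eqE /= eq_sym => ->; rewrite mulr0.
elim: n => [|n IH].
  by rewrite big_ord0 -[RHS](contr0l z); apply: contr_eq => j _; rewrite big_ord0.
rewrite big_ord_recr /= -IH -contrZl -contrDl; apply: contr_eq => j _.
exact: big_ord_recr.
Qed.

Lemma wedge_coord t v (z : ext t) : wedge v z = \sum_(i < t) v i *: wedge (delta i) z.
Proof.
suff h n : wedge (fun j => \sum_(i < n) v i * delta i j) z =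
    \sum_(i < n) v i *: wedge (delta i) z.
  rewrite -h; apply: wedge_eq => j jt; rewrite (bigD1 (Ordinal jt)) //= /delta eqxx mulr1.
  by rewrite big1 ?addr0 // => k /negbTE; rewrite -val_eqE /= eq_sym => ->; rewrite mulr0.
elim: n => [|n IH].
  by rewrite big_ord0 -[RHS](wedge0l z); apply: wedge_eq => j _; rewrite big_ord0.
rewrite big_ord_recr /= -IH -wedgeZl -wedgeDl; apply: wedge_eq => j _.
exact: big_ord_recr.
Qed.

Lemma dot_delta t u i : (i < t)%N -> dot t u (delta i) = u i.
Proof.
move=> it; rewrite /dot (bigD1 (Ordinal it)) //= /delta eqxx mulr1 big1 ?addr0 //.
by move=> k /negbTE; rewrite -val_eqE /= => ->; rewrite mulr0.
Qed.

(** Contracting the top element by basis covectors produces every basis element up to sign, so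
    stability under contraction spreads one multiple of [Top] over the whole algebra. *)
Lemma ext_from_top t (Q : submod (ext t)) r :
  (forall u z, Q z -> Q (contr u z)) -> Q (r *: Top t) -> forall z, Q (r *: z).
Proof.
elim: t Q => [|t IH] Q Qc QT z.
  have := submodZ (z : C) QT; rewrite !scalerA.
  by rewrite -[_ *: _]/(_ * _ * _) mulr1 mulrC.
have h x : Q (hi (r *: x)).
  apply: (IH (preim_submod (@hi t) Q)) => [u y /= /(Qc (below t u))|].
    by rewrite contr_hi raddfN => /submodN; rewrite opprK.
  by rewrite /= hiZ.
rewrite -(lo_hi z) scalerDr; apply: submodD; last by rewrite -hiZ.
by rewrite -loZ; have := Qc (fun i => (i == t)%:R) _ (h z.1); rewrite contr_hi_top.
Qed.

Lemma ext_from_one t (Q : submod (ext t)) :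
  (forall v z, Q z -> Q (wedge v z)) -> Q (one t) -> forall z, Q z.
Proof.
elim: t Q => [|t IH] Q Qw Q1 z.
  by have := submodZ (z : C) Q1; rewrite -[_ *: _]/(_ * _) mulr1.
have h : forall x, preim_submod (@lo t) Q x.
  by apply: IH => //= v x /(Qw (below t v)); rewrite wedge_lo.
rewrite -(lo_hi z) -wedge_lo_top; apply: submodD; first exact: h.
by apply: Qw; apply: h.
Qed.

Lemma allext_sub t (P : C -> Prop) (Q : submod (ext t)) (z : ext t) :
  (forall r y, P r -> Q (r *: y)) -> allext P z -> Q z.
Proof.
elim: t Q z => [|t IH] Q z /= h.
  by move=> Pz; have := h z 1 Pz; rewrite -[_ *: _]/(_ * _) mulr1.
move=> [Pa Pb]; rewrite -(lo_hi z); apply: submodD.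
  apply: (IH (preim_submod (@lo t) Q)) => // r y Pr /=; rewrite loZ; exact: h.
apply: (IH (preim_submod (@hi t) Q)) => // r y Pr /=; rewrite hiZ; exact: h.
Qed.

Lemma gr0_wedge t v (z : ext t) : gr 0 (wedge v z) = 0.
Proof. by elim: t z => [|t IH] z //=; rewrite IH. Qed.

Lemma gr_wedge t p v (z : ext t) : gr p.+1 (wedge v z) = wedge v (gr p z).
Proof.
elim: t p z => [|t IH] p z; first by case: p.
rewrite /= IH [gr p (_ - _)]linearB /= [gr p (_ *: _)]linearZ /=; congr (_, _ - _).
by case: p => [|p]; rewrite ?IH // gr0_wedge raddf0.
Qed.

Lemma gr_gr t p (z : ext t) : gr p (gr p z) = gr p z.
Proof. by elim: t p z => [|t IH] [|p] z //=; rewrite !IH. Qed.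

Lemma gr_top t (z : ext t) : gr t z = top z *: Top t.
Proof.
have g0 s p (x : ext s) : (s < p)%N -> gr p x = 0.
  elim: s p x => [|s IH] [|p] x //= h; rewrite !IH //; exact: ltnW.
elim: t z => [|t IH] z /=; first by rewrite -[RHS]/(_ * _) mulr1.
by rewrite g0 // IH; congr (_, _); rewrite /= scaler0.
Qed.

Lemma gr_one t : gr 0 (one t) = one t.
Proof. by elim: t => //= t ->. Qed.

Lemma top_Top t : top (Top t) = 1.
Proof. by elim: t. Qed.

Lemma top_gr t (z : ext t) : top (gr t z) = top z.
Proof. by rewrite gr_top linearZ /= top_Top -[LHS]/(_ * _) mulr1. Qed.

Lemma gr_big t p (z : ext t) : (t < p)%N -> gr p z = 0.
Proof. elim: t p z => [|t IH] [|p] z //= h; rewrite !IH //; exact: ltnW. Qed.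

Lemma allext_one t (P : C -> Prop) a : allext P (a *: one t) -> P a.
Proof. by elim: t => [|t IH] /=; [rewrite -[_ *: _]/(_ * _) mulr1|case=> /IH]. Qed.

Lemma scale_one_eq0 t a : a *: one t = 0 -> a = 0.
Proof.
by elim: t => [|t IH] /=; [rewrite -[_ *: _]/(_ * _) mulr1|case=> /IH].
Qed.

Variable Phi : nat -> nat -> C.

(* the algebra map ext q -> ext t sending the j-th basis vector to Phi j *)
Fixpoint Lam t q : ext q -> ext t :=
  match q with
  | 0 => fun w => (w : C) *: one t
  | q'.+1 => fun w : ext q' * ext q' => Lam t w.1 + wedge (Phi q') (Lam t w.2)
  end.

Lemma Lam_is_linear t q : linear (@Lam t q).
Proof.
elim: q => [|q IH] a y z /=; first by rewrite scalerDl scalerA.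
by rewrite !IH linearD linearZ /= scalerDr addrACA.
Qed.
HB.instance Definition _ t q :=
  GRing.isLinear.Build C (ext q) (ext t) *:%R (@Lam t q) (@Lam_is_linear t q).

Lemma LamZ t q a (w : ext q) : Lam t (a *: w) = a *: Lam t w.
Proof. exact: linearZ. Qed.
Lemma Lam_sum t q (I : Type) (r : seq I) (F : I -> ext q) :
  Lam t (\sum_(i <- r) F i) = \sum_(i <- r) Lam t (F i).
Proof. exact: linear_sum. Qed.

Definition comb q (d : nat -> C) : nat -> C := fun i => \sum_(j < q) d j * Phi j i.

Lemma wedge_comb t q d (z : ext t) :
  wedge (comb q d) z = \sum_(j < q) d j *: wedge (Phi j) z.
Proof.
elim: q => [|q IH].
  rewrite big_ord0 -[RHS](wedge0l z); apply: wedge_eq => i _; exact: big_ord0.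
rewrite big_ord_recr /= -IH -wedgeZl -wedgeDl; apply: wedge_eq => i _.
exact: big_ord_recr.
Qed.

Lemma Lam_wedge t q d (w : ext q) : Lam t (wedge d w) = wedge (comb q d) (Lam t w).
Proof.
elim: q w => [|q IH] w /=.
  rewrite scale0r -[LHS](wedge0l ((w : C) *: one t)); apply: wedge_eq => i _.
  by rewrite /comb big_ord0.
have e (z : ext t) : wedge (comb q.+1 d) z = wedge (comb q d) z + d q *: wedge (Phi q) z.
  by rewrite !wedge_comb big_ord_recr.
rewrite !IH [Lam t (_ - _)]linearB /= [Lam t (_ *: _)]linearZ /= IH !e.
rewrite [wedge _ (_ - _)]linearB /= [wedge _ (_ *: _)]linearZ /=.
rewrite [wedge _ (_ + _)]linearD /= [wedge (Phi q) (_ + _)]linearD /= wedgeK addr0.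
by rewrite (wedgeC (Phi q)) opprK -!addrA; congr (_ + _); exact: addrC.
Qed.

Lemma Lam_one t q : Lam t (one q) = one t.
Proof. by elim: q => [|q IH] /=; rewrite ?scale1r // IH raddf0 raddf0 addr0. Qed.

Lemma contr_one t u : contr u (one t) = 0.
Proof. by elim: t => [|t IH] //=; rewrite IH !raddf0 addr0. Qed.

(** Contraction by [u] in the target is contraction by the pulled back covector j |-> <u, Phi_j> in
    the source. Hence the image of [Lam] is stable under all contractions. *)
Lemma Lam_contr t q u (w : ext q) :
  contr u (Lam t w) = Lam t (contr (fun j => dot t u (Phi j)) w).
Proof.
elim: q w => [|q IH] w /=; first by rewrite linearZ /= contr_one scaler0 scale0r.
rewrite !linearD /= linearZ linearN /= contr_wedge !IH.
by rewrite linearN /= addrA.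
Qed.

Lemma Lam_gr t q p (w : ext q) : gr p (Lam t w) = Lam t (gr p w).
Proof.
elim: q p w => [|q IH] p w /=.
  rewrite linearZ /=; case: p => [|p]; first by rewrite gr_one.
  have h : gr p.+1 (one t) = 0.
    by elim: t p {w} => [|t IH] p //=; rewrite IH raddf0.
  by rewrite h; rewrite scaler0 scale0r.
rewrite linearD /= IH; congr (_ + _).
by case: p => [|p]; rewrite ?gr0_wedge ?gr_wedge ?IH // !raddf0.
Qed.

(** The subalgebra generated by the first [q] columns, not the ideal: its part of degree p is the
    image of the p-th exterior power of the map given by these columns. The quotient is the cokernel
    of the map in degree 1 and the ring modulo maximal minors in degree t. *)
Definition ImL t (q : nat) : submod (ext t).
Proof.
exists (fun z => exists w : ext q, z = Lam t w).
- by exists 0; rewrite raddf0.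
- by move=> _ _ [x ->] [y ->]; exists (x + y); rewrite linearD.
- by move=> a _ [x ->]; exists (a *: x); rewrite linearZ.
Defined.

(** Top coefficients of products of columns: the ideal of t × t minors of the first [q] columns. *)
Definition IL (t q : nat) : ideal C.
Proof.
exists (fun r => exists w : ext q, r = top (Lam t w)).
- by exists 0; rewrite !raddf0.
- by move=> _ _ [x ->] [y ->]; exists (x + y); rewrite !linearD.
- by move=> a _ [x ->]; exists (a *: x); rewrite !linearZ.
Defined.

Lemma ImL_wedge t q j z : (j < q)%N -> ImL t q z -> ImL t q (wedge (Phi j) z).
Proof.
move=> jq [w ->]; exists (wedge (fun i => (i == j)%:R) w); rewrite Lam_wedge.
apply: wedge_eq => i _; rewrite /comb (bigD1 (Ordinal jq)) //= eqxx mul1r big1 ?addr0 //.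
by move=> k /negbTE; rewrite -val_eqE /= => ->; rewrite mul0r.
Qed.

Lemma ImL_contr t q u z : ImL t q z -> ImL t q (contr u z).
Proof. by move=> [w ->]; rewrite Lam_contr; eexists. Qed.

(** Cramer's rule in invariant form: r [Top] is the degree t part of an element of the image, and
    contractions lead from it to every r z. *)
Lemma ImL_IL t q r z : IL t q r -> ImL t q (r *: z).
Proof.
move=> [w ->]; apply: ext_from_top => [u y|]; first exact: ImL_contr.
by rewrite -gr_top Lam_gr; eexists.
Qed.

Lemma ImL_S t q z : ImL t q z -> ImL t q.+1 z.
Proof. by move=> [w ->]; exists (w, 0); rewrite /= !raddf0 addr0. Qed.

Lemma ImL_one t q : ImL t q (one t).
Proof. by exists (one q); rewrite Lam_one. Qed.

Lemma top_ImL t q z : ImL t q z -> IL t q (top z).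
Proof. by move=> [w ->]; exists w. Qed.

Lemma allext_submod t (I : ideal C) : submod (ext t).
Proof.
exists (allext I).
- by elim: t => [|t IH] //=; apply: submod0.
- by elim: t => [|t IH] x y //=; [apply: submodD|move=> [? ?] [? ?]; split; apply: IH].
- by elim: t => [|t IH] a x //=; [apply: (submodZ (s := I))|move=> [? ?]; split; apply: IH].
Defined.

Lemma allext_wedge t (I : ideal C) v (z : ext t) : allext I z -> allext I (wedge v z).
Proof.
elim: t z => [|t IH] z /=; first by move=> _; apply: submod0.
move=> [h1 h2]; split; first exact: IH.
apply: (submodB (W := allext_submod t I)); last exact: IH.
exact: (submodZ (s := allext_submod t I)).
Qed.

End Exterior.

(** * Regular elements modulo variables, graded separation and gluing in depth two *)

Section SubmodMore.
Variables (R : pzRingType) (V : lmodType R).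

Lemma submod_sum (W : submod V) (I : Type) (r : seq I) (P : pred I) (F : I -> V) :
  (forall i, P i -> W (F i)) -> W (\sum_(i <- r | P i) F i).
Proof.
by move=> h; elim/big_rec: _ => [|i x Pi Wx]; [exact: submod0|apply: submodD => //; exact: h].
Qed.

Definition add_submod (W1 W2 : submod V) : submod V.
Proof.
exists (fun x => exists y, W1 y /\ W2 (x - y)).
- by exists 0; rewrite subr0; split; apply: submod0.
- move=> x y [x' [h1 h2]] [y' [h3 h4]]; exists (x' + y').
  by rewrite opprD addrACA; split; apply: submodD.
- by move=> a x [x' [h1 h2]]; exists (a *: x'); rewrite -scalerBr; split; apply: submodZ.
Defined.

Lemma add_submodl (W1 W2 : submod V) x : W1 x -> add_submod W1 W2 x.
Proof. by move=> h; exists x; rewrite subrr; split=> //; apply: submod0. Qed.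
Lemma add_submodr (W1 W2 : submod V) x : W2 x -> add_submod W1 W2 x.
Proof. by move=> h; exists 0; rewrite subr0; split=> //; apply: submod0. Qed.
Lemma add_submodS (W1 W2 W1' : submod V) x : (forall y, W1 y -> W1' y) ->
  add_submod W1 W2 x -> add_submod W1' W2 x.
Proof. by move=> h [y [/h h1 h2]]; exists y. Qed.
End SubmodMore.

Lemma idealMl (C : comPzRingType) (I : ideal C) a r : I r -> I (a * r).
Proof. exact: (@submodZ _ _ I a r). Qed.
Lemma idealMr (C : comPzRingType) (I : ideal C) a r : I r -> I (r * a).
Proof. by rewrite mulrC; apply: idealMl. Qed.

Section Regular.
Variables (C : comNzRingType) (L : nat) (x : nat -> C).

Section OneModule.
Variable H : lmodType C.
Implicit Types (W : submod H) (h : H).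

(* XS k is (x_k, ..., x_(L-1)) H, and lv W k is W + XS k *)
Definition XS (k : nat) : submod H.
Proof.
exists (fun h => exists c : nat -> H, h = \sum_(k <= i < L) x i *: c i).
- by exists (fun=> 0); rewrite big1 // => i _; rewrite scaler0.
- move=> _ _ [c ->] [d ->]; exists (fun i => c i + d i).
  by rewrite -big_split; apply: eq_bigr => i _; rewrite scalerDr.
- move=> a _ [c ->]; exists (fun i => a *: c i).
  by rewrite scaler_sumr; apply: eq_bigr => i _; rewrite !scalerA mulrC.
Defined.

Definition lv W k : submod H := add_submod W (XS k).

Lemma lvW W k h : W h -> lv W k h. Proof. exact: add_submodl. Qed.
Lemma lvX W k h : XS k h -> lv W k h. Proof. exact: add_submodr. Qed.
Lemma lvS W W' k h : (forall h, W h -> W' h) -> lv W k h -> lv W' k h.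
Proof. exact: add_submodS. Qed.

Lemma XSL h : XS L h <-> h = 0.
Proof.
split=> [[c ->]|->]; first by rewrite big_geq.
exact: submod0.
Qed.

Lemma XS_step k h : (k < L)%N -> XS k h <-> exists g, XS k.+1 (h - x k *: g).
Proof.
move=> kL; split=> [[c ->]|[g [c e]]].
  by exists (c k), c; rewrite big_ltn // addrC addrA addNr add0r.
exists (fun i => if i == k then g else c i); rewrite big_ltn // eqxx.
rewrite -[LHS](subrK (x k *: g)) e addrC; congr (_ + _).
by apply: eq_big_nat => i /andP[ki _]; rewrite gtn_eqF.
Qed.

Lemma XS_le k k' h : (k <= k')%N -> XS k' h -> XS k h.
Proof.
move=> kk' [c ->]; case: (leqP k' L) => [k'L|/ltnW k'L]; last first.
  by rewrite big_geq //; apply: submod0.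
exists (fun i => if (i < k')%N then 0 else c i).
rewrite (big_cat_nat kk' k'L) /=.
set S := \sum_(k <= i < k') _; have -> : S = 0.
  rewrite /S big_nat_cond big1 // => i; rewrite andbT => /andP[_ ->].
  by rewrite scaler0.
by rewrite add0r; apply: eq_big_nat => i /andP[ki _]; rewrite ltnNge ki.
Qed.

Lemma lv_le W k k' h : (k <= k')%N -> lv W k' h -> lv W k h.
Proof. by move=> kk' [y [Wy Xy]]; exists y; split=> //; apply: XS_le Xy. Qed.

Lemma XS_x k i h : (k <= i < L)%N -> XS k (x i *: h).
Proof.
move=> /andP[ki iL]; apply: (XS_le ki); apply/(XS_step _ iL).
by exists h; rewrite subrr; apply: submod0.
Qed.

Lemma lv_step W k h : (k < L)%N -> lv W k h <-> exists g, lv W k.+1 (h - x k *: g).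
Proof.
move=> kL; split=> [[y [Wy /(XS_step _ kL) [g hg]]]|[g [y [Wy hy]]]].
  by exists g, y; split=> //; rewrite addrAC.
by exists y; split=> //; apply/(XS_step _ kL); exists g; rewrite addrAC.
Qed.

Lemma lvL W h : lv W L h <-> W h.
Proof.
split=> [[y [Wy /XSL/eqP]]|]; last exact: lvW.
by rewrite subr_eq0 => /eqP ->.
Qed.

(* x_k is a nonzerodivisor on H / (W + XS k.+1) *)
Definition Reg W k := forall h, lv W k.+1 (x k *: h) -> lv W k.+1 h.

Definition regular_on W (q : C) := forall h, W (q *: h) -> W h.

Lemma regular_exp W q N : regular_on W q -> regular_on W (q ^+ N).
Proof.
move=> hq; elim: N => [|N IH] h; first by rewrite expr0 scale1r.
by rewrite exprS -scalerA => /hq /IH.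
Qed.

(** [cmp d] takes the component of degree d, and the x_k have degree 1. The uniform lower bound
    [cmp_lo] is what kills an element divisible by all powers of x_k. *)
Record grading := Grading {
  cmp : int -> H -> H;
  cmpB : forall d a b, cmp d (a - b) = cmp d a - cmp d b;
  cmpx : forall k d h, (k < L)%N -> cmp d (x k *: h) = x k *: cmp (d - 1) h;
  cmp_lo : exists B : int, forall d h, d < B -> cmp d h = 0;
  cmp_sum : forall h, exists s : seq int,
    [/\ uniq s, forall d, d \notin s -> cmp d h = 0 & h = \sum_(d <- s) cmp d h] }.

Definition graded (G : grading) W := forall d h, W h -> W (cmp G d h).

Lemma cmp0 (G : grading) d : cmp G d 0 = 0.
Proof. by rewrite -[in LHS](subrr (0 : H)) cmpB subrr. Qed.
Lemma cmpN (G : grading) d a : cmp G d (- a) = - cmp G d a.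
Proof. by rewrite -[- a]sub0r cmpB cmp0 sub0r. Qed.
Lemma cmpD (G : grading) d a b : cmp G d (a + b) = cmp G d a + cmp G d b.
Proof. by rewrite -[in LHS](opprK b) cmpB cmpN opprK. Qed.
Lemma cmp_bigsum (G : grading) d (I : Type) (r : seq I) (P : pred I) (F : I -> H) :
  cmp G d (\sum_(i <- r | P i) F i) = \sum_(i <- r | P i) cmp G d (F i).
Proof. exact: (big_morph _ (cmpD G d) (cmp0 G d)). Qed.

Lemma graded_lv G W k : graded G W -> graded G (lv W k).
Proof.
move=> gW d h [y [Wy [c e]]]; exists (cmp G d y); split; first exact: gW.
rewrite -cmpB e cmp_bigsum; exists (fun i => cmp G (d - 1) (c i)).
by apply: eq_big_nat => i /andP[_ iL]; rewrite cmpx.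
Qed.

Lemma cmp_exp (G : grading) k d h j : (k < L)%N ->
  cmp G d (x k ^+ j *: h) = x k ^+ j *: cmp G (d - j%:Z) h.
Proof.
move=> kL; elim: j d => [|j IH] d; first by rewrite !expr0 !scale1r subr0.
rewrite exprS -!scalerA cmpx // IH; congr (_ *: (_ *: cmp G _ h)); lia.
Qed.

(* Krull's intersection theorem, in the graded case *)
Lemma separated G W k h : (k < L)%N -> graded G W ->
  (forall j, exists g, W (h - x k ^+ j *: g)) -> W h.
Proof.
move=> kL gW hj; case: (cmp_sum G h) => s [_ _ ->]; apply: submod_sum => d _.
case: (cmp_lo G) => B hB; case: (hj (absz (d - B + 1))) => g /(gW d).
by rewrite cmpB cmp_exp // [cmp G (d - _) g]hB ?scaler0 ?subr0 //; lia.
Qed.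

(** If q kills h at level k + 1, then h is x_k g by regularity of q at level k, and q kills g
    because x_k can be cancelled. Iterating, h is divisible by every power of x_k, so it is zero by
    [separated]. *)
Lemma regular_lift G W q k0 k : graded G W -> (k0 <= k <= L)%N ->
  (forall i, (k0 <= i < k)%N -> Reg W i) ->
  regular_on (lv W k0) q -> regular_on (lv W k) q.
Proof.
move=> gW; elim: k => [|k IH] /andP[].
  by rewrite leqn0 => /eqP ->.
rewrite leq_eqVlt => /orP[/eqP ->//|k0k] kL hR hq.
have hqk : regular_on (lv W k) q.
  apply: IH hq => [|i /andP[h1 h2]]; first by apply/andP; split=> //; exact: ltnW.
  by apply: hR; rewrite h1 ltnW.
move=> h qh; apply: (@separated G _ k _ kL) => [|j]; first exact: graded_lv.
suff : exists g, lv W k.+1 (h - x k ^+ j *: g) /\ lv W k.+1 (q *: g).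
  by case=> g [hg _]; exists g.
elim: j => [|j [g [hg qg]]].
  by exists h; rewrite expr0 scale1r subrr; split=> //; apply: submod0.
have /hqk /(lv_step _ _ kL) [g' hg'] : lv W k (q *: g) by apply: lv_le qg.
exists g'; split.
  rewrite exprSr -scalerA -(subrK (x k ^+ j *: g) h) -addrA -scalerBr.
  by apply: submodD => //; apply: submodZ.
apply: hR; first by rewrite leqnn andbT.
rewrite scalerA mulrC -scalerA -(subrK (q *: g) (q *: (x k *: g'))).
by apply: submodD => //; rewrite -scalerBr -opprB scalerN; apply/submodN/submodZ.
Qed.
End OneModule.
End Regular.

Lemma cancel_four (V : zmodType) (a b w i r : V) :
  a - r = a - (b + w) + b + (w - i - r) + i.
Proof.
have -> : a - (b + w) + b = a - w by rewrite opprD (addrC (- b)) addrA subrK.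
by rewrite -(addrA w) (addrC (- i)) !addrA subrK subrK.
Qed.

Lemma scalerCA (C : comPzRingType) (V : lmodType C) (a b : C) (v : V) :
  a *: (b *: v) = b *: (a *: v).
Proof. by rewrite !scalerA mulrC. Qed.

(** Membership of r h in W becomes membership of r in an ideal, to which [radical] and tests on
    generators apply. *)
Definition colon (C : comNzRingType) (H : lmodType C) (W : submod H) (h : H) : ideal C.
Proof.
exists (fun r => W (r *: h)).
- by rewrite scale0r; apply: submod0.
- by move=> x y hx hy; rewrite scalerDl; apply: submodD.
- by move=> a y hy; rewrite -scalerA; apply: submodZ.
Defined.

Definition plus_multiples (C : comNzRingType) (H : lmodType C) (W : submod H) (q : C) : submod H.
Proof.
exists (fun z => exists g, W (z - q *: g)).
- by exists 0; rewrite scaler0 subr0; apply: submod0.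
- by move=> y z [g hg] [g' hg']; exists (g + g'); rewrite scalerDr opprD addrACA; apply: submodD.
- move=> a z [g hg]; exists (a *: g).
  by rewrite scalerA mulrC -scalerA -scalerBr; apply: submodZ.
Defined.

Section Radical.
Variables (C : comNzRingType) (I : ideal C).

Definition radical : ideal C.
Proof.
exists (fun r => exists N, I (r ^+ N)).
- by exists 1%N; rewrite expr1; apply: submod0.
- move=> x y [n hx] [k hy]; exists (n + k)%N; rewrite exprDn.
  apply: (submod_sum (W := I)) => i _; rewrite -mulr_natl; apply: idealMl.
  case: (leqP k i) => ki.
    by rewrite -(subnK ki) exprD mulrA; apply: idealMl.
  have -> : (n + k - i = (k - i) + n)%N by lia.
  by rewrite exprD; apply/idealMr/idealMl.
- move=> a x [n hx]; exists n; rewrite -[a *: x]/(a * x) exprMn; exact: idealMl.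
Defined.

Lemma radical_span (E : C -> Prop) r :
  (forall s, E s -> radical s) -> span (E : C^o -> Prop) r -> radical r.
Proof. by move=> h; apply. Qed.

End Radical.

Section Like.
Variables (C : comNzRingType) (L : nat) (x : nat -> C) (H : lmodType C).

Lemma XS_scale k r (h : H) : XS L x C^o k r -> XS L x H k (r *: h).
Proof.
move=> [c ->]; exists (fun i => c i *: h); rewrite scaler_suml.
by apply: eq_bigr => i _; rewrite scalerA.
Qed.

(** Modulo the variables after x_p, sigma is x_p^N and hence regular; [regular_lift] then restores
    x_{p+1}, .., x_{k-1} one at a time. *)
Lemma regular_like (G : grading L x H) (W : submod H) p k sigma N :
  graded G W -> (p < k <= L)%N -> (forall i, (p <= i < k)%N -> Reg L x W i) ->
  XS L x C^o p.+1 (sigma - x p ^+ N) -> regular_on (lv L x W k) sigma.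
Proof.
move=> gW /andP[pk kL] hR sX.
apply: (@regular_lift _ _ _ _ G W sigma p.+1) => //; first by rewrite pk.
  by move=> i /andP[h1 h2]; apply: hR; rewrite h2 ltnW.
have hx : regular_on (lv L x W p.+1) (x p ^+ N).
  by apply: regular_exp => r; apply: hR; rewrite leqnn.
move=> r hr; apply: hx; have h2 : lv L x W p.+1 (sigma *: r - x p ^+ N *: r).
  by rewrite -scalerBl; apply: lvX; apply: XS_scale.
by have := submodB hr h2; rewrite opprB addrCA subrr addr0.
Qed.
(** An elementary form of the vanishing of the first local cohomology in depth two. The element b1 =
    Σ c1_i h_i satisfies s_j b1 = q1 h_j; from q2 b1 = q1 b2 and regularity of q2 modulo q1 it
    follows that b1 = q1 h0, and q1 can be cancelled from q1 h_j = q1 s_j h0. *)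
Lemma glue (G : grading L x H) (W : submod H) e (I : finType) (s : I -> C) (h : I -> H)
    (q1 q2 : C) (c1 c2 : I -> C) N1 N2 d1 :
  graded G W -> (e.+1 < L)%N -> (forall i, (e <= i < L)%N -> Reg L x W i) ->
  (forall i j, W (s i *: h j - s j *: h i)) ->
  q1 = \sum_i c1 i * s i -> q2 = \sum_i c2 i * s i ->
  (forall d h, cmp G d (q1 *: h) = q1 *: cmp G (d - d1) h) ->
  XS L x C^o e.+2 (q1 - x e.+1 ^+ N1) -> XS L x C^o e.+1 (q2 - x e ^+ N2) ->
  exists h0, forall i, W (h i - s i *: h0).
Proof.
move=> gW eL hR compat q1E q2E q1hom q1X q2X.
have reg1 k : (e.+1 < k <= L)%N -> regular_on (lv L x W k) q1.
  move=> hk; apply: (regular_like gW hk) q1X => i hi; apply: hR; lia.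
have reg2 : regular_on (lv L x W e.+1) q2.
  by apply: (regular_like gW _ _ q2X); [lia|move=> i hi; apply: hR; lia].
pose b1 := \sum_i c1 i *: h i; pose b2 := \sum_i c2 i *: h i.
have hb1 j : W (s j *: b1 - q1 *: h j).
  rewrite q1E scaler_suml scaler_sumr -sumrB; apply: submod_sum => i _.
  by rewrite scalerCA -scalerA -scalerBr; apply: submodZ.
have hb2 : W (q2 *: b1 - q1 *: b2).
  rewrite q2E scaler_suml scaler_sumr -sumrB; apply: submod_sum => i _.
  by rewrite -scalerA [q1 *: _]scalerA mulrC -scalerA -scalerBr; apply: submodZ.
(* W + q1 H: [q1hom] keeps it graded, as [regular_lift] requires when q2 is shown to be regular
   modulo q1. *)
pose W' := plus_multiples W q1.
have lvW' k z : lv L x W' k z <-> exists g, lv L x W k (z - q1 *: g).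
  split=> [[y [[g hg] hy]]|[g [y [hy hz]]]].
    by exists g, (y - q1 *: g); split=> //; rewrite opprB addrA subrK.
  by exists (y + q1 *: g); split; [exists g; rewrite addrK|rewrite opprD addrA addrAC].
have gW' : graded G W'.
  by move=> d z [g hg]; exists (cmp G (d - d1) g); rewrite -q1hom -cmpB; apply: gW.
have regW' : regular_on (lv L x W' e.+2) q2.
  have q1y g : lv L x W e.+2 (q1 *: g - x e.+1 ^+ N1 *: g).
    by rewrite -scalerBl; apply/lvX/XS_scale.
  (* At level e + 2 the form q1 may be replaced by a pure power of x_{e+1}; factors x_{e+1} are
     removed one at a time. *)
  have key n z g : lv L x W e.+2 (q2 *: z - x e.+1 ^+ n *: g) ->
      exists g', lv L x W e.+2 (z - x e.+1 ^+ n *: g').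
    elim: n z g => [|n IH] z g hz.
      by exists z; rewrite expr0 scale1r subrr; apply: submod0.
    have hz1 : lv L x W e.+1 z.
      apply: reg2; rewrite -(subrK (x e.+1 ^+ n.+1 *: g) (q2 *: z)); apply: submodD.
        exact: lv_le hz.
      by rewrite exprS -scalerA; apply/lvX/XS_x; rewrite leqnn.
    case/(lv_step _ _ _ eL): hz1 => g1 hg1.
    have hz2 : lv L x W e.+2 (x e.+1 *: (q2 *: g1 - x e.+1 ^+ n *: g)).
      rewrite scalerBr scalerCA [x _ *: (x _ ^+ n *: _)]scalerA -exprS.
      rewrite -(subrK (q2 *: z) (q2 *: _)) -addrA; apply: submodD => //.
      by rewrite -scalerBr -opprB scalerN; apply/submodN/submodZ.
    have [|g' hg'] := IH g1 g; first by apply: hR hz2; lia.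
    exists g'; rewrite exprS -scalerA -(subrK (x e.+1 *: g1) z) -addrA -scalerBr.
    by apply: submodD => //; apply: submodZ.
  move=> z /lvW' [g hg]; apply/lvW'.
  have /key [g' hg'] : lv L x W e.+2 (q2 *: z - x e.+1 ^+ N1 *: g).
    by rewrite -(subrK (q1 *: g) (q2 *: z)) -addrA; apply: submodD.
  exists g'; rewrite -(subrK (x e.+1 ^+ N1 *: g') z) -addrA; apply: submodD => //.
  by rewrite -opprB; apply: submodN.
have RW' i : (e.+2 <= i < L)%N -> Reg L x W' i.
  move=> /andP[ei iL] z /lvW' [g hg]; apply/lvW'.
  have hg1 : lv L x W i g.
    apply: reg1; first by rewrite ei ltnW.
    rewrite -[q1 *: g](subKr (x i *: z)); apply: submodB; last exact: lv_le hg.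
    by apply/lvX/XS_x; rewrite leqnn.
  case/(lv_step _ _ _ iL): hg1 => g' hg'; exists g'.
  apply: hR; first by lia.
  rewrite scalerBr [x i *: (q1 *: _)]scalerCA.
  rewrite -(subrK (q1 *: g) (x i *: z)) -addrA -scalerBr.
  by apply: submodD => //; apply: submodZ.
have /lvL [h0 hh0] : lv L x W' L b1.
  apply: (@regular_lift _ _ _ _ G W' q2 e.+2 L) => //; first by rewrite eL leqnn.
  by apply/lvW'; exists b2; apply: lvW.
exists h0 => i; apply/(@lvL _ L x); apply: (reg1 L); first by rewrite eL leqnn.
apply: lvW; rewrite scalerBr -(subrK (s i *: b1) (q1 *: h i)) -addrA; apply: submodD.
  by rewrite -opprB; apply: submodN.
by rewrite [q1 *: _]scalerCA -scalerBr; apply: submodZ.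
Qed.
End Like.

(** * Regular sequences modulo determinantal ideals *)

Section Columns.
Variables (C : comNzRingType) (L : nat) (x : nat -> C) (Phi : nat -> nat -> C) (t : nat).
Notation X k := (XS L x (C^o) k).
Notation XS := (XS L x).
Notation lv := (lv L x).
Notation Reg := (Reg L x).
Notation ImL := (ImL Phi t).
Notation IL := (IL Phi t).

Lemma allextZ s (I : ideal C) r (z : ext C s) : I r -> allext I (r *: z).
Proof.
move=> Ir; elim: s z => [|s IH] z /=; last by split; apply: IH.
exact: idealMr.
Qed.

Lemma XS_ext s k (z : ext C s) : XS _ k z <-> allext (X k) z.
Proof.
split=> [[c ->]|]; last first.
  by apply: (@allext_sub _ _ _ (XS (ext C s) k)) => r y; apply: XS_scale.
rewrite big_nat_cond; apply: (submod_sum (W := allext_submod s (X k))) => i.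
rewrite andbT => hi; apply: (@allextZ s (X k)).
by have := XS_x x (1 : C^o) hi; rewrite -[_ *: _]/(_ * _) mulr1.
Qed.

Lemma lv_ImL_top q k z : lv (ImL q) k z -> lv (IL q) k (top z).
Proof.
move=> [y [/top_ImL Wy /XS_ext/allextP hy]]; exists (top y); split=> //.
by rewrite linearB in hy.
Qed.

Lemma lv_ImL_IL q k r z : lv (IL q) k r -> lv (ImL q) k (r *: z).
Proof.
move=> [y [Wy hy]]; exists (y *: z); split; first exact: ImL_IL.
by rewrite -scalerBl; apply: XS_scale.
Qed.

Lemma lv_wedge q k v z : (forall y, ImL q y -> ImL q (wedge v y)) ->
  lv (ImL q) k z -> lv (ImL q) k (wedge v z).
Proof.
move=> h [y [/h Wy /XS_ext/(allext_wedge v)/XS_ext hy]]; exists (wedge v y).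
by rewrite linearB in hy.
Qed.

Lemma ImL_comb q d y : ImL q y -> ImL q (wedge (comb Phi q d) y).
Proof. by move=> [w ->]; rewrite -Lam_wedge; eexists. Qed.

Lemma allext_lv (I : ideal C) s k (z : ext C s) : allext (lv I k) z ->
  exists y, allext I y /\ XS _ k (z - y).
Proof.
elim: s z => [|s IH] z /= h; first by case: h => y [Iy hy]; exists y.
case: h => /IH [a [Ia ha]] /IH [b [Ib hb]]; exists (a, b).
by split; [split|apply/(@XS_ext s.+1); split; apply/XS_ext].
Qed.

(* multiplying v into Top detects its coordinates; sigma times any element of
   the exterior algebra lies in the image of Lam for one more column, which
   maps v into the image of Lam *)
Lemma column_inj q k sigma v :
  lv (ImL q) k v -> lv (ImL q) k (wedge (Phi q) v) ->
  IL q.+1 sigma -> regular_on (lv (IL q) k) sigma ->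
  allext (lv (IL q) k) v.
Proof.
move=> hv hpv hs reg; apply: nondeg => y; apply: reg.
have -> : sigma *: (top (mul y v) : C^o) = top (mul (sigma *: y) v).
  by rewrite mulZl linearZ.
apply: lv_ImL_top; have [w ->] := ImL_IL y hs => /=.
rewrite mulDl mul_wedge; apply: (submodD (s := lv (ImL q) k)).
  have lin : linear (fun a : ext C q => mul (Lam Phi t a) v).
    by move=> r a b; rewrite linearD linearZ /= mulDl mulZl.
  pose Q : submod (ext C q) := @preim_submod _ _ _
    (HB.pack (fun a => mul (Lam Phi t a) v) (GRing.isLinear.Build _ _ _ _ _ lin))
    (lv (ImL q) k).
  apply: (@ext_from_one _ _ Q) => /= [d z|]; last by rewrite Lam_one mul1l.
  rewrite Lam_wedge mul_wedge; apply: lv_wedge; exact: ImL_comb.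
have lin : linear (fun a : ext C q => wedge (Phi q) (mul (Lam Phi t a) v)).
  by move=> r a b; rewrite linearD linearZ /= mulDl mulZl linearD linearZ.
pose Q : submod (ext C q) := @preim_submod _ _ _
  (HB.pack (fun a => wedge (Phi q) (mul (Lam Phi t a) v)) (GRing.isLinear.Build _ _ _ _ _ lin))
  (lv (ImL q) k).
apply: (@ext_from_one _ _ Q) => /= [d z|]; last by rewrite Lam_one mul1l.
rewrite Lam_wedge mul_wedge wedgeC => /(lv_wedge (@ImL_comb q d)).
exact: submodN.
Qed.

Hypothesis Xprime : forall k r s, (k <= L)%N -> X k (r * s) -> X k r \/ X k s.
Hypothesis x_notin : forall k, (k < L)%N -> ~ X k.+1 (x k).

Lemma Xexp k r N : (k <= L)%N -> ~ X k 1 -> X k (r ^+ N) -> X k r.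
Proof.
by move=> kL h1; elim: N => [|N IH]; rewrite ?expr0 // exprS => /(Xprime kL) [].
Qed.

Lemma Lam_mul q (y w : ext C q) k : XS _ k (Lam Phi t w) -> XS _ k (Lam Phi t (mul y w)).
Proof.
move=> h; have lin : linear (fun y : ext C q => Lam Phi t (mul y w)).
  by move=> r a b; rewrite mulDl mulZl linearD linearZ.
pose Q : submod (ext C q) := @preim_submod _ _ _
  (HB.pack (fun y => Lam Phi t (mul y w)) (GRing.isLinear.Build _ _ _ _ _ lin))
  (XS _ k).
apply: (@ext_from_one _ _ Q) => /= [d z|]; last by rewrite mul1l.
by rewrite mul_wedge Lam_wedge => /XS_ext /(allext_wedge (comb Phi q d)) /XS_ext.
Qed.

Hypothesis x_top : forall p, (p < L)%N -> ~ X p.+1 1.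

(** The determinant of the first t columns is nonzero in the domain C/X_k, because its multiple
    sigma is a power of x_0 modulo the other variables. Products with complementary elements recover
    each coordinate of w times this determinant. *)
Lemma square_inj k sigma N (w : ext C t) : (0 < k <= L)%N ->
  IL t sigma -> X 1 (sigma - x 0 ^+ N) -> XS _ k (Lam Phi t w) -> XS _ k w.
Proof.
move=> /andP[k0 kL] [w0 hs] hX hLw; have L0 : (0 < L)%N := leq_trans k0 kL.
have fX : ~ X k (top (Lam Phi t (Top C t))).
  move=> /(XS_le k0) hf; apply: (x_notin L0).
  apply: (@Xexp _ _ N) => //; first exact: x_top.
  have : X 1 sigma.
    rewrite hs -top_gr Lam_gr gr_top [Lam _ _ _]linearZ /= topZ.
    exact: (@idealMl _ (X 1) _ _ hf).
  by move=> h; have := submodB h hX; rewrite opprB addrCA subrr addr0.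
apply/XS_ext/nondeg => y; have := Lam_mul y hLw => /XS_ext/allextP.
rewrite -top_gr Lam_gr gr_top [Lam _ _ _]linearZ /= topZ.
by move=> /(Xprime kL) [].
Qed.

(** For a square matrix [Lam] is injective modulo X_k; so if x_k z is [Lam] of w, then w is
    divisible by x_k, and x_k can be cancelled in the domain C/X_{k+1}. *)
Lemma square_reg k sigma N : (0 < k < L)%N ->
  IL t sigma -> X 1 (sigma - x 0 ^+ N) -> Reg (ImL t) k.
Proof.
move=> /andP[k0 kL] hs hX z [_ [[w ->] hz]].
have hLw : XS _ k (Lam Phi t w).
  have := XS_le (leqnSn k) hz; move/submodN; rewrite opprB => h.
  rewrite -(subrK (x k *: z) (Lam Phi t w)); apply: submodD => //.
  by apply: XS_x; rewrite leqnn.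
have hw : XS _ k w by apply: square_inj hs hX hLw; rewrite k0 ltnW.
have [w' /XS_ext hw'] : exists w', XS _ k.+1 (w - x k *: w') by apply/XS_step.
have h2 : XS _ k.+1 (Lam Phi t (w - x k *: w')).
  apply/XS_ext; pose Q := @preim_submod _ _ _ (@Lam C Phi t t) (allext_submod t (X k.+1)).
  suff h r (y : ext C t) : X k.+1 r -> Q (r *: y) by exact: (allext_sub h hw').
  by move=> Xr; rewrite /Q /= linearZ; exact: (@allextZ t (X k.+1)).
have : XS _ k.+1 (x k *: (z - Lam Phi t w')).
  have := submodD hz h2; rewrite linearB linearZ /= addrA subrK.
  by rewrite -scalerBr.
move=> /XS_ext h3; exists (Lam Phi t w'); split; first by exists w'.
apply/XS_ext; elim: (t) (z - _) h3 => [|s IH] y /=.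
  by move=> /(Xprime kL) [] // /(x_notin kL).
by move=> [/IH ? /IH ?].
Qed.

Variables (GC : grading L x (C^o)) (c : nat) (sig : nat -> C) (N : nat -> nat).
Hypothesis cL : (c <= L)%N.
Hypothesis gIL : forall q, graded GC (IL q).
Hypothesis sigI : forall p, (p < c)%N -> IL (t + p) (sig p).
Hypothesis sigX : forall p, (p < c)%N -> X p.+1 (sig p - x p ^+ N p).

Lemma IL_Reg q k : Reg (ImL q) k -> Reg (IL q) k.
Proof.
move=> h r hr; have e : lv (ImL q) k.+1 (x k *: (r *: Top C t)).
  by rewrite scalerA; apply: lv_ImL_IL.
by have /lv_ImL_top := h _ e; rewrite topZ top_Top mulr1.
Qed.

Lemma sigma_regular q p k : (p < c)%N -> (p < k <= L)%N ->
  (forall i, (p <= i < k)%N -> Reg (IL q) i) ->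
  regular_on (lv (IL q) k) (sig p).
Proof.
move=> pc pk hR; exact: (regular_like (@gIL q) pk hR (sigX pc)).
Qed.

(** Induction on the number of columns. If x_k z = a + Phi_q ∧ v, then modulo x_k the product Phi_q
    ∧ v lies in the image for q columns, so by [column_inj] v has coordinates in the ideal of their
    minors. Thus v is x_k r up to an element of the image that stays there after multiplication by
    Phi_q, and x_k can be divided out of z - Phi_q ∧ r. *)
Theorem ext_Reg p k : (p < c)%N -> (p < k < L)%N -> Reg (ImL (t + p)) k.
Proof.
elim: p k => [|p IH] k pc /andP[pk kL].
  rewrite addn0; apply: (@square_reg k (sig 0) (N 0)); rewrite ?pk //.
    by have := sigI pc; rewrite addn0.
  exact: sigX.
have pc' := ltnW pc; set q := (t + p)%N; rewrite addnS -/q.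
have R i : (p < i < L)%N -> Reg (ImL q) i by apply: IH.
move=> z [_ [[w ->] hz]]; pose a : ext C q := w.1; pose b : ext C q := w.2.
have {}hz : XS (ext C t) k.+1 (x k *: z - (Lam Phi t a + wedge (Phi q) (Lam Phi t b))) := hz.
clearbody a b; move: w => _; set v := Lam Phi t b in hz *.
have hv : ImL q v by exists b.
have hpv : lv (ImL q) k (wedge (Phi q) v).
  have /XS_le h := hz; have {}h := h k (leqnSn k).
  have -> : wedge (Phi q) v = x k *: z - Lam Phi t a
      - (x k *: z - (Lam Phi t a + wedge (Phi q) v)).
    by rewrite opprB addrC addrA subrK addrAC subrr add0r.
  apply: submodB; last exact: lvX.
  by apply: submodB; [apply/lvX/XS_x; rewrite leqnn|apply: lvW; exists a].
have [i [Ii hi]] : exists y, allext (IL q) y /\ XS _ k (v - y).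
  apply/allext_lv/(column_inj (lvW _ _ _ hv) hpv).
    by have := sigI pc; rewrite addnS; exact.
  apply: sigma_regular => //; first by rewrite pk ltnW.
  by move=> j /andP[h1 h2]; apply/IL_Reg/R; rewrite h1 (ltn_trans h2).
have IImL y : allext (IL q) y -> ImL q y.
  by apply: allext_sub => r w; apply: ImL_IL.
case/(XS_step _ _ kL): hi => r hr.
have hr1 : lv (ImL q) k.+1 r.
  apply: R; first by rewrite kL (ltnW pk).
  have -> : x k *: r = v - i - (v - i - x k *: r) by rewrite opprB addrC subrK.
  by apply: submodB; [apply/lvW/submodB => //; apply: IImL|apply: lvX].
have hpr : lv (ImL q.+1) k.+1 (wedge (Phi q) r).
  case: hr1 => _ [[w ->] hw]; exists (wedge (Phi q) (Lam Phi t w)); split.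
    by exists (0, w); rewrite /= raddf0 add0r.
  by move/XS_ext/(allext_wedge (Phi q))/XS_ext: hw; rewrite linearB.
suff : lv (ImL q) k.+1 (z - wedge (Phi q) r).
  move/(lvS (@ImL_S _ _ t q)) => h.
  by rewrite -(subrK (wedge (Phi q) r) z); apply: (submodD (s := lv (ImL q.+1) k.+1)).
apply: R; first by rewrite kL (ltnW pk).
rewrite scalerBr; have <- : wedge (Phi q) (x k *: r) = x k *: wedge (Phi q) r by exact: linearZ.
have -> : x k *: z - wedge (Phi q) (x k *: r) =
   (x k *: z - (Lam Phi t a + wedge (Phi q) v)) + Lam Phi t a
   + wedge (Phi q) (v - i - x k *: r) + wedge (Phi q) i.
  have wB y y' : wedge (Phi q) (y - y') = wedge (Phi q) y - wedge (Phi q) y'.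
    exact: linearB.
  by rewrite !wB; apply: cancel_four.
apply: (submodD (s := lv (ImL q) k.+1)); last by apply: lvW; apply: IImL; exact: (@allext_wedge _ _ (IL q)).
apply: (submodD (s := lv (ImL q) k.+1)); last first.
  by move/XS_ext/(allext_wedge (Phi q))/XS_ext: hr => h; apply: lvX.
by apply: (submodD (s := lv (ImL q) k.+1)); [apply: lvX|apply: lvW; exists a].
Qed.

Variables (m : nat) (NJ : nat -> nat) (sigJ : nat -> C).
Hypotheses (c_gt0 : (0 < c)%N) (mE : m = (t + c.-1)%N) (L_gt : (2 * c < L)%N).

Definition cols (l : seq nat) : ext C t := foldr (fun j => wedge (Phi j)) (one C t) l.
(** For l of length t - 1, the determinant of g and the columns l up to sign: a covector in g whose
    coefficients are signed (t-1)-minors. *)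
Definition uu (l : seq nat) (g : nat -> C) : C := top (wedge g (cols l)).

Definition Jgen (s : C) : Prop := exists (l : seq nat) (i : nat),
  [/\ size l = t.-1, all (ltn^~ m) l, (i < t)%N & s = uu l (delta C i)].
Definition Jid : ideal C := span (Jgen : C^o -> Prop).

Hypothesis sigJI : forall e, (c <= e <= 2 * c)%N -> Jid (sigJ e).
Hypothesis sigJX : forall e, (c <= e <= 2 * c)%N -> X e.+1 (sigJ e - x e ^+ NJ e).

Lemma gr_cols l : gr (size l) (cols l) = cols l.
Proof. by elim: l => [|j l IH]; [exact: gr_one|rewrite /= gr_wedge IH]. Qed.

Lemma ImL_cols q l : all (ltn^~ q) l -> ImL q (cols l).
Proof.
elim: l => [|j l IH] /=; first by move=> _; apply: ImL_one.
by move=> /andP[jq /IH]; apply: ImL_wedge.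
Qed.

(** Contracting a product of columns by [delta C i] is linear in the i-th entries of these columns;
    [kap T l j] is the coefficient of [Phi j i] after applying T, and it is independent of i. *)
Fixpoint kap (T : ext C t -> C) (l : seq nat) (j : nat) : C :=
  if l is a :: l' then (j == a)%:R * T (cols l') - kap (fun z => T (wedge (Phi a) z)) l' j
  else 0.

Lemma kapP (T : ext C t -> C) l i : (forall y z, T (y - z) = T y - T z) ->
  (forall a z, T (a *: z) = a * T z) -> all (ltn^~ m) l -> (i < t)%N ->
  T (contr (delta C i) (cols l)) = \sum_(j < m) Phi j i * kap T l j.
Proof.
move=> TB TZ hl it; elim: l T TB TZ hl => [|a l IH] T TB TZ /=.
  move=> _; rewrite contr_one big1 => [|j _]; last by rewrite mulr0.
  by rewrite -(subrr (0 : ext C t)) TB subrr.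
move=> /andP[am hl]; rewrite contr_wedge TB TZ.
have -> : dot t (delta C i) (Phi a) = Phi a i.
  by rewrite -(dot_delta (Phi a) it); apply: eq_bigr => k _; rewrite mulrC.
rewrite (IH (fun z => T (wedge (Phi a) z))) //.
- rewrite -[RHS]addr0; rewrite -sumrN.
  transitivity (\sum_(j < m) (Phi j i * ((j == a :> nat)%:R * T (cols l))) +
     \sum_(j < m) - (Phi j i * kap (fun z => T (wedge (Phi a) z)) l j)).
    congr (_ + _); rewrite (bigD1 (Ordinal am)) //= eqxx mul1r big1 ?addr0 //.
    by move=> j /negbTE; rewrite -val_eqE /= => ->; rewrite mul0r mulr0.
  rewrite addr0 -big_split; apply: eq_bigr => j _ /=.
  by rewrite mulrBr.
- by move=> y z; rewrite linearB TB.
- by move=> r z; rewrite linearZ TZ.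
Qed.

Definition kappa l (g0 g : nat -> C) j := kap (fun z => top (wedge g0 (wedge g z))) l j.

(** The product of g0, g and the columns l has degree t + 1, hence vanishes; contracting it by
    [delta C i] gives the identity. Where u_l(g0) is invertible it makes the cokernel cyclic,
    generated by g0, with explicit coefficients. *)
Lemma kappaP l g0 g i : size l = t.-1 -> all (ltn^~ m) l -> (i < t)%N ->
  \sum_(j < m) Phi j i * kappa l g0 g j = uu l g0 * g i - uu l g * g0 i.
Proof.
move=> sl hl it; have t0 : (0 < t)%N := leq_ltn_trans (leq0n _) it.
have := @kapP (fun z => top (wedge g0 (wedge g z))) l i _ _ hl it.
rewrite /kappa => <-; first last.
- by move=> a z; rewrite linearZ /= linearZ /= topZ.
- by move=> y z; rewrite linearB /= linearB /= topB.
have h0 : wedge g0 (wedge g (cols l)) = 0.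
  by rewrite -(gr_cols l) -!gr_wedge gr_big // sl prednK.
have hd v : dot t (delta C i) v = v i.
  by rewrite -(dot_delta v it); apply: eq_bigr => k _; rewrite mulrC.
have e1 : contr (delta C i) (wedge g0 (wedge g (cols l))) = 0 by rewrite h0 raddf0.
rewrite !contr_wedge !hd in e1.
have /eqP := congr1 (@top C t) e1.
rewrite topB topZ [wedge g0 (_ - _)]linearB /= topB [wedge g0 (_ *: _)]linearZ /=.
have -> : top (0 : ext C t) = 0 by exact: (raddf0 (@top C t)).
rewrite topZ opprB addrA subr_eq0 /uu => /eqP e.
by rewrite (mulrC (top (wedge g0 _))) -e [top _ * g0 i]mulrC addrAC subrr add0r.
Qed.

Lemma IL_S q r : IL q r -> IL q.+1 r.
Proof. by move=> [w ->]; exists (w, 0); rewrite /= !raddf0 addr0. Qed.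

Lemma IL_Reg_all p k : (p < c)%N -> (p < k < L)%N -> Reg (IL (t + p)) k.
Proof. by move=> h1 h2; apply/IL_Reg/ext_Reg. Qed.

(** The last entry d_q multiplies column q into the span of the others, so by [column_inj] it lies
    in the ideal of their maximal minors. Then a Buchsbaum-Rim syzygy has the same last entry up to
    sign and all entries in the ideal; combining the two leaves a syzygy of one column fewer. *)
Lemma ker_one p d : (p < c)%N -> (forall i, (i < t)%N -> comb Phi (t + p) d i = 0) ->
  forall j, (j < t + p)%N -> IL (t + p) (d j).
Proof.
elim: p d => [|p IH] d pc hd j.
  rewrite addn0 in hd * => jt.
  have : wedge d (one C t) = 0.
    apply/(@XSL _ L x); apply: (@square_inj L (sig 0) (N 0)).
    - by rewrite leqnn andbT; apply: leq_trans cL.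
    - by have := sigI pc; rewrite addn0.
    - exact: sigX.
    apply/XSL; rewrite Lam_wedge Lam_one -(wedge0l (one C t)); apply: wedge_eq => i it.
    exact: hd.
  move=> /(congr1 (contr (delta C j))); rewrite raddf0 contr_wedge contr_one raddf0 subr0.
  have -> : dot t (delta C j) d = d j.
    by rewrite -(dot_delta d jt); apply: eq_bigr => k _; rewrite mulrC.
  by move/scale_one_eq0 => ->; apply: submod0.
rewrite addnS in hd *; have pc' := ltnW pc; set q := (t + p)%N in hd *.
have hq : forall i, (i < t)%N -> d q * Phi q i = - comb Phi q d i.
  move=> i /hd; rewrite /comb big_ord_recr /= => /eqP.
  by rewrite addrC addr_eq0 => /eqP.
have pL : (p.+1 < L.+1)%N by rewrite ltnS; apply: leq_trans cL; exact: ltnW.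
have dq : IL q (d q).
  suff : allext (lv (IL q) L) (d q *: one C t) by move/allext_one/lvL.
  apply: (@column_inj q L (sig p.+1)).
  - by apply/lvW/submodZ; apply: ImL_one.
  - rewrite wedgeZr -wedgeZl (@wedge_eq _ _ _ (fun i => (-1) * comb Phi q d i)) => [|i it].
      by rewrite wedgeZl; apply: lvW; apply: submodZ; apply: ImL_comb; apply: ImL_one.
    by rewrite hq // mulN1r.
  - by have := sigI pc; rewrite addnS.
  apply: sigma_regular => //; first by rewrite leqnn andbT; apply: leq_trans cL.
  by move=> i h; apply: IL_Reg_all.
case: (dq) => w0 hw0; pose w := gr t w0.
have hw : d q = top (Lam Phi t w) by rewrite -Lam_gr top_gr.
have hz : wedge (Phi q) (Lam Phi t w) = 0.
  by rewrite /w -Lam_gr -gr_wedge gr_big.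
(* Coefficients of the Buchsbaum-Rim syzygy, read off by contracting Phi_q ∧ [Lam] w = 0, a product
   of degree t + 1. *)
pose e j := top (wedge (Phi q) (Lam Phi t (contr (delta C j) w))).
have eI j' : IL q.+1 (e j').
  by exists (0, contr (delta C j') w); rewrite /= raddf0 add0r.
have he i : (i < t)%N -> d q * Phi q i = \sum_(j < q) e j * Phi j i.
  move=> it; have := congr1 (fun z => top (contr (delta C i) z)) hz.
  have hdd v : dot t (delta C i) v = v i.
    by rewrite -(dot_delta v it); apply: eq_bigr => k _; rewrite mulrC.
  rewrite /= raddf0 contr_wedge topB topZ hdd -hw Lam_contr (raddf0 (@top C t)).
  move/eqP; rewrite subr_eq0 mulrC => /eqP ->.
  rewrite contr_coord !linear_sum /= (raddf_sum (@top C t)) /=; apply: eq_bigr => k _.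
  by rewrite !linearZ /= topZ hdd mulrC.
rewrite ltnS leq_eqVlt => /orP[/eqP ->|jq]; first exact: IL_S.
have : IL q (d j + e j).
  apply: (IH (fun j => d j + e j)) => // i it.
  have := he i it; rewrite hq // => /eqP; rewrite eq_sym -addr_eq0 => /eqP.
  rewrite /comb -big_split /= => hh; rewrite -[RHS]hh; apply: eq_bigr => k _.
  by rewrite mulrDl addrC.
by move/IL_S => h; rewrite -(addrK (e j) (d j)); apply: submodB.
Qed.

Definition torsion (H : lmodType C) (W : submod H) k h :=
  forall s, Jgen s -> exists n, lv W k (s ^+ n *: h).

(** J is generated by minors that have a power killing h, so a power of [sJ e] kills h too; but
    [sJ e] is regular by [regular_like]. *)
Lemma torsion_free (H : lmodType C) (G : grading L x H) (W : submod H) e k h :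
  graded G W -> (c <= e <= 2 * c)%N -> (e < k <= L)%N ->
  (forall i, (e <= i < k)%N -> Reg W i) -> torsion W k h -> lv W k h.
Proof.
move=> gW he hk hR tor.
pose ann := colon (lv W k) h.
have [n hn] : exists n, ann (sigJ e ^+ n).
  apply: (@radical_span _ ann Jgen); last exact: sigJI.
  by move=> s /tor [n hn]; exists n.
have := regular_like gW hk hR (sigJX he).
by move=> /(@regular_exp _ _ _ _ n); apply.
Qed.

Variable GE : grading L x (ext C t).
Hypothesis gImL : forall q, graded GE (ImL q).

Lemma ext_Reg_m k : (c <= k < L)%N -> Reg (ImL m) k.
Proof. by move=> h; rewrite mE; apply: ext_Reg; lia. Qed.

Lemma IL_Reg_m k : (c <= k < L)%N -> Reg (IL m) k.
Proof. by move=> h; apply/IL_Reg/ext_Reg_m. Qed.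

Lemma ext_torsion_free k z : (c < k <= L)%N -> torsion (ImL m) k z -> lv (ImL m) k z.
Proof.
move=> hk; apply: (@torsion_free _ GE _ c) => //; first by lia.
by move=> i hi; apply: ext_Reg_m; lia.
Qed.

Lemma delta_dot (v : nat -> C) i : (i < t)%N -> dot t (delta C i) v = v i.
Proof.
by move=> it; rewrite -(dot_delta v it); apply: eq_bigr => k _; rewrite mulrC.
Qed.

Lemma top_wedge_contr (g v : nat -> C) : top (wedge v (contr g (Top C t))) = dot t g v.
Proof.
have := @contr_wedge C t g v (Top C t).
have -> : wedge v (Top C t) = 0.
  have -> : Top C t = gr t (Top C t) by rewrite gr_top top_Top scale1r.
  by rewrite -gr_wedge gr_big.
rewrite raddf0 => /eqP; rewrite eq_sym subr_eq0 => /eqP <-.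
by rewrite topZ top_Top mulr1.
Qed.

Lemma wedge_ImL_scale q k i r y : lv (IL q) k r ->
  lv (ImL q) k (wedge (delta C i) (r *: y)).
Proof. by move=> h; rewrite wedgeZr; apply: lv_ImL_IL. Qed.

(** Contraction of [Top] identifies covectors with elements of degree t - 1. Multiplied by the minor
    u_l(e_i), the element becomes g_i [cols l] minus e_i times the contraction of [cols l] by g,
    whose coefficients lie in I because g kills the columns; torsion-freeness removes the minor. *)
Lemma covector_ImL k g : (c < k <= L)%N ->
  (forall j, (j < m)%N -> lv (IL m) k (dot t g (Phi j))) ->
  lv (ImL m) k (contr g (Top C t)).
Proof.
move=> hk hg; apply: ext_torsion_free => // s [l [i [sl hl it ->]]]; exists 1%N.
have t0 : (0 < t)%N := leq_ltn_trans (leq0n _) it.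
have -> : uu l (delta C i) ^+ 1 *: contr g (Top C t)
    = g i *: cols l - wedge (delta C i) (contr g (cols l)).
  rewrite expr1 -contrZr /uu -gr_top; have := gr_cols l; rewrite sl => hgr.
  have -> : gr t (wedge (delta C i) (cols l)) = wedge (delta C i) (cols l).
    by have := gr_wedge t.-1 (delta C i) (cols l); rewrite prednK // hgr.
  by rewrite contr_wedge dot_delta.
have hc := ImL_cols hl.
apply: submodB; first by apply/lvW/submodZ.
case: hc => w ->; rewrite Lam_contr contr_coord Lam_sum wedge_sum.
apply: submod_sum => j _; rewrite LamZ; apply: wedge_ImL_scale; exact: hg.
Qed.

(** The rows of phi and their combinations modulo I: these are linear relations satisfied modulo I
    by every column of h_f. *)
Definition rowW : submod 'rV[C]_m.
Proof.
exists (fun d : 'rV[C]_m => exists g : nat -> C, forall j : 'I_m, IL m (d 0 j - dot t g (Phi j))).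
- exists (fun=> 0) => j; rewrite mxE /dot big1 ?subr0 => [|i _]; last by rewrite mul0r.
  exact: submod0.
- move=> d d' [g hg] [g' hg']; exists (fun i => g i + g' i) => j.
  have := submodD (hg j) (hg' j); rewrite addrACA -opprD mxE; congr (IL m (_ - _)).
  by rewrite -big_split; apply: eq_bigr => i _; rewrite /= mulrDl.
- move=> a d [g hg]; exists (fun i => a * g i) => j.
  have := idealMl a (hg j); rewrite mulrBr mxE; congr (IL m (_ - _)).
  by rewrite /dot mulr_sumr; apply: eq_bigr => i _; rewrite mulrA.
Defined.

Lemma XS_row k (d : 'rV[C]_m) : XS _ k d <-> forall j, X k (d 0 j).
Proof.
split=> [[cc ->] j|h].
  rewrite summxE big_nat_cond; apply: (submod_sum (W := X k)) => i; rewrite andbT => hi.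
  by rewrite mxE; apply: (@XS_x _ L x C^o k i).
rewrite [d]row_sum_delta; apply: submod_sum => j _; apply: XS_scale; exact: h.
Qed.

(** If x_k d is g phi modulo I, then g kills the columns modulo x_k. [covector_ImL] writes g as g1 +
    x_k g2 with g1 phi zero modulo I, so x_k (d - g2 phi) is zero modulo I and x_k is cancelled
    there. *)
Lemma rowW_Reg k : (c < k < L)%N -> Reg rowW k.
Proof.
move=> hk d [e [[g hg] /XS_row he]].
have hkL : (k < L)%N by case/andP: hk.
have h1 (j : 'I_m) : lv (IL m) k.+1 (x k * d 0 j - dot t g (Phi j)).
  rewrite -(subrK (e 0 j) (x k * _)) -addrA; apply: submodD; last exact/lvW/hg.
  by apply: lvX; have := he j; rewrite !mxE.
have : lv (ImL m) k (contr g (Top C t)).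
  apply: covector_ImL; first by case/andP: hk => -> /ltnW ->.
  move=> j jm; have := h1 (Ordinal jm) => /(lv_le (leqnSn k)) h.
  rewrite -[dot _ _ _](subKr (x k * d 0 (Ordinal jm))); apply: submodB => //.
  by apply: lvX; apply: (@XS_x _ L x C^o); rewrite leqnn.
move=> [_ [[w ->] /(XS_step _ _ hkL) [r hr]]].
pose g1 i := top (wedge (delta C i) (Lam Phi t w)).
pose g2 i := top (wedge (delta C i) r).
have hgX i : (i < t)%N -> X k.+1 (g i - g1 i - x k * g2 i).
  move=> it; move/XS_ext/(allext_wedge (delta C i))/allextP: hr.
  by rewrite !wedgeBr wedgeZr !topB topZ top_wedge_contr dot_delta.
have hg1 (j : 'I_m) : IL m (dot t g1 (Phi j)).
  have -> : dot t g1 (Phi j) = top (wedge (Phi j) (Lam Phi t w)).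
    rewrite [wedge (Phi j) _]wedge_coord top_sum; apply: eq_bigr => i _.
    by rewrite topZ mulrC.
  by apply/top_ImL/ImL_wedge => //; exists w.
have h2 (j : 'I_m) : X k.+1 (dot t g (Phi j) - dot t g1 (Phi j) - x k * dot t g2 (Phi j)).
  rewrite /dot mulr_sumr -!sumrB; apply: (submod_sum (W := X k.+1)) => i _.
  by rewrite mulrA -!mulrBl; apply: idealMr; apply: hgX.
have h3 (j : 'I_m) : lv (IL m) k.+1 (d 0 j - dot t g2 (Phi j)).
  apply: IL_Reg_m; first by case/andP: hk => /ltnW -> ->.
  have -> : x k *: (d 0 j - dot t g2 (Phi j) : C^o) =
     (x k * d 0 j - dot t g (Phi j)) + dot t g1 (Phi j)
     + (dot t g (Phi j) - dot t g1 (Phi j) - x k * dot t g2 (Phi j)).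
    by rewrite -[LHS]/(x k * (_ - _)); ring.
  apply: submodD; last exact: lvX.
  by apply: submodD => //; apply: lvW.
have /cid2 [y hy1 hy2] : exists2 y : 'I_m -> C, (forall j, IL m (y j))
    & forall j, X k.+1 (d 0 j - dot t g2 (Phi j) - y j).
  have /all_sig2 [y ? ?] : forall j : 'I_m, {y | IL m y & X k.+1 (d 0 j - dot t g2 (Phi j) - y)}.
    by move=> j; apply: cid2; case: (h3 j) => y [? ?]; exists y.
  by exists y.
exists (\row_j (y j + dot t g2 (Phi j))); split.
  by exists g2 => j; rewrite mxE addrK.
by apply/XS_row => j; rewrite !mxE opprD (addrC (- y j)) addrA.
Qed.

Variable GB : grading L x 'rV[C]_m.
Hypothesis growW : graded GB rowW.

End Columns.

(** * Gradings on exterior algebras and on row vectors *)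

Section Gradings.
Variables (C : comNzRingType) (L : nat) (x : nat -> C).

Lemma cmp_sumW (H : lmodType C) (G : grading L x H) h (s : seq int) : uniq s ->
  (forall d, d \notin s -> cmp G d h = 0) -> h = \sum_(d <- s) cmp G d h.
Proof.
move=> us hs; case: (cmp_sum G h) => r [ur hr e]; rewrite {1}e.
rewrite [RHS](bigID (mem r)) /= [X in _ + X]big1 ?addr0; last by move=> d /hr.
rewrite [LHS](bigID (mem s)) /= [X in _ + X]big1 ?addr0; last by move=> d /hs.
rewrite -[LHS]big_filter -[RHS]big_filter; apply/perm_big/uniq_perm; rewrite ?filter_uniq // => d.
by rewrite !mem_filter andbC.
Qed.

Section Shift.
Variables (H : lmodType C) (G : grading L x H) (b : int).
Let f (d : int) (h : H) := cmp G (d - b) h.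
Fact shift_x k d h : (k < L)%N -> f d (x k *: h) = x k *: f (d - 1) h.
Proof. by move=> kL; rewrite /f cmpx //; congr (_ *: cmp G _ _); ring. Qed.
Fact shift_lo : exists B : int, forall d h, d < B -> f d h = 0.
Proof. by case: (cmp_lo G) => B hB; exists (B + b) => d h hd; apply: hB; lia. Qed.
Fact shift_sum h : exists s : seq int,
  [/\ uniq s, forall d, d \notin s -> f d h = 0 & h = \sum_(d <- s) f d h].
Proof.
case: (cmp_sum G h) => s [us hs e]; exists [seq d + b | d <- s]; split.
- by rewrite map_inj_uniq //; apply: addIr.
- move=> d hd; apply: hs; apply: contra hd => hd.
  by apply/mapP; exists (d - b); rewrite ?subrK.
- by rewrite big_map {1}e; apply: eq_bigr => d _; rewrite /f addrK.
Qed.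
Definition gshift : grading L x H :=
  @Grading C L x H f (fun d a b => cmpB G _ a b) shift_x shift_lo shift_sum.
End Shift.

Section Restricted.
Variables (D : comNzRingType) (rho : {rmorphism C -> D}).
Local Notation rext t := (restr (ext D t) rho).
Section Pair.
Variables (t : nat) (G1 G2 : grading L x (rext t)).
Let f (d : int) (h : rext t.+1) : rext t.+1 := (cmp G1 d h.1 : ext D t, cmp G2 d h.2 : ext D t).
Fact pair_B d a b : f d (a - b) = f d a - f d b.
Proof. by congr (_, _); [exact: (cmpB G1 d a.1 b.1)|exact: (cmpB G2 d a.2 b.2)]. Qed.
Fact pair_x k d h : (k < L)%N -> f d (x k *: h) = x k *: f (d - 1) h.
Proof. by move=> kL; congr (_, _); [exact: (cmpx G1 d h.1 kL)|exact: (cmpx G2 d h.2 kL)]. Qed.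
Fact pair_lo : exists B : int, forall d h, d < B -> f d h = 0.
Proof.
case: (cmp_lo G1) (cmp_lo G2) => B hB [B' hB']; exists (Num.min B B') => d h.
by rewrite lt_min => /andP[/hB h1 /hB' h2]; congr (_, _); [apply: h1|apply: h2].
Qed.
Fact pair_sum h : exists s : seq int,
  [/\ uniq s, forall d, d \notin s -> f d h = 0 & h = \sum_(d <- s) f d h].
Proof.
case: (cmp_sum G1 h.1) (cmp_sum G2 h.2) => s [us hs e] [s' [us' hs' e']].
have n1 d : d \notin undup (s ++ s') -> cmp G1 d h.1 = 0.
  by rewrite mem_undup mem_cat negb_or => /andP[/hs].
have n2 d : d \notin undup (s ++ s') -> cmp G2 d h.2 = 0.
  by rewrite mem_undup mem_cat negb_or => /andP[_ /hs'].
exists (undup (s ++ s')); split; first exact: undup_uniq.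
  by move=> d hd; congr (_, _); [apply: n1|apply: n2].
have e1 := cmp_sumW (undup_uniq (s ++ s')) n1.
have e2 := cmp_sumW (undup_uniq (s ++ s')) n2.
rewrite [LHS]surjective_pairing {1}e1 {1}e2; elim: (undup _) => [|d r IH].
  by rewrite !big_nil.
by rewrite !big_cons -IH.
Qed.
Definition gpair : grading L x (rext t.+1) := @Grading C L x (rext t.+1) f pair_B pair_x pair_lo pair_sum.
End Pair.

Variables (G : grading L x (restr D^o rho)) (b : nat -> int).
Fixpoint gext t : grading L x (rext t) :=
  match t with
  | 0 => G
  | t'.+1 => gpair (gext t') (gshift (gext t') (b t'))
  end.

Definition hom_elt (e : int) (r : D) :=
  forall d s, cmp G d (r * s : D) = r * (cmp G (d - e) (s : D) : D).

Lemma gext_wedge t v e d (z : ext D t) : (forall i, hom_elt (e - b i) (v i)) ->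
  cmp (gext t) d (wedge v z) = wedge v (cmp (gext t) (d - e) z : ext D t).
Proof.
move=> hv; elim: t d z => [|t IH] d z; first exact: (cmp0 G).
have hs r (y : ext D t) d' e' : hom_elt e' r ->
    cmp (gext t) d' (r *: y) = r *: (cmp (gext t) (d' - e') y : ext D t).
  move=> hr; elim: (t) y d' => [|s IHs] y d' /=; first exact: hr.
  congr (_, _); rewrite /= ?IHs //; congr (_ *: (cmp (gext s) _ _ : ext D s)); ring.
rewrite /=; congr (_, _); rewrite /= ?IH //.
rewrite [cmp _ _ (_ - _)](cmpB (gext t)) (hs _ _ _ _ (hv t)) IH.
congr (_ *: (cmp (gext t) _ _ : ext D t) - wedge v (cmp (gext t) _ _ : ext D t)); ring.
Qed.

Lemma gext_scale t r e d (y : ext D t) : hom_elt e r ->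
  cmp (gext t) d (r *: y) = r *: (cmp (gext t) (d - e) y : ext D t).
Proof.
move=> hr; elim: t y d => [|s IHs] y d' /=; first exact: hr.
by congr (_, _); rewrite /= ?IHs //; congr (_ *: (cmp (gext s) _ _ : ext D s)); ring.
Qed.

Lemma gext_contr t u e d (z : ext D t) : (forall i, hom_elt (e + b i) (u i)) ->
  cmp (gext t) d (contr u z) = contr u (cmp (gext t) (d - e) z : ext D t).
Proof.
move=> hu; elim: t d z => [|t IH] d z; first exact: (cmp0 G).
rewrite /=; congr (_, _); rewrite /=.
  rewrite [cmp _ _ (_ + _)](cmpD (gext t)) (gext_scale _ _ (hu t)) IH.
  congr (_ + _ *: (cmp (gext t) _ _ : ext D t)); ring.
rewrite [cmp _ _ (- _)](cmpN (gext t)) IH.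
congr (- contr u (cmp (gext t) _ _ : ext D t)); ring.
Qed.

Lemma gext_top t d (z : ext D t) :
  cmp G d (top z : D) = top (cmp (gext t) (d + \sum_(i < t) b i) z : ext D t).
Proof.
elim: t d z => [|t IH] d z; first by rewrite big_ord0 addr0.
by rewrite /= IH big_ord_recr /= addrA addrK.
Qed.

Lemma gext_one t d a : cmp (gext t) d (a *: one D t) = (cmp G d (a : D) : D) *: one D t.
Proof.
elim: t => [|t IH] /=; first by rewrite -![_ *: 1]/(_ * 1) !mulr1.
rewrite IH scaler0; congr (_, _); rewrite /= scaler0; exact: (cmp0 (gext t)).
Qed.
End Restricted.

Lemma gext_Lam (D : comNzRingType) (rho : {rmorphism C -> D})
    (G : grading L x (restr D^o rho)) (a b : nat -> int) (Phi : nat -> nat -> D) t q d w :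
  (forall j i, (j < q)%N -> hom_elt G (a j - b i) (Phi j i)) ->
  cmp (gext G b t) d (Lam Phi t (w : ext D q)) = Lam Phi t (cmp (gext G a q) d w : ext D q).
Proof.
elim: q d w => [|q IH] d w hP; first exact: gext_one.
rewrite /= [cmp _ _ (_ + _)](cmpD (gext G b t)) IH => [|j i jq]; last by apply: hP; exact: ltnW.
rewrite (gext_wedge (e := a q)) => [|i]; last exact: hP.
by rewrite IH // => j i jq; apply: hP; exact: ltnW.
Qed.

Section Unrestrict.
Variables (H : lmodType C) (G : grading L x (restr H idfun)).
Definition gid : grading L x H :=
  @Grading C L x H (fun d => cmp G d) (cmpB G) (cmpx G) (cmp_lo G) (cmp_sum G).
End Unrestrict.

Section Row.
Variables (G : grading L x C^o) (m : nat) (a : 'I_m -> int).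
Let f (d : int) (r : 'rV[C]_m) : 'rV[C]_m := \row_j cmp G (d + a j) (r 0 j).
Fact row_B d r s : f d (r - s) = f d r - f d s.
Proof. by apply/rowP => j; rewrite !mxE cmpB. Qed.
Fact row_x k d r : (k < L)%N -> f d (x k *: r) = x k *: f (d - 1) r.
Proof.
move=> kL; apply/rowP => j; rewrite !mxE [cmp _ _ _](cmpx G) //.
by congr (_ *: cmp G _ _); ring.
Qed.
Fact row_lo : exists B : int, forall d h, d < B -> f d h = 0.
Proof.
case: (cmp_lo G) => B hB; exists (B - \sum_j `|a j|) => d r hd.
apply/rowP => j; rewrite !mxE; apply: hB.
have : `|a j| <= \sum_j `|a j| by rewrite (bigD1 j) //= lerDl sumr_ge0.
have := ler_norm (a j); lia.
Qed.
Fact row_sum r : exists s : seq int,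
  [/\ uniq s, forall d, d \notin s -> f d r = 0 & r = \sum_(d <- s) f d r].
Proof.
pose s j := sval (cid (cmp_sum G (r 0 j))).
have sP j : [/\ uniq (s j), forall d, d \notin s j -> cmp G d (r 0 j) = 0
    & r 0 j = \sum_(d <- s j) cmp G d (r 0 j)] := svalP (cid (cmp_sum G (r 0 j))).
pose S := undup (flatten [seq [seq d - a j | d <- s j] | j <- enum 'I_m]).
have nS j d : d \notin S -> cmp G (d + a j) (r 0 j) = 0.
  rewrite mem_undup => hd; case: (sP j) => _ h _; apply: h; apply: contra hd => hd.
  apply/flattenP; exists [seq d - a j | d <- s j].
    by apply/mapP; exists j; rewrite ?mem_enum.
  by apply/mapP; exists (d + a j); rewrite ?addrK.
exists S; split; first exact: undup_uniq.
  by move=> d hd; apply/rowP => j; rewrite !mxE nS.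
apply/rowP => j; rewrite summxE.
rewrite (@cmp_sumW _ G (r 0 j : C^o) [seq d + a j | d <- S]) ?big_map.
- by apply: eq_bigr => d _; rewrite !mxE.
- by rewrite map_inj_uniq ?undup_uniq //; apply: addIr.
- move=> d hd; rewrite -(subrK (a j) d); apply: nS; apply: contra hd => hd.
  by apply/mapP; exists (d - a j); rewrite ?subrK.
Qed.
Definition grow : grading L x 'rV[C]_m := @Grading C L x _ f row_B row_x row_lo row_sum.
End Row.
End Gradings.

(** * Products of vectors and determinants *)

Section WedgeDet.
Variable C : comNzRingType.

Fixpoint wed t s : ('I_s -> nat -> C) -> ext C t :=
  match s with
  | 0 => fun _ => one C t
  | s'.+1 => fun v => wedge (v ord0) (wed t (fun k => v (lift ord0 k)))
  end.

Lemma wed_eq t s (v w : 'I_s -> nat -> C) : (forall k, v k = w k) -> wed t v = wed t w.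
Proof.
elim: s v w => [|s IH] v w e //=; rewrite e; congr wedge; apply: IH => k; exact: e.
Qed.

Lemma wed_fst t s (v : 'I_s -> nat -> C) : (wed t.+1 v).1 = wed t v.
Proof. by elim: s v => [|s IH] v //=; rewrite IH. Qed.

Lemma wed_snd t s (v : 'I_s.+1 -> nat -> C) :
  (wed t.+1 v).2 = \sum_(k < s.+1) ((-1) ^+ k * v k t) *: wed t (fun l => v (lift k l)).
Proof.
have w2 (u : nat -> C) (z : ext C t.+1) :
  (wedge u z : ext C t.+1).2 = u t *: z.1 - wedge u z.2 by [].
elim: s v => [|s IH] v.
  by rewrite /= raddf0 subr0 big_ord1 mul1r.
rewrite big_ord_recl mul1r.
rewrite -[wed t.+1 v]/(wedge (v ord0) (wed t.+1 (fun k => v (lift ord0 k)))).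
rewrite w2 wed_fst IH; congr (_ + _).
rewrite wedge_sum -sumrN; apply: eq_bigr => k _.
have -> : wed t (fun l => v (lift (lift ord0 k) l)) =
    wedge (v ord0) (wed t (fun l => v (lift ord0 (lift k l)))).
  rewrite /=; congr (wedge (v _) _); first exact: val_inj.
  by apply: wed_eq => l; congr v; apply: val_inj; rewrite /= /bump /= leq_add2l addnCA.
by rewrite wedgeZr -scaleNr -mulNr -mulN1r -exprS.
Qed.

(** The sign (-1)^(t(t-1)/2) of order reversal: in a pair the last basis vector stands first. *)
Fixpoint wsgn (t : nat) : C := if t is t'.+1 then wsgn t' * (-1) ^+ t' else 1.

Lemma wsgn_sqr t : wsgn t * wsgn t = 1.
Proof. by elim: t => [|t IH] /=; rewrite ?mulr1 // mulrACA IH mul1r -expr2 sqrr_sign. Qed.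

Lemma wed_det t (v : 'I_t -> nat -> C) :
  top (wed t v) = wsgn t * \det (\matrix_(i, k) v k i).
Proof.
elim: t v => [|t IH] v; first by rewrite /= det_mx00 mulr1.
have -> : top (wed t.+1 v) = top (wed t.+1 v).2 by [].
rewrite wed_snd top_sum (expand_det_row _ ord_max) mulr_sumr.
apply: eq_bigr => k _; rewrite topZ IH mxE /cofactor /= exprD.
have -> : row' ord_max (col' k (\matrix_(i < t.+1, k0 < t.+1) v k0 i)) =
    \matrix_(i < t, l < t) v (lift k l) i.
  by apply/matrixP => i l; rewrite !mxE lift_max.
have h : (-1) ^+ t * (-1) ^+ t = 1 :> C by rewrite -expr2 sqrr_sign.
set e := (-1) ^+ k; set u := v k t; set D := \det _; set w := wsgn t.
transitivity (w * ((-1) ^+ t * (-1) ^+ t) * (u * (e * D))); last by ring.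
rewrite h; ring.
Qed.

Variable Phi : nat -> nat -> C.

Lemma cols_wed t (l : seq nat) :
  cols Phi t l = wed t (fun k : 'I_(size l) => Phi (nth 0 l k)).
Proof. by elim: l => [|a l IH] //=; rewrite IH. Qed.

Lemma gr_cols_neq t l p : p != size l -> gr p (cols Phi t l) = 0.
Proof.
elim: l p => [|a l IH] p.
  case: p => // p _; rewrite /cols; elim: t p => [|s IH] p; rewrite /= ?IH ?raddf0 //.
case: p => [_|p]; first exact: gr0_wedge.
by rewrite eqSS => /IH e; rewrite [cols _ _ _]/= gr_wedge e raddf0.
Qed.

Lemma Lam_closed t q (S : submod (ext C t)) (w : ext C q) : S (one C t) ->
  (forall j y, (j < q)%N -> S y -> S (wedge (Phi j) y)) -> S (Lam Phi t w).
Proof.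
move=> S1; elim: q w => [|q IH] w Sw; first exact: submodZ.
rewrite /=; apply: (submodD (s := S)); last apply: (Sw) => //.
  by apply: (IH w.1) => j y jq; apply: Sw; apply: ltnW.
by apply: (IH w.2) => j y jq; apply: Sw; apply: ltnW.
Qed.

Lemma ImL_span t q (Q : submod (ext C t)) :
  (forall l, all (ltn^~ q) l -> Q (cols Phi t l)) -> forall z, ImL Phi t q z -> Q z.
Proof.
move=> hQ z [w ->].
pose S := span (fun z => exists l, all (ltn^~ q) l /\ z = cols Phi t l).
have SQ y : S y -> Q y by apply=> _ [l [hl ->]]; exact: hQ.
have S1 : S (one C t) by apply: span_gen; exists [::].
have Sw j y : (j < q)%N -> S y -> S (wedge (Phi j) y).
  move=> jq; apply: (_ : forall y, S y -> preim_submod (@wedge C t (Phi j)) S y) => {}y.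
  apply=> _ [l [hl ->]]; apply: span_gen; exists (j :: l); rewrite /= jq; split=> //.
by apply: SQ; apply: Lam_closed.
Qed.

End WedgeDet.

(** * The polynomial ring, and the columns of a homogeneous matrix over it *)

Section PolyRing.
Variables (K : fieldType) (n : nat).
Local Notation R := {mpoly K[n.+1]}.

Definition xx (k : nat) : R := 'X_(inord k).
(** Sets x_k, .., x_n to 0: membership in the ideal they generate becomes an equation in a domain,
    and its primality follows. *)
Definition ev (k : nat) : R -> R :=
  comp_mpoly [tuple (if (i < k)%N then 'X_i else 0) | i < n.+1].
HB.instance Definition _ k := GRing.RMorphism.on (ev k).

Lemma ev_x k i : (i <= n)%N -> ev k (xx i) = if (i < k)%N then xx i else 0.
Proof.
by move=> hi; rewrite /ev /xx comp_mpolyXU -tnth_nth tnth_mktuple inordK.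
Qed.

Lemma ev_X k r : XS n.+1 xx R^o k (r - ev k r).
Proof.
pose P r := XS n.+1 xx R^o k (r - ev k r).
have P0 : P 0 by rewrite /P rmorph0 subrr; apply: submod0.
have PD r1 r2 : P r1 -> P r2 -> P (r1 + r2).
  by rewrite /P rmorphD opprD addrACA; apply: submodD.
have PM r1 r2 : P r1 -> P r2 -> P (r1 * r2).
  rewrite /P rmorphM => h1 h2.
  have -> : r1 * r2 - ev k r1 * ev k r2 = (r1 - ev k r1) * r2 + ev k r1 * (r2 - ev k r2).
    by ring.
  by apply: submodD; [apply: idealMr|apply: idealMl].
have PC c : P c%:MP by rewrite /P /ev comp_mpolyC subrr; apply: submod0.
have PX (i : 'I_n.+1) : P 'X_i.
  have ei : 'X_i = xx i by rewrite /xx inord_val.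
  rewrite /P ei ev_x; last by rewrite -ltnS.
  case: ifP => [_|/negbT].
    by rewrite subrr; apply: submod0.
  rewrite -leqNgt subr0 => ki; rewrite -[xx i]mulr1.
  by apply: (@XS_x _ n.+1 xx R^o k i 1); rewrite ki /=.
rewrite -/(P r); clearbody P; rewrite [r]mpolyE; elim/big_rec: _ => [|mm s _ hs]; first exact: P0.
apply: PD hs; rewrite -mul_mpolyC; apply: (PM) => //.
rewrite mpolyXE_id; elim/big_rec: _ => [|i s' _ hs']; first by rewrite -mpolyC1.
apply: (PM) hs'; elim: (mm i) => [|j IH]; first by rewrite expr0 -mpolyC1.
by rewrite exprS; apply: PM.
Qed.

Lemma XS_ev k r : XS n.+1 xx R^o k r <-> ev k r = 0.
Proof.
split=> [[c ->]|h]; last by have := ev_X k r; rewrite h subr0.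
rewrite rmorph_sum big_nat_cond big1 // => i; rewrite andbT => /andP[ki iL].
by rewrite -[_ *: c i]/(_ * _) rmorphM /= ev_x ?ifN ?mul0r // -leqNgt.
Qed.

Lemma xx_prime k r s : XS n.+1 xx R^o k (r * s) ->
  XS n.+1 xx R^o k r \/ XS n.+1 xx R^o k s.
Proof.
move=> /XS_ev; rewrite rmorphM => /eqP; rewrite mulf_eq0.
by case/orP => /eqP h; [left|right]; apply/XS_ev.
Qed.

Lemma xx_notin k : (k < n.+1)%N -> ~ XS n.+1 xx R^o k.+1 (xx k).
Proof.
rewrite ltnS => kn /XS_ev; rewrite ev_x // ltnSn => /(congr1 (mcoeff U_(inord k))).
by rewrite /xx mcoeffX eqxx mcoeff0 => /eqP; rewrite oner_eq0.
Qed.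

Lemma xx_top k : ~ XS n.+1 xx R^o k 1.
Proof. by move=> /XS_ev; rewrite rmorph1 => /eqP; rewrite oner_eq0. Qed.

Definition pcmp (d : int) (r : R) : R := if d is Posz k then pihomog mdeg k r else 0.

Lemma pcmp_deg d r : poly_deg d (pcmp d r).
Proof. by case: d => [k|k] //=; apply: pihomogP. Qed.

Lemma pcmp_id d r : poly_deg d r -> pcmp d r = r.
Proof. by case: d => [k|k] /=; [apply: pihomog_dE|move=> ->]. Qed.

Lemma pcmp_neq d e r : poly_deg e r -> d != e -> pcmp d r = 0.
Proof.
case: d e => [k|k] [l|l] //=; last by move=> -> _; apply: pihomog0.
by move=> hr ne; apply: pihomog_ne0 hr; apply: contra ne => /eqP ->.
Qed.

Lemma pcmpB d r s : pcmp d (r - s) = pcmp d r - pcmp d s.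
Proof. by case: d => [k|k] /=; rewrite ?subrr // raddfB. Qed.
Lemma pcmp0 d : pcmp d 0 = 0.
Proof. by have := pcmpB d 0 0; rewrite !subrr. Qed.
Lemma pcmpD d r s : pcmp d (r + s) = pcmp d r + pcmp d s.
Proof. by case: d => [k|k] /=; rewrite ?addr0 // raddfD. Qed.

Lemma pcmp_sum r : exists s : seq int,
  [/\ uniq s, forall d, d \notin s -> pcmp d r = 0 & r = \sum_(d <- s) pcmp d r].
Proof.
exists [seq Posz k | k <- iota 0 (msize r)]; split.
- by rewrite map_inj_uniq ?iota_uniq // => k l [].
- case=> [k|k] //= hk; rewrite pihomogE big_seq_cond big1 // => mm /andP[hm /eqP e].
  case/negP: hk; apply/mapP; exists k => //; rewrite mem_iota /= add0n -e.
  exact: msize_mdeg_lt.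
- rewrite big_map /= {1}(pihomog_partitionE (mf := mdeg) (leqnn (msize r))).
  by rewrite -(big_mkord xpredT (fun d => pihomog mdeg d r)) /index_iota subn0.
Qed.

Lemma pcmpM e d r s : poly_deg e r -> pcmp d (r * s) = r * pcmp (d - e) s.
Proof.
move=> hr; case: (pcmp_sum s) => l [ul hl es].
rewrite {1}es mulr_sumr (big_morph (pcmp d) (pcmpD d) (pcmp0 d)).
transitivity (\sum_(i <- l) if i == d - e then r * pcmp i s else 0).
  apply: eq_bigr => i _; have h := poly_degM hr (pcmp_deg i s).
  case: eqP => [e1|/eqP ne]; first by apply: pcmp_id; move: h; rewrite e1 addrC subrK.
  apply: pcmp_neq h _; apply: contra ne => /eqP ->; apply/eqP; ring.
rewrite -big_mkcond; case: (boolP (d - e \in l)) => hd.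
  by rewrite -big_filter filter_pred1_uniq // big_seq1.
by rewrite hl // mulr0 big1_seq // => i /andP[/eqP -> /(negP hd)].
Qed.

Lemma poly_degX k : poly_deg 1 (xx k).
Proof. by rewrite /= /xx dhomogX; apply/eqP; exact: mdeg1. Qed.

Fact gR_x k d (h : restr R^o idfun) : (k < n.+1)%N ->
  pcmp d (xx k *: h) = xx k *: (pcmp (d - 1) h : restr R^o idfun).
Proof. by move=> _; apply: (pcmpM d (h : R) (poly_degX k)). Qed.
Fact gR_lo : exists B : int, forall d (h : restr R^o idfun), d < B -> pcmp d h = 0.
Proof. by exists 0 => -[]. Qed.
Definition gR' : grading n.+1 xx (restr R^o idfun) :=
  @Grading R n.+1 xx (restr R^o idfun) (fun d r => pcmp d r) pcmpB gR_x gR_lo pcmp_sum.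
Definition gR : grading n.+1 xx R^o := gid gR'.

Lemma poly_hom_elt e r : poly_deg e r -> hom_elt gR' e r.
Proof. by move=> h d s; apply: pcmpM. Qed.

End PolyRing.

Section Instance.
Variables (K : fieldType) (n t m : nat) (a : 'I_m -> int) (b : 'I_t -> int).
Local Notation R := {mpoly K[n.+1]}.
Local Notation L := n.+1.
Local Notation xx := (xx K n).
Variable A : 'M[R]_(t, m).

(** Columns are indexed by all natural numbers and extended by 0, so that initial blocks of columns
    need no change of index type. *)
Definition Ph (j i : nat) : R :=
  if insub j is Some j' then (if insub i is Some i' then A i' j' else 0) else 0.
Definition na (j : nat) : int := if insub j is Some j' then a j' else 0.
Definition nb (i : nat) : int := if insub i is Some i' then b i' else 0.

Lemma PhE (j : 'I_m) (i : 'I_t) : Ph j i = A i j.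
Proof. by rewrite /Ph !valK. Qed.
Lemma naE (j : 'I_m) : na j = a j. Proof. by rewrite /na valK. Qed.
Lemma nbE (i : 'I_t) : nb i = b i. Proof. by rewrite /nb valK. Qed.

Notation I := (IL Ph t m).

Lemma top_wed_minor (f : 'I_t -> 'I_m) :
  top (wed t (fun k => Ph (f k))) = wsgn R t * \det (colsub f A).
Proof.
rewrite wed_det; congr (_ * \det _); apply/matrixP => i k; rewrite !mxE; exact: PhE.
Qed.

Lemma top_cols_minor l : all (ltn^~ m) l -> minors A t (top (cols Ph t l)).
Proof.
move=> hl; case: (eqVneq (size l) t) => [e|ne]; last first.
  by rewrite -top_gr gr_cols_neq 1?eq_sym // raddf0; apply: submod0.
have hn (k : 'I_t) : (nth 0 l k < m)%N by apply: (allP hl); rewrite mem_nth // e.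
have -> : cols Ph t l = wed t (fun k : 'I_t => Ph (Ordinal (hn k))).
  rewrite cols_wed; move: hn; case: _ / (esym e) => hn; exact: wed_eq.
rewrite top_wed_minor; apply: (@idealMl _ (minors A t)); apply: span_gen.
exists id, (fun k => Ordinal (hn k)); congr (\det _).
Qed.

Lemma IL_minors r : det_ideal A r <-> I r.
Proof.
split.
  apply=> _ [f [g ->]].
  have -> : mxsub f g A = rowsub f 1%:M *m colsub g A.
    by rewrite mul_rowsub_mx mul1mx; apply/matrixP => i j; rewrite !mxE.
  rewrite det_mulmx; apply: (@idealMl _ I).
  have := top_wed_minor g => h.
  have -> : \det (colsub g A) = wsgn R t * top (wed t (fun k => Ph (g k))).
    by rewrite h mulrA wsgn_sqr mul1r.
  apply: (@idealMl _ I); apply: top_ImL.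
  have : forall s (f : 'I_s -> 'I_m), ImL Ph t m (wed t (fun k => Ph (f k))).
    elim=> [|s IH] h' /=; first exact: ImL_one.
    by apply: ImL_wedge => //; apply: IH.
  exact.
move=> [w ->]; pose Q := preim_submod (@top _ t : {linear _ -> R^o}) (minors A t).
suff : Q (Lam Ph t w) by [].
apply: (@ImL_span _ _ t m Q) => [l hl|]; [exact: top_cols_minor|by exists w].
Qed.

Hypothesis hA : homogeneous_mx a b A.

Lemma hom_Ph j i : hom_elt (gR' K n) (na j - nb i) (Ph j i).
Proof.
rewrite /Ph /na /nb; case: insubP => [j' _ _|_]; last by move=> d s; rewrite !mul0r; apply: pcmp0.
case: insubP => [i' _ _|_]; first exact/poly_hom_elt/hA.
by move=> d s; rewrite !mul0r; apply: pcmp0.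
Qed.

Definition gE : grading L xx (ext R t) := gid (gext (gR' K n) nb t).

Lemma graded_ImL q : graded gE (ImL Ph t q).
Proof.
move=> d _ [w ->]; exists (cmp (gext (gR' K n) na q) d (w : restr (ext R q) idfun)).
by apply: gext_Lam => j i _; apply: hom_Ph.
Qed.

Lemma graded_IL q : graded (gR K n) (IL Ph t q).
Proof.
move=> d _ [w ->].
have := gext_top (gR' K n) nb d (Lam Ph t w) => /=.
rewrite /gR /= => ->.
rewrite (@gext_Lam _ _ _ _ idfun (gR' K n) na nb Ph t q) => [|j i _]; last exact: hom_Ph.
by eexists.
Qed.

Definition gB : grading L xx 'rV[R]_m := grow (gR K n) a.

Lemma graded_rowW : graded gB (rowW Ph t m).
Proof.
move=> e d [g hg]; exists (fun i => pcmp (e + nb i) (g i)) => j; rewrite mxE.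
have := @graded_IL m (e + a j) _ (hg j); rewrite /= pcmpB; congr (I (_ - _)).
rewrite /dot (big_morph (pcmp (e + a j)) (@pcmpD K n (e + a j)) (pcmp0 K n (e + a j))).
apply: eq_bigr => i _; rewrite mulrC [in RHS]mulrC.
have := hom_Ph j i (e + a j) (g i) => /= ->; rewrite naE; congr (_ * pcmp _ _); ring.
Qed.

End Instance.

(* The consequences of genericity that are used: modulo the later variables, a
   power of x_p lies in the ideal of maximal minors of the first t + p columns,
   and a power of x_e lies in the ideal J of (t-1)-minors. *)
Record generic (K : fieldType) (n t m c : nat) (A : 'M[{mpoly K[n.+1]}]_(t, m)) := Generic {
  sg : nat -> {mpoly K[n.+1]};
  sgN : nat -> nat;
  sgd : nat -> int;
  sJ : nat -> {mpoly K[n.+1]};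
  sJN : nat -> nat;
  sJd : nat -> int;
  sgI : forall p, (p < c)%N -> IL (Ph A) t (t + p) (sg p);
  sgX : forall p, (p < c)%N -> XS n.+1 (xx K n) ({mpoly K[n.+1]}^o) p.+1 (sg p - xx K n p ^+ sgN p);
  sghom : forall p, (p < c)%N -> poly_deg (sgd p) (sg p);
  sJI : forall e, (c <= e <= 2 * c)%N -> Jid (Ph A) t m (sJ e);
  sJX : forall e, (c <= e <= 2 * c)%N ->
    XS n.+1 (xx K n) ({mpoly K[n.+1]}^o) e.+1 (sJ e - xx K n e ^+ sJN e);
  sJhom : forall e, (c <= e <= 2 * c)%N -> poly_deg (sJd e) (sJ e) }.

Section Facts.
Variables (K : fieldType) (n t c m : nat) (a : 'I_m -> int) (b : 'I_t -> int).
Local Notation R := {mpoly K[n.+1]}.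
Local Notation L := n.+1.
Local Notation xx := (xx K n).
Variable A : 'M[R]_(t, m).
Hypotheses (hA : homogeneous_mx a b A) (G : generic c A).
Hypotheses (c_gt0 : (0 < c)%N) (mE : m = (t + c.-1)%N) (n_ge : (2 * c <= n)%N).
Notation I := (IL (Ph A) t m).
Notation X k := (XS L xx R^o k).

Let cL : (c <= L)%N. Proof. lia. Qed.
Let L_gt : (2 * c < L)%N. Proof. lia. Qed.
Let Xprime k r s : (k <= L)%N -> X k (r * s) -> X k r \/ X k s.
Proof. move=> _; exact: xx_prime. Qed.
Let x_notin := @xx_notin K n.
Let x_top p : (p < L)%N -> ~ X p.+1 1.
Proof. move=> _; exact: xx_top. Qed.
Let gIL := graded_IL hA.
Let gImL := graded_ImL hA.

Lemma ext_Reg_G p k : (p < c)%N -> (p < k < L)%N -> Reg L xx (ImL (Ph A) t (t + p)) k.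
Proof. exact: (ext_Reg Xprime x_notin x_top gIL (sgI G) (sgX G)). Qed.

Lemma ext_Reg_mG k : (c <= k < L)%N -> Reg L xx (ImL (Ph A) t m) k.
Proof. by move=> hk; have := @ext_Reg_G c.-1 k; rewrite -mE; apply; lia. Qed.

Lemma I_Reg k : (c <= k < L)%N -> Reg L xx I k.
Proof. by move=> hk; apply/IL_Reg/ext_Reg_mG. Qed.

Lemma BRK (p : 'cV[R]_m) : A *m p = 0 -> forall j, I (p j 0).
Proof.
move=> h j; pose d k := if insub k is Some k' then p k' 0 else 0.
have -> : p j 0 = d j by rewrite /d valK.
have := @ker_one _ _ _ _ _ Xprime x_notin x_top _ c _ _ cL gIL (sgI G) (sgX G) c.-1 d.
rewrite -mE; apply => //; first by rewrite prednK.
move=> i it; have := congr1 (fun M : 'cV[R]_t => M (Ordinal it) 0) h.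
rewrite !mxE => <-; apply: eq_bigr => k _.
by rewrite mulrC /d valK -[i]/(val (Ordinal it)) PhE.
Qed.

End Facts.

(** * One-dimensional spaces, and classes in the conormal module *)

Section Lines.
Variable K : fieldType.
Definition line (V : lmodType K) (e : V) := e != 0 /\ forall v, exists k, v = k *: e.

Lemma line_Kiso (V W : lmodType K) (e : V) (e' : W) : line e -> line e' -> Kiso V W.
Proof.
move=> [e0 he] [e0' he'].
pose k v := sval (cid (he v)); have kE v : v = k v *: e := svalP (cid (he v)).
pose k' v := sval (cid (he' v)); have kE' v : v = k' v *: e' := svalP (cid (he' v)).
have inj r s : r *: e = s *: e -> r = s.
  move/eqP; rewrite -subr_eq0 -scalerBl scaler_eq0 (negbTE e0) orbF subr_eq0.
  by move/eqP.
have inj' r s : r *: e' = s *: e' -> r = s.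
  move/eqP; rewrite -subr_eq0 -scalerBl scaler_eq0 (negbTE e0') orbF subr_eq0.
  by move/eqP.
have lin : linear (fun v => k v *: e').
  move=> r u v; rewrite scalerA -scalerDl; congr (_ *: _); apply: inj.
  by rewrite -kE scalerDl -scalerA -!kE.
pose F : {linear V -> W} := HB.pack (fun v => k v *: e') (GRing.isLinear.Build K V W *:%R _ lin).
exists F.
exists (fun w => k' w *: e) => v /=.
  by rewrite {2}[v]kE; congr (_ *: _); apply: inj'; rewrite -kE'.
by rewrite {2}[v]kE'; congr (_ *: _); apply: inj; rewrite -kE.
Qed.

Lemma line_K : line (1 : K^o).
Proof. by split; [exact: oner_neq0|move=> v; exists v; rewrite -[RHS]/(_ * _) mulr1]. Qed.
End Lines.

Section Conormal.
Variables (K : pzRingType) (S : gralg K) (I : ideal S).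

Definition I2 : ideal S := span (fun r : S^o => exists x y, [/\ I x, I y & r = x * y]).

Let II := ideal_mul I (gsub (I : submod (gself S))).
Definition cn0 r (h : I r) : submod_type (I : submod (gself S)) :=
  SubmodElt (introT (asboolP _) h : (r : gself S) \in subpred (I : submod (gself S))).
(** The class of r in I/I^2; the value 0 outside I is a default. *)
Definition cnt (r : S) : conormal I :=
  if pselect (I r) is left h then quot_pi II (cn0 h) else 0.

Lemma cntE r (h : I r) : cnt r = quot_pi II (cn0 h).
Proof.
rewrite /cnt; case: pselect => // h'; congr (quot_pi _ (cn0 _)); exact: Prop_irrelevance.
Qed.

Lemma sm_eq (V : lmodType S) (W : submod V) (x y : submod_type W) : sm_val x = sm_val y -> x = y.
Proof. exact: val_inj. Qed.

Lemma cntD r s : I r -> I s -> cnt (r + s) = cnt r + cnt s.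
Proof.
move=> hr hs; rewrite (cntE hr) (cntE hs) (cntE (submodD hr hs)).
rewrite -[RHS](raddfD (quot_pi II)); congr (quot_pi II); exact: sm_eq.
Qed.

Lemma cntZ a r : I r -> cnt (a * r) = (qring_pi I a : gquot I) *: cnt r.
Proof.
move=> hr; have h : I (a * r) by apply: (submodZ (s := I) a hr).
rewrite (cntE hr) (cntE h) [RHS](descent_scaleE (conormal_killed (I := I))).
apply: etrans; last first.
  exact: (esym (quot_scaleE II a (cn0 hr))).
by congr (quot_pi II); apply: sm_eq.
Qed.

Lemma cnt_surj (x : conormal I) : exists r, I r /\ x = cnt r.
Proof.
elim/quot_ind: (x : quot II) => y.
exists (sm_val y); have h := sm_valW y; split=> //; rewrite (cntE h).
by congr (quot_pi II); apply: sm_eq.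
Qed.

Lemma cnt_eq0 r : I r -> cnt r = 0 <-> I2 r.
Proof.
move=> hr; rewrite (cntE hr); split.
  have -> : (0 : conormal I) = quot_pi II 0 by rewrite raddf0.
  move/quot_piP; rewrite subr0 => h.
  pose Q := @Submod S (submod_type (I : submod (gself S))) (fun y => I2 (sm_val y))
    (submod0 I2) (fun y z => submodD (s := I2) (x := sm_val y) (y := sm_val z))
    (fun a y => submodZ (s := I2) a (x := sm_val y)).
  apply: (h Q) => _ [a [w [Ia ->]]]; apply: span_gen.
  by exists a, (sm_val w); split=> //; exact: sm_valW.
move=> h; pose P s := I s /\ forall h : I s, II (cn0 h).
have [P0 PD PZ] : [/\ P 0, forall x y, P x -> P y -> P (x + y) & forall a x, P x -> P (a * x)].
  split.
  - split=> [|h']; first exact: submod0.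
    by rewrite (_ : cn0 h' = 0); [apply: submod0|apply: sm_eq].
  - move=> x y [Ix hx] [Iy hy]; split=> [|h']; first exact: submodD.
    rewrite (_ : cn0 h' = cn0 Ix + cn0 Iy); [exact: submodD|exact: sm_eq].
  - move=> a x [Ix hx]; split=> [|h']; first exact: (submodZ (s := I) a Ix).
    by rewrite (_ : cn0 h' = a *: cn0 Ix); [apply: submodZ|apply: sm_eq].
have [_] : P r.
  apply: (h (Submod (V := S^o) P0 PD PZ)) => _ [x [y [Ix Iy ->]]]; split.
    by rewrite mulrC; apply: (submodZ (s := I)).
  move=> h'; apply: span_gen; exists x, (cn0 Iy); split=> //; exact: sm_eq.
by move=> /(_ hr) hh; apply: quot_pi0.
Qed.

Lemma cnt_deg d r : I r -> ga_deg d r -> gm_deg d (cnt r).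
Proof. by move=> hr hd; rewrite (cntE hr); exists (cn0 hr). Qed.

Lemma cnt_deg_surj d (x : conormal I) : gm_deg d x -> exists r, [/\ I r, ga_deg d r & x = cnt r].
Proof.
move=> [y [hy ->]]; exists (sm_val y); have h := sm_valW y; split=> //.
by rewrite (cntE h); congr (quot_pi II); apply: sm_eq.
Qed.

Lemma cnt0 : cnt 0 = 0.
Proof. by apply/cnt_eq0; [apply: submod0|apply: submod0]. Qed.
Lemma cntN r : I r -> cnt (- r) = - cnt r.
Proof.
move=> h; apply/eqP; rewrite -addr_eq0 -cntD ?addNr ?cnt0 //; exact: submodN.
Qed.
Lemma cntB r s : I r -> I s -> cnt (r - s) = cnt r - cnt s.
Proof. by move=> hr hs; rewrite cntD ?cntN //; apply: submodN. Qed.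
End Conormal.

(** * The vector of maximal minors and the product of the rows *)

Section MinorVector.
Variables (C : comNzRingType) (Phi : nat -> nat -> C) (t : nat).

Lemma top_contr s u (z : ext C s) : top (contr u z) = 0.
Proof. by elim: s z => [|s IH] z //=; rewrite topN IH oppr0. Qed.

(** The coordinates of the linear form T o [Lam] on [ext C s]. For T = [top] these are all maximal
    minors at once. *)
Fixpoint Fs s (T : {linear ext C t -> C^o}) : ext C s :=
  match s with
  | 0 => T (one C t)
  | s'.+1 => (Fs s' T, Fs s' (T \o wedge (Phi s')))
  end.

Lemma Fs0 s (T : {linear ext C t -> C^o}) : (forall z, T z = 0) -> Fs s T = 0.
Proof.
elim: s T => [|s IH] T e /=; first exact: e.
by congr (_, _); apply: IH => // z /=; apply: e.
Qed.

Lemma Fs_sub s r (T T1 T2 : {linear ext C t -> C^o}) :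
  (forall z, T z = r *: T1 z - T2 z) -> Fs s T = r *: Fs s T1 - Fs s T2.
Proof.
elim: s T T1 T2 => [|s IH] T T1 T2 e /=; first exact: e.
by congr (_, _); apply: IH => // z /=; apply: e.
Qed.

(** The transpose of [Lam_contr]: multiplication by row k on coordinates corresponds to contraction
    by the k-th covector under T. *)
Lemma Fs_row s k (T : {linear ext C t -> C^o}) : (k < t)%N ->
  wedge (fun j => Phi j k) (Fs s T) = Fs s (T \o contr (delta C k)).
Proof.
move=> kt; elim: s T => [|s IH] T; first by rewrite /= contr_one raddf0.
rewrite /=; congr (_, _); rewrite /= ?IH //; apply/esym/Fs_sub => z /=.
rewrite contr_wedge delta_dot // raddfB; congr (_ - _); exact: linearZ.
Qed.

Lemma Fs_allext s (I : ideal C) m (T : {linear ext C t -> C^o}) : (s <= m)%N ->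
  (forall z, ImL Phi t m z -> I (T z)) -> allext I (Fs s T).
Proof.
elim: s T => [|s IH] T sm hT /=; first by apply: hT; apply: ImL_one.
split; first by apply: IH => //; apply: ltnW.
apply: IH => [|z hz /=]; first exact: ltnW.
by apply: hT; apply: ImL_wedge.
Qed.

Lemma Fs_gen s (Q : ideal C) (T : {linear ext C t -> C^o}) (w : ext C s) :
  allext Q (Fs s T) -> Q (T (Lam Phi t w)).
Proof.
elim: s T w => [|s IH] T w /=; first by rewrite linearZ; apply: (submodZ (s := Q)).
by move=> [h1 h2]; rewrite raddfD; apply: submodD; [exact: IH|exact: (IH _ _ h2)].
Qed.

Lemma Fs_gr s p (T : {linear ext C t -> C^o}) : (forall z, T (gr p z) = T z) ->
  gr p (Fs s T) = Fs s T.
Proof.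
elim: s p T => [|s IH] p T hT /=.
  case: p hT => // p hT; rewrite -hT; have -> : gr p.+1 (one C t) = 0; last by rewrite raddf0.
  by elim: (t) (p) => [|r IHr] q //=; rewrite IHr ?raddf0.
congr (_, _); first exact: IH.
case: p hT => [|p] hT; last by apply: IH => z /=; rewrite -gr_wedge hT.
by rewrite Fs0 // => z /=; rewrite -hT gr0_wedge raddf0.
Qed.

Lemma gr0_one (z : ext C t) : gr 0 z = z -> exists c, z = c *: one C t.
Proof.
elim: (t) z => [|s IH] z /=; first by exists z; rewrite -[RHS]/(_ * 1) mulr1.
move=> e; have [c hc] := IH z.1 (congr1 fst e).
exists c; have e2 : z.2 = 0 := esym (congr1 snd e).
by rewrite -[LHS](ext_eta z) e2 hc; congr (_, _); rewrite /= scaler0.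
Qed.
End MinorVector.

Section Peel.
Variables (C : comNzRingType) (m t : nat) (f0 : C) (row hh : nat -> nat -> C).
Hypothesis hrow : forall k l, (k < t)%N -> (l < t)%N ->
  dot m (hh k) (row l) = if l == k then f0 else 0.

Let v s k : nat -> C := row (t - s + k)%N.

(** Contracting row ∧ z = 0 by the covector dual to that row gives f0 z = row ∧ y, where y has
    degree one less and is killed by the remaining rows, since the covector kills them. *)
Lemma peel s (z : ext C m) : (s <= t)%N -> gr s z = z ->
  (forall k, (k < s)%N -> wedge (v s k) z = 0) ->
  exists g, f0 ^+ s *: z = g *: wed m (fun k : 'I_s => v s k).
Proof.
elim: s z => [|s IH] z st hg hz.
  by have [g ->] := gr0_one hg; exists g; rewrite expr0 scale1r.
pose y := contr (hh (t - s.+1)) z.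
have e1 : f0 *: z = wedge (v s.+1 0) y.
  have := contr_wedge (hh (t - s.+1)) (v s.+1 0) z.
  rewrite hz // raddf0 /v addn0 hrow ?eqxx; [|lia|lia].
  by move/eqP; rewrite eq_sym subr_eq0 => /eqP.
have vS k : v s.+1 k.+1 = v s k by rewrite /v; congr row; lia.
have [||k ks|g hg'] := IH (gr s y); rewrite ?gr_gr //.
- exact: ltnW.
- rewrite -gr_wedge -vS /y.
  have := contr_wedge (hh (t - s.+1)) (v s.+1 k.+1) z.
  rewrite hz // raddf0 {1}/v hrow; [|lia|lia].
  rewrite ifN; last by lia.
  by rewrite scale0r sub0r => /esym/eqP; rewrite oppr_eq0 => /eqP ->; rewrite raddf0.
exists g; have e2 : f0 *: z = wedge (v s.+1 0) (gr s y).
  by rewrite -gr_wedge -e1 linearZ /= hg.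
rewrite exprSr -scalerA e2 -wedgeZr hg' wedgeZr; congr (_ *: wedge _ _).
by apply: wed_eq => k; rewrite -vS.
Qed.
End Peel.

Lemma extZ_eq0 (D : idomainType) s r (z : ext D s) : r *: z = 0 -> r = 0 \/ z = 0.
Proof.
elim: s z => [|s IH] z.
  by move/eqP; rewrite -[_ *: _]/(_ * _) mulf_eq0 => /orP[]/eqP; [left|right].
move=> e; have e1 : r *: z.1 = 0 := congr1 fst e; have e2 : r *: z.2 = 0 := congr1 snd e.
case: (IH _ e1) => [|h1]; first by left.
case: (IH _ e2) => [|h2]; first by left.
by right; rewrite -(ext_eta z) h1 h2.
Qed.

Section Unpeel.
Variables (C : comNzRingType) (m t : nat) (f0 : C) (row hh : nat -> nat -> C).
Hypothesis hrow : forall k l, (k < t)%N -> (l < t)%N ->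
  dot m (hh k) (row l) = if l == k then f0 else 0.

Lemma contr_wed s u (v : 'I_s -> nat -> C) : (forall k, dot m u (v k) = 0) ->
  contr u (wed m v) = 0.
Proof.
elim: s v => [|s IH] v hv /=; first exact: contr_one.
by rewrite contr_wedge hv scale0r sub0r IH ?raddf0 ?oppr0 // => k; apply: hv.
Qed.

(** Successive contraction by the dual covectors turns the product of s rows back into f0^s. *)
Lemma unpeel s r : (s <= t)%N -> r *: wed m (fun k : 'I_s => row (t - s + k)%N) = 0 ->
  r * f0 ^+ s = 0.
Proof.
elim: s r => [|s IH] r st; first by rewrite expr0 mulr1 => /scale_one_eq0.
move=> /(congr1 (contr (hh (t - s.+1)))); rewrite raddf0 /= contrZr contr_wedge.
rewrite contr_wed => [|k]; last first.
  by rewrite hrow /= /bump; [rewrite ifN //|..]; have := ltn_ord k; lia.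
rewrite raddf0 subr0 addn0 hrow ?eqxx; [|lia|lia].
have -> : wed m (fun k : 'I_s => row (t - s.+1 + lift ord0 k)%N) =
    wed m (fun k : 'I_s => row (t - s + k)%N).
  by apply: wed_eq => k; congr row; rewrite /= /bump; lia.
move=> e; have {}e : (f0 * r) *: wed m (fun k : 'I_s => row (t - s + k)%N) = 0.
  by rewrite mulrC -scalerA.
by have := IH _ (ltnW st) e; rewrite exprS mulrA [r * f0]mulrC.
Qed.
End Unpeel.

Section Degrees.
Variables (K : fieldType) (n : nat).
Local Notation R := {mpoly K[n.+1]}.

Fixpoint degw (w : nat -> int) s (d : int) : ext R s -> Prop :=
  match s with
  | 0 => fun z => poly_deg d (z : R)
  | s'.+1 => fun z : ext R s' * ext R s' => degw w d z.1 /\ degw w (d - w s') z.2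
  end.

Lemma degwB w s d (y z : ext R s) : degw w d y -> degw w d z -> degw w d (y - z).
Proof.
elim: s d y z => [|s IH] d y z /=; first exact: poly_degB.
by move=> [h1 h2] [h3 h4]; split; apply: IH.
Qed.

Lemma degw0 w s d : degw w d (0 : ext R s).
Proof. by elim: s d => [|s IH] d /=; [exact: poly_deg0|split; apply: IH]. Qed.

Lemma degwZ w s d e r (z : ext R s) : poly_deg e r -> degw w d z -> degw w (e + d) (r *: z).
Proof.
move=> hr; elim: s d z => [|s IH] d z /=; first exact: poly_degM.
by move=> [h1 h2]; split; [exact: IH|rewrite -addrA; exact: IH].
Qed.

Lemma degw_wedge w s v e d (z : ext R s) : (forall i, poly_deg (e - w i) (v i)) ->
  degw w d z -> degw w (d + e) (wedge v z).
Proof.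
move=> hv; elim: s d z => [|s IH] d z /=; first by move=> _; apply: poly_deg0.
move=> [h1 h2]; split; first exact: IH.
apply: degwB; first by rewrite -addrA addrC; apply: degwZ.
by rewrite addrAC; apply: IH.
Qed.

Lemma degw_one w s : degw w 0 (one R s).
Proof.
elim: s => [|s IH] /=; last by split=> //; apply: degw0.
exact: (@ga_deg1 _ (poly_gralg K n.+1)).
Qed.

Lemma degw_gr w s d p (z : ext R s) : degw w d z -> degw w d (gr p z).
Proof.
elim: s p d z => [|s IH] p d z /=; first by case: p => // p _; apply: poly_deg0.
by move=> [h1 h2]; split; [exact: IH|case: p => [|p]; [exact: degw0|exact: IH]].
Qed.

Lemma degw_top w s d (z : ext R s) : degw w d z -> poly_deg (d - \sum_(i < s) w i) (top z).
Proof.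
elim: s d z => [|s IH] d z /=; first by rewrite big_ord0 subr0.
by move=> [_ /IH]; rewrite big_ord_recr /= opprD addrAC addrA.
Qed.

Lemma degw_scale w s d l (y z : ext R s) : degw w d y -> degw w d z -> z = l *: y ->
  z = pcmp 0 l *: y.
Proof.
elim: s d y z => [|s IH] d y z /=.
  move=> hy hz e; rewrite -[LHS](pcmp_id hz) e -[_ *: _]/(_ * _) mulrC (pcmpM _ _ hy).
  by rewrite subrr mulrC.
move=> [h1 h2] [h3 h4] e; rewrite -[LHS](ext_eta z).
by congr (_, _); [apply: IH h1 h3 _; rewrite e|apply: IH h2 h4 _; rewrite e].
Qed.

Lemma poly_deg_const (r : R) : poly_deg 0 r -> exists k, r = k%:MP_[n.+1] :> R.
Proof.
move=> /= /dhomogP h; exists r@_0; apply/mpolyP => mm; rewrite mcoeffC.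
case: (eqVneq mm 0%MM) => [->|ne]; first by rewrite mulr1.
rewrite mulr0; apply/eqP; rewrite mcoeff_eq0; apply: contra ne => /h /eqP.
by rewrite mdeg_eq0.
Qed.

Lemma poly_deg_exp d (r : R) j : poly_deg d r -> poly_deg (d *+ j) (r ^+ j).
Proof.
move=> h; elim: j => [|j IH]; first exact: (@ga_deg1 _ (poly_gralg K n.+1)).
by rewrite exprS mulrS; apply: poly_degM.
Qed.

Lemma poly_degD d (r s : R) : poly_deg d r -> poly_deg d s -> poly_deg d (r + s).
Proof. exact: (@gm_degD _ (poly_gralg K n.+1) (gself (poly_gralg K n.+1))). Qed.

Lemma poly_deg_sum d (J : Type) (l : seq J) (F : J -> R) :
  (forall j, poly_deg d (F j)) -> poly_deg d (\sum_(j <- l) F j).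
Proof.
by move=> h; elim/big_rec: _ => [|j r _ hr]; [exact: poly_deg0|exact: poly_degD].
Qed.

Lemma poly_deg_prod (J : Type) (l : seq J) (F : J -> R) (e : J -> int) :
  (forall j, poly_deg (e j) (F j)) -> poly_deg (\sum_(j <- l) e j) (\prod_(j <- l) F j).
Proof.
move=> h; elim/big_rec2: _ => [|j d r _ hr]; last exact: poly_degM.
exact: (@ga_deg1 _ (poly_gralg K n.+1)).
Qed.
End Degrees.

(** * Degree 0 endomorphisms of the conormal module *)

Section Rigid.
Variables (K : fieldType) (n t c m : nat) (a : 'I_m -> int) (b : 'I_t -> int).
Local Notation R := {mpoly K[n.+1]}.
Local Notation L := n.+1.
Local Notation xx := (xx K n).
Variable A : 'M[R]_(t, m).
Hypotheses (hA : homogeneous_mx a b A) (G : generic c A).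
Hypotheses (c_gt1 : (1 < c)%N) (t_gt0 : (0 < t)%N) (mE : m = (t + c.-1)%N) (n_ge : (2 * c <= n)%N).
Hypothesis pos_deg : forall i j, 0 < a j - b i.
Hypothesis max_n2_lt : forall n1 n2 : int,
  EN_twist a b 1 n1 -> EN_twist a b 2 n2 -> n2 < 2 * n1.

Notation I := (det_ideal A).
Notation X k := (XS L xx R^o k).
Notation row := (fun k j => Ph A j k).

Lemma IL_le q q' r : (q <= q')%N -> IL (Ph A) t q r -> IL (Ph A) t q' r.
Proof.
by move=> /subnK <-; elim: (q' - q)%N => [|j IH] h //; rewrite addSn; apply/IL_S/IH.
Qed.

Lemma sgI_m p : (p < c)%N -> I (sg G p).
Proof. by move=> pc; apply/IL_minors/(@IL_le (t + p)); [lia|apply: (sgI G)]. Qed.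

Lemma sg_neq0 p : (p < c)%N -> sg G p != 0.
Proof.
move=> pc; apply/eqP => e; have := sgX G pc; rewrite e sub0r => /submodN; rewrite opprK.
have pL : (p < L)%N by lia.
elim: (sgN G p) => [|N IH]; first by rewrite expr0; apply: xx_top.
by rewrite exprS => /xx_prime [/(xx_notin pL)|/IH].
Qed.

Lemma row_kill f0 : I f0 -> exists hh : nat -> nat -> R,
  forall k l, (k < t)%N -> (l < t)%N -> dot m (hh k) (row l) = if l == k then f0 else 0.
Proof.
move=> hf.
have /choice [h hh] : forall k : 'I_t, exists y : 'cV[R]_m, f0 *: delta_mx k 0 = A *m y.
  by move=> k; exact: (mx_image_minor _ hf).
exists (fun k j => if insub k is Some k' then (if insub j is Some j' then h k' j' 0 else 0) else 0).
move=> k l kt lt; rewrite insubT.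
have := congr1 (fun M : 'cV[R]_t => M (Ordinal lt) 0) (hh (Ordinal kt)).
rewrite !mxE eqxx andbT -val_eqE /= => e.
transitivity (f0 * (l == k)%:R); last by case: ifP => _; rewrite ?mulr1 ?mulr0.
rewrite e; apply: eq_bigr => j _; rewrite valK mulrC.
by rewrite -[l]/(val (Ordinal lt)) PhE.
Qed.

Definition ww : ext R m := wed m (fun k : 'I_t => row k).

(** For p and q the first two of the forms [sg], [peel] writes p^t z and q^t z as multiples of the
    product of the rows. Since p^t, q^t form a regular sequence of R, which is where c >= 2 enters,
    [glue] with the zero submodule removes the denominators. *)
Lemma killed_by_rows (z : ext R m) : gr t z = z ->
  (forall k, (k < t)%N -> wedge (row k) z = 0) -> exists l, z = l *: ww.
Proof.
move=> hg hz.
have P f0 : I f0 -> exists g, f0 ^+ t *: z = g *: ww.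
  move=> /row_kill [hh hrow].
  have [k kt|g ->] := peel hrow (leqnn t) hg; first by rewrite subnn; exact: hz.
  exists g; congr (_ *: _); apply: wed_eq => k; by rewrite subnn.
have c0 : (0 < c)%N by lia.
have [gp ep] := P _ (sgI_m c0); have [gq eq] := P _ (sgI_m c_gt1).
set p := sg G 0 in ep; set q := sg G 1 in eq.
have ww0 r : r *: ww = 0 -> r = 0.
  move=> e; have [hh hrow] := row_kill (sgI_m c0).
  have e' : r *: wed m (fun k : 'I_t => row (t - t + k)%N) = 0.
    by rewrite -[RHS]e; congr (_ *: _); apply: wed_eq => k; rewrite subnn.
  have /eqP := unpeel hrow (leqnn t) e'.
  by rewrite mulf_eq0 expf_eq0 (negbTE (sg_neq0 c0)) andbF orbF => /eqP.
have e1 : p ^+ t * gq = q ^+ t * gp.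
  apply/eqP; rewrite -subr_eq0; apply/eqP/ww0.
  by rewrite scalerBl -!scalerA -ep -eq !scalerA mulrC subrr.
pose W := XS L xx R^o L.
have W0 r : W r <-> r = 0 by apply: XSL.
have regW i : (0 <= i < L)%N -> Reg L xx W i.
  move=> /andP[_ iL] r [y [/W0 -> ]]; rewrite subr0 => /xx_prime [/(xx_notin iL) //|h].
  exact: lvX.
have pw k r s N : X k (r - s ^+ N) -> X k (r ^+ t - s ^+ (N * t)).
  by rewrite exprM [r ^+ t - _]subrXX => h; apply: idealMr.
have [|||||||||h0 hh0] := @glue R L xx R^o (gR K n) W 0 bool
  (fun i => if i then p ^+ t else q ^+ t) (fun i => if i then gp else gq)
  (q ^+ t) (p ^+ t) (fun i => (~~ i)%:R) (fun i => i%:R)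
  (sgN G 1 * t) (sgN G 0 * t) (sgd G 1 *+ t).
- by move=> d h /W0 ->; rewrite cmp0; apply/W0.
- by lia.
- exact: regW.
- move=> i j; apply/W0; case: i j => [] []; rewrite -![_ *: _]/(_ * _) ?e1 ?subrr //.
- by rewrite big_bool /= mul0r mul1r add0r.
- by rewrite big_bool /= mul0r mul1r addr0.
- by move=> d h; apply: (pcmpM d (h : R)); apply/poly_deg_exp/(sghom G).
- by apply: pw; apply: (sgX G).
- by apply: pw; apply: (sgX G).
have /W0/eqP := hh0 true; rewrite subr_eq0 => /eqP egp.
exists h0; apply/eqP; rewrite -subr_eq0; apply/eqP.
have : p ^+ t *: (z - h0 *: ww) = 0.
  by rewrite scalerBr ep egp scalerA subrr.
case/extZ_eq0 => // /eqP; rewrite expf_eq0 (negbTE (sg_neq0 c0)) andbF //.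
Qed.
End Rigid.

Section IdMap.
Variables (K : pzRingType) (S : gralg K) (M : grmod S).
Fact id_linear : linear (fun x : M => x). Proof. by []. Qed.
Definition id_hom : hom M M :=
  SubmodElt (introT (asboolP _) id_linear :
    ((fun x : M => x) : depfun (fun _ : M => M)) \in subpred (hom_submod M M)).
Fact id_hom_deg : ghom_deg (M := M) (N := M) 0 id_hom.
Proof. by move=> e x hx; rewrite add0r. Qed.
Definition id_hom0 : hom0 M M :=
  SubmodElt (introT (asboolP _) id_hom_deg :
    (id_hom : restr (hom M M) (ga_scal S)) \in subpred (hom0_submod M M)).

Lemma hom_linear (N : grmod S) (f : hom M N) : linear (hom_fun f).
Proof. exact: (sm_valW f). Qed.
Lemma hom_funD (N : grmod S) (f : hom M N) x y : hom_fun f (x + y) = hom_fun f x + hom_fun f y.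
Proof. by have := hom_linear f 1 x y; rewrite !scale1r. Qed.
Lemma hom_fun0 (N : grmod S) (f : hom M N) : hom_fun f 0 = 0.
Proof. by apply: (addrI (hom_fun f 0)); rewrite -hom_funD !addr0. Qed.
Lemma hom_funZ (N : grmod S) (f : hom M N) a x : hom_fun f (a *: x) = a *: hom_fun f x.
Proof. by have := hom_linear f a x 0; rewrite hom_fun0 !addr0. Qed.
End IdMap.

Lemma allext_mono (C : comNzRingType) s (P Q : C -> Prop) (z : ext C s) :
  (forall r, P r -> Q r) -> allext P z -> allext Q z.
Proof. by move=> h; elim: s z => [|s IH] z /=; [exact: h|case=> /IH h1 /IH h2]. Qed.

Section Rigid2.
Variables (K : fieldType) (n t c m : nat) (a : 'I_m -> int) (b : 'I_t -> int).
Local Notation R := {mpoly K[n.+1]}.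
Local Notation S := (poly_gralg K n.+1).
Local Notation L := n.+1.
Local Notation xx := (xx K n).
Variable A : 'M[R]_(t, m).
Hypotheses (hA : homogeneous_mx a b A) (G : generic c A).
Hypotheses (c_gt1 : (1 < c)%N) (t_gt0 : (0 < t)%N) (mE : m = (t + c.-1)%N) (n_ge : (2 * c <= n)%N).
Hypothesis pos_deg : forall i j, 0 < a j - b i.
Hypothesis max_n2_lt : forall n1 n2 : int,
  EN_twist a b 1 n1 -> EN_twist a b 2 n2 -> n2 < 2 * n1.

Notation I := (det_ideal A).
Notation row := (fun k j => Ph A j k).

Lemma det_deg (g : 'I_t -> 'I_m) :
  poly_deg (\sum_k a (g k) - \sum_i b i) (\det (colsub g A)).
Proof.
rewrite /determinant; apply: poly_deg_sum => s.
have sg d (r : R) : poly_deg d r -> poly_deg d ((-1) ^+ s * r).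
  move=> h; case: (odd_perm s); rewrite ?expr0 ?expr1 ?mul1r // mulN1r -sub0r.
  by apply: poly_degB => //; apply: poly_deg0.
apply: sg.
have -> : \sum_k a (g k) - \sum_i b i = \sum_i (a (g (s i)) - b i).
  by rewrite sumrB (reindex_inj (@perm_inj _ s)).
by apply: poly_deg_prod => i; rewrite mxE; apply: hA.
Qed.

Lemma EN1 (g : 'I_t -> 'I_m) : injective g -> EN_twist a b 1 (\sum_k a (g k) - \sum_i b i).
Proof.
move=> gi; exists [set g k | k : 'I_t], 0%MM; split.
- by rewrite card_imset // card_ord addnK.
- by rewrite mdeg0.
- rewrite [in RHS]big_imset /=; last by move=> x y _ _; apply: gi.
  by rewrite [X in _ = _ - X]big1 ?subr0 // => i _; rewrite mnm0E mulr0n.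
Qed.

Lemma colsub_inj (g : 'I_t -> 'I_m) : \det (colsub g A) != 0 -> injective g.
Proof.
move=> h i j e; apply/eqP; apply: contraNT h => ne.
by rewrite -det_tr (determinant_alternate ne) // => k; rewrite !mxE e.
Qed.

Lemma I_ind (Q : ideal R) : (forall g : 'I_t -> 'I_m, Q (\det (colsub g A))) ->
  forall r, I r -> Q r.
Proof.
move=> h r; apply=> _ [f [g ->]].
have -> : mxsub f g A = rowsub f 1%:M *m colsub g A.
  by rewrite mul_rowsub_mx mul1mx; apply/matrixP => i j; rewrite !mxE.
by rewrite det_mulmx; apply: (@idealMl _ Q).
Qed.

(** Vanishing of a component is not stable under multiplication; quantifying over all multiples
    makes it an ideal condition, which can be tested on generators. *)
Definition annih (e : int) (y : R) : ideal R.
Proof.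
exists (fun x : R^o => forall r : R, pcmp e (r * ((x : R) * y)) = 0).
- by move=> r; rewrite mul0r mulr0; apply: pcmp0.
- by move=> x x' h h' r; rewrite mulrDl mulrDr pcmpD h h' addr0.
- move=> u x h r; have -> : r * ((u * (x : R)) * y) = (r * u) * ((x : R) * y) by ring.
  exact: h.
Defined.

(** I^2 is generated by products of two maximal minors, and the degree of a nonzero maximal minor is
    a first Eagon-Northcott twist. *)
Lemma I2_vanish e y : (forall n1, EN_twist a b 1 n1 -> e < 2 * n1) ->
  I2 I y -> poly_deg e y -> y = 0.
Proof.
move=> he hy hd; rewrite -(pcmp_id hd).
suff : annih e 1 y by move=> /(_ 1); rewrite mul1r mulr1.
apply: (hy (annih e 1 : ideal S)) => _ [u [v [hu hv ->]]] r.
rewrite mulr1; suff : annih e v u by apply.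
apply: (@I_ind (annih e v)) hu => g; suff h : annih e (\det (colsub g A)) v.
  by move=> r'; rewrite [X in r' * X]mulrC; apply: h.
apply: (@I_ind (annih e _)) hv => g' {}r.
case: (eqVneq (\det (colsub g A)) 0) => [->|/colsub_inj gi]; first by rewrite !mulr0 pcmp0.
case: (eqVneq (\det (colsub g' A)) 0) => [->|/colsub_inj gi']; first by rewrite mul0r mulr0 pcmp0.
have h1 := he _ (EN1 gi); have h2 := he _ (EN1 gi').
rewrite mulrC (pcmpM _ _ (poly_degM (det_deg g') (det_deg g))).
set d := e - _; have : d < 0 by rewrite /d; lia.
by case: d => // d _ /=; rewrite mulr0.
Qed.

(** Descent through the pairs: T collects the indices of the basis vectors split off so far, and p
    is the degree still to be found. At the bottom only a coordinate indexed by a set T of size q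
    remains, of degree D + Σ_T a_j. *)
Lemma component_vanish q D s (T : {set 'I_m}) p (z : ext R s) : (s <= m)%N ->
  (forall (T : {set 'I_m}) y, #|T| = q -> poly_deg (D + \sum_(j in T) a j) y -> I2 I y -> y = 0) ->
  (forall j, j \in T -> (s <= j)%N) -> (p + #|T|)%N = q -> gr p z = z ->
  degw (fun j => - na a j) (D + \sum_(j in T) a j) z -> allext (I2 I) z -> z = 0.
Proof.
move=> sm hq; elim: s p T sm z => [|s IH] p T sm z hT hp hg /= hd hz.
  case: p hp hg => [hp _|p _ <- //]; exact: (hq T).
case: hd hz => [d1 d2] [z1 z2].
have g1 : gr p z.1 = z.1 by rewrite -[in RHS]hg.
have -> : z = (z.1, z.2) :> ext R s.+1 by rewrite ext_eta.
congr (_, _).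
  by apply: (IH p T) => // [|j /hT]; exact: ltnW.
case: p hp hg {g1} => [_ <- //|p] hp hg.
have g2 : gr p z.2 = z.2 by rewrite -[in RHS]hg.
have sT : Ordinal sm \notin T by apply/negP => /hT; rewrite ltnn.
apply: (IH p (Ordinal sm |: T)) => //.
- exact: ltnW.
- by move=> j; rewrite !inE => /orP[/eqP -> //|/hT]; exact: ltnW.
- by rewrite cardsU1 sT -hp; lia.
- move: d2; rewrite big_setU1 //= -[s]/(val (Ordinal sm)) naE opprK.
  by congr (degw _ _ _); ring.
Qed.

Lemma I2_vanish_twist2 e y : EN_twist a b 2 e -> I2 I y -> poly_deg e y -> y = 0.
Proof. by move=> he; apply: I2_vanish => n1 h1; apply: max_n2_lt. Qed.

(** Adding a column j outside T and a basis vector i of G turns this degree into a second twist,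
    larger by a_j - b_i > 0 and still below twice every first twist. *)
Lemma I2_vanish_twist1 (T : {set 'I_m}) y : #|T| = t ->
  I2 I y -> poly_deg (- \sum_i b i + \sum_(j in T) a j) y -> y = 0.
Proof.
move=> hT; apply: I2_vanish => n1 h1.
have [j jT] : exists j, j \notin T.
  apply/existsP; rewrite -negb_forall; apply/negP => /forallP h.
  have : #|T| = m by rewrite -[RHS]card_ord; apply: eq_card => j; rewrite inE (h j).
  lia.
pose i := Ordinal t_gt0.
have /(max_n2_lt h1) : EN_twist a b 2 (\sum_(k in j |: T) a k - \sum_k b k - b i).
  exists (j |: T), U_(i)%MM; split.
  - by rewrite cardsU1 jT hT addn2 subn1.
  - by rewrite mdeg1.
  - congr (_ - _); rewrite [RHS](bigD1 i) // mnm1E eqxx mulr1n big1 /= ?addr0 // => k ki.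
    by rewrite mnm1E eq_sym (negbTE ki) mulr0n.
rewrite big_setU1 //=; have := pos_deg i j; move: (\sum_(j in T) a j) (\sum_k b k) => s1 s2; lia.
Qed.

Variable chi : hom (conormal I) (conormal I).
Hypothesis chi_deg : ghom_deg (M := conormal I) (N := conormal I) 0 chi.

(** A relation rather than a function, because y is determined only modulo I^2; [relext] applies it
    to all coordinates of an exterior element at once. *)
Definition rel (x y : R) := [/\ I x, I y & hom_fun chi (cnt I x) = cnt I y].

Lemma rel0 : rel 0 0.
Proof. by split; [exact: submod0|exact: submod0|rewrite cnt0 hom_fun0]. Qed.

Lemma relZB u x y x' y' : rel x y -> rel x' y' -> rel (u * x - x') (u * y - y').
Proof.
move=> [h1 h2 h3] [h4 h5 h6].
have k1 : I (u * x) by apply: idealMl.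
have k2 : I (u * y) by apply: idealMl.
split; [exact: submodB|exact: submodB|].
rewrite !cntB // !cntZ // hom_funD hom_funZ h3; congr (_ + _).
rewrite -!scaleN1r hom_funZ h6 //.
Qed.

Fixpoint relext s : ext R s -> ext R s -> Prop :=
  match s with
  | 0 => rel
  | s'.+1 => fun y z : ext R s' * ext R s' => relext y.1 z.1 /\ relext y.2 z.2
  end.

Lemma relext0 s : relext (0 : ext R s) 0.
Proof. by elim: s => [|s IH] //=; exact: rel0. Qed.

Lemma relextZB s u (y z y' z' : ext R s) : relext y z -> relext y' z' ->
  relext (u *: y - y') (u *: z - z').
Proof.
elim: s y z y' z' => [|s IH] y z y' z' /=; first exact: relZB.
by move=> [h1 h2] [h3 h4]; split; apply: IH.
Qed.

Lemma relext_wedge s v (y z : ext R s) : relext y z -> relext (wedge v y) (wedge v z).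
Proof.
elim: s y z => [|s IH] y z /=; first by move=> _; exact: rel0.
by move=> [h1 h2]; split; [exact: IH|apply: relextZB => //; exact: IH].
Qed.

Lemma relext_gr s p (y z : ext R s) : relext y z -> relext (gr p y) (gr p z).
Proof.
elim: s p y z => [|s IH] p y z /=; first by case: p => // p _; exact: rel0.
by move=> [h1 h2]; split; [exact: IH|case: p => [|p]; [exact: relext0|exact: IH]].
Qed.

Lemma relext_I2 s (z : ext R s) : relext 0 z -> allext (I2 I) z.
Proof.
elim: s z => [|s IH] z /=; last by move=> [/IH h1 /IH h2].
by move=> [_ h]; rewrite cnt0 hom_fun0 => /esym /(cnt_eq0 h).
Qed.

Lemma relext_lift w s d (y : ext R s) : degw w d y -> allext I y ->
  exists z, degw w d z /\ relext y z.
Proof.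
elim: s d y => [|s IH] d y; last first.
  move=> [d1 d2] [i1 i2]; have [z1 [? ?]] := IH _ _ d1 i1; have [z2 [? ?]] := IH _ _ d2 i2.
  by exists (z1, z2).
move=> hd hI; have := chi_deg (cnt_deg (hI : I y) hd); rewrite add0r.
by move=> /cnt_deg_surj [z [h1 h2 h3]]; exists z.
Qed.

Lemma relext_scale s u (Q : R -> Prop) (y : ext R s) :
  (forall r, rel r (u * r) -> Q r) -> relext y (u *: y) -> allext Q y.
Proof. by move=> hQ; elim: s y => [|s IH] y /=; [exact: hQ|case=> /IH h1 /IH h2]. Qed.

(** The vector of maximal minors of phi, in degree t of the exterior algebra of R^m. *)
Definition ff : ext R m := Fs (Ph A) m (@top _ t : {linear _ -> R^o}).
Let w' := fun j => - na a j.
Let D := - \sum_i b i.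

Lemma Ph_deg i j : poly_deg (na a j - nb b i) (Ph A j i).
Proof.
rewrite /Ph /na /nb; case: insubP => [j' _ _|_]; last exact: poly_deg0.
case: insubP => [i' _ _|_]; [exact: hA|exact: poly_deg0].
Qed.

Lemma degw_Fs s e (T : {linear ext R t -> R^o}) :
  (forall d z, degw (nb b) d z -> poly_deg (d - e) (T z)) ->
  degw w' (- e) (Fs (Ph A) s T).
Proof.
elim: s e T => [|s IH] e T hT /=.
  by have := hT 0 _ (degw_one K n (nb b) t); rewrite sub0r.
split; first exact: IH.
have -> : - e - w' s = - (e - na a s) by rewrite /w'; ring.
apply: IH => d z hz /=; have -> : d - (e - na a s) = d + na a s - e by ring.
apply/hT/degw_wedge => // i; exact: (@Ph_deg i s).
Qed.

Lemma ff_deg : degw w' D ff.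
Proof.
apply: degw_Fs => d z hz; have := degw_top hz.
by congr (poly_deg (d - _) _); apply: eq_bigr => i _; rewrite nbE.
Qed.

Lemma ff_gr : gr t ff = ff.
Proof. by apply: Fs_gr => z; apply: top_gr. Qed.

Lemma ff_row k : (k < t)%N -> wedge (row k) ff = 0.
Proof. by move=> kt; rewrite Fs_row // Fs0 // => z; exact: top_contr. Qed.

Lemma ff_I : allext I ff.
Proof.
apply: (@Fs_allext _ _ _ _ (I : ideal R) m _ (leqnn m)) => z hz.
by apply/IL_minors/top_ImL.
Qed.

Lemma ff_gen (Q : ideal R) : allext Q ff -> forall r, I r -> Q r.
Proof.
by move=> h r /IL_minors [w ->]; exact: (@Fs_gen _ _ _ _ Q (@top _ t : {linear _ -> R^o}) w h).
Qed.

Lemma row_deg k i : poly_deg (- nb b k - w' i) (Ph A i k).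
Proof. by have := Ph_deg k i; rewrite /w' opprK addrC. Qed.

(** The equations row ∧ [ff] = 0 are the syzygies of the minors in the second step of the
    Eagon-Northcott complex. A lift of chi([ff]) satisfies them only modulo I^2, but I^2 is zero in
    the degrees concerned. Comparison of degrees makes the remaining factors constants. *)
Lemma rigid_scalar : exists k : K, forall r, I r -> hom_fun chi (cnt I r) = cnt I (k%:MP * r).
Proof.
have [g [gd gr_]] := relext_lift ff_deg ff_I.
pose g' := gr t g.
have g'd : degw w' D g' by apply: degw_gr.
have g'r : relext ff g' by rewrite -ff_gr; apply: relext_gr.
have g'0 k : (k < t)%N -> wedge (row k) g' = 0.
  (* With the k-th basis vector of G as monomial, e + Σ_T a_j is a second Eagon-Northcott twist for
     every T of size t + 1. *)
  move=> kt; pose e := D - nb b k.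
  apply: (@component_vanish t.+1 e m set0 t.+1) => //.
  - move=> T y hT hI hd; apply: (I2_vanish_twist2 _ hd hI).
    exists T, U_(Ordinal kt)%MM; split; rewrite ?mdeg1 ?hT; first by lia.
      by [].
    rewrite /e /D [X in _ = _ - X](bigD1 (Ordinal kt)) // mnm1E eqxx mulr1n /=.
    rewrite [X in b _ + X]big1 ?addr0; last first.
      by move=> i ik; rewrite mnm1E eq_sym (negbTE ik) mulr0n.
    by rewrite -[k]/(val (Ordinal kt)) nbE; ring.
  - by move=> j; rewrite inE.
  - by rewrite cards0 addn0.
  - by rewrite gr_wedge /g' gr_gr.
  - rewrite big_set0 addr0 /e; apply: degw_wedge => // i; exact: row_deg.
  - by apply: relext_I2; rewrite -(ff_row kt); apply: relext_wedge.
have [l' el'] := killed_by_rows G c_gt1 t_gt0 mE n_ge (gr_gr _ _) g'0.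
have [l el] := killed_by_rows G c_gt1 t_gt0 mE n_ge ff_gr ff_row.
have wd : degw w' D (ww A).
  have h s (v : 'I_s -> 'I_t) : degw w' (- \sum_k b (v k)) (wed m (fun k => row (v k))).
    elim: s v => [|s IH] v; first by rewrite big_ord0 oppr0; apply: degw_one.
    rewrite big_ord_recl opprD addrC -nbE; apply: degw_wedge => [i|]; first exact: row_deg.
    exact: IH.
  exact: (h t id).
have [k ek] := poly_deg_const (pcmp_deg 0 l).
have [k' ek'] := poly_deg_const (pcmp_deg 0 l').
have {}el := degw_scale wd ff_deg el; have {}el' := degw_scale wd g'd el'.
rewrite ek in el; rewrite ek' in el'.
have k0 : k != 0.
  apply/eqP => k0; have : sg G 0 = 0.
    apply/(@XSL R L xx R^o); apply: (@ff_gen (XS L xx R^o L)); last by apply: sgI_m => //; lia.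
    by rewrite el k0 mpolyC0 scale0r; apply: (submod0 (allext_submod m (XS L xx R^o L))).
  by apply/eqP; apply: sg_neq0; lia.
exists (k' / k) => r Ir.
have eg : g' = (k' / k)%:MP *: ff.
  by rewrite el el' scalerA -mpolyCM divfK.
pose P (r : S) := I r /\ hom_fun chi (cnt I r) = cnt I ((k' / k)%:MP * r).
have [P0 PD PZ] : [/\ P 0, forall x y, P x -> P y -> P (x + y) & forall (u : S) (x : S), P x -> P (u * x)].
  split.
  - by split; [exact: submod0|rewrite mulr0 cnt0 hom_fun0].
  - move=> x y [Ix hx] [Iy hy]; split; first exact: submodD.
    have k1 : I ((k' / k)%:MP * x) := @idealMl R I _ _ Ix.
    have k2 : I ((k' / k)%:MP * y) := @idealMl R I _ _ Iy.
    by rewrite mulrDr (cntD k1 k2) (cntD Ix Iy) hom_funD hx hy.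
  - move=> u x [Ix hx]; split; first exact: idealMl.
    have k1 : I ((k' / k)%:MP * x) := @idealMl R I _ _ Ix.
    by rewrite mulrCA (cntZ u Ix) hom_funZ hx (cntZ u k1).
have [//] : P r.
apply: (@ff_gen (Submod (V := R^o) P0 PD PZ)) Ir => {P0 PD PZ} /=.
have : relext ff ((k' / k)%:MP *: ff) by rewrite -eg.
by apply: relext_scale => s [].
Qed.

End Rigid2.

Section HomLine.
Variables (K : fieldType) (n t c m : nat) (a : 'I_m -> int) (b : 'I_t -> int).
Local Notation R := {mpoly K[n.+1]}.
Variable A : 'M[R]_(t, m).
Hypotheses (hA : homogeneous_mx a b A) (G : generic c A).
Hypotheses (c_gt1 : (1 < c)%N) (t_gt0 : (0 < t)%N) (mE : m = (t + c.-1)%N) (n_ge : (2 * c <= n)%N).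
Hypothesis pos_deg : forall i j, 0 < a j - b i.
Hypothesis max_n2_lt : forall n1 n2 : int,
  EN_twist a b 1 n1 -> EN_twist a b 2 n2 -> n2 < 2 * n1.
Notation I := (det_ideal A).

(** Otherwise all maximal minors lie in I^2, in degrees where I^2 is zero; then I = 0, against
    [sg G 0] being nonzero. *)
Lemma sg0_not_I2 : exists r, I r /\ ~ I2 I r.
Proof.
apply: contrapT => h; have hI r : I r -> I2 I r.
  by move=> Ir; apply: contrapT => h'; apply: h; exists r.
have : sg G 0 = 0; last by apply/eqP; apply: sg_neq0; lia.
have fz : ff A = 0.
  apply: (component_vanish (a := a) (A := A) c_gt1 t_gt0 mE n_ge (q := t) (D := - \sum_i b i) (T := set0) (p := t)) => //.
  - by move=> T y hT hd hI2; apply: (I2_vanish_twist1 hA c_gt1 t_gt0 mE n_ge pos_deg max_n2_lt hT).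
  - by move=> j; rewrite inE.
  - by rewrite cards0 addn0.
  - exact: ff_gr.
  - by rewrite big_set0 addr0; apply: ff_deg.
  - exact: allext_mono hI (ff_I A).
apply/(@XSL R n.+1 (xx K n) R^o); apply: (@ff_gen _ _ _ _ A (XS n.+1 (xx K n) R^o n.+1)); last by apply: sgI_m => //; lia.
by rewrite fz; apply: (submod0 (allext_submod m (XS n.+1 (xx K n) R^o n.+1))).
Qed.

Lemma hom0_line : line (id_hom0 (conormal I)).
Proof.
split.
  apply/eqP => e; have [r [Ir nr]] := sg0_not_I2; apply: nr; apply/(cnt_eq0 Ir).
  exact: (congr1 (fun f : hom0 (conormal I) (conormal I) => hom_fun (sm_val f) (cnt I r)) e).
move=> chi; have chi_deg := sm_valW chi.
have [k hk] := rigid_scalar hA G c_gt1 t_gt0 mE n_ge max_n2_lt chi_deg.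
exists k; apply: val_inj; apply: val_inj; apply: functional_extensionality_dep => x.
have [r [Ir ->]] := cnt_surj x.
have := hk r Ir; rewrite cntZ // => e; exact: e.
Qed.
End HomLine.

Lemma gr1_wedge (C : comNzRingType) q (w : ext C q) : exists d, gr 1 w = wedge d (one C q).
Proof.
elim: q w => [|q IH] w /=; first by exists (fun=> 0).
have [d e1] := IH w.1; have [c' e2] := gr0_one (gr_gr 0 w.2).
exists (fun i => if i == q then c' else d i); congr (_, _); rewrite /=.
  by rewrite e1; apply: wedge_eq => i iq; rewrite ltn_eqF.
by rewrite eqxx raddf0 subr0.
Qed.

Lemma contr_wedge_one (C : comNzRingType) s u v :
  contr u (wedge v (one C s)) = dot s u v *: one C s.
Proof. by rewrite contr_wedge contr_one raddf0 subr0. Qed.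

(** * The matrices h_f and the local structure of the conormal module *)

Section Rho.
Variables (K : fieldType) (n t c m : nat) (a : 'I_m -> int) (b : 'I_t -> int).
Local Notation R := {mpoly K[n.+1]}.
Local Notation S := (poly_gralg K n.+1).
Local Notation L := n.+1.
Local Notation xx := (xx K n).
Variable A : 'M[R]_(t, m).
Hypotheses (hA : homogeneous_mx a b A) (G : generic c A).
Hypotheses (c_gt1 : (1 < c)%N) (t_gt0 : (0 < t)%N) (mE : m = (t + c.-1)%N) (n_ge : (2 * c <= n)%N).
Notation I := (det_ideal A).

Lemma brk (p : 'cV[R]_m) : A *m p = 0 -> forall j, I (p j 0).
Proof. by move=> h j; apply/IL_minors; apply: (BRK hA G _ mE n_ge h); lia. Qed.

Lemma brk_mx k (p : 'M[R]_(m, k)) : A *m p = 0 -> forall j i, I (p j i).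
Proof.
move=> h j i; have /brk /(_ j) : A *m col i p = 0 by rewrite colE mulmxA h mul0mx.
by rewrite mxE.
Qed.

Lemma I_Ml r s : I s -> I (r * s). Proof. exact: (@idealMl R I). Qed.
Lemma I_Mr r s : I s -> I (s * r). Proof. exact: (@idealMr R I). Qed.
Lemma I_eq r s : I r -> r = s -> I s. Proof. by move=> h <-. Qed.
Lemma I_sum (J : Type) (l : seq J) (P : pred J) (F : J -> R) :
  (forall j, P j -> I (F j)) -> I (\sum_(j <- l | P j) F j).
Proof. exact: (submod_sum (W := I : submod R^o)). Qed.

Lemma cofactor_ex f : exists H : 'M[R]_(m, t), I f -> A *m H = f%:M.
Proof.
case: (EM (I f)) => [hf|]; last by exists 0.
have /choice [h hh] : forall k : 'I_t, exists y : 'cV[R]_m, f *: delta_mx k 0 = A *m y.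
  by move=> k; exact: (mx_image_minor _ hf).
exists (\matrix_(j, k) h k j 0) => _; apply/matrixP => i k.
have := congr1 (fun M : 'cV[R]_t => M i 0) (hh k); rewrite !mxE eqxx andbT mulr_natr => ->.
by apply: eq_bigr => j _; rewrite mxE.
Qed.

(** A choice of h_f. Only its class modulo I matters, and this is unique because the kernel of phi
    has entries in I. *)
Definition Hm f : 'M[R]_(m, t) := sval (cid (cofactor_ex f)).
Lemma HmP f : I f -> A *m Hm f = f%:M.
Proof. exact: (svalP (cid (cofactor_ex f))). Qed.

Lemma Hm_uniq f (H : 'M[R]_(m, t)) : I f -> A *m H = f%:M -> forall j i, I (Hm f j i - H j i).
Proof.
move=> hf e j i; have := @brk_mx _ (Hm f - H) _ j i; rewrite mulmxBr HmP // e subrr !mxE.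
exact.
Qed.

Lemma Hm_lin r f g j i : I f -> I g -> I (Hm (r * f + g) j i - (r * Hm f j i + Hm g j i)).
Proof.
move=> hf hg; have := @Hm_uniq (r * f + g) (r *: Hm f + Hm g).
move/(_ _ _ j i); rewrite !mxE; apply.
  by apply: submodD => //; apply: I_Ml.
by rewrite mulmxDr -scalemxAr !HmP // scale_scalar_mx raddfD.
Qed.

Lemma Hm_mul f g j i : I f -> I g -> I (Hm (f * g) j i).
Proof.
move=> hf hg; have := @Hm_uniq (f * g) (f *: Hm g) (I_Ml _ hg) _ j i; rewrite !mxE => h.
rewrite -(subrK (f * Hm g j i) (Hm _ _ _)); apply: submodD; last exact: I_Mr.
by apply: h; rewrite -scalemxAr HmP // scale_scalar_mx.
Qed.

(** For a product one may take h_{fg} = f h_g, with entries in I. So h_f modulo I depends only on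
    the class of f in I/I^2. *)
Lemma Hm_I2 f j i : I2 I f -> I (Hm f j i).
Proof.
pose P (f : S) := I f /\ I (Hm f j i).
have Plin r f1 f2 : P f1 -> P f2 -> P (r * f1 + f2).
  move=> [h1 h2] [h3 h4]; split; first by apply: submodD => //; apply: I_Ml.
  rewrite -(subrK (r * Hm f1 j i + Hm f2 j i) (Hm _ _ _)); apply: submodD; first exact: Hm_lin.
  by apply: submodD => //; apply: I_Ml.
have P0 : P 0.
  by split; [apply: submod0|rewrite -(mulr0 0); apply: Hm_mul; apply: submod0].
have PD x y : P x -> P y -> P (x + y) by move=> hx hy; rewrite -[x]mul1r; apply: Plin.
have PZ (u x : S) : P x -> P (u * x) by move=> hx; rewrite -[_ * _]addr0; apply: Plin.
move=> h; have [] : P f => //.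
apply: (h (@Submod S S^o P P0 PD PZ)) => _ [x [y [hx hy ->]]]; split; first exact: I_Ml.
exact: Hm_mul.
Qed.

Lemma I_graded d r : I r -> I (pcmp d r).
Proof. by move=> /IL_minors h; apply/IL_minors; exact: (graded_IL hA (q := m) d h). Qed.

Lemma Hm_deg f d j i : I f -> poly_deg d f -> I (Hm f j i - pcmp (d - (a j - b i)) (Hm f j i)).
Proof.
move=> hf hd; pose H : 'M[R]_(m, t) := \matrix_(j, i) pcmp (d - (a j - b i)) (Hm f j i).
have := @Hm_uniq f H hf _ j i; rewrite mxE; apply.
apply/matrixP => k l; have := congr1 (fun M : 'M[R]_t => pcmp (d - (b k - b l)) (M k l)) (HmP hf).
rewrite !mxE (big_morph _ (pcmpD _) (pcmp0 _ _ _)) => e.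
transitivity (pcmp (d - (b k - b l)) (f *+ (k == l))).
  rewrite -e; apply: eq_bigr => r _; rewrite mxE (pcmpM _ _ (hA k r)); congr (_ * pcmp _ _); ring.
case: eqP => [->|_]; last by rewrite mulr0n pcmp0.
by rewrite subrr subr0 mulr1n pcmp_id.
Qed.

(** phi (h_f phi - f Id) = 0, so the bracket has entries in I. Thus the rows of h_f are covectors on
    the cokernel modulo I. *)
Lemma Hm_cov f j j' : I f -> I (\sum_i Hm f j i * A i j').
Proof.
move=> hf; have := @brk_mx _ (Hm f *m A - f%:M) _ j j'.
rewrite mulmxBr mulmxA HmP // mul_scalar_mx mul_mx_scalar subrr !mxE => /(_ erefl) h.
rewrite -(subrK (f *+ (j == j')) (\sum_i _)); apply: submodD => //.
by case: (j == j'); rewrite ?mulr1n ?mulr0n //; apply: submod0.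
Qed.

Local Notation mdat := ((t.-1).-tuple 'I_m).
Definition ls (l : mdat) : seq nat := [seq val k | k <- l].
Definition um (l : mdat) (i : 'I_t) : R := uu (Ph A) t (ls l) (delta R i).

Lemma ls_size l : size (ls l) = t.-1. Proof. by rewrite size_map size_tuple. Qed.
Lemma ls_all l : all (ltn^~ m) (ls l).
Proof. by apply/allP => _ /mapP[k _ ->]; apply: ltn_ord. Qed.

Lemma Jgen_um s : Jgen (Ph A) t m s <-> exists l i, s = um l i.
Proof.
split=> [[l [i [sl hl it ->]]]|[l [i ->]]]; last first.
  by exists (ls l), i; rewrite ls_size ls_all.
have sz : size (pmap insub l : seq 'I_m) == t.-1.
  rewrite size_pmap_sub -sl; apply/eqP/eqP; rewrite -all_count; exact: hl.
exists (Tuple sz), (Ordinal it); rewrite /um /ls /=; congr uu.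
elim: l hl {sl sz} => [|x l IH] //= /andP[hx /IH e].
by rewrite insubT /= -e.
Qed.

Lemma uu_coord l (g : nat -> R) : uu (Ph A) t (ls l) g = \sum_(i < t) g i * um l i.
Proof. by rewrite /uu wedge_coord top_sum; apply: eq_bigr => i _; rewrite topZ. Qed.

Definition FF (l : mdat) (j : 'I_m) : R := \sum_(i < t) um l i * A i j.
Lemma FFE l j : FF l j = uu (Ph A) t (ls l) (Ph A j).
Proof. by rewrite uu_coord; apply: eq_bigr => i _; rewrite PhE mulrC. Qed.

Lemma FF_I l j : I (FF l j).
Proof.
apply/IL_minors; rewrite FFE; apply/top_ImL/ImL_wedge => //; exact/ImL_cols/ls_all.
Qed.

Definition kk (l : mdat) (i0 i : 'I_t) (j : 'I_m) : R :=
  kappa (Ph A) t (ls l) (delta R i0) (delta R i) j.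

Lemma kkP l i0 i k : \sum_j A k j * kk l i0 i j = um l i0 * (k == i)%:R - um l i * (k == i0)%:R.
Proof.
have := @kappaP R (Ph A) t m (ls l) (delta R i0) (delta R i) k (ls_size l) (ls_all l) (ltn_ord k).
rewrite /delta -!val_eqE /= => <-; apply: eq_bigr => j _.
by rewrite PhE.
Qed.

(** Pair z with [kkP], whose left side is a combination of columns and is therefore sent into I.
    Covectors on the cokernel are thus proportional to the vector of minors u_l. *)
Lemma cov_prop l i0 i (z : 'I_t -> R) : (forall j, I (\sum_k z k * A k j)) ->
  I (um l i0 * z i - um l i * z i0).
Proof.
move=> hz; have -> : um l i0 * z i - um l i * z i0 = \sum_j (\sum_k z k * A k j) * kk l i0 i j.
  transitivity (\sum_k z k * (\sum_j A k j * kk l i0 i j)); last first.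
    under [RHS]eq_bigr do rewrite mulr_suml; rewrite exchange_big /=; apply: eq_bigr => k _.
    by rewrite mulr_sumr; apply: eq_bigr => j _; rewrite mulrA.
  have e (w : 'I_t -> R) i' : \sum_k w k * (k == i')%:R = w i'.
    rewrite (bigD1 i') //= eqxx mulr1 big1 ?addr0 // => k /negbTE ->; exact: mulr0.
  transitivity (\sum_k ((z k * um l i0) * (k == i)%:R - (z k * um l i) * (k == i0)%:R)).
    by rewrite sumrB !e mulrC [z i0 * _]mulrC.
  by apply: eq_bigr => k _; rewrite kkP mulrBr !mulrA.
by apply: I_sum => j _; apply: I_Mr.
Qed.

Lemma um_cov l j : I (\sum_k um l k * A k j).
Proof. exact: FF_I. Qed.

Lemma rho_row l i0 i f j : I f -> I (um l i0 * Hm f j i - um l i * Hm f j i0).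
Proof. by move=> hf; apply: (cov_prop l i0 i) => j'; apply: Hm_cov. Qed.

(** Two evaluations of u_l phi h_f: phi h_f is f Id, and the entries of u_l phi are the maximal
    minors [FF l j], which therefore generate I where a coefficient of u_l is invertible. *)
Lemma key l i0 f : I f -> um l i0 * f = \sum_j Hm f j i0 * FF l j.
Proof.
move=> hf; transitivity (\sum_k um l k * (A *m Hm f) k i0).
  rewrite HmP // (bigD1 i0) //= mxE eqxx big1 ?addr0 // => k ki.
  by rewrite mxE (negbTE ki) mulr0.
under eq_bigr do rewrite mxE mulr_sumr; rewrite exchange_big /=; apply: eq_bigr => j _.
by rewrite mulr_sumr; apply: eq_bigr => k _; ring.
Qed.

(** The matrix built from the coefficients [kk] also solves phi h = [FF l j'] Id, so uniqueness
    modulo I applies. *)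
Lemma Hm_FF l j' j i : I (Hm (FF l j') j i - (um l i * (j == j')%:R
   - \sum_k A k j' * kk l i k j)).
Proof.
pose H : 'M[R]_(m, t) := \matrix_(j, i) (um l i * (j == j')%:R - \sum_k A k j' * kk l i k j).
have := @Hm_uniq (FF l j') H (FF_I _ _) _ j i; rewrite mxE; apply.
apply/matrixP => r s; rewrite !mxE.
transitivity (um l s * A r j' - \sum_k A k j' * (\sum_j A r j * kk l s k j)).
  under [in LHS]eq_bigr do rewrite mxE mulrBr.
  rewrite sumrB; congr (_ - _).
    rewrite (bigD1 j') //= eqxx mulr1 mulrC big1 ?addr0 // => k /negbTE ->.
    by rewrite !mulr0.
  under [in LHS]eq_bigr do rewrite mulr_sumr.
  rewrite exchange_big /=; apply: eq_bigr => k _; rewrite mulr_sumr; apply: eq_bigr => x _.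
  by rewrite mulrCA.
have -> : \sum_k A k j' * (\sum_j A r j * kk l s k j) =
    um l s * A r j' - (r == s)%:R * FF l j'.
  transitivity (\sum_k ((A k j' * um l s) * (r == k)%:R - (r == s)%:R * (um l k * A k j'))).
    apply: eq_bigr => k _; rewrite kkP; ring.
  rewrite sumrB -mulr_sumr; congr (_ - _).
  rewrite (bigD1 r) //= eqxx mulr1 mulrC big1 ?addr0 // => k; rewrite eq_sym => /negbTE ->.
  by rewrite mulr0.
by rewrite opprB addrCA subrr addr0 mulr_natl.
Qed.

(** A local converse to [row_rho]: by [Hm_FF] the pairing of d with column i0 of h for [FF l j'] is
    u d_{j'} minus a combination of the entries of column j' of phi, with coefficients independent
    of j'. *)
Lemma relations l i0 (d : 'rV[R]_m) :
  (forall j', I (\sum_j d 0 j * Hm (FF l j') j i0)) -> rowW (Ph A) t m (um l i0 *: d).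
Proof.
move=> hd; exists (fun k => if insub k is Some k' then \sum_j d 0 j * kk l i0 k' j else 0) => j'.
apply/IL_minors; rewrite mxE.
have -> : dot t (fun k => if insub k is Some k' then \sum_j d 0 j * kk l i0 k' j else 0) (Ph A j')
   = \sum_j d 0 j * (\sum_k A k j' * kk l i0 k j).
  rewrite /dot; under eq_bigr do rewrite valK PhE mulr_suml.
  rewrite exchange_big /=; apply: eq_bigr => j _; rewrite mulr_sumr; apply: eq_bigr => k _.
  by rewrite [RHS]mulrCA [RHS]mulrC.
have h1 : I (\sum_j d 0 j * (Hm (FF l j') j i0 - (um l i0 * (j == j')%:R
   - \sum_k A k j' * kk l i0 k j))) by apply: I_sum => j _; apply/I_Ml/Hm_FF.
apply: I_eq (submodB (hd j') h1) _; rewrite -sumrB.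
transitivity (\sum_j ((um l i0 * d 0 j) * (j == j')%:R - d 0 j * (\sum_k A k j' * kk l i0 k j))).
  by apply: eq_bigr => j _; ring.
rewrite sumrB; congr (_ - _).
rewrite (bigD1 j') //= eqxx mulr1 big1 ?addr0 // => k /negbTE ->; exact: mulr0.
Qed.

Lemma row_rho (d : 'rV[R]_m) f i : rowW (Ph A) t m d -> I f -> I (\sum_j d 0 j * Hm f j i).
Proof.
move=> [g hg] hf.
have h1 : I (\sum_(j < m) (d 0 j - dot t g (Ph A j)) * Hm f j i).
  by apply: I_sum => j _; apply/I_Mr/IL_minors.
have h2 : I (\sum_(j < m) dot t g (Ph A j) * Hm f j i).
  have -> : \sum_(j < m) dot t g (Ph A j) * Hm f j i = \sum_(k < t) g k * (A *m Hm f) k i.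
    under eq_bigr do rewrite /dot mulr_suml.
    rewrite exchange_big /=; apply: eq_bigr => k _; rewrite mxE mulr_sumr; apply: eq_bigr => j _.
    by rewrite PhE mulrA.
  apply: I_sum => k _; apply: I_Ml; rewrite HmP // mxE.
  by case: (k == i); rewrite ?mulr1n ?mulr0n //; apply: submod0.
apply: I_eq (submodD h1 h2) _; rewrite -big_split; apply: eq_bigr => j _ /=.
by rewrite -mulrDl subrK.
Qed.

(** In degree 1 of the exterior algebra the image of [Lam] is the image of phi, so regularity of the
    exterior quotient applies to v placed there. *)
Lemma coker_torsion_free (v : 'cV[R]_t) :
  (forall l i, exists N, mx_image A (um l i ^+ N *: v)) -> mx_image A v.
Proof.
move=> hv; pose vf k := if insub k is Some k' then v k' 0 else 0.
have vfE (k : 'I_t) : vf k = v k 0 by rewrite /vf valK.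
pose z : ext R t := wedge vf (one R t).
have Ximg r y : r *: v = A *m y -> ImL (Ph A) t m (r *: z).
  move=> e; rewrite /z -wedgeZl.
  pose yf k := if insub k is Some k' then y k' 0 else 0.
  have -> : wedge (fun i => r * vf i) (one R t) = wedge (comb (Ph A) m yf) (one R t).
    apply: wedge_eq => i it; have := congr1 (fun M : 'cV[R]_t => M (Ordinal it) 0) e.
    rewrite !mxE -(vfE (Ordinal it)) /= => ->; apply: eq_bigr => j _.
    by rewrite /yf valK -[i]/(val (Ordinal it)) PhE mulrC.
  by apply: ImL_comb; apply: ImL_one.
have : ImL (Ph A) t m z.
  have T : torsion L xx (Ph A) t m (ImL (Ph A) t m) L z.
    move=> s /Jgen_um [l [i ->]]; have [N [y e]] := hv l i; exists N.
    by apply/lvL/(Ximg _ y).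
  have regs i : (c <= i < L)%N -> Reg L xx (ImL (Ph A) t m) i.
    by move=> hi; apply: (ext_Reg_mG hA G _ mE n_ge); lia.
  have cc : (c <= c <= 2 * c)%N by lia.
  have cL : (c < L <= L)%N by lia.
  have := @torsion_free R L xx (Ph A) t c m (sJN G) (sJ G) (sJI G) (sJX G) _ (gE K n b)
    (ImL (Ph A) t m) c L z (@graded_ImL K n t m a b A hA m) cc cL regs T.
  by move/lvL.
move=> [w ew]; have [d hd] := gr1_wedge w.
have e : z = wedge (comb (Ph A) m d) (one R t).
  have -> : z = gr 1 z by rewrite gr_wedge gr_one.
  by rewrite ew Lam_gr hd Lam_wedge Lam_one.
exists (\col_j d j); apply/colP => k; rewrite mxE.
have := congr1 (contr (delta R k)) e.
rewrite !contr_wedge_one !delta_dot //.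
move=> e'; have : (vf k - comb (Ph A) m d k) *: one R t = 0 by rewrite scalerBl e' subrr.
move/scale_one_eq0/eqP; rewrite subr_eq0 vfE => /eqP ->; apply: eq_bigr => j _.
by rewrite mxE PhE mulrC.
Qed.

(** Times a minor, v is u_l(v) e_{i0} plus a combination of columns, by [kkP]; the first term lies
    in the image because I kills the cokernel, and torsion-freeness finishes. *)
Lemma image_of_minors (v : 'cV[R]_t) : (forall l, I (\sum_i um l i * v i 0)) -> mx_image A v.
Proof.
move=> hv; apply: coker_torsion_free => l i0; exists 1%N; rewrite expr1.
have -> : um l i0 *: v = (\sum_i um l i * v i 0) *: delta_mx i0 0
    + A *m (\col_j \sum_i v i 0 * kk l i0 i j).
  apply/colP => k; rewrite !mxE eqxx andbT.
  have -> : \sum_j A k j * (\col_j \sum_i v i 0 * kk l i0 i j) j 0 =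
      \sum_i v i 0 * (\sum_j A k j * kk l i0 i j).
    under eq_bigr do rewrite mxE mulr_sumr.
    rewrite exchange_big /=; apply: eq_bigr => i _; rewrite mulr_sumr; apply: eq_bigr => j _.
    by rewrite mulrCA.
  under [X in _ + X]eq_bigr do rewrite kkP mulrBr.
  rewrite sumrB [X in _ + (X - _)](bigD1 k) //= eqxx [X in _ + (_ + X - _)]big1 => [|i]; last first.
    by rewrite eq_sym => /negbTE ->; rewrite !mulr0.
  rewrite mulr_suml addr0 mulr1 addrCA -sumrB big1 ?addr0 1?mulrC // => i _.
  by rewrite mulrA [v i 0 * _]mulrC subrr.
apply: submodD; first exact: mx_image_minor.
by exists (\col_j \sum_i v i 0 * kk l i0 i j).
Qed.
End Rho.

(** * A matrix that preserves the row relations is a scalar modulo them *)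

Section Endgame.
Variables (K : fieldType) (n t c m : nat) (a : 'I_m -> int) (b : 'I_t -> int).
Local Notation R := {mpoly K[n.+1]}.
Local Notation S := (poly_gralg K n.+1).
Local Notation L := n.+1.
Local Notation xx := (xx K n).
Variable A : 'M[R]_(t, m).
Hypotheses (hA : homogeneous_mx a b A) (G : generic c A).
Hypotheses (c_gt1 : (1 < c)%N) (t_gt1 : (1 < t)%N) (mE : m = (t + c.-1)%N) (n_ge : (2 * c <= n)%N).
Hypothesis pos_deg : forall i j, 0 < a j - b i.
Hypothesis max_n2_lt : forall n1 n2 : int,
  EN_twist a b 1 n1 -> EN_twist a b 2 n2 -> n2 < 2 * n1.
Notation I := (det_ideal A).

(** Let T be the columns of n1. If j is outside T, adjoining j and i gives a second twist n1 + a_j -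
    b_i < 2 n1. If j is in T, each of the other t - 1 >= 1 columns has a_k larger than the greatest
    b, so their sum exceeds that of any t - 1 of the b's. *)
Lemma small_degree i j n1 : EN_twist a b 1 n1 -> a j - b i < n1.
Proof.
move=> h1; have [T [u [hT hu e]]] := h1.
have hu0 : u = 0%MM by apply/eqP; rewrite -mdeg_eq0 hu.
have {}e : n1 = \sum_(j in T) a j - \sum_i b i.
  by rewrite e hu0 [X in _ - X]big1 ?subr0 // => k _; rewrite mnm0E mulr0n.
rewrite addnK in hT; case: (boolP (j \in T)) => jT; last first.
  have /(max_n2_lt h1) : EN_twist a b 2 (\sum_(k in j |: T) a k - \sum_k b k - b i).
    exists (j |: T), U_(i)%MM; split.
    - by rewrite cardsU1 jT hT addn2 subn1.
    - by rewrite mdeg1.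
    - congr (_ - _); rewrite [RHS](bigD1 i) // mnm1E eqxx mulr1n big1 /= ?addr0 // => k ki.
      by rewrite mnm1E eq_sym (negbTE ki) mulr0n.
  by rewrite big_setU1 //= e; move: (\sum_(j in T) a j) (\sum_k b k) => s1 s2; lia.
have t0 : (0 < t)%N by lia.
pose i1 := [arg max_(k > Ordinal t0) b k]%O.
have hB k : b k <= b i1 by rewrite /i1; case: arg_maxP => // k' _ /(_ k isT).
rewrite e (bigD1 j) //= [\sum_k b k](bigD1 i) //=.
have s1 : \sum_(k in T | k != j) a k >= \sum_(k in T | k != j) (b i1 + 1).
  by apply: ler_sum => k _; have := pos_deg i1 k; lia.
have s2 : \sum_(k | k != i) b k <= \sum_(k : 'I_t | k != i) b i1 by apply: ler_sum.
have c1 : \sum_(k in T | k != j) (b i1 + 1) = (b i1 + 1) *+ t.-1.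
  rewrite sumr_const; congr (_ *+ _); have := cardsD1 j T; rewrite jT hT add1n => ->.
  by apply: eq_card => k; rewrite !inE andbC.
have c2 : \sum_(k : 'I_t | k != i) b i1 = b i1 *+ t.-1.
  rewrite sumr_const; congr (_ *+ _); have := cardC1 i; rewrite card_ord => <-.
  by apply: eq_card => k; rewrite !inE.
rewrite c1 in s1; rewrite c2 in s2; rewrite mulrnDl in s1.
have t1 : (1 : int) *+ t.-1 >= 1 by rewrite -[X in X <= _]/(1%:R) ler_nat; lia.
move: s1 s2 t1; move: (\sum_(k in T | k != j) a k) (\sum_(k | k != i) b k) (b i1 *+ t.-1) (1 *+ t.-1).
move=> x1 x2 x3 x4; lia.
Qed.

Lemma I_vanish e f : (forall n1, EN_twist a b 1 n1 -> e < n1) -> I f -> poly_deg e f -> f = 0.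
Proof.
move=> he hf hd; rewrite -(pcmp_id hd).
suff : forall r, pcmp e (r * f) = 0 by move=> /(_ 1); rewrite mul1r.
have P0 : forall r, pcmp e (r * (0 : R)) = 0 by move=> r; rewrite mulr0 pcmp0.
have PD (x y : R) : (forall r, pcmp e (r * x) = 0) -> (forall r, pcmp e (r * y) = 0) ->
  forall r, pcmp e (r * (x + y)) = 0.
  by move=> hx hy r; rewrite mulrDr pcmpD hx hy addr0.
have PZ (u x : R) : (forall r, pcmp e (r * x) = 0) -> forall r, pcmp e (r * (u * x)) = 0.
  by move=> hx r; rewrite mulrA hx.
apply: (@I_ind K n t m A (@Submod R R^o _ P0 PD PZ)) hf => g r.
case: (eqVneq (\det (colsub g A)) 0) => [->|/colsub_inj gi]; first by rewrite mulr0 pcmp0.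
rewrite mulrC (pcmpM _ _ (det_deg hA g)).
have := he _ (EN1 a b gi); set d := e - _ => h; have : d < 0 by rewrite /d; lia.
by case: d {h} => // d _ /=; rewrite mulr0.
Qed.

Local Notation mdat := ((t.-1).-tuple 'I_m).
Let idx : finType := (mdat * 'I_t)%type.

Lemma Jid_comb r : Jid (Ph A) t m r -> exists cf : idx -> R, r = \sum_i cf i * um A i.1 i.2.
Proof.
have P0 : exists cf : idx -> R, (0 : R) = \sum_i cf i * um A i.1 i.2.
  by exists (fun=> 0); rewrite big1 // => i _; rewrite mul0r.
have PD (x y : R) : (exists cf : idx -> R, x = \sum_i cf i * um A i.1 i.2) ->
    (exists cf : idx -> R, y = \sum_i cf i * um A i.1 i.2) ->
    exists cf : idx -> R, x + y = \sum_i cf i * um A i.1 i.2.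
  move=> [f ->] [g ->]; exists (fun i => f i + g i); rewrite -big_split.
  by apply: eq_bigr => i _; rewrite /= mulrDl.
have PZ (u x : R) : (exists cf : idx -> R, x = \sum_i cf i * um A i.1 i.2) ->
    exists cf : idx -> R, u * x = \sum_i cf i * um A i.1 i.2.
  move=> [f ->]; exists (fun i => u * f i); rewrite mulr_sumr.
  by apply: eq_bigr => i _; rewrite mulrA.
apply: (_ : span _ r -> (@Submod R R^o _ P0 PD PZ) r); apply.
move=> _ /Jgen_um [l [i ->]]; exists (fun k => (k == (l, i))%:R).
rewrite (bigD1 (l, i)) //= eqxx mul1r big1 ?addr0 // => k /negbTE ->; exact: mul0r.
Qed.

Definition dum (l : mdat) (i : 'I_t) : int := \sum_(k <- l) a k - \sum_i b i + b i.

Lemma um_deg l i : poly_deg (dum l i) (um A l i).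
Proof.
have h1 : degw (nb b) (\sum_(k <- l) a k) (cols (Ph A) t (ls l)).
  rewrite /ls; elim: (tval l) => [|k s IH]; first by rewrite big_nil; apply: degw_one.
  rewrite big_cons addrC -naE; apply: degw_wedge => // i'; exact: (Ph_deg hA i' k).
have := degw_top (degw_wedge (v := delta R i) (e := b i) _ h1).
rewrite /um /uu /dum; have -> : \sum_(i < t) nb b i = \sum_i b i by apply: eq_bigr => k _; rewrite nbE.
rewrite addrAC; apply => k; rewrite /delta; case: eqP => [->|_]; last exact: poly_deg0.
by rewrite nbE subrr; exact: (@ga_deg1 _ (poly_gralg K n.+1)).
Qed.

Theorem scalar_matrix (P : 'M[R]_m) : (forall j j', poly_deg (a j' - a j) (P j j')) ->
  (forall k, rowW (Ph A) t m (\row_j' \sum_j A k j * P j j')) ->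
  exists mu : K, forall j, rowW (Ph A) t m (row j P - mu%:MP *: delta_mx 0 j).
Proof.
move=> Pdeg hP.
have /choice [q hq] : forall k, exists g : nat -> R, forall j : 'I_m,
    I ((A *m P) k j - dot t g (Ph A j)).
  move=> k; have [g hg] := hP k; exists g => j; apply/IL_minors.
  by have := hg j; rewrite !mxE.
(* Homogeneous parts turn the congruence modulo I into the equality phi P = Q phi, because I is zero
   in the degrees a_j - b_k. *)
pose Q : 'M[R]_t := \matrix_(k, i) pcmp (b i - b k) (q k i).
have PQ : A *m P = Q *m A.
  apply/matrixP => k j.
  have dAP : poly_deg (a j - b k) ((A *m P) k j).
    rewrite mxE; apply: poly_deg_sum => r; have := poly_degM (hA k r) (Pdeg r j).
    by congr (poly_deg _ _); ring.
  have dQA : poly_deg (a j - b k) ((Q *m A) k j).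
    rewrite mxE; apply: poly_deg_sum => r; rewrite mxE.
    have := poly_degM (pcmp_deg (b r - b k) (q k r)) (hA r j).
    by congr (poly_deg _ _); ring.
  apply/eqP; rewrite -subr_eq0; apply/eqP; apply: (@I_vanish (a j - b k)).
  - by move=> n1; apply: small_degree.
  - have := I_graded hA (a j - b k) (hq k j); rewrite pcmpB (pcmp_id dAP) => hh; apply: I_eq hh _.
    congr (_ - _); rewrite /dot (big_morph _ (pcmpD _) (pcmp0 _ _ _)) mxE.
    apply: eq_bigr => i _; rewrite mxE PhE mulrC (pcmpM _ _ (hA i j)) mulrC.
    by congr (pcmp _ _ * _); ring.
  - exact: poly_degB.
(* The covector u_l Q kills the columns modulo I, since Q phi = phi P. By [cov_prop] it is locally
   proportional to u_l; [glue] makes the factor global, and its part of degree 0 is mu. *)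
pose uQ l i := \sum_k um A l k * Q k i.
have uQcov l j : I (\sum_i uQ l i * A i j).
  have -> : \sum_i uQ l i * A i j = \sum_r FF A l r * P r j.
    transitivity (\sum_k um A l k * (Q *m A) k j).
      under eq_bigr do rewrite mulr_suml; rewrite exchange_big /=; apply: eq_bigr => k _.
      by rewrite mxE mulr_sumr; apply: eq_bigr => i _; rewrite mulrA.
    under [RHS]eq_bigr do rewrite mulr_suml; rewrite [RHS]exchange_big /= -PQ.
    by apply: eq_bigr => k _; rewrite mxE mulr_sumr; apply: eq_bigr => r _; rewrite mulrA.
  by apply: I_sum => r _; apply/I_Mr/FF_I.
have compat l i l' i' : I (um A l i * uQ l' i' - um A l' i' * uQ l i).
  have h1 : I (\sum_k Q k i' * (um A l i * um A l' k - um A l k * um A l' i)).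
    by apply: I_sum => k _; apply/I_Ml/(cov_prop l i k)/um_cov.
  have h2 := cov_prop l' i i' (uQcov l).
  apply: I_eq (submodD h1 h2) _; rewrite /uQ !mulr_sumr.
  rewrite -!sumrB -big_split /=; apply: eq_bigr => k _; ring.
have c0 : (0 < c)%N by lia.
have e1 : (c <= c.+1 <= 2 * c)%N by lia.
have e2 : (c <= c <= 2 * c)%N by lia.
have [cf1 hcf1] := Jid_comb (sJI G e1); have [cf2 hcf2] := Jid_comb (sJI G e2).
have eL : (c.+1 < L)%N by lia.
have regs i : (c <= i < L)%N -> Reg L xx (IL (Ph A) t m) i.
  by move=> hi; apply: (I_Reg hA G _ mE n_ge).
have [h0 hh0] : exists h0 : R^o, forall i : idx,
    IL (Ph A) t m (uQ i.1 i.2 - um A i.1 i.2 *: h0).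
  apply: (@glue R L xx R^o (gR K n) (IL (Ph A) t m) c idx (fun i => um A i.1 i.2)
    (fun i => uQ i.1 i.2) (sJ G c.+1) (sJ G c) cf1 cf2 (sJN G c.+1) (sJN G c) (sJd G c.+1)) => //.
  - exact: graded_IL hA m.
  - by move=> i j; apply/IL_minors; apply: compat.
  - by move=> d h; apply: (pcmpM d (h : R)); apply: (sJhom G).
  - exact: (sJX G e1).
  - exact: (sJX G e2).
have [mu hmu] := poly_deg_const (pcmp_deg 0 (h0 : R)).
have huQ l i : I (uQ l i - um A l i * mu%:MP).
  have dQ : poly_deg (dum l i) (uQ l i).
    apply: poly_deg_sum => k; rewrite mxE.
    have := poly_degM (um_deg l k) (pcmp_deg (b i - b k) (q k i)).
    by congr (poly_deg _ _); rewrite /dum; ring.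
  have /IL_minors h := hh0 (l, i).
  have := I_graded hA (dum l i) h; rewrite pcmpB (pcmp_id dQ) => hh; apply: I_eq hh _ => /=.
  by rewrite -[_ *: h0]/(_ * _) (pcmpM _ _ (um_deg l i)) subrr hmu.
have /choice [z hz] : forall i, exists y : 'cV[R]_m, col i (Q - mu%:MP%:M) = A *m y.
  move=> i; apply: (image_of_minors hA G c_gt1 _ mE n_ge); first by lia.
  move=> l; apply: I_eq (huQ l i) _; rewrite /uQ.
  have -> : um A l i * mu%:MP = \sum_k um A l k * (mu%:MP%:M : 'M[R]_t) k i.
    rewrite (bigD1 i) //= mxE eqxx big1 ?addr0 // => k ki.
    by rewrite mxE (negbTE ki) mulr0.
  by rewrite -sumrB; apply: eq_bigr => k _; rewrite !mxE mulrBr.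
(* phi Z = Q - mu gives phi (P - mu - Z phi) = 0, so P - mu - Z phi has entries in I, which says
   that the rows of P - mu lie in [rowW]. *)
pose Z : 'M[R]_(m, t) := \matrix_(j, i) z i j 0.
have AZ : A *m Z = Q - mu%:MP%:M.
  apply/matrixP => k i; have := congr1 (fun M : 'cV[R]_t => M k 0) (hz i).
  by rewrite [in LHS]mxE => ->; rewrite !mxE; apply: eq_bigr => j _; rewrite mxE.
have key0 j j' : I ((P - mu%:MP%:M - Z *m A) j j').
  apply: (brk_mx hA G c_gt1 _ mE n_ge); first by lia.
  by rewrite !mulmxBr mulmxA AZ PQ mulmxBl mul_mx_scalar mul_scalar_mx subrr.
exists mu => j; exists (fun k => if insub k is Some k' then Z j k' else 0) => j'.
apply/IL_minors; apply: I_eq (key0 j j') _; rewrite !mxE eqxx /= mulr_natr; congr (_ - _ - _).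
  by rewrite eq_sym.
by apply: eq_bigr => k _; rewrite valK PhE.
Qed.
End Endgame.

(** * Prime ideals and points of Proj avoiding a form *)

Section Avoid.
Variables (C : comPzRingType) (bb : ideal C) (g : C).
Hypothesis hg : forall N, ~ bb (g ^+ N).

Definition avoiding (J : C -> Prop) := [/\ J 0, (forall x y, J x -> J y -> J (x + y)),
  (forall u x, J x -> J (u * x)), (forall x, bb x -> J x) & forall N, ~ J (g ^+ N)].

(** Zorn's lemma: an ideal maximal among those that contain bb and no power of g is prime. *)
Lemma prime_avoiding : exists J : ideal C, [/\ forall x, bb x -> J x,
  forall x y, J (x * y) -> J x \/ J y & forall N, ~ J (g ^+ N)].
Proof.
pose T := {J : C -> Prop | avoiding J}.
pose le (J1 J2 : T) := `[< forall x, sval J1 x -> sval J2 x >].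
have Teq (J1 J2 : T) : le J1 J2 -> le J2 J1 -> J1 = J2.
  case: J1 J2 => [J1 h1] [J2 h2] /asboolP l1 /asboolP l2.
  have e : J1 = J2 by apply: funext => x; apply: propext; split; [exact: l1|exact: l2].
  by case: _ / e h2 {l1 l2} => h2; congr exist; apply: Prop_irrelevance.
have b_av : avoiding bb.
  by split=> //; [exact: submod0|move=> *; exact: submodD|move=> u x; exact: (submodZ (s := bb))].
have [] := @classical_sets.Zorn T le.
- by move=> J; apply/asboolP.
- by move=> J1 J2 J3 /asboolP h1 /asboolP h2; apply/asboolP => x /h1 /h2.
- by move=> J1 J2; apply: Teq.
- move=> Ch tot; pose U x := bb x \/ exists J : T, Ch J /\ sval J x.
  have U_av : avoiding U.
    split.
    + by left; apply: submod0.
    + move=> x y [bx|[J [CJ Jx]]] [hy|[J' [CJ' Jy]]].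
      * by left; apply: submodD.
      * right; exists J'; split=> //; case: (svalP J') => _ D _ B _; apply: D => //; exact: B.
      * right; exists J; split=> //; case: (svalP J) => _ D _ B _; apply: D => //; exact: B.
      * case: (tot J J' CJ CJ') => /asboolP h.
          right; exists J'; split=> //; case: (svalP J') => _ D _ _ _; apply: D => //; exact: h.
        right; exists J; split=> //; case: (svalP J) => _ D _ _ _; apply: D => //; exact: h.
    + move=> u x [bx|[J [CJ Jx]]]; first by left; apply: (submodZ (s := bb)).
      by right; exists J; split=> //; case: (svalP J) => _ _ Z _ _; apply: Z.
    + by left.
    + by move=> N [/hg //|[J [_]]]; case: (svalP J) => _ _ _ _; apply.
  by exists (exist _ U U_av) => J CJ; apply/asboolP => x Jx; right; exists J.
move=> [J hJ] maxJ; case: (hJ) => J0 JD JZ Jb Jg.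
exists (@Submod C C^o J J0 JD JZ); split=> // x y /= Jxy.
have add z : ~ J z -> exists N u w, J w /\ g ^+ N = u * z + w.
  move=> nz; pose J' v := exists u w, J w /\ v = u * z + w.
  apply: contrapT => h; have J'_av : avoiding J'.
    split.
    - by exists 0, 0; rewrite mul0r addr0.
    - move=> _ _ [u [w [hw ->]]] [u' [w' [hw' ->]]]; exists (u + u'), (w + w').
      by split; [exact: JD|rewrite mulrDl addrACA].
    - move=> v _ [u [w [hw ->]]]; exists (v * u), (v * w).
      by split; [exact: JZ|rewrite mulrDr mulrA].
    - by move=> v /Jb hv; exists 0, v; rewrite mul0r add0r.
    - by move=> N [u [w [hw e]]]; apply: h; exists N, u, w.
  have hle : le (exist _ J hJ) (exist _ J' J'_av).
    by apply/asboolP => v /= Jv; exists 0, v; rewrite mul0r add0r.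
  have e := maxJ _ hle; apply: nz.
  have : sval (exist _ J' J'_av : T) z by exists 1, 0; rewrite mul1r addr0.
  by rewrite e.
case: (EM (J x)) => [|nx]; first by left.
case: (EM (J y)) => [|ny]; first by right.
have [N [u [w [hw e]]]] := add x nx; have [M [v [z [hz e']]]] := add y ny.
case: (Jg (N + M)%N); rewrite exprD e e'.
have -> : (u * x + w) * (v * y + z) = (u * v) * (x * y) + (u * x * z + (v * y + z) * w) by ring.
by apply: (JD); [exact: JZ|apply: (JD); exact: JZ].
Qed.
End Avoid.

Section Points.
Variables (K : fieldType) (n : nat).
Local Notation R := {mpoly K[n.+1]}.
Local Notation S := (poly_gralg K n.+1).
Variable I : ideal S.
Hypothesis I_gr : forall d r, I r -> I (pcmp d r).
Local Notation gA := (gquot I).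
Local Notation pi := (qring_pi I).

Lemma pcmp_bound (r : R) : exists B : nat, forall d, B%:Z < d -> pcmp d r = 0.
Proof.
case: (pcmp_sum r) => s [_ hs _]; exists (\max_(d <- s) absz d)%N => d hd; apply: hs.
apply/negP => ds; have : (absz d <= \max_(d <- s) absz d)%N by apply: leq_bigmax_seq.
lia.
Qed.

Lemma pcmp_mul d (r s : R) : exists l : seq int, [/\ uniq l, forall e, e \notin l -> pcmp e r = 0
  & pcmp d (r * s) = \sum_(e <- l) pcmp e r * pcmp (d - e) s].
Proof.
case: (pcmp_sum r) => l [ul hl er]; exists l; split=> //.
rewrite {1}er mulr_suml (big_morph _ (pcmpD _) (pcmp0 _ _ _)).
by apply: eq_bigr => e _; rewrite (pcmpM _ _ (pcmp_deg e r)).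
Qed.

Variable J : ideal R.
Hypotheses (J_prime : forall x y, J (x * y) -> J x \/ J y) (IJ : forall r, I r -> J r).

(** The largest homogeneous ideal contained in J. *)
Definition star : ideal S.
Proof.
exists (fun r : S^o => forall d, J (pcmp d r)).
- by move=> d; rewrite pcmp0; apply: submod0.
- by move=> x y hx hy d; rewrite pcmpD; apply: submodD.
- move=> u x hx d; have [l [_ _ e]] := pcmp_mul d u x.
  rewrite -[u *: x]/((u : R) * (x : R)) e; apply: (submod_sum (W := J)) => i _; exact: idealMl.
Defined.

Lemma star_sub r : star r -> J r.
Proof.
move=> h; case: (pcmp_sum (r : R)) => l [_ _ ->]; apply: (submod_sum (W := J)) => d _; exact: h.
Qed.

Lemma star_hom d r : poly_deg d r -> J r -> star r.
Proof.
move=> hd hr e; case: (eqVneq e d) => [->|ne]; first by rewrite (pcmp_id hd).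
by rewrite (pcmp_neq hd ne); apply: submod0.
Qed.

Lemma star_I r : I r -> star r.
Proof. by move=> hr d; apply/IJ/I_gr. Qed.

(** Let d and e be the highest degrees in which x and y have components outside J. Modulo J, the
    component of x y in degree d + e is the product of these two. *)
Lemma star_prime x y : star (x * y) -> star x \/ star y.
Proof.
have top z : ~ star z -> exists d, ~ J (pcmp d z) /\ forall e, d < e -> J (pcmp e z).
  move=> nz; have [d hd] : exists d, ~ J (pcmp d z).
    by apply: contrapT => h; apply: nz => d; apply: contrapT => h'; apply: h; exists d.
  have [B hB] := pcmp_bound z.
  pose P k := `[< ~ J (pcmp k%:Z z) >].
  have dn e : ~ J (pcmp e z) -> exists2 k : nat, P k & e = k%:Z.
    by case: e => // k hk; [exists k => //; apply/asboolP|case: hk; apply: submod0].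
  have exP : exists k, P k by have [k hk _] := dn _ hd; exists k.
  have ubP k : P k -> (k <= B)%N.
    move=> /asboolP hk; rewrite leqNgt; apply/negP => Bk; apply: hk.
    by rewrite hB ?ltz_nat //; apply: submod0.
  case: (ex_maxnP exP ubP) => k /asboolP Pk mx; exists k%:Z; split=> // e ke.
  by apply: contrapT => /dn [k' /mx hk' e']; move: ke; rewrite e' ltz_nat ltnNge hk'.
move=> h; apply: contrapT => /not_orP [/top [d [hd md]] /top [e [he me]]].
have [l [ul hl eq]] := pcmp_mul (d + e) x y.
have dl : d \in l by apply: contrapT => /negP /hl h0; apply: hd; rewrite h0; apply: submod0.
have := h (d + e); rewrite [pcmp _ _]eq (bigD1_seq d) //=.
have -> : d + e - d = e by ring.
set rest := \sum_(_ <- _ | _) _ => hs.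
have hr : J rest.
  apply: (submod_sum (W := J)) => i ne; case: (ltgtP i d) => [id_|id_|di].
  - by apply: idealMl; apply: me; lia.
  - by apply: idealMr; apply: md.
  - by rewrite di eqxx in ne.
have := submodB hs hr; rewrite addrK => /J_prime [/hd|/he] //.
Qed.

Variables (g : R) (dg : int).
Hypotheses (dg_gt0 : 0 < dg) (g_deg : poly_deg dg g) (gJ : forall N, ~ J (g ^+ N)).

Definition pt_id : ideal gA.
Proof.
exists (fun z : gA^o => exists r, star r /\ z = pi r).
- by exists 0; split; [apply: submod0|rewrite rmorph0].
- by move=> _ _ [r [hr ->]] [s [hs ->]]; exists (r + s); split; [apply: submodD|rewrite rmorphD].
- move=> u _ [r [hr ->]]; elim/qring_ind: u => u; exists (u * r).
  by split; [apply: (submodZ (s := star))|rewrite -[_ *: _]/(_ * _) rmorphM].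
Defined.

Lemma pt_idE r : pt_id (pi r) <-> star r.
Proof.
split=> [[s [hs /quot_piP h]]|h]; last by exists r.
have {h}h : I (r - s) := h.
by rewrite -(subrK s r); apply: submodD => //; apply: star_I.
Qed.

Lemma pt_ex : exists p : proj_point gA, forall r, p (pi r) <-> star r.
Proof.
have h1 : ~ pt_id 1.
  by rewrite -(rmorph1 pi) => /pt_idE /star_sub h; apply: (gJ (N := 0%N)); rewrite expr0.
have h2 (x y : gA) : pt_id (x * y) -> pt_id x \/ pt_id y.
  elim/qring_ind: x => x; elim/qring_ind: y => y; rewrite -rmorphM => /pt_idE /star_prime.
  by case=> h; [left|right]; apply/pt_idE.
have h3 (x : gA) : pt_id x -> span (fun y : gA^o => pt_id y /\ homogeneous y) x.
  elim/qring_ind: x => x /pt_idE hx; case: (pcmp_sum (x : R)) => l [_ _ e].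
  rewrite e rmorph_sum; apply: (submod_sum (W := span _)) => d _; apply: span_gen; split.
    by apply/pt_idE; apply: (star_hom (pcmp_deg d x)); apply: hx.
  by exists d, (pcmp d x); split=> //; apply: pcmp_deg.
have h4 : exists (d : int) (x : gA), [/\ 0 < d, ga_deg d x & ~ pt_id x].
  exists dg, (pi g); split=> //; first by exists g.
  by move=> /pt_idE /star_sub h; apply: (gJ (N := 1%N)); rewrite expr1.
by exists (ProjPoint h1 h2 h3 h4); exact: pt_idE.
Qed.
End Points.

(** A homogeneous Nullstellensatz. The positive degree of g makes the homogeneous prime relevant,
    that is, a point of Proj. *)
Lemma point_avoiding (K : fieldType) (n : nat) (I : ideal (poly_gralg K n.+1))
    (E : {mpoly K[n.+1]} -> Prop) (g : {mpoly K[n.+1]}) (dg : int) :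
  (forall d r, I r -> I (pcmp d r)) ->
  (forall r, E r -> exists d, poly_deg d r) ->
  (forall r, I r -> span (E : {mpoly K[n.+1]}^o -> Prop) r) ->
  0 < dg -> poly_deg dg g ->
  (forall N, ~ span (E : {mpoly K[n.+1]}^o -> Prop) (g ^+ N)) ->
  exists p : proj_point (gquot I), (forall r, E r -> p (qring_pi I r)) /\ ~ p (qring_pi I g).
Proof.
move=> I_gr Eh IE dg0 hg hN.
have [J [bJ Jp Jg]] := prime_avoiding hN.
have IJ r : I r -> J r by move=> /IE /bJ.
have [p hp] := pt_ex I_gr Jp IJ dg0 hg Jg.
exists p; split.
  move=> r Er; have [d hd] := Eh r Er; apply/hp; apply: (star_hom hd); apply: bJ.
  exact: span_gen.
by move=> /hp /star_sub h; apply: (Jg 1%N); rewrite expr1.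
Qed.

(** * Germs of sections and morphisms of sheaves *)

Section Germs.
Variables (K : pzRingType) (S : gralg K).
Local Notation point := (proj_point S).
Local Notation popen := (popen S).

Definition good (M : grmod S) (q : point) (w : M) (y : S) :=
  exists d, [/\ gm_deg d w, ga_deg d y & ~ q y].

(* the germ w/y, or 0 when w/y does not make sense *)
Definition fr (M : grmod S) (q : point) (w : M) (y : S) : loc M q :=
  if pselect (exists x : frac M q, fr_num x = w /\ fr_den x = y) is left h
  then loc_pi (sval (cid h)) else 0.

Section OneModule14.
Variables (M : grmod S) (q : point).
Implicit Types (w : M) (y : S).

Lemma fr_pi (x : frac M q) : fr q (fr_num x) (fr_den x) = loc_pi x.
Proof.
rewrite /fr; case: pselect => [h|[]]; last by exists x.
case: (cid h) => x' /= [e1 e2]; apply: loc_eq; by rewrite e1 e2.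
Qed.

Lemma frE d w y (h1 : gm_deg d w) (h2 : ga_deg d y) (h3 : ~ q y) :
  loc_pi (Frac h1 h2 h3) = fr q w y.
Proof. by rewrite -fr_pi. Qed.

Lemma fr_eq w y w' y' : good q w y -> good q w' y' ->
  fr q w y = fr q w' y' <-> exists u, [/\ homogeneous u, ~ q u & u *: (y' *: w) = u *: (y *: w')].
Proof.
by move=> [d [h1 h2 h3]] [d' [h1' h2' h3']]; rewrite -(frE h1 h2 h3) -(frE h1' h2' h3') loc_piP.
Qed.

Lemma fr_eqW w y w' y' : good q w y -> good q w' y' -> y' *: w = y *: w' -> fr q w y = fr q w' y'.
Proof.
move=> g g' e; apply/(fr_eq g g'); exists 1; rewrite e; split=> //; last exact: pt_proper.
exact: homog1.
Qed.

Lemma good0 y : homogeneous y -> ~ q y -> good q (0 : M) y.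
Proof. by move=> [d hd] hy; exists d; split=> //; apply: gm_deg0. Qed.

Lemma fr0 y : fr q (0 : M) y = 0.
Proof.
rewrite /fr; case: pselect => // h; case: (cid h) => x /= [e1 _].
have -> : 0 = loc_pi (frac_zero M q) by [].
by apply: loc_eq; rewrite /= e1 !scaler0.
Qed.

Lemma fr_eq0 w y : good q w y -> fr q w y = 0 <-> exists u, [/\ homogeneous u, ~ q u & u *: w = 0].
Proof.
move=> g; have [d [h1 h2 h3]] := g; have g0 : good q (0 : M) y by apply: good0 => //; exists d.
rewrite -(fr0 y) (fr_eq g g0); split=> -[u [hu qu e]].
  exists (u * y); split; [by apply: homogM => //; exists d|exact: out_mul|].
  by rewrite -scalerA e !scaler0.
by exists u; split=> //; rewrite !scaler0 scalerA mulrC -scalerA e scaler0.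
Qed.

Lemma frD d w w' y : gm_deg d w -> gm_deg d w' -> ga_deg d y -> ~ q y ->
  fr q w y + fr q w' y = fr q (w + w') y.
Proof.
move=> h1 h1' h2 h3; rewrite -(frE h1 h2 h3) -(frE h1' h2 h3) -(frE (gm_degD h1 h1') h2 h3).
rewrite [LHS]loc_addE; apply: loc_eq => /=; by rewrite -scalerDr scalerA.
Qed.

Lemma fr_sum d (J : Type) (l : seq J) (F : J -> M) y : (forall j, gm_deg d (F j)) ->
  ga_deg d y -> ~ q y -> \sum_(j <- l) fr q (F j) y = fr q (\sum_(j <- l) F j) y.
Proof.
move=> h h2 h3; elim: l => [|j l IH]; first by rewrite !big_nil fr0.
rewrite !big_cons IH (frD (d := d)) //.
by elim/big_rec: _ => [|k x _ hx]; [exact: gm_deg0|exact: gm_degD].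
Qed.

Lemma loc_fr (z : loc M q) : exists w y, good q w y /\ z = fr q w y.
Proof.
elim/loc_ind: z => x; exists (fr_num x), (fr_den x); rewrite fr_pi; split=> //.
by exists (fr_deg x); split; [exact: fr_numP|exact: fr_denP|exact: fr_den_out].
Qed.
End OneModule14.

Lemma frZ (M : grmod S) q (a : gself S) z (w : M) y : good (M := gself S) q a z -> good q w y ->
  (fr (M := gself S) q a z : local_ring q) *: fr q w y = fr q ((a : S) *: w) (z * y).
Proof.
move=> [d [h1 h2 h3]] [d' [h1' h2' h3']]; rewrite -(frE h1 h2 h3) -(frE h1' h2' h3').
rewrite [LHS]loc_scaleE -fr_pi //.
Qed.

Lemma goodM (M : grmod S) q (a : gself S) z (w : M) y : good (M := gself S) q a z -> good q w y -> good q ((a : S) *: w) (z * y).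
Proof.
move=> [d [h1 h2 h3]] [d' [h1' h2' h3']]; exists (d + d').
by split; [exact: gm_degZ|exact: ga_degM|exact: out_mul].
Qed.

Lemma pt_mull (q : point) (x y : S) : q x -> q (y * x).
Proof. exact: (submodZ (s := q)). Qed.
Lemma pt_mulr (q : point) (x y : S) : q x -> q (x * y).
Proof. by rewrite mulrC; apply: pt_mull. Qed.

Lemma D_subproof (x : S) : homogeneous x -> zariski (fun p : point => ~ p x).
Proof.
move=> hx; exists (fun y => y = x); split=> [y ->//|p].
by split=> [h|[y [-> //]]]; exists x.
Qed.
Definition Dop (x : S) (hx : homogeneous x) : popen := Popen (D_subproof hx).

Lemma sec_near (M : grmod S) (U : popen) (s : sec M U) q (Uq : U q) :
  exists (V : popen) w y d, [/\ psub V U, V q, gm_deg d w, ga_deg d y &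
    (forall p, V p -> ~ p y) /\ forall p (Vp : V p) (Up : U p), sec_val s Up = fr p w y].
Proof.
case: (sec_valP s Uq) => V [VU [d [w [y [hm [hf [fV [Vq sV]]]]]]]].
exists V, w, y, d; split=> //; split=> // p Vp Up.
by rewrite (sec_irr s Up (VU p Vp)) sV frE.
Qed.

Section FracSection.
Variables (M : grmod S) (W : popen) (w : M) (y : S) (d : int).
Hypotheses (hw : gm_deg d w) (hy : ga_deg d y) (hW : forall p, W p -> ~ p y).
Fact frsec_proof : @locally_frac _ _ M W (fun p _ => fr p w y).
Proof.
move=> p Wp; exists W, (@psub_refl _ _ W), d, w, y, hw, hy, hW; split=> // q Wq.
by rewrite frE.
Qed.
Definition frsec : sec M W := Sec frsec_proof.
End FracSection.

Section Eval.
Variables (M V : grmod S).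
Local Notation F := (tilde M).
Local Notation H := (tilde V).

Section At.
Variables (U : popen) (eta : shmor F H U).

(** Restriction to the intersection of two neighbourhoods shows that the value depends neither on
    the neighbourhood nor on the degree assigned to the fraction. *)
Lemma ev_ex q (m : M) (y : S) : exists v : loc V q, forall d (hm : gm_deg d m) (hy : ga_deg d y)
  (W : popen) (WU : psub W U) (Wq : W q) (hW : forall p, W p -> ~ p y),
  sec_val (sm_fun eta WU (frsec hm hy hW)) Wq = v.
Proof.
case: (EM (exists d (hm : gm_deg d m) (hy : ga_deg d y) (W : popen), [/\ psub W U, W q & forall p, W p -> ~ p y])).
  move=> [d [hm [hy [W [WU Wq hW]]]]]; exists (sec_val (sm_fun eta WU (frsec hm hy hW)) Wq).
  move=> d' hm' hy' W' WU' Wq' hW'.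
  have Z : pcap W W' q by split.
  have := congr1 (fun s : sec V (pcap W W') => sec_val s Z)
    (sm_nat eta WU (@pcapl _ _ W W') (frsec hm hy hW)).
  have := congr1 (fun s : sec V (pcap W W') => sec_val s Z)
    (sm_nat eta WU' (@pcapr _ _ W W') (frsec hm' hy' hW')).
  rewrite /= => e1 e2.
  rewrite (sec_irr _ Wq' (pcapr Z)) (sec_irr _ Wq (pcapl Z)) e1 e2.
  rewrite (Prop_irrelevance (psub_trans (pcapr (V:=W')) WU') (psub_trans (pcapl (V:=W')) WU)).
  have -> : sec_res (@pcapr _ _ W W') (frsec hm' hy' hW') = sec_res (@pcapl _ _ W W') (frsec hm hy hW).
    exact: sec_ext.
  by [].
by move=> h; exists 0 => d hm hy W WU Wq hW; case: h; exists d, hm, hy, W.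
Qed.

(* the value of eta on the germ m/y at q *)
Definition secev q (m : M) (y : S) : loc V q := sval (cid (ev_ex q m y)).

Lemma evP q m y d (W : popen) (WU : psub W U) (Wq : W q) (s : sec M W) :
  gm_deg d m -> ga_deg d y -> ~ q y ->
  (exists (W' : popen), [/\ W' q, psub W' W & forall p (Wp : W p), W' p -> sec_val s Wp = fr p m y]) ->
  sec_val (sm_fun eta WU s) Wq = secev q m y.
Proof.
move=> hm hy qy [W' [W'q W'W hs]].
have hyy : homogeneous y by exists d.
pose Z := pcap W' (Dop hyy); have Zq : Z q by split.
have ZW : psub Z W by move=> p [/W'W].
have hZ p : Z p -> ~ p y by move=> [].
have := congr1 (fun s : sec V Z => sec_val s Zq) (sm_nat eta WU ZW s).
rewrite /= (sec_irr _ (ZW q Zq) Wq) => ->.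
have -> : sec_res ZW s = frsec hm hy hZ.
  by apply: sec_ext => p Zp /=; apply: hs; case: Zp.
exact: (svalP (cid (ev_ex q m y)) d hm hy Z _ Zq hZ).
Qed.

Lemma ev_frsec q m y d (W : popen) (WU : psub W U) (Wq : W q) (hm : gm_deg d m) (hy : ga_deg d y)
  (hW : forall p, W p -> ~ p y) : sec_val (sm_fun eta WU (frsec hm hy hW)) Wq = secev q m y.
Proof. exact: (svalP (cid (ev_ex q m y))). Qed.
End At.

Lemma ev_res U W (h : psub W U) (eta : shmor F H U) q m y : W q -> good q m y ->
  secev (shmor_res h eta) q m y = secev eta q m y.
Proof.
move=> Wq [d [hm hy qy]]; have hyy : homogeneous y by exists d.
pose Z := pcap W (Dop hyy); have Zq : Z q by split.
have hZ p : Z p -> ~ p y by move=> [].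
rewrite -(ev_frsec (shmor_res h eta) (@pcapl _ _ W (Dop hyy)) Zq hm hy hZ).
by rewrite -(ev_frsec eta (psub_trans (@pcapl _ _ W (Dop hyy)) h) Zq hm hy hZ).
Qed.

(** Sections are fractions locally, so morphisms can be compared on fractions at each point instead
    of on sections. *)
Lemma shmor_ev_ext U (eta eta' : shmor F H U) :
  (forall q m y, U q -> good q m y -> secev eta q m y = secev eta' q m y) -> eta = eta'.
Proof.
move=> h; apply: shmor_ext => W WU s; apply: sec_ext => q Wq.
have [W' [m [y [d [W'W W'q hm hy [hW' hs]]]]]] := sec_near s Wq.
have X : exists (W' : popen), [/\ W' q, psub W' W & forall p (Wp : W p), W' p -> sec_val s Wp = fr p m y].
  by exists W'; split=> // p Wp W'p; apply: hs.
rewrite (evP eta WU Wq hm hy (hW' q W'q) X) (evP eta' WU Wq hm hy (hW' q W'q) X).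
by apply: h; [exact: WU|exists d; split=> //; exact: hW'].
Qed.

Section EvalRules.
Variables (U : popen) (q : point) (Uq : U q).
Implicit Types (eta : shmor F H U).

Let W1 (y : S) (hy : homogeneous y) := pcap U (Dop hy).

Lemma ev_lin (al : oring U) eta eta' m y : good q m y ->
  secev (al *: eta + eta') q m y = oring_val al Uq *: secev eta q m y + secev eta' q m y.
Proof.
move=> [d [hm hy qy]]; have hyy : homogeneous y by exists d.
have Zq : W1 hyy q by split.
have hZ p : W1 hyy p -> ~ p y by move=> [].
rewrite -(ev_frsec (al *: eta + eta') (@pcapl _ _ U (Dop hyy)) Zq hm hy hZ).
rewrite -(ev_frsec eta (@pcapl _ _ U (Dop hyy)) Zq hm hy hZ).
rewrite -(ev_frsec eta' (@pcapl _ _ U (Dop hyy)) Zq hm hy hZ).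
by rewrite /oring_val (sec_irr al Uq (pcapl Zq)).
Qed.

Lemma ev_add eta d m m' y : gm_deg d m -> gm_deg d m' -> ga_deg d y -> ~ q y ->
  secev eta q (m + m') y = secev eta q m y + secev eta q m' y.
Proof.
move=> hm hm' hy qy; have hyy : homogeneous y by exists d.
have Zq : W1 hyy q by split.
have hZ p : W1 hyy p -> ~ p y by move=> [].
rewrite -(ev_frsec eta (@pcapl _ _ U (Dop hyy)) Zq hm hy hZ).
rewrite -(ev_frsec eta (@pcapl _ _ U (Dop hyy)) Zq hm' hy hZ).
rewrite -(ev_frsec eta (@pcapl _ _ U (Dop hyy)) Zq (gm_degD hm hm') hy hZ).
have -> : frsec (gm_degD hm hm') hy hZ = (1 : oring (W1 hyy)) *: frsec hm hy hZ + frsec hm' hy hZ.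
  rewrite scale1r; apply: sec_ext => p Zp /=; rewrite -(frD hm hm') //; exact: hZ.
by rewrite sm_lin scale1r.
Qed.

Lemma ev_eq eta m y m' y' : good q m y -> good q m' y' -> fr q m y = fr q m' y' ->
  secev eta q m y = secev eta q m' y'.
Proof.
move=> g g' /(fr_eq g g') [u [hu qu e]].
have [d [hm hy qy]] := g; have [d' [hm' hy' qy']] := g'.
have hyy : homogeneous (u * y * y').
  by apply: homogM; [apply: homogM => //; exists d|exists d'].
have Zq : W1 hyy q by split=> //; apply: out_mul => //; apply: out_mul.
have hZ p : W1 hyy p -> [/\ ~ p u, ~ p y & ~ p y'].
  move=> [_ hp]; split=> h; apply: hp.
  - by do 2!apply: pt_mulr.
  - by apply: pt_mulr; apply: pt_mull.
  - exact: pt_mull.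
have hZy p : W1 hyy p -> ~ p y by move=> /hZ [].
have hZy' p : W1 hyy p -> ~ p y' by move=> /hZ [].
rewrite -(ev_frsec eta (@pcapl _ _ U (Dop hyy)) Zq hm hy hZy).
rewrite -(ev_frsec eta (@pcapl _ _ U (Dop hyy)) Zq hm' hy' hZy').
suff -> : frsec hm hy hZy = frsec hm' hy' hZy' by [].
apply: sec_ext => p Zp /=; apply/fr_eq.
- by exists d; split=> //; apply: hZy.
- by exists d'; split=> //; apply: hZy'.
- by exists u; split=> //; case: (hZ p Zp).
Qed.

Lemma ev_scale eta a z m y : good (M := gself S) q a z -> good q m y ->
  secev eta q ((a : S) *: m) (z * y) = (fr (M := gself S) q a z : local_ring q) *: secev eta q m y.
Proof.
move=> [e [ha hz qz]] [d [hm hy qy]].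
have hyy : homogeneous (z * y) by exists (e + d); apply: ga_degM.
have Zq : W1 hyy q by split=> //; apply: out_mul.
have hZ p : W1 hyy p -> ~ p (z * y) by move=> [].
have hZz p : W1 hyy p -> ~ p z by move=> /hZ h pz; apply: h; rewrite mulrC; apply: (submodZ (s := p)).
have hZy p : W1 hyy p -> ~ p y by move=> /hZ h py; apply: h; apply: (submodZ (s := p)).
pose al : oring (W1 hyy) := frsec (M := gself S) ha hz hZz.
rewrite -(ev_frsec eta (@pcapl _ _ U (Dop hyy)) Zq hm hy hZy).
rewrite -(ev_frsec eta (@pcapl _ _ U (Dop hyy)) Zq (gm_degZ ha hm) (ga_degM hz hy) hZ).
have -> : frsec (gm_degZ ha hm) (ga_degM hz hy) hZ = al *: frsec hm hy hZy.
  apply: sec_ext => p Zp; rewrite [RHS](_ : _ = (fr (M := gself S) p a z : local_ring p) *: fr p m y) //.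
  by rewrite frZ //; [exists e|exists d]; split=> //; [exact: (hZz)|exact: (hZy)].
have := sm_lin eta (@pcapl _ _ U (Dop hyy)) al (frsec hm hy hZy) 0.
have -> : sm_fun eta (@pcapl _ _ U (Dop hyy)) 0 = 0.
  have := sm_lin eta (@pcapl _ _ U (Dop hyy)) 1 0 0.
  by rewrite !scale1r addr0 => e0; apply: (addrI (sm_fun eta (@pcapl _ _ U (Dop hyy)) 0)); rewrite -e0 addr0.
by rewrite !addr0 => ->.
Qed.
End EvalRules.

Section HomSection.
Variables (f : hom M V) (D : int) (x : S) (U : popen).
Hypotheses (hf : forall e m, gm_deg e m -> gm_deg (D + e) (hom_fun f m)) (hx : ga_deg D x)
  (hU : forall p, U p -> ~ p x).

Lemma good_hom (p : point) m y : ~ p x -> good p m y -> good p (hom_fun f m) (x * y).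
Proof.
move=> px [d [h1 h2 h3]]; exists (D + d).
by split; [exact: hf|exact: ga_degM|exact: out_mul].
Qed.

Definition hmap (p : point) (z : loc M p) : loc V p :=
  fr p (hom_fun f (fr_num (repr z))) (x * fr_den (repr z)).

Lemma good_frac (p : point) (z : frac M p) : good p (fr_num z) (fr_den z).
Proof. by exists (fr_deg z); split; [exact: fr_numP|exact: fr_denP|exact: fr_den_out]. Qed.

Lemma hmap_fr (p : point) m y : ~ p x -> good p m y -> hmap (fr p m y) = fr p (hom_fun f m) (x * y).
Proof.
move=> px g; rewrite /hmap; set z := repr _.
have ez : fr p (fr_num z) (fr_den z) = fr p m y by rewrite fr_pi /z loc_piE.
have [u [hu pu e]] := proj1 (fr_eq (good_frac z) g) ez.
apply/(fr_eq (good_hom px (good_frac z)) (good_hom px g)); exists u; split=> //.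
have := congr1 (fun w => x *: hom_fun f w) e; rewrite !hom_funZ => e'.
by rewrite -!scalerA ![u *: (x *: _)]scalerA [u * x]mulrC -!scalerA.
Qed.

Fact hsec_proof (W : popen) (h : psub W U) (s : sec M W) :
  @locally_frac _ _ V W (fun p Wp => hmap (sec_val s Wp)).
Proof.
move=> p Wp; have [W' [m [y [d [W'W W'p hm hy [hW' hs]]]]]] := sec_near s Wp.
have hxy q : W' q -> ~ q (x * y) by move=> W'q; apply: out_mul; [exact/hU/h/W'W|exact: hW'].
exists W', W'W, (D + d), (hom_fun f m), (x * y), (hf hm), (ga_degM hx hy), hxy; split=> // q W'q.
rewrite (hs q W'q) hmap_fr; [by rewrite frE|exact/hU/h/W'W|].
by exists d; split=> //; exact: hW'.
Qed.
Definition hsec (W : popen) (h : psub W U) (s : sec M W) : sec V W := Sec (hsec_proof h s).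

Fact hsec_lin (W : popen) (h : psub W U) : linear (hsec h : F W -> H W).
Proof.
move=> al s s'; apply: sec_ext => p Wp.
rewrite [LHS](_ : _ = hmap (oring_val al Wp *: sec_val s Wp + sec_val s' Wp)) //.
rewrite [RHS](_ : _ = oring_val al Wp *: hmap (sec_val s Wp) + hmap (sec_val s' Wp)) //.
have px := hU (h p Wp).
have [a [z [ga ->]]] := loc_fr (oring_val al Wp).
have [m [y [gm ->]]] := loc_fr (sec_val s Wp).
have [m' [y' [gm' ->]]] := loc_fr (sec_val s' Wp).
rewrite (frZ ga gm) (hmap_fr px gm) (hmap_fr px gm') (frZ ga (good_hom px gm)).
have gam := goodM ga gm.
have [d [h1 h2 h3]] := gam; have [d' [h1' h2' h3']] := gm'.
have k1 : gm_deg (d' + d) (y' *: ((a : S) *: m)) by apply: gm_degZ.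
have k2 : gm_deg (d' + d) ((z * y) *: m') by rewrite addrC; apply: gm_degZ.
have k3 : ga_deg (d' + d) (y' * (z * y)) by apply: ga_degM.
have k4 : ~ p (y' * (z * y)) by apply: out_mul.
have g1 : good p (y' *: ((a : S) *: m)) (y' * (z * y)) by exists (d' + d).
have g2 : good p ((z * y) *: m') (y' * (z * y)) by exists (d' + d).
have -> : fr p ((a : S) *: m) (z * y) = fr p (y' *: ((a : S) *: m)) (y' * (z * y)).
  by apply: fr_eqW => //; rewrite [RHS]scalerA; congr (_ *: _); ring.
have -> : fr p m' y' = fr p ((z * y) *: m') (y' * (z * y)).
  by apply: fr_eqW => //; rewrite [RHS]scalerA.
rewrite (frD k1 k2 k3 k4) hmap_fr //; last by exists (d' + d); split=> //; exact: gm_degD.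
rewrite hom_funD -(frD (hf k1) (hf k2) (ga_degM hx k3)); last exact: out_mul.
congr (_ + _); apply: fr_eqW.
- exact: good_hom.
- exact: (goodM ga (good_hom px gm)).
- by rewrite !hom_funZ !scalerA; congr (_ *: _); ring.
- exact: good_hom.
- exact: good_hom.
- by rewrite !hom_funZ !scalerA; congr (_ *: _); ring.
Qed.

Fact hsec_nat (W W' : popen) (h : psub W U) (k : psub W' W) (s : F W) :
  sh_res k (hsec h s : H W) = (hsec (psub_trans k h) (sh_res k s) : H W').
Proof. by apply: sec_ext. Qed.

(** The morphism f/x on an open set where x does not vanish; f and x have the same degree D, so
    fractions of degree 0 are preserved. *)
Definition hmor : shmor F H U := Shmor hsec_lin hsec_nat.

Lemma ev_hmor q m y : U q -> good q m y -> secev hmor q m y = fr q (hom_fun f m) (x * y).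
Proof.
move=> Uq [d [hm hy qy]]; have hyy : homogeneous y by exists d.
have Zq : pcap U (Dop hyy) q by split.
have hZ p : pcap U (Dop hyy) p -> ~ p y by move=> [].
rewrite -(ev_frsec hmor (@pcapl _ _ U (Dop hyy)) Zq hm hy hZ).
by rewrite /= hmap_fr //; [exact: hU|exists d].
Qed.
End HomSection.
End Eval.
End Germs.

Section Degrees16.
Variables (K : pzRingType) (S : gralg K).
Lemma ga_deg_exp d (x : S) N : ga_deg d x -> ga_deg (d *+ N) (x ^+ N).
Proof.
move=> h; elim: N => [|N IH]; first by rewrite expr0; apply: ga_deg1.
by rewrite exprS mulrS; apply: ga_degM.
Qed.

Lemma ga_deg_exp1 (x : S) N : ga_deg 1 x -> ga_deg N%:Z (x ^+ N).
Proof. by move=> h; have := ga_deg_exp N h; rewrite -[1 *+ N]/(N%:R) natz. Qed.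

Lemma not_pt_exp (q : proj_point S) x N : ~ q x -> ~ q (x ^+ N).
Proof.
move=> h; elim: N => [|N IH]; first by rewrite expr0; apply: pt_proper.
by rewrite exprS; apply: out_mul.
Qed.

End Degrees16.

Section EvMore.
Variables (K : pzRingType) (S : gralg K) (M V : grmod S).
Local Notation F := (tilde M).
Local Notation H := (tilde V).

Lemma ga_degE d e (x : S) : ga_deg d x -> d = e -> ga_deg e x. Proof. by move=> h <-. Qed.
Lemma gm_degE (N : grmod S) d e (x : N) : gm_deg d x -> d = e -> gm_deg e x. Proof. by move=> h <-. Qed.
Lemma goodI (N : grmod S) d (q : proj_point S) (w : N) (y : S) : gm_deg d w -> ga_deg d y -> ~ q y -> good q w y.
Proof. by exists d. Qed.

Lemma out_prod (q : proj_point S) (J : finType) (D : J -> S) :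
  ~ q (\prod_j D j) <-> forall j, ~ q (D j).
Proof.
split=> [h j hj|h]; first by apply: h; rewrite (bigD1 j) //=; apply: pt_mulr.
by elim/big_rec: _ => [|j x _ hx]; [exact: pt_proper|exact: out_mul].
Qed.

Lemma ga_deg_prod (J : finType) (P : pred J) (D : J -> S) d : (forall j, ga_deg (d j) (D j)) ->
  ga_deg (\sum_(j | P j) d j) (\prod_(j | P j) D j).
Proof. by move=> h; elim/big_rec2: _ => [|j x y _ hx]; [exact: ga_deg1|exact: ga_degM]. Qed.

Variables (U : popen S) (q : proj_point S) (Uq : U q).
Lemma ev0 (eta : shmor F H U) d y : ga_deg d y -> ~ q y -> secev eta q 0 y = 0.
Proof.
move=> hy qy; have := ev_add Uq eta (gm_deg0 M d) (gm_deg0 M d) hy qy; rewrite addr0 => e.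
by apply: (addrI (secev eta q 0 y)); rewrite -e addr0.
Qed.

Lemma ev_sum (eta : shmor F H U) d (J : Type) (l : seq J) (f : J -> M) y :
  (forall j, gm_deg d (f j)) -> ga_deg d y -> ~ q y ->
  secev eta q (\sum_(j <- l) f j) y = \sum_(j <- l) secev eta q (f j) y.
Proof.
move=> hf hy qy; elim: l => [|j l IH]; first by rewrite !big_nil (ev0 _ hy).
have hs : gm_deg d (\sum_(k <- l) f k).
  by elim/big_rec: _ => [|k x _ hx]; [exact: gm_deg0|exact: gm_degD].
by rewrite !big_cons (ev_add Uq eta (hf j) hs hy qy) IH.
Qed.

Lemma ev_zero m y : good q m y -> secev (0 : shmor F H U) q m y = 0.
Proof.
move=> g; have := ev_lin Uq 1 (0 : shmor F H U) 0 g; rewrite scaler0 addr0 (oring_const1 Uq) scale1r => e.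
by apply: (addrI (secev (0 : shmor F H U) q m y)); rewrite -e addr0.
Qed.

Lemma evZ (al : oring U) (eta : shmor F H U) m y : good q m y ->
  secev (al *: eta) q m y = oring_val al Uq *: secev eta q m y.
Proof. by move=> g; have := ev_lin Uq al eta 0 g; rewrite addr0 (ev_zero g) addr0. Qed.

Lemma evD (eta eta' : shmor F H U) m y : good q m y ->
  secev (eta + eta') q m y = secev eta q m y + secev eta' q m y.
Proof. by move=> g; have := ev_lin Uq 1 eta eta' g; rewrite (oring_const1 Uq) !scale1r. Qed.

Lemma ev_big (J : Type) (l : seq J) (f : J -> shmor F H U) m y : good q m y ->
  secev (\sum_(j <- l) f j) q m y = \sum_(j <- l) secev (f j) q m y.
Proof.
by move=> g; elim: l => [|j l IH]; rewrite ?big_nil ?ev_zero // !big_cons evD // IH.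
Qed.
End EvMore.

(** * Endomorphisms of the sheaf Hom *)

Section Sheaf.
Variables (K : pzRingType) (S : gralg K) (CN V : grmod S) (T J : Type) (m : nat) (a : 'I_m -> int) (b : J -> int).
Variables (du : T -> J -> int) (us : T -> J -> S) (rho : 'I_m -> J -> hom CN (gself S)) (Fc : T -> 'I_m -> CN).
Local Notation rh j i x := (hom_fun (rho j i) x : S).
Local Notation eF l i0 j := (du l i0 + a j - b i0).
Hypotheses (duE : forall l i i0, du l i = du l i0 - b i0 + b i)
  (us_deg : forall l i, ga_deg (du l i) (us l i))
  (rho_deg : forall j i e x, gm_deg e x -> ga_deg (e - (a j - b i)) (rh j i x))
  (rho_row : forall l i0 i j x, us l i0 * rh j i x = us l i * rh j i0 x)
  (rho_key : forall l i0 x, us l i0 *: x = \sum_j rh j i0 x *: Fc l j)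
  (Fc_deg : forall l i0 j, gm_deg (eF l i0 j) (Fc l j)).
Variables (v0 : T -> J -> V) (e0 : T -> J -> int).
Hypotheses (v0_deg : forall l i, gm_deg (e0 l i) (v0 l i))
  (v0_gen : forall l i d (w : V), gm_deg d w -> exists N x,
    ga_deg (d + du l i *+ N - e0 l i) x /\ us l i ^+ N *: w = x *: v0 l i).

Local Notation FC := (tilde CN).
Local Notation HV := (tilde V).
Implicit Types (p q : proj_point S) (U W : popen S).

(** Near q, eta of the germ of one local generator [Fc l j] is a single fraction, rewritten as a
    multiple of v0 because V is cyclic where u_l(e_{i0}) is invertible. The cofactor f is kept free
    so that later sums can use it. *)
Lemma decomp1 U (eta : shmor FC HV U) q l i0 x j :
  ga_deg 1 x -> U q -> ~ q (us l i0) -> ~ q x ->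
  exists T : int * (S * S), [/\ ga_deg T.1 T.2.1, ~ q T.2.1,
    ga_deg (T.1 + a j - b i0 - e0 l i0) T.2.2 &
    forall p e f y, U p -> ~ p T.2.1 -> ga_deg (e - (a j - b i0)) f -> ga_deg e y -> ~ p y ->
      secev eta p (f *: Fc l j) (us l i0 * y) = fr p ((T.2.2 * f) *: v0 l i0) (T.2.1 * y)].
Proof.
move=> hx Uq qu qx; have hus := us_deg l i0.
(* As x has degree 1, x^N0 raises the degree of [Fc l j] to a natural number k, and x^k can serve as
   denominator. *)
pose N0 := `|eF l i0 j|%N.
have [k hk] : exists k : nat, N0%:Z + eF l i0 j = k%:Z.
  by exists (absz (N0%:Z + eF l i0 j)); rewrite /N0; move: (eF l i0 j) => z; clear; lia.
have hxn N : ga_deg N%:Z (x ^+ N) by apply: ga_deg_exp1.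
have hm : gm_deg k%:Z (x ^+ N0 *: Fc l j).
  by rewrite -hk; apply: gm_degZ => //; apply: Fc_deg.
have hxh : homogeneous x by exists 1.
pose W := pcap U (Dop hxh); have Wq : W q by split.
have hW p : W p -> ~ p (x ^+ k) by move=> [_ px]; apply: not_pt_exp.
pose s := sm_fun eta (@pcapl _ _ U (Dop hxh)) (frsec hm (hxn k) hW) : sec V W.
have [V' [w [z [d [V'W V'q hw hz [V'z hs]]]]]] := sec_near s Wq.
have evw p : V' p -> secev eta p (x ^+ N0 *: Fc l j) (x ^+ k) = fr p w z.
  by move=> V'p; rewrite -(hs p V'p (V'W p V'p)); symmetry; apply: ev_frsec.
have [N [xw [hxw exw]]] := v0_gen l i0 hw.
have [g [[dg hg] qg gV]] : exists g, [/\ homogeneous g, ~ q g & forall p, ~ p g -> V' p].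
  case: (po_open V') => E [hE VE]; have /VE [g [Eg qg]] := V'q; exists g; split=> //; first exact: hE.
  by move=> p pg; apply/VE; exists g.
have husN := ga_deg_exp N hus.
have hv0 := v0_deg l i0.
exists (du l i0 + N0%:Z + du l i0 *+ N + d + dg,
  (us l i0 * x ^+ N0 * us l i0 ^+ N * z * g, x ^+ k * xw * g)) => /=; split.
- exact: (ga_degM (ga_degM (ga_degM (ga_degM hus (hxn N0)) husN) hz) hg).
- by apply: out_mul => //; apply: out_mul; [apply: out_mul; [apply: out_mul => //|]; exact: not_pt_exp|exact: V'z].
- apply: (ga_degE (ga_degM (ga_degM (hxn k) hxw) hg)); rewrite -hk; ring.
move=> p e f y Up pD hf hy py.
have [p1 p2 p3 p4 p5] : [/\ ~ p (us l i0), ~ p (x ^+ N0), ~ p (us l i0 ^+ N), ~ p z & ~ p g].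
  split=> h; apply: pD.
  - by do 4!apply: pt_mulr.
  - by do 3!apply: pt_mulr; apply: pt_mull.
  - by do 2!apply: pt_mulr; apply: pt_mull.
  - by apply: pt_mulr; apply: pt_mull.
  - exact: pt_mull.
have px : ~ p x by have [] := V'W p (gV p p5).
have pxN M : ~ p (x ^+ M) by apply: not_pt_exp.
have g1 : good p (f *: Fc l j) (us l i0 * y).
  apply: (@goodI _ _ _ (e + du l i0)) => //.
  - apply: (gm_degE (gm_degZ hf (Fc_deg l i0 j))); ring.
  - apply: (ga_degE (ga_degM hus hy)); ring.
  - exact: out_mul.
have g2 : good (M := gself S) p (f * x ^+ k) (us l i0 * y * x ^+ N0).
  apply: (@goodI _ _ (gself S) (e - (a j - b i0) + k%:Z)) => //.
  - exact: ga_degM.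
  - apply: (ga_degE (ga_degM (ga_degM hus hy) (hxn N0))); rewrite -hk; ring.
  - by do 2![apply: out_mul => //].
have g3 : good p (x ^+ N0 *: Fc l j) (x ^+ k) by apply: (goodI hm (hxn k)); apply: pxN.
have g4 : good p w z by apply: goodI hw hz p4.
have g5 : good p (xw *: v0 l i0) (us l i0 ^+ N * z).
  apply: (@goodI _ _ _ (d + du l i0 *+ N)).
  - by apply: (gm_degE (gm_degZ hxw hv0)); ring.
  - by rewrite addrC; apply: ga_degM.
  - exact: out_mul.
rewrite (ev_eq Up eta g1 (goodM g2 g3)); last first.
  apply: (fr_eqW g1 (goodM g2 g3)); rewrite !scalerA; congr (_ *: _); ring.
rewrite (ev_scale Up eta g2 g3) evw; last exact: gV.
have -> : fr p w z = fr p (xw *: v0 l i0) (us l i0 ^+ N * z).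
  by apply: (fr_eqW g4 g5); rewrite -exw !scalerA; congr (_ *: _); ring.
rewrite (frZ g2 g5); apply: (fr_eqW (goodM g2 g5)).
  apply: (@goodI _ _ _ (du l i0 + N0%:Z + du l i0 *+ N + d + dg + e)).
  - apply: (gm_degE (gm_degZ (ga_degM (ga_degM (ga_degM (hxn k) hxw) hg) hf) hv0)).
    by rewrite -hk; ring.
  - by do 5![apply: ga_degM => //].
  - exact: out_mul.
by rewrite !scalerA; congr (_ *: _); ring.
Qed.

Definition gsum (be : 'I_m -> S) i x : S := \sum_j be j * rh j i x.

Lemma gsum_deg be i x e d : gm_deg e x -> (forall j, ga_deg (d + a j - b i) (be j)) ->
  ga_deg (d + e) (gsum be i x).
Proof.
move=> hx hb; apply: (@big_ind _ (fun z : S => ga_deg (d + e) z)); first exact: ga_deg0.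
  by move=> u v; apply: (@gm_degD _ _ (gself S)).
move=> j _; apply: (ga_degE (ga_degM (hb j) (rho_deg j i hx))); ring.
Qed.

Lemma gsum_row be l i0 i x : us l i0 * gsum be i x = us l i * gsum be i0 x.
Proof.
rewrite !mulr_sumr; apply: eq_bigr => j _.
by rewrite mulrCA rho_row mulrCA.
Qed.

Lemma decomp U (eta : shmor FC HV U) q l i0 x :
  ga_deg 1 x -> U q -> ~ q (us l i0) -> ~ q x ->
  exists dh h be, [/\ ga_deg dh h, ~ q h, forall p, ~ p h -> ~ p (us l i0),
    forall j, ga_deg (dh + a j - b i0 - e0 l i0) (be j) &
    forall p e F y, U p -> ~ p h -> gm_deg e F -> ga_deg e y -> ~ p y ->
      secev eta p F y = fr p (gsum be i0 F *: v0 l i0) (h * y)].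
Proof.
move=> hx Uq qu qx; have hus := us_deg l i0.
have [X hX] := choice (fun j => decomp1 eta j hx Uq qu qx).
pose D j := (X j).2.1; pose ga j := (X j).2.2; pose dD j := (X j).1.
have hD j : ga_deg (dD j) (D j) by case: (hX j).
pose D' j := \prod_(k | k != j) D k.
have eD j : \prod_k D k = D j * D' j by rewrite (bigD1 j).
have hbe j : ga_deg (du l i0 + \sum_k dD k + a j - b i0 - e0 l i0) (us l i0 * ga j * D' j).
  have [_ _ h _] := hX j.
  apply: (ga_degE (ga_degM (ga_degM hus h) (ga_deg_prod (fun k => k != j) hD))).
  by rewrite [in RHS](bigD1 j) //= /dD; ring.
have hh : ga_deg (du l i0 + \sum_k dD k) (us l i0 * \prod_k D k).
  exact: ga_degM hus (ga_deg_prod predT hD).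
exists (du l i0 + \sum_k dD k), (us l i0 * \prod_k D k), (fun j => us l i0 * ga j * D' j).
split=> //.
- by apply: out_mul => //; apply/out_prod => j; case: (hX j).
- by move=> p ph h; apply: ph; apply: pt_mulr.
move=> p e F y Up ph hF hy py.
have pu : ~ p (us l i0) by move=> h; apply: ph; apply: pt_mulr.
have pD j : ~ p (D j).
  by move: j; apply/out_prod => h; apply: ph; apply: pt_mull.
have gx : good p F y by apply: goodI hF hy py.
have gu : good p (us l i0 *: F) (us l i0 * y).
  by apply: (goodI (gm_degZ hus hF) (ga_degM hus hy)); apply: out_mul.
rewrite (ev_eq Up eta gx gu); last by apply: (fr_eqW gx gu); rewrite !scalerA; congr (_ *: _); ring.
have hterm j : gm_deg (du l i0 + e) (rh j i0 F *: Fc l j).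
  by apply: (gm_degE (gm_degZ (rho_deg j i0 hF) (Fc_deg l i0 j))); ring.
rewrite rho_key (ev_sum Up eta _ hterm (ga_degM hus hy)); last exact: out_mul.
have hv0 := v0_deg l i0.
have hterm2 j : gm_deg (du l i0 + \sum_k dD k + e) ((us l i0 * ga j * D' j * rh j i0 F) *: v0 l i0).
  by apply: (gm_degE (gm_degZ (ga_degM (hbe j) (rho_deg j i0 hF)) hv0)); ring.
rewrite /gsum scaler_suml -(fr_sum _ hterm2 (ga_degM hh hy)); last exact: out_mul.
apply: eq_bigr => j _; have [_ _ hga hev] := hX j.
rewrite (hev p e _ y Up (pD j) (rho_deg j i0 hF) hy py); apply: fr_eqW.
- apply: (@goodI _ _ _ (dD j + e)).
  + by apply: (gm_degE (gm_degZ (ga_degM hga (rho_deg j i0 hF)) hv0)); rewrite /dD; ring.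
  + exact: ga_degM.
  + by apply: out_mul => //; apply: pD.
- by apply: (goodI (hterm2 j) (ga_degM hh hy)); apply: out_mul.
by rewrite !scalerA (eD j) /ga /D; congr (_ *: _); ring.
Qed.

Fact rv_linear j i (v : V) : linear (fun x : CN => rh j i x *: v).
Proof.
move=> u x y; have -> : rh j i (u *: x + y) = u * rh j i x + rh j i y := hom_linear (rho j i) u x y.
by rewrite scalerDl scalerA.
Qed.
Definition rv j i (v : V) : hom CN V :=
  SubmodElt (introT (asboolP _) (rv_linear j i v) :
    ((fun x : CN => rh j i x *: v) : depfun (fun _ : CN => V)) \in subpred (hom_submod CN V)).
Lemma rvE j i v x : hom_fun (rv j i v) x = rh j i x *: v. Proof. by []. Qed.

Lemma rv_deg j i (v : V) dv : gm_deg dv v ->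
  forall e x, gm_deg e x -> gm_deg (dv - (a j - b i) + e) (hom_fun (rv j i v) x).
Proof. by move=> hv e x hx; rewrite rvE; apply: (gm_degE (gm_degZ (rho_deg j i hx) hv)); ring. Qed.

Local Notation N := (sheaf_hom FC HV).
Variable Theta : shmor N N (whole S).

Definition Th U (eta : shmor FC HV U) : shmor FC HV U :=
  sm_fun Theta ((fun _ _ => Logic.I) : psub U (whole S)) (eta : N U).

Lemma Th_res U W (h : psub W U) (eta : shmor FC HV U) p x y : W p -> good p x y ->
  secev (Th (shmor_res h eta)) p x y = secev (Th eta) p x y.
Proof.
move=> Wp g; rewrite -(ev_res h (Th eta) Wp g).
have -> : Th (shmor_res h eta) = shmor_res h (Th eta); last by [].
apply: etrans (esym (sm_nat Theta ((fun _ _ => Logic.I) : psub U (whole S)) h (eta : N U))).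
exact: sm_irr.
Qed.

Lemma Th_lin U (al : oring U) (eta eta' : shmor FC HV U) :
  Th (al *: eta + eta') = al *: Th eta + Th eta'.
Proof. exact: (sm_lin Theta ((fun _ _ => Logic.I) : psub U (whole S)) al eta eta'). Qed.
Lemma Th0 U : Th (0 : shmor FC HV U) = 0.
Proof.
have := Th_lin 1 (0 : shmor FC HV U) 0; rewrite scaler0 addr0 scale1r => e.
by apply: (addrI (Th (0 : shmor FC HV U))); rewrite -e addr0.
Qed.
Lemma ThZ U (al : oring U) (eta : shmor FC HV U) : Th (al *: eta) = al *: Th eta.
Proof. by rewrite -[al *: eta]addr0 Th_lin Th0 addr0. Qed.
Lemma ThD U (eta eta' : shmor FC HV U) : Th (eta + eta') = Th eta + Th eta'.
Proof. by have := Th_lin 1 eta eta'; rewrite !scale1r. Qed.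
Lemma Th_sum U (J' : Type) (s : seq J') (f : J' -> shmor FC HV U) :
  Th (\sum_(j <- s) f j) = \sum_(j <- s) Th (f j).
Proof. exact: (big_morph (@Th U) (@ThD U) (@Th0 U)). Qed.

(** Row j of a matrix of Theta over the open set where H does not vanish: rho_{j i} v / x goes to
    Σ_j' P_j' rho_{j' i} v / (H x), with the same P and H for all i, v and x. *)
Definition Val j (dH : int) (H : S) (P : 'I_m -> S) : Prop :=
  [/\ ga_deg dH H, forall j', ga_deg (dH + a j' - a j) (P j') &
  forall i v dv x U (hv : gm_deg dv v) (hx : ga_deg (dv - (a j - b i)) x)
    (hU : forall p, U p -> ~ p x) p e F y,
    U p -> ~ p H -> gm_deg e F -> ga_deg e y -> ~ p y ->
    secev (Th (hmor (rv_deg j i hv) hx hU)) p F y = fr p (gsum P i F *: v) (H * (x * y))].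

(** Theta is evaluated on the single morphism rho_{j i0} v0. Where u_l(e_{i0}) is invertible, rho_{j
    i} is a multiple of rho_{j i0} and v one of v0, so every rho_{j i} v is this morphism times a
    section of the structure sheaf. *)
Lemma Val_near j q l i0 x : ga_deg 1 x -> ~ q (us l i0) -> ~ q x ->
  exists dH H P, Val j dH H P /\ ~ q H.
Proof.
move=> hx qu qx; have hus := us_deg l i0.
have hxn M : ga_deg M%:Z (x ^+ M) by apply: ga_deg_exp1.
have hv0 := v0_deg l i0.
pose z0 := e0 l i0 - (a j - b i0); pose n0 := `|z0|%N.
have [k hk] : exists k : nat, n0%:Z + z0 = k%:Z.
  by exists (absz (n0%:Z + z0)); rewrite /n0; move: (z0) => z; clear; lia.
have hv1 : gm_deg (n0%:Z + e0 l i0) (x ^+ n0 *: v0 l i0) by apply: gm_degZ.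
have hx0 : ga_deg (n0%:Z + e0 l i0 - (a j - b i0)) (x ^+ k).
  by apply: (ga_degE (hxn k)); rewrite -hk /z0; ring.
have hxh : homogeneous x by exists 1.
have hU0 p : Dop hxh p -> ~ p (x ^+ k) by move=> px; apply: not_pt_exp.
pose eta0 := hmor (rv_deg j i0 hv1) hx0 hU0.
have U0q : Dop hxh q by [].
have [dh [h [be [hh qh ph_us hbe hev]]]] := decomp (Th eta0) hx U0q qu qx.
pose H := us l i0 * x ^+ n0.+1 * h.
pose P j' := us l i0 * x ^+ k.+1 * be j'.
have prP i F : gsum P i F = us l i0 * x ^+ k.+1 * gsum be i F.
  by rewrite /gsum mulr_sumr; apply: eq_bigr => j' _; rewrite -!mulrA.
exists (du l i0 + n0.+1%:Z + dh), H, P; split; last first.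
  by do 2![apply: out_mul => //]; apply: not_pt_exp.
split.
- exact: (ga_degM (ga_degM hus (hxn _)) hh).
- move=> j'; apply: (ga_degE (ga_degM (ga_degM hus (hxn k.+1)) (hbe j'))).
  by rewrite -[k.+1]addn1 -[n0.+1]addn1 !PoszD -hk /z0; ring.
move=> i v dv x' U hv hx' hU p e F y Up pH hF hy py.
have [N' [al0 [hal0 eal0]]] := v0_gen l i0 hv.
have ph : ~ p h by move=> hp; apply: pH; apply: pt_mull.
have pu : ~ p (us l i0) := ph_us p ph.
have px : ~ p x.
  by move=> hp; apply: pH; apply: pt_mulr; apply: pt_mull; rewrite exprS; apply: pt_mulr.
have hush : homogeneous (us l i0) by exists (du l i0).
pose W := pcap U (pcap (Dop hxh) (Dop hush)).
have WU : psub W U by move=> p' [].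
have WU0 : psub W (Dop hxh) by move=> p' [_ []].
have Wp : W p by split.
pose A1 := us l i * al0 * x ^+ k; pose A2 := us l i0 ^+ N'.+1 * x ^+ n0 * x'.
have hA1 : ga_deg (du l i + (dv + du l i0 *+ N' - e0 l i0) + k%:Z) A1.
  by do 2![apply: ga_degM => //]; apply: us_deg.
have hA2 : ga_deg (du l i + (dv + du l i0 *+ N' - e0 l i0) + k%:Z) A2.
  apply: (ga_degE (ga_degM (ga_degM (ga_deg_exp N'.+1 hus) (hxn n0)) hx')).
  by rewrite -hk /z0 mulrS (duE l i i0); ring.
have hWA p' : W p' -> ~ p' A2.
  move=> [/hU h1 [h2 h3]]; do 2![apply: out_mul => //]; exact: not_pt_exp.
pose al : oring W := @frsec _ _ (gself S) W A1 A2 _ hA1 hA2 hWA.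
have gal p' : W p' -> good (M := gself S) p' A1 A2.
  by move=> Wp'; apply: (@goodI _ _ (gself S) _ _ _ _ hA1 hA2); apply: (hWA).
have eres : shmor_res WU (hmor (rv_deg j i hv) hx' hU) = al *: shmor_res WU0 eta0.
  apply: shmor_ev_ext => p' F' y' Wp' g'.
  have [e' [hF' hy' py']] := g'.
  have p'x' := hU p' (WU p' Wp').
  rewrite (ev_res WU _ Wp' g') ev_hmor //; last exact: WU.
  rewrite (evZ Wp' al _ g') (ev_res WU0 _ Wp' g') ev_hmor //; last exact: WU0.
  have g1 := good_hom (rv_deg j i hv) hx' p'x' g'.
  have g2 := good_hom (rv_deg j i0 hv1) hx0 (hU0 p' (WU0 p' Wp')) g'.
  rewrite [oring_val al Wp'](_ : _ = fr (M := gself S) p' A1 A2) // (frZ (gal p' Wp') g2).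
  apply: (fr_eqW g1 (goodM (gal p' Wp') g2)); rewrite !rvE.
  transitivity ((x ^+ n0 * x' * x ^+ k * y' * (us l i0 * rh j i F')) *: (us l i0 ^+ N' *: v)).
    by rewrite !scalerA /A2 exprS; congr (_ *: _); ring.
  by rewrite rho_row eal0 !scalerA /A1; congr (_ *: _); ring.
have gF : good p F y by apply: goodI hF hy py.
rewrite -(Th_res WU _ Wp gF) eres ThZ (evZ Wp al _ gF) (Th_res WU0 _ Wp gF).
rewrite [oring_val al Wp](_ : _ = fr (M := gself S) p A1 A2) //.
rewrite (hev p e F y (WU0 p Wp) ph hF hy py).
have g2 : good p (gsum be i0 F *: v0 l i0) (h * y).
  apply: (@goodI _ _ _ (dh + e)) => //; last exact: out_mul.
    apply: (gm_degE (gm_degZ (gsum_deg (d := dh - e0 l i0) hF _) hv0)); last by ring.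
    by move=> j'; apply: (ga_degE (hbe j')); ring.
  exact: ga_degM.
rewrite (frZ (gal p Wp) g2); apply: (fr_eqW (goodM (gal p Wp) g2)).
  have hp : ~ p (H * (x' * y)) by apply: out_mul => //; apply: out_mul => //; apply: (hU).
  apply: (@goodI _ _ _ (du l i0 + n0.+1%:Z + dh + (dv - (a j - b i) + e))) => //; last first.
    exact: (ga_degM (ga_degM (ga_degM hus (hxn _)) hh) (ga_degM hx' hy)).
  rewrite prP.
  have hg : ga_deg (dh - e0 l i0 + b i - b i0 + e) (gsum be i F).
    by apply: gsum_deg => // j'; apply: (ga_degE (hbe j')); ring.
  apply: (gm_degE (gm_degZ (ga_degM (ga_degM hus (hxn k.+1)) hg) hv)).
  rewrite -[k.+1]addn1 -[n0.+1]addn1 !PoszD -hk /z0; ring.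
rewrite prP /H; symmetry.
transitivity ((us l i0 * x ^+ n0 * x' * h * y * x ^+ k.+1 * (us l i0 * gsum be i F)) *: (us l i0 ^+ N' *: v)).
  by rewrite !scalerA /A2 exprS; congr (_ *: _); ring.
by rewrite gsum_row eal0 !scalerA /A1 !exprS; congr (_ *: _); ring.
Qed.

Lemma gsumZ be i u F : gsum be i (u *: F) = u * gsum be i F.
Proof.
rewrite /gsum mulr_sumr; apply: eq_bigr => j _.
by rewrite (hom_funZ (rho j i) u F) -[u *: _]/(u * _) mulrCA.
Qed.

Lemma shift_ge0 (z : int) : exists k0 k : nat, k0%:Z + z = k%:Z.
Proof. by exists (absz z), (absz ((absz z)%:Z + z)); lia. Qed.

Lemma shift_all (I0 : finType) (z : I0 -> int) : exists (k0 : nat) (k : I0 -> nat),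
  forall i, k0%:Z + z i = (k i)%:Z.
Proof.
exists (\sum_i absz (z i))%N, (fun i => absz ((\sum_i absz (z i))%N%:Z + z i)) => i.
have : (absz (z i) <= \sum_i absz (z i))%N by rewrite (bigD1 i) //= leq_addr.
lia.
Qed.

Section Shift16.
Variables (x : S) (hx : ga_deg 1 x).
Let hxn M : ga_deg M%:Z (x ^+ M) := ga_deg_exp1 M hx.
Let hxh : homogeneous x. Proof. by exists 1. Qed.
Let hDx M p : Dop hxh p -> ~ p (x ^+ M). Proof. by move=> px; apply: not_pt_exp. Qed.

Lemma shift_germ q e (F : CN) : gm_deg e F -> ~ q x -> exists n1 k1 : nat,
  gm_deg k1%:Z (x ^+ n1 *: F) /\ good q (x ^+ n1 *: F) (x ^+ k1).
Proof.
move=> hF qx; have [n1 [k1 e1]] := shift_ge0 e; exists n1, k1.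
have h : gm_deg k1%:Z (x ^+ n1 *: F) by rewrite -e1; apply: gm_degZ.
by split=> //; apply: (goodI h) => //; apply: not_pt_exp.
Qed.

Lemma Val_compare j dH H P dH' H' P' : Val j dH H P -> Val j dH' H' P' ->
  forall q l i e F, ~ q H -> ~ q H' -> ~ q x -> gm_deg e F ->
  exists u, [/\ homogeneous u, ~ q u &
    u *: (gsum (fun j' => H' * P j' - H * P' j') i F *: v0 l i) = 0].
Proof.
move=> [hH hP hV] [hH' hP' hV'] q l i e F qH qH' qx hF.
have [n0 [k0 ek]] := shift_ge0 (e0 l i - (a j - b i)).
have [n1 [k1 [hF1 gF1]]] := shift_germ hF qx.
have hv : gm_deg (n0%:Z + e0 l i) (x ^+ n0 *: v0 l i) by apply: gm_degZ.
have hz : ga_deg (n0%:Z + e0 l i - (a j - b i)) (x ^+ k0) by rewrite -addrA ek.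
have qxn M : ~ q (x ^+ M) by apply: not_pt_exp.
have Uq : Dop hxh q by [].
have := hV i _ _ _ (Dop hxh) hv hz (@hDx k0) q _ _ _ Uq qH hF1 (hxn k1) (qxn k1).
rewrite (hV' i _ _ _ (Dop hxh) hv hz (@hDx k0) q _ _ _ Uq qH' hF1 (hxn k1) (qxn k1)).
have gd dH1 H1 P1 : ga_deg dH1 H1 -> (forall j', ga_deg (dH1 + a j' - a j) (P1 j')) -> ~ q H1 ->
    good q (gsum P1 i (x ^+ n1 *: F) *: (x ^+ n0 *: v0 l i)) (H1 * (x ^+ k0 * x ^+ k1)).
  move=> h1 h2 h3; apply: (@goodI _ _ _ (dH1 + (k0%:Z + k1%:Z))).
  - have h4 : ga_deg (dH1 - a j + b i + k1%:Z) (gsum P1 i (x ^+ n1 *: F)).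
      by apply: gsum_deg => // j'; apply: (ga_degE (h2 j')); ring.
    by apply: (gm_degE (gm_degZ h4 hv)); rewrite -ek; ring.
  - by apply: ga_degM => //; apply: ga_degM.
  - by apply: out_mul => //; apply: out_mul.
move=> /(fr_eq (gd _ _ _ hH' hP' qH') (gd _ _ _ hH hP qH)) [u [hu qu eu]].
exists (u * (x ^+ k0 * x ^+ k1 * x ^+ n1 * x ^+ n0)); split.
- by apply: homogM => //; exists (k0%:Z + k1%:Z + n1%:Z + n0%:Z); do 3![apply: ga_degM => //].
- by apply: out_mul => //; do 3![apply: out_mul => //].
have -> : gsum (fun j' => H' * P j' - H * P' j') i F = H' * gsum P i F - H * gsum P' i F.
  by rewrite /gsum !mulr_sumr -sumrB; apply: eq_bigr => j' _; rewrite mulrBl !mulrA.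
move/eqP: eu; rewrite !gsumZ -subr_eq0 => /eqP eu.
rewrite scalerBl scalerBr; apply: oppr_inj; rewrite oppr0 -[RHS]eu opprB.
by congr (_ - _); rewrite !scalerA; congr (_ *: _); ring.
Qed.

Lemma hmor_vanish : (forall U (eta : shmor FC HV U), eta = 0) ->
  forall q l j i e F, ~ q x -> gm_deg e F ->
  exists u, [/\ homogeneous u, ~ q u & u *: (rh j i F *: v0 l i) = 0].
Proof.
move=> h0 q l j i e F qx hF.
have [n0 [k0 ek]] := shift_ge0 (e0 l i - (a j - b i)).
have [n1 [k1 [hF1 gF1]]] := shift_germ hF qx.
have hv : gm_deg (n0%:Z + e0 l i) (x ^+ n0 *: v0 l i) by apply: gm_degZ.
have hz : ga_deg (n0%:Z + e0 l i - (a j - b i)) (x ^+ k0) by rewrite -addrA ek.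
have qxn M : ~ q (x ^+ M) by apply: not_pt_exp.
have Uq : Dop hxh q by [].
have := ev_hmor (rv_deg j i hv) hz (@hDx k0) Uq gF1.
rewrite (h0 _ (hmor _ _ _)) (ev_zero V Uq gF1) => /esym.
have g1 := good_hom (rv_deg j i hv) hz (qxn k0) gF1.
move/(fr_eq0 g1) => [u [hu qu eu]].
exists (u * (x ^+ n1 * x ^+ n0)); split.
- by apply: homogM => //; exists (n1%:Z + n0%:Z); apply: ga_degM.
- by apply: out_mul => //; apply: out_mul.
rewrite -[RHS]eu rvE (hom_funZ (rho j i) (x ^+ n1) F) -[x ^+ n1 *: _]/(x ^+ n1 * _).
by rewrite !scalerA; congr (_ *: _); ring.
Qed.

Section Matrix.
Variable P : 'I_m -> 'I_m -> S.
Hypothesis P_deg : forall j j', ga_deg (a j' - a j) (P j j').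
Hypothesis P_Val : forall j dH H B, Val j dH H B ->
  forall i F, exists N, H ^+ N * (gsum B i F - H * gsum (P j) i F) = 0.

Lemma Theta_P j i v dv z U (hv : gm_deg dv v) (hz : ga_deg (dv - (a j - b i)) z)
    (hU : forall p, U p -> ~ p z) q l i0 e F y :
  ~ q (us l i0) -> ~ q x -> U q -> gm_deg e F -> ga_deg e y -> ~ q y ->
  secev (Th (hmor (rv_deg j i hv) hz hU)) q F y = fr q (gsum (P j) i F *: v) (z * y).
Proof.
move=> qu qx Uq hF hy qy.
have [dH [H [B [HV qH]]]] := Val_near j hx qu qx.
have [hH hB hV] := HV.
rewrite (hV i v dv z U hv hz hU q e F y Uq qH hF hy qy).
have [N0 eN] := P_Val HV i F; have qz := hU q Uq.
apply/fr_eq.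
- apply: (@goodI _ _ _ (dH + (dv - (a j - b i) + e))).
  + have h : ga_deg (dH - a j + b i + e) (gsum B i F).
      by apply: gsum_deg => // j'; apply: (ga_degE (hB j')); ring.
    by apply: (gm_degE (gm_degZ h hv)); ring.
  + by apply: ga_degM => //; apply: ga_degM.
  + by apply: out_mul => //; apply: out_mul.
- apply: (@goodI _ _ _ (dv - (a j - b i) + e)).
  + have h : ga_deg (- a j + b i + e) (gsum (P j) i F).
      by apply: gsum_deg => // j'; apply: (ga_degE (P_deg j j')); ring.
    by apply: (gm_degE (gm_degZ h hv)); ring.
  + exact: ga_degM.
  + exact: out_mul.
exists (H ^+ N0); split; [by exists (dH *+ N0); apply: ga_deg_exp|exact: not_pt_exp|].
rewrite !scalerA; apply/eqP; rewrite -subr_eq0 -scalerBl; apply/eqP.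
have -> : H ^+ N0 * (z * y) * gsum B i F - H ^+ N0 * (H * (z * y)) * gsum (P j) i F =
   (z * y) * (H ^+ N0 * (gsum B i F - H * gsum (P j) i F)) by ring.
by rewrite eN mulr0 scale0r.
Qed.

(** A relation Σ be_j rho_j = 0 makes the combination Σ be_j rho_{j i} v0 the zero morphism; its
    image under Theta is computed by the same combination of the rows of P. *)
Lemma relation_P (be : 'I_m -> S) (bk : int) :
  (forall j, ga_deg (a j - bk) (be j)) ->
  (forall i F, \sum_j be j * rh j i F = 0) ->
  forall q l i e F, ~ q (us l i) -> ~ q x -> gm_deg e F ->
  exists u, [/\ homogeneous u, ~ q u &
    u *: (gsum (fun j' => \sum_j be j * P j j') i F *: v0 l i) = 0].
Proof.
move=> hbe rel q l i e F qu qx hF.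
have [n0 [k ek]] := shift_all (fun j => e0 l i - (a j - b i)).
have [s0 [s es]] := shift_all (fun j => a j - bk).
have [n1 [k1 [hF1 gF1]]] := shift_germ hF qx.
have hv : gm_deg (n0%:Z + e0 l i) (x ^+ n0 *: v0 l i) by apply: gm_degZ.
have hz j : ga_deg (n0%:Z + e0 l i - (a j - b i)) (x ^+ k j) by rewrite -addrA (ek j).
have qxn M : ~ q (x ^+ M) by apply: not_pt_exp.
have Uq : Dop hxh q by [].
pose eta j := hmor (rv_deg j i hv) (hz j) (@hDx (k j)).
have hnum j : ga_deg (s j)%:Z (be j * x ^+ s0).
  by apply: (ga_degE (ga_degM (hbe j) (hxn s0))); rewrite -es; ring.
pose sc j : oring (Dop hxh) := @frsec _ _ (gself S) (Dop hxh) _ _ _ (hnum j) (hxn (s j)) (@hDx (s j)).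
have gsc p j : Dop hxh p -> good (M := gself S) p (be j * x ^+ s0) (x ^+ s j).
  by move=> px; exists (s j)%:Z; split; [exact: hnum|exact: hxn|exact: hDx].
(* The exponents [s j] and [k j] vary with j, their sum does not: all terms get the common
   denominator x^kk. *)
pose kk := absz (s0%:Z + n0%:Z + e0 l i + b i - bk)%R.
have ekk j : (s j + k j = kk)%N by have := ek j; have := es j; rewrite /kk; lia.
have exx j y : x ^+ s j * (x ^+ k j * y) = x ^+ kk * y by rewrite mulrA -exprD ekk.
have e_0 : \sum_j sc j *: eta j = 0.
  apply: shmor_ev_ext => p F' y' Up g'; have [e' [hF' hy' py']] := g'.
  rewrite (ev_big Up _ _ g') (ev_zero V Up g').
  have hterm j : gm_deg (kk%:Z + e') ((be j * x ^+ s0) *: (rh j i F' *: (x ^+ n0 *: v0 l i))).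
    apply: (gm_degE (gm_degZ (hnum j) (gm_degZ (rho_deg j i hF') hv))).
    by rewrite -(ekk j) PoszD -ek; ring.
  transitivity (\sum_j fr p ((be j * x ^+ s0) *: (rh j i F' *: (x ^+ n0 *: v0 l i))) (x ^+ kk * y')).
    apply: eq_bigr => j _; rewrite (evZ Up _ _ g') ev_hmor //.
    rewrite [oring_val (sc j) Up](_ : _ = fr (M := gself S) p (be j * x ^+ s0) (x ^+ s j)) //.
    by rewrite (frZ (gsc p j Up)) ?exx //; apply: (good_hom (rv_deg j i hv) (hz j) _ g'); apply: not_pt_exp.
  rewrite (fr_sum _ hterm (ga_degM (hxn kk) hy')); last by apply: out_mul => //; apply: not_pt_exp.
  under eq_bigr do rewrite !scalerA.
  rewrite -scaler_suml -[RHS](fr0 V p (x ^+ kk * y')); congr fr.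
  rewrite (_ : \sum_j _ = (x ^+ s0 * x ^+ n0) * \sum_j be j * rh j i F'); last first.
    by rewrite mulr_sumr; apply: eq_bigr => j _; ring.
  by rewrite rel mulr0 scale0r.
have := congr1 (fun z => secev (Th z) q (x ^+ n1 *: F) (x ^+ k1)) e_0.
rewrite Th0 (ev_zero V Uq gF1) Th_sum (ev_big Uq _ _ gF1).
have hg j : ga_deg (- a j + b i + k1%:Z) (gsum (P j) i (x ^+ n1 *: F)).
  by apply: gsum_deg => // j'; apply: (ga_degE (P_deg j j')); ring.
have hterm j : gm_deg (kk%:Z + k1%:Z) ((be j * x ^+ s0) *: (gsum (P j) i (x ^+ n1 *: F) *: (x ^+ n0 *: v0 l i))).
  apply: (gm_degE (gm_degZ (hnum j) (gm_degZ (hg j) hv))).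
  by rewrite -(ekk j) PoszD -ek; ring.
rewrite (_ : \sum_j _ = \sum_j fr q ((be j * x ^+ s0) *: (gsum (P j) i (x ^+ n1 *: F) *: (x ^+ n0 *: v0 l i))) (x ^+ kk * x ^+ k1)); last first.
  apply: eq_bigr => j _; rewrite ThZ (evZ Uq _ _ gF1).
  rewrite [oring_val (sc j) Uq](_ : _ = fr (M := gself S) q (be j * x ^+ s0) (x ^+ s j)) //.
  rewrite (@Theta_P j i _ _ _ (Dop hxh) hv (hz j) (@hDx (k j)) q l i _ _ _ qu qx Uq hF1 (hxn k1) (qxn k1)).
  rewrite (frZ (gsc q j Uq)) ?exx //.
  apply: (goodI (d := (k j)%:Z + k1%:Z)).
  - by apply: (gm_degE (gm_degZ (hg j) hv)); rewrite -ek; ring.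
  - exact: ga_degM.
  - exact: out_mul.
rewrite (fr_sum _ hterm (ga_degM (hxn kk) (hxn k1))); last exact: out_mul.
have gs : good q (\sum_j (be j * x ^+ s0) *: (gsum (P j) i (x ^+ n1 *: F) *: (x ^+ n0 *: v0 l i))) (x ^+ kk * x ^+ k1).
  apply: (goodI (d := kk%:Z + k1%:Z)); [|exact: ga_degM|exact: out_mul].
  by elim/big_rec: _ => [|j z _ hz']; [exact: gm_deg0|exact: gm_degD].
move/(fr_eq0 gs) => [u [hu qu' eu]].
exists (u * (x ^+ s0 * x ^+ n1 * x ^+ n0)); split.
- by apply: homogM => //; exists (s0%:Z + n1%:Z + n0%:Z); do 2![apply: ga_degM => //].
- by apply: out_mul => //; do 2![apply: out_mul => //].
rewrite -[RHS]eu -!scalerA; congr (_ *: _).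
rewrite !scalerA /gsum mulr_sumr scaler_suml.
under eq_bigr do rewrite mulr_suml mulr_sumr scaler_suml.
rewrite exchange_big; apply: eq_bigr => j _ /=.
rewrite -[\sum_j0 P j j0 * _]/(gsum (P j) i _) gsumZ !scalerA -scaler_suml; congr (_ *: _).
rewrite /gsum ?mulr_sumr ?mulr_suml ?mulr_sumr ?mulr_suml; apply: eq_bigr => j' _; ring.
Qed.

Variable kap : K.
Hypothesis P_kap : forall j i F, gsum (P j) i F = ga_scal S kap * rh j i F.

Lemma Theta_scalar U (eta : shmor FC HV U) q l i0 e F y :
  ~ q (us l i0) -> ~ q x -> U q -> gm_deg e F -> ga_deg e y -> ~ q y ->
  secev (Th eta) q F y = secev (oring_const U kap *: eta) q F y.
Proof.
move=> qu qx Uq hF hy qy.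
have gF : good q F y by apply: goodI hF hy qy.
have [dh [h [be [hh qh ph_us hbe hev]]]] := decomp eta hx Uq qu qx.
have hhh : homogeneous h by exists dh.
pose W := pcap U (Dop hhh); have WU : psub W U by move=> p [].
have Wq : W q by split.
have hW p : W p -> ~ p h by case.
have hv j : gm_deg (dh + a j - b i0) (be j *: v0 l i0).
  by apply: (gm_degE (gm_degZ (hbe j) (v0_deg l i0))); ring.
have hz j : ga_deg (dh + a j - b i0 - (a j - b i0)) h by apply: (ga_degE hh); ring.
have hterm j e' F' : gm_deg e' F' -> gm_deg (dh + e') (rh j i0 F' *: (be j *: v0 l i0)).
  by move=> hF'; apply: (gm_degE (gm_degZ (rho_deg j i0 hF') (hv j))); ring.
have evE p e' F' y' : W p -> gm_deg e' F' -> ga_deg e' y' -> ~ p y' ->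
    secev eta p F' y' = \sum_j fr p (rh j i0 F' *: (be j *: v0 l i0)) (h * y').
  move=> Wp hF' hy' py'; rewrite (hev p e' F' y' (WU p Wp) (hW p Wp) hF' hy' py').
  rewrite (fr_sum _ (fun j => hterm j e' F' hF') (ga_degM hh hy')); last by apply: out_mul => //; exact: hW.
  congr fr; rewrite /gsum scaler_suml; apply: eq_bigr => j _.
  by rewrite scalerA mulrC.
have eres : shmor_res WU eta = \sum_j hmor (rv_deg j i0 (hv j)) (hz j) hW.
  apply: shmor_ev_ext => p F' y' Wp g'; have [e' [hF' hy' py']] := g'.
  rewrite (ev_res WU _ Wp g') (ev_big Wp _ _ g') (evE p e') //.
  by apply: eq_bigr => j _; rewrite ev_hmor.
rewrite -(Th_res WU eta Wq gF) eres Th_sum (ev_big Wq _ _ gF) (evZ Uq _ _ gF) (evE q e) //.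
rewrite scaler_sumr; apply: eq_bigr => j _.
rewrite (Theta_P (l := l) (i0 := i0) _ _ _ qu qx Wq hF hy qy) P_kap.
have h1 : good (M := gself S) q (ga_scal S kap) 1.
  by exists 0; split; [exact: ga_deg_scal|exact: ga_deg1|exact: pt_proper].
rewrite [oring_val _ Uq](_ : _ = fr (M := gself S) q (ga_scal S kap) 1); last first.
  exact: (@frE _ _ (gself S) q).
have h2 := goodI (hterm j e F hF) (ga_degM hh hy) (out_mul qh qy).
by rewrite (frZ h1 h2) mul1r !scalerA.
Qed.
End Matrix.
End Shift16.

Hypothesis V_van : forall (w : V) d g, gm_deg d w -> homogeneous g ->
  forall q, ~ q g ->
  (forall p l i x, ga_deg 1 x -> ~ p g -> ~ p (us l i) -> ~ p x ->
     exists u, [/\ homogeneous u, ~ p u & u *: w = 0]) ->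
  exists u, [/\ homogeneous u, ~ q u & u *: w = 0].

(** Both sides agree at points where some u_l(e_i) is not zero. By [V_van] an element of V whose
    germs vanish at these points has vanishing germs everywhere, so the difference is zero. *)
Lemma Theta_global (kap : K) :
  (forall U (eta : shmor FC HV U) q l i0 x e F y, ga_deg 1 x ->
    ~ q (us l i0) -> ~ q x -> U q -> gm_deg e F -> ga_deg e y -> ~ q y ->
    secev (Th eta) q F y = secev (oring_const U kap *: eta) q F y) ->
  forall U (eta : shmor FC HV U), Th eta = oring_const U kap *: eta.
Proof.
move=> h U eta.
suff e : Th eta - oring_const U kap *: eta = (0 : shmor FC HV U) by apply: subr0_eq.
apply: shmor_ev_ext => q F y Uq g; rewrite (ev_zero V Uq g).
have [e [hF hy qy]] := g; have hyy : homogeneous y by exists e.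
pose W := pcap U (Dop hyy); have Wq : W q by [].
have WU : psub W U by move=> p [].
have hW p : W p -> ~ p y by case.
pose et := Th eta - oring_const U kap *: eta.
have [V' [w [z [d [V'W V'q hw hz [V'z hs]]]]]] := sec_near (sm_fun et WU (frsec hF hy hW) : sec V W) Wq.
have evw p : V' p -> secev et p F y = fr p w z.
  by move=> V'p; rewrite -(hs p V'p (V'W p V'p)); symmetry; apply: ev_frsec.
have gw p : V' p -> good p w z by move=> V'p; apply: (goodI hw hz); apply: V'z.
rewrite (evw q V'q); apply/(fr_eq0 (gw q V'q)).
have [g0 [hg qg gV]] : exists g, [/\ homogeneous g, ~ q g & forall p, ~ p g -> V' p].
  case: (po_open V') => E [hE VE]; have /VE [g0 [Eg qg]] := V'q; exists g0; split=> //; first exact: hE.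
  by move=> p pg; apply/VE; exists g0.
apply: (V_van hw hg qg) => p l i x hx pg pu px; apply/(fr_eq0 (gw p (gV p pg))).
have Wp := V'W p (gV p pg); have gp : good p F y by apply: (goodI hF hy); apply: (hW).
rewrite -(evw p (gV p pg)); have := evD (WU p Wp) et (oring_const U kap *: eta) gp.
rewrite subrK (h U eta p l i x e F y hx pu px (WU p Wp) hF hy (hW p Wp)) => e1.
by apply: (addIr (secev (oring_const U kap *: eta) p F y)); rewrite -e1 add0r.
Qed.
End Sheaf.

(** * From germs on Proj back to modules over the polynomial ring *)

Section Graded.
Variables (K : fieldType) (n : nat) (I : ideal (poly_gralg K n.+1)).
Local Notation R := {mpoly K[n.+1]}.
Local Notation gA := (gquot I).
Definition pr (r : R) : gA := qring_pi I r.
Fact pr_zmod : zmod_morphism pr. Proof. exact: (@qring_piB _ I). Qed.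
HB.instance Definition _ := GRing.isZmodMorphism.Build R gA pr pr_zmod.
Fact pr_monoid : monoid_morphism pr. Proof. exact: (@qring_pi_monoid_morphism _ I). Qed.
HB.instance Definition _ := GRing.isMonoidMorphism.Build R gA pr pr_monoid.

Lemma prM x y : pr (x * y) = pr x * pr y. Proof. exact: rmorphM. Qed.
Lemma prD x y : pr (x + y) = pr x + pr y. Proof. exact: rmorphD. Qed.
Lemma prB x y : pr (x - y) = pr x - pr y. Proof. exact: rmorphB. Qed.
Lemma prX x N : pr (x ^+ N) = pr x ^+ N. Proof. exact: rmorphXn. Qed.
Lemma xx_deg1 (r : 'I_n.+1) : ga_deg 1 (pr (xx K n r)).
Proof. by exists (xx K n r); split=> //; apply: poly_degX. Qed.

Lemma pr_eq0 r : pr r = 0 <-> I r.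
Proof.
rewrite -(rmorph0 (qring_pi I)); split=> [/quot_piP|h]; first by rewrite subr0.
by apply/quot_piP; rewrite subr0.
Qed.

Lemma pr_surj (x : gA) : exists r, x = pr r.
Proof. by elim/qring_ind: x => r; exists r. Qed.

Lemma pr_deg d r : poly_deg d r -> ga_deg d (pr r).
Proof. by move=> h; exists r. Qed.

Lemma pr_deg_surj d (x : gA) : ga_deg d x -> exists r, poly_deg d r /\ x = pr r.
Proof. by move=> [r [h ->]]; exists r. Qed.

Lemma homog_pr d r : poly_deg d r -> homogeneous (pr r).
Proof. by move=> h; exists d; apply: pr_deg. Qed.

Lemma poly_deg_ge0 d (r : R) : poly_deg d r -> r != 0 -> 0 <= d.
Proof. by case: d => // k /= ->; rewrite eqxx. Qed.

Lemma pos_deg_X d (y : R) : poly_deg d y -> 0 < d -> XS n.+1 (xx K n) R^o 0 y.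
Proof.
case: d => // k /= /dhomogP h k0; rewrite [y]mpolyE big_seq.
apply: (submod_sum (W := XS n.+1 (xx K n) R^o 0)) => mm /h e.
rewrite -mul_mpolyC; apply: idealMl.
have [i hi] : exists i, (0 < mm i)%N.
  apply/existsP; rewrite -[X in is_true X]negbK negb_exists; apply/negP => /forallP h0.
  have e0 : mdeg mm = 0%N.
    by rewrite mdegE; apply: big1 => i _; apply/eqP; rewrite -leqn0 leqNgt; exact: (h0 i).
  by move: k0; rewrite -(etrans (esym e0) e).
have le : (U_(i) <= mm)%MM by rewrite lep1mP -lt0n.
rewrite -(submK le) mpolyXD mulrC.
have -> : 'X_i = xx K n i by rewrite /xx inord_val.
have := @XS_x _ n.+1 (xx K n) R^o 0 i 'X_[mm - U_(i)]; rewrite -[_ *: _]/(_ * _) mulrC.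
by rewrite [_ * 'X_[_]]mulrC; apply; rewrite ltn_ord.
Qed.

Lemma pt_var (q : proj_point gA) : exists r : 'I_n.+1, ~ q (pr (xx K n r)).
Proof.
case: (pt_relevant q) => d [x [d0 /pr_deg_surj [y [hy ->]] qy]].
apply: contrapT => h; apply: qy; have [cf ->] := pos_deg_X hy d0.
rewrite rmorph_sum big_nat_cond; apply: (submod_sum (W := q)) => i; rewrite andbT => /andP[_ iL].
rewrite -[_ *: cf i]/(_ * _) rmorphM; apply: pt_mulr.
by apply: contrapT => h'; apply: h; exists (Ordinal iL).
Qed.
End Graded.

Section Rows.
Variables (K : fieldType) (n t c m : nat) (a : 'I_m -> int) (b : 'I_t -> int).
Local Notation R := {mpoly K[n.+1]}.
Local Notation S := (poly_gralg K n.+1).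
Local Notation L := n.+1.
Local Notation xx := (xx K n).
Variable A : 'M[R]_(t, m).
Hypotheses (hA : homogeneous_mx a b A) (G : generic c A).
Hypotheses (c_gt1 : (1 < c)%N) (t_gt0 : (0 < t)%N) (mE : m = (t + c.-1)%N) (n_ge : (2 * c <= n)%N).
Notation I := (det_ideal A).
Local Notation gA := (coord_ring A).
Local Notation CN := (conormal_mod A).
Local Notation pr := (pr I).
Local Notation mdat := ((t.-1).-tuple 'I_m).
Local Notation us l i := (pr (um A l i)).

Lemma us_deg l i : ga_deg (dum a b l i) (us l i).
Proof. exact/pr_deg/um_deg. Qed.

Lemma cntZ_pr (r f : R) : I f -> cnt I (r * f) = pr r *: cnt I f.
Proof. exact: (@cntZ K S I r f). Qed.

Definition rho_fun (j : 'I_m) (i : 'I_t) (x : CN) : (gself gA) :=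
  pr (Hm A (sval (cid (cnt_surj x))) j i).

(** Independence of the representative: two of them differ by an element of I^2, where h vanishes
    modulo I. *)
Lemma rho_funE j i f : I f -> rho_fun j i (cnt I f) = pr (Hm A f j i).
Proof.
move=> hf; rewrite /rho_fun; case: (cid _) => g /= [hg e].
apply/eqP; rewrite -subr_eq0 -rmorphB; apply/eqP/pr_eq0.
have h2 : I2 I (f - g).
  by apply/(cnt_eq0 (submodB hf hg)); rewrite cntB // e subrr.
have h3 := Hm_I2 hA G c_gt1 t_gt0 mE n_ge j i h2.
have h4 := Hm_lin hA G c_gt1 t_gt0 mE n_ge 1 j i (submodB hf hg) hg.
rewrite !mul1r subrK in h4.
have h5 := submodD h3 h4; apply: I_eq (submodN h5) _; ring.
Qed.

Fact rho_linear j i : linear (rho_fun j i).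
Proof.
move=> u x y; have [f [hf ->]] := cnt_surj x; have [g [hg ->]] := cnt_surj y.
have [r ->] := pr_surj u.
have huf : I (r * f) by apply: I_Ml.
rewrite -(cntZ_pr r hf) -(cntD huf hg) !rho_funE //; last exact: submodD.
rewrite (_ : pr r *: (pr (Hm A f j i) : gself gA) = pr r * pr (Hm A f j i)) // -rmorphM -rmorphD.
apply/eqP; rewrite -subr_eq0 -rmorphB; apply/eqP/pr_eq0.
exact: (Hm_lin hA G c_gt1 t_gt0 mE n_ge).
Qed.
Definition rho j i : hom CN (gself gA) :=
  SubmodElt (introT (asboolP _) (rho_linear j i) :
    (rho_fun j i : depfun (fun _ : CN => gself gA)) \in subpred (hom_submod CN (gself gA))).
Local Notation rh j i x := (hom_fun (rho j i) x : gA).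

Lemma rhoE j i f : I f -> rh j i (cnt I f) = pr (Hm A f j i).
Proof. exact: rho_funE. Qed.

Lemma rho_deg j i e x : gm_deg e x -> ga_deg (e - (a j - b i)) (rh j i x).
Proof.
move=> /cnt_deg_surj [f [hf hd ->]]; rewrite rhoE //.
exists (pcmp (e - (a j - b i)) (Hm A f j i)); split; first exact: pcmp_deg.
apply/eqP; rewrite -subr_eq0 -rmorphB; apply/eqP/pr_eq0.
exact: (Hm_deg hA G c_gt1 t_gt0 mE n_ge).
Qed.

Lemma rho_row_pr l i0 i j x : us l i0 * rh j i x = us l i * rh j i0 x.
Proof.
have [f [hf ->]] := cnt_surj x; rewrite !rhoE // -!rmorphM; apply/eqP.
rewrite -subr_eq0 -rmorphB; apply/eqP/pr_eq0.
exact: (rho_row hA G c_gt1 t_gt0 mE n_ge).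
Qed.

Definition Fc l j : CN := cnt I (FF A l j).

Lemma key_pr l i0 x : us l i0 *: x = \sum_j rh j i0 x *: Fc l j.
Proof.
have [f [hf ->]] := cnt_surj x; rewrite -(cntZ_pr _ hf) (key l i0 hf).
have cnt_sum (F : 'I_m -> R) : (forall j, I (F j)) -> cnt I (\sum_j F j) = \sum_j cnt I (F j).
  move=> h; have [] : I (\sum_j F j) /\ cnt I (\sum_j F j) = \sum_j cnt I (F j) by
    elim/big_rec2: _ => [|j x1 x2 _ [h1 h2]];
    [split; [exact: submod0|exact: cnt0]|split; [exact: submodD|rewrite cntD // h2]].
  by [].
rewrite cnt_sum => [|j]; last exact/I_Ml/FF_I.
by apply: eq_bigr => j _; rewrite (cntZ_pr _ (FF_I l j)) rhoE.
Qed.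

Definition eF l (i0 : 'I_t) j : int := dum a b l i0 + a j - b i0.

Lemma Fc_deg l i0 j : gm_deg (eF l i0 j) (Fc l j).
Proof.
apply: cnt_deg; first exact: FF_I.
apply: poly_deg_sum => k; have := poly_degM (um_deg hA l k) (hA k j).
by congr (poly_deg _ _); rewrite /eF /dum; ring.
Qed.

Lemma row_pr (d : 'rV[R]_m) i x : rowW (Ph A) t m d -> \sum_j pr (d 0 j) * rh j i x = 0.
Proof.
move=> hd; have [f [hf ->]] := cnt_surj x.
under eq_bigr do rewrite rhoE // -rmorphM.
rewrite -rmorph_sum; apply/pr_eq0; exact: row_rho.
Qed.

Lemma phi_rho k i x : \sum_j pr (A k j) * rh j i x = 0.
Proof.
have [f [hf ->]] := cnt_surj x.
under eq_bigr do rewrite rhoE // -rmorphM.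
rewrite -rmorph_sum; apply/pr_eq0.
have := congr1 (fun M : 'M[R]_t => M k i) (HmP hf); rewrite !mxE => ->.
by case: (k == i); rewrite ?mulr1n ?mulr0n //; apply: submod0.
Qed.

Variable V : grmod gA.

(* Where u_l(e_i) is invertible, V is the cyclic module generated by v_0. *)
Record locally_cyclic := LocallyCyclic {
  cv0 : mdat -> 'I_t -> V;
  ce0 : mdat -> 'I_t -> int;
  v0_deg : forall l i, gm_deg (ce0 l i) (cv0 l i);
  v0_gen : forall l i d (w : V), gm_deg d w -> exists N x,
    ga_deg (d + dum a b l i *+ N - ce0 l i) x /\ us l i ^+ N *: w = x *: cv0 l i;
  v0_ann : forall l i x, x *: cv0 l i = 0 -> exists N, us l i ^+ N * x = 0 }.

Variable LC : locally_cyclic.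
Hypothesis TF : forall w : V, pr (sJ G (2 * c)) *: w = 0 -> w = 0.
Local Notation v0 := (cv0 LC).
Local Notation e0 := (ce0 LC).

Definition annR (w : V) : ideal R.
Proof.
exists (fun r : R^o => pr r *: w = 0).
- by rewrite rmorph0 scale0r.
- by move=> r s h1 h2; rewrite rmorphD scalerDl h1 h2 addr0.
- by move=> u r h; rewrite -[u *: r]/((u : R) * (r : R)) rmorphM -scalerA h scaler0.
Defined.

Lemma annRE w r : annR w r <-> pr r *: w = 0. Proof. by []. Qed.

Lemma I_span_hom (E : R -> Prop) : (forall d r, poly_deg d r -> I r -> E r) ->
  forall r, I r -> span (E : R^o -> Prop) r.
Proof.
move=> hE; apply: (@I_ind K n t m A (span (E : R^o -> Prop))) => g; apply: span_gen.
apply: hE (det_deg hA g) _; apply: span_gen; exists id, g; congr (\det _).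
Qed.

(** Otherwise some point contains all forms that annihilate w but not g, and there no form outside
    the point can kill w. *)
Lemma van_point w g dg : 0 < dg -> poly_deg dg g ->
  (forall q : proj_point gA, ~ q (pr g) -> exists u, [/\ homogeneous u, ~ q u & u *: w = 0]) ->
  exists N, annR w (g ^+ N).
Proof.
move=> dg0 hg h; pose E r := (exists d, poly_deg d r) /\ annR w r.
have EW r : span (E : R^o -> Prop) r -> annR w r by apply=> s [].
apply: contrapT => hN.
have [|||p [pE pg]] := @point_avoiding K n I E g dg (I_graded hA) _ _ dg0 hg.
- by move=> r [].
- apply: I_span_hom => d r hd hr; split; first by exists d.
  by apply/annRE; have /pr_eq0 -> := hr; rewrite scale0r.
- by move=> N /EW hh; apply: hN; exists N.
have [u [[d /pr_deg_surj [r [hr ur]]] pu uw]] := h p pg.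
by apply: pu; rewrite ur; apply: pE; split; [exists d|apply/annRE; rewrite -ur].
Qed.

(** g may be a constant or zero; the factor x_r supplies the positive degree required for a point of
    Proj. *)
Lemma van_point0 w g dg : 0 <= dg \/ g = 0 -> poly_deg dg g -> forall r : 'I_n.+1,
  (forall q : proj_point gA, ~ q (pr g) -> ~ q (pr (xx r)) ->
    exists u, [/\ homogeneous u, ~ q u & u *: w = 0]) ->
  exists N, annR w ((g * xx r) ^+ N).
Proof.
move=> [dg0|->] hg r h; last first.
  by exists 1%N; rewrite mul0r expr1; apply: submod0.
apply: (@van_point w (g * xx r) (dg + 1)); first by lia.
  by apply: poly_degM => //; apply: poly_degX.
by move=> q; rewrite rmorphM => hq; apply: h => h'; apply: hq; [apply: pt_mulr|apply: pt_mull].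
Qed.

Lemma deg_or0 d (r : R) : poly_deg d r -> 0 <= d \/ r = 0.
Proof. by case: (eqVneq r 0) => [->|/poly_deg_ge0 h]; [right|left; apply: h]. Qed.

Lemma radical_J (T : ideal R) (x : R) e : (c <= e <= 2 * c)%N ->
  (forall l i, radical T (um A l i * x)) -> radical T (sJ G e * x).
Proof.
move=> he h.
have P0 : radical T (0 * x) by rewrite mul0r; apply: submod0.
have PD (r s : R) : radical T (r * x) -> radical T (s * x) -> radical T ((r + s) * x).
  by move=> h1 h2; rewrite mulrDl; apply: submodD.
have PZ (u r : R) : radical T (r * x) -> radical T (u * r * x).
  by move=> h1; rewrite -mulrA; apply: idealMl.
have := sJI G he; rewrite /Jid; move/(_ (@Submod R R^o (fun r => radical T ((r : R) * x)) P0 PD PZ)); apply.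
by move=> _ /Jgen_um [l [i ->]]; exact: h.
Qed.

Lemma TF_exp (w : V) N : pr (sJ G (2 * c) ^+ N) *: w = 0 -> w = 0.
Proof.
elim: N w => [|N IH] w; first by rewrite expr0 rmorph1 scale1r.
by rewrite exprS rmorphM -scalerA => /TF /IH.
Qed.

(** A power of each minor times f x_r kills w, hence so does a power of [sJ G (2 * c)] times f x_r;
    the first factor is regular on V by [TF]. *)
Lemma van_module (w : V) f df : poly_deg df f -> forall r : 'I_n.+1,
  (forall (q : proj_point gA) l i, ~ q (pr f) -> ~ q (us l i) -> ~ q (pr (xx r)) ->
    exists u, [/\ homogeneous u, ~ q u & u *: w = 0]) ->
  exists N, pr ((f * xx r) ^+ N) *: w = 0.
Proof.
move=> hf r h.
have [||N hN] := @radical_J (annR w) (f * xx r) (2 * c).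
- by lia.
- move=> l i; rewrite mulrA.
  have hd := poly_degM (um_deg hA l i) hf.
  apply: (van_point0 (deg_or0 hd) hd) => q; rewrite rmorphM => hq qr.
  by apply: (h q l i) => // h'; apply: hq; [apply: pt_mull|apply: pt_mulr].
exists N; apply: (@TF_exp _ N); rewrite scalerA -rmorphM -exprMn; exact/annRE.
Qed.

Lemma uniform_exp (T : finType) (P : T -> nat -> Prop) :
  (forall x N M, (N <= M)%N -> P x N -> P x M) -> (forall x, exists N, P x N) ->
  exists N, forall x, P x N.
Proof.
move=> mono /choice [N hN]; exists (\max_x N x)%N => x; apply: mono (hN x); exact: leq_bigmax.
Qed.

Definition rsum (d : 'rV[R]_m) i x : gA := \sum_j pr (d 0 j) * rh j i x.

Lemma annR_le w g N M : (N <= M)%N -> annR w (g ^+ N) -> annR w (g ^+ M).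
Proof. by move=> /subnK <-; rewrite exprD => h; apply: idealMl. Qed.

(** The product is still a power of x_e modulo the later variables; the factor x_e is the one
    introduced to have positive degree on Proj. The bound e > c comes from [rowW_Reg]. *)
Lemma B_regular e : (c.+1 <= e <= 2 * c)%N -> regular_on (rowW (Ph A) t m) (sJ G e * xx e).
Proof.
move=> he d hd; apply/(@lvL R L xx).
have hL : (e < L <= L)%N by lia.
have cL : (c <= L)%N by lia.
have L_gt : (2 * c < L)%N by lia.
have c0 : (0 < c)%N by lia.
have ce : (c <= e <= 2 * c)%N by lia.
have regs i : (e <= i < L)%N -> Reg L xx (rowW (Ph A) t m) i.
  move=> hi; apply: (@rowW_Reg R L xx (Ph A) t (fun k r s _ => @xx_prime K n k r s) (@xx_notin K n)
    (fun p _ => @xx_top K n p.+1) (gR K n) c (sg G) (sgN G) cL (graded_IL hA) (sgI G) (sgX G)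
    m (sJN G) (sJ G) c0 mE L_gt (sJI G) (sJX G) (gE K n b) (graded_ImL hA)); lia.
apply: (@regular_like R L xx _ (gB K n a) _ e L (sJ G e * xx e) (sJN G e).+1 (graded_rowW hA) hL regs _).
  by rewrite exprSr -mulrBl; apply: idealMr; apply: (sJX G ce).
by apply: lvW.
Qed.

Lemma B_regular_exp e N d : (c.+1 <= e <= 2 * c)%N ->
  rowW (Ph A) t m ((sJ G e * xx e) ^+ N *: d) -> rowW (Ph A) t m d.
Proof. by move=> he; apply: (regular_exp (B_regular he)). Qed.

(* a row which gives zero germs off V(H) is, up to a power of H, a combination of rows of A *)
Lemma van_row (d : 'rV[R]_m) (de : int) H dH : poly_deg dH H ->
  (forall j, poly_deg (de + a j) (d 0 j)) ->
  (forall (q : proj_point gA) l i e x, ~ q (pr H) -> ~ q (us l i) -> gm_deg e x ->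
    exists u, [/\ homogeneous u, ~ q u & u *: (rsum d i x *: v0 l i) = 0]) ->
  exists N, rowW (Ph A) t m (H ^+ N *: d).
Proof.
move=> hH hd h.
have step l i (r : 'I_n.+1) : exists N, rowW (Ph A) t m ((um A l i * (H * xx r)) ^+ N *: d).
  pose g := um A l i * H.
  have hg := poly_degM (um_deg hA l i) hH.
  pose w k := rsum d i (Fc l k) *: v0 l i.
  have [N hN] : exists N, forall k, annR (w k) ((g * xx r) ^+ N).
    apply: uniform_exp => [k N M|k]; first exact: annR_le.
    apply: (van_point0 (deg_or0 hg) hg) => q; rewrite rmorphM => hq qr.
    apply: (h q l i _ _ _ _ (Fc_deg l i k)) => h'; apply: hq; [exact: pt_mull|exact: pt_mulr].
  have [M hM] : exists M, forall k, us l i ^+ M * (pr ((g * xx r) ^+ N) * rsum d i (Fc l k)) = 0.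
    apply: uniform_exp => [k N' M' le e|k].
      by rewrite -(subnK le) exprD -mulrA e mulr0.
    have h0 : (pr ((g * xx r) ^+ N) * rsum d i (Fc l k)) *: v0 l i = 0.
      by rewrite -scalerA; have /annRE := hN k.
    exact: (v0_ann h0).
  exists (M + N).+1.
  have : rowW (Ph A) t m (um A l i *: ((um A l i ^+ M * (g * xx r) ^+ N) *: d)).
    apply: (relations hA G c_gt1 t_gt0 mE n_ge) => j'; apply/pr_eq0.
    rewrite -[RHS](hM j') rmorph_sum mulrA mulr_sumr; apply: eq_bigr => j _.
    rewrite /Fc (rhoE j i (FF_I l j')); set z := Hm _ _ _ _.
    transitivity (pr (um A l i ^+ M * (g * xx r) ^+ N * d 0 j * z)); first by rewrite mxE.
    by rewrite !prM prX -!mulrA.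
  rewrite scalerA => h2.
  have -> : (um A l i * (H * xx r)) ^+ (M + N).+1 =
     (H * xx r) ^+ M.+1 * (um A l i * (um A l i ^+ M * (g * xx r) ^+ N)).
    rewrite /g -mulrA; move: (um A l i) (H * xx r) => v z.
    by rewrite !exprMn -addSn !exprD !exprS; ring.
  by rewrite -scalerA; apply: submodZ.
pose T := colon (rowW (Ph A) t m) d.
have e1 : (c.+1 <= c.+1 <= 2 * c)%N by lia.
have e1' : (c <= c.+1 <= 2 * c)%N by lia.
have iL : (c.+1 < n.+1)%N by lia.
have [|N hN] := @radical_J T (H * xx (Ordinal iL)) c.+1 e1'.
  by move=> l i; have [N hN] := step l i (Ordinal iL); exists N.
exists N; apply: (@B_regular_exp c.+1 N _ e1); rewrite scalerA -exprMn.
have -> : sJ G c.+1 * xx c.+1 * H = sJ G c.+1 * (H * xx (Ordinal iL)) by rewrite /=; ring.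
exact: hN.
Qed.

End Rows.

Section SpanFinite.
Variable C : comNzRingType.

Lemma span_fin (E : C -> Prop) r : span (E : C^o -> Prop) r ->
  exists l : seq (C * C), (forall p, p \in l -> E p.2) /\ r = \sum_(p <- l) p.1 * p.2.
Proof.
pose Q (r : C^o) := exists l : seq (C * C),
  (forall p, p \in l -> E p.2) /\ (r : C) = \sum_(p <- l) p.1 * p.2.
have Q0 : Q 0 by exists [::]; rewrite big_nil.
have QD x y : Q x -> Q y -> Q (x + y).
  move=> [l [hl ->]] [l' [hl' ->]]; exists (l ++ l'); rewrite big_cat; split=> // p.
  by rewrite mem_cat => /orP[/hl|/hl'].
have QZ u x : Q x -> Q (u *: x).
  move=> [l [hl ->]]; exists [seq (u * p.1, p.2) | p <- l]; split=> [p /mapP[p' /hl ? ->] //|].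
  rewrite -[u *: _]/(u * _) mulr_sumr big_map; apply: eq_bigr => p _; exact: mulrA.
move/(_ (Submod Q0 QD QZ)); apply=> x Ex; exists [:: (1, x)].
by split=> [p|]; [rewrite inE => /eqP ->|rewrite big_seq1 mul1r].
Qed.

Lemma span_family (J : finType) (s : J -> C) r :
  span ((fun r => exists i, r = s i) : C^o -> Prop) r -> exists c, r = \sum_i c i * s i.
Proof.
pose Q (r : C^o) := exists c, (r : C) = \sum_i c i * s i.
have Q0 : Q 0 by exists (fun=> 0); rewrite big1 // => i _; rewrite mul0r.
have QD x y : Q x -> Q y -> Q (x + y).
  move=> [c ->] [c' ->]; exists (fun i => c i + c' i); rewrite -big_split.
  by apply: eq_bigr => i _; rewrite mulrDl.
have QZ u x : Q x -> Q (u *: x).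
  move=> [c ->]; exists (fun i => u * c i); rewrite -[u *: _]/(u * _) mulr_sumr.
  by apply: eq_bigr => i _; rewrite mulrA.
move/(_ (Submod Q0 QD QZ)); apply=> _ [i ->]; exists (fun k => (k == i)%:R).
by rewrite (bigD1 i) //= eqxx mul1r big1 ?addr0 // => k /negbTE ->; rewrite mul0r.
Qed.
End SpanFinite.

Lemma cross_scale (C : comNzRingType) (W : lmodType C) (x y : C) (u v : W) N :
  (x * y) ^+ N *: (y *: u - x *: v) = y ^+ N.+1 *: (x ^+ N *: u) - x ^+ N.+1 *: (y ^+ N *: v).
Proof.
by rewrite scalerBr !scalerA exprMn !exprS; congr (_ *: _ - _ *: _); ring.
Qed.

Lemma cross_scale3 (C : comNzRingType) (W : lmodType C) (x y : C) (u v w : W) N M :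
  y ^+ M *: ((x * y) ^+ N *: (y *: u - x *: v)) + (x ^+ N.+1 * y ^+ N) *: (y ^+ M *: (v - y *: w)) =
  y ^+ (N + M).+1 *: (x ^+ N *: (u - x *: w)).
Proof.
rewrite !scalerBr !scalerA.
have -> : y ^+ M * (x * y) ^+ N * x = x ^+ N.+1 * y ^+ N * y ^+ M by rewrite exprMn exprS; ring.
by rewrite addrA subrK !exprS exprD exprMn; congr (_ *: _ - _ *: _); ring.
Qed.

Section SheafId.
Variables (K : pzRingType) (S : gralg K) (F : sheaf S).
Fact id_lin (V : popen S) (h : psub V (whole S)) : linear (fun x : F V => x).
Proof. by []. Qed.
Definition sheaf_id : shmor F F (whole S) :=
  @Shmor K S F F (whole S) (fun V h x => x) id_lin (fun V W h k x => erefl).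
End SheafId.

(** * Every endomorphism of the sheaf Hom is a scalar *)

Section Main.
Variables (K : fieldType) (n t c m : nat) (a : 'I_m -> int) (b : 'I_t -> int).
Local Notation R := {mpoly K[n.+1]}.
Local Notation S := (poly_gralg K n.+1).
Local Notation L := n.+1.
Local Notation xx := (xx K n).
Variable A : 'M[R]_(t, m).
Hypotheses (hA : homogeneous_mx a b A) (G : generic c A).
Hypotheses (c_gt1 : (1 < c)%N) (t_gt0 : (0 < t)%N) (mE : m = (t + c.-1)%N) (n_ge : (2 * c <= n)%N).
Hypothesis pos : forall i j, 0 < a j - b i.
Notation I := (det_ideal A).
Local Notation gA := (coord_ring A).
Local Notation CN := (conormal_mod A).
Local Notation pr := (pr I).
Local Notation mdat := ((t.-1).-tuple 'I_m).
Local Notation us l i := (pr (um A l i)).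
Local Notation rho := (rho hA G c_gt1 t_gt0 mE n_ge).
Local Notation rh j i x := (hom_fun (rho j i) x : gA).
Variables (V : grmod gA) (LC : locally_cyclic a b V).
Hypothesis TF : forall w : V, pr (sJ G (2 * c)) *: w = 0 -> w = 0.
Local Notation v0 := (cv0 LC).
Local Notation FC := (tilde CN).
Local Notation HV := (tilde V).
Local Notation N := (sheaf_hom FC HV).
Variable Theta : shmor N N (whole gA).

Lemma dum_shift (l : mdat) i i0 : dum a b l i = dum a b l i0 - b i0 + b i.
Proof. by rewrite /dum; ring. Qed.

Let ud : forall l i, ga_deg (dum a b l i) (us l i) := us_deg hA.
Let rd := rho_deg hA G c_gt1 t_gt0 mE n_ge.
Let rr := rho_row_pr hA G c_gt1 t_gt0 mE n_ge.
Let kp := key_pr hA G c_gt1 t_gt0 mE n_ge.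
Let fd := Fc_deg hA.

Local Notation VAL := (@Val K gA CN V 'I_t m a b rho rd Theta).
(** [Val] with data lifted to forms over R, so that regularity on R^m modulo [rowW] can be used. *)
Definition PolyVal j (dH : int) (H : R) (P : 'rV[R]_m) : Prop :=
  [/\ poly_deg dH H, forall j', poly_deg (dH + a j' - a j) (P 0 j') &
      VAL j dH (pr H) (fun j' => pr (P 0 j'))].

Lemma PolyVal_near j (q : proj_point gA) l i0 : ~ q (us l i0) ->
  exists dH H P, PolyVal j dH H P /\ ~ q (pr H).
Proof.
move=> qu; have [r qx] := pt_var q.
have [dH [H [B [HV' qH]]]] := @Val_near K gA CN V mdat 'I_t m a b _ _ rho _ dum_shift ud rd rr kp fd
  v0 _ (v0_deg LC) (v0_gen LC) Theta j q l i0 (pr (xx r)) (xx_deg1 _ r) qu qx.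
have [hH hB hV] := HV'.
have [H' [hH' eH]] := pr_deg_surj hH.
have [B' hB'] := choice (fun j' => pr_deg_surj (hB j')).
exists dH, H', (\row_j' B' j'); rewrite -eH; split=> //; split=> //.
  by move=> j'; rewrite mxE; case: (hB' j').
suff -> : (fun j' => pr ((\row_k B' k) 0 j')) = B by rewrite -eH.
by apply: functional_extensionality_dep => j'; rewrite mxE; case: (hB' j').
Qed.

Lemma PolyVal_compare j dH H P dH' H' P' : PolyVal j dH H P -> PolyVal j dH' H' P' ->
  exists N0, rowW (Ph A) t m ((H * H') ^+ N0 *: (H' *: P - H *: P')).
Proof.
move=> [hH hP hV] [hH' hP' hV'].
apply: (@van_row K n t c m a b A hA G c_gt1 t_gt0 mE n_ge V LC _ (dH + dH' - a j) _ (dH + dH')).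
- exact: poly_degM.
- move=> j'; rewrite !mxE; apply: poly_degB.
    by have := poly_degM hH' (hP j'); congr (poly_deg _ _); ring.
  by have := poly_degM hH (hP' j'); congr (poly_deg _ _); ring.
move=> q l i e F; rewrite prM => qHH qu hF.
have qH : ~ q (pr H) by move=> h; apply: qHH; apply: pt_mulr.
have qH' : ~ q (pr H') by move=> h; apply: qHH; apply: pt_mull.
have [r qx] := pt_var q.
have [u [hu qu' eu]] := Val_compare (v0_deg LC) (xx_deg1 _ r) hV hV' l i qH qH' qx hF.
exists u; split; [exact: hu|exact: qu'|].
have -> : rsum hA G c_gt1 t_gt0 mE n_ge (H' *: P - H *: P') i F =
    gsum rho (fun j' => pr H' * pr (P 0 j') - pr H * pr (P' 0 j')) i F.
  rewrite /rsum /gsum; apply: eq_bigr => j' _; congr (_ * _).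
  by rewrite -!prM -prB; congr (pr _); rewrite !mxE.
exact: eu.
Qed.

(** Forms in I are admissible H, since they vanish at every point. If for some minor no power of its
    product with x_e were generated by admissible H, a point would contain all of them while that
    minor does not vanish there, against [PolyVal_near]. *)
Lemma PolyVal_cover j e : (c <= e <= 2 * c)%N ->
  radical (span ((fun H => exists dH P, PolyVal j dH H P) : R^o -> Prop)) (sJ G e * xx e).
Proof.
move=> he; have eL : (e < n.+1)%N by lia.
apply: (radical_J _ he) => l i.
pose E H := exists dH P, PolyVal j dH H P.
have hu := um_deg hA l i.
have [dg0|->] := deg_or0 hu; last by rewrite mul0r; apply: submod0.
apply: contrapT => hN; pose r := Ordinal eL.
have [|||||q [qE qg]] := @point_avoiding K n I E (um A l i * xx r) (dum a b l i + 1) (I_graded hA).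
- by move=> H [dH [P [hH _ _]]]; exists dH.
- apply: (I_span_hom hA) => d H hH IH; exists d, 0; split=> //.
    by move=> j'; rewrite mxE; apply: poly_deg0.
  split=> [|j'|]; [exact: pr_deg|rewrite mxE rmorph0; exact: ga_deg0|].
  move=> i' v dv x U hv hx hU p e' F y Up pH; case: pH.
  by have /pr_eq0 -> := IH; apply: submod0.
- by move: dg0; clear; lia.
- by apply: poly_degM => //; apply: poly_degX.
- by move=> N0 h; apply: hN; exists N0.
have qu : ~ q (us l i) by move=> h; apply: qg; rewrite -/(pr _) prM; apply: pt_mulr.
have [dH [H [P [hV qH]]]] := PolyVal_near j qu.
by apply: qH; apply: qE; exists dH, P.
Qed.

(** Finitely many H_i suffice. With a uniform exponent N0, the vectors H_i^N0 P_i are compatible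
    with the scalars H_i^(N0+1), and these generate powers of [sJ] x_e at e = c + 1 and e = c + 2.
    The indices start at c + 1 because regularity modulo [rowW] does. *)
Lemma PolyVal_global j : exists P : 'rV[R]_m, (forall j', poly_deg (a j' - a j) (P 0 j')) /\
  forall dH H B, PolyVal j dH H B -> exists N0, rowW (Ph A) t m (H ^+ N0 *: (B - H *: P)).
Proof.
pose E H := exists dH P, PolyVal j dH H P.
have e1 : (c <= c.+1 <= 2 * c)%N by lia.
have e2 : (c <= c.+2 <= 2 * c)%N by lia.
have [M1 /span_fin [l1 [hl1 E1]]] := PolyVal_cover j e1.
have [M2 /span_fin [l2 [hl2 E2]]] := PolyVal_cover j e2.
pose l := l1 ++ l2; pose J := 'I_(size l).
pose Hf (i : J) : R := (nth (0, 0) l i).2.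
have hE (i : J) : E (Hf i).
  have : nth (0, 0) l i \in l by apply: mem_nth.
  by rewrite mem_cat => /orP[/hl1|/hl2].
have [dH hdH] := choice hE; have [P hP] := choice hdH.
have [N0 hN0] : exists N0, forall ij : J * J,
    rowW (Ph A) t m ((Hf ij.1 * Hf ij.2) ^+ N0 *: (Hf ij.2 *: P ij.1 - Hf ij.1 *: P ij.2)).
  apply: uniform_exp => [ij N1 N2 le h|ij]; last exact: PolyVal_compare (hP _) (hP _).
  by rewrite -(subnK le) exprD -scalerA; apply: submodZ.
pose s i := Hf i ^+ N0.+1; pose h i := Hf i ^+ N0 *: P i.
pose T := span ((fun r => exists i, r = s i) : R^o -> Prop).
have TH i : radical T (Hf i) by exists N0.+1; apply: span_gen; exists i.
have radT (ll : seq (R * R)) : {subset ll <= l} -> radical T (\sum_(p <- ll) p.1 * p.2).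
  move=> sub; rewrite big_seq; apply: (submod_sum (W := radical T)) => p /sub pl.
  apply: idealMl; have hi : (index p l < size l)%N by rewrite index_mem.
  by have := TH (Ordinal hi); rewrite /Hf /= nth_index.
have fin e M ll : (sJ G e * xx e) ^+ M = \sum_(p <- ll) p.1 * p.2 -> {subset ll <= l} ->
    exists M' cf, (sJ G e * xx e) ^+ M' = \sum_i cf i * s i.
  move=> eM sub; have [M' hM'] := radT ll sub; rewrite -eM -exprM in hM'.
  by have [cf ecf] := span_family hM'; exists (M * M')%N, cf.
have [M1' [cf1 ecf1]] : exists M' cf, (sJ G c.+1 * xx c.+1) ^+ M' = \sum_i cf i * s i.
  by apply: (fin _ _ l1 E1) => p pl; rewrite mem_cat pl.
have [M2' [cf2 ecf2]] : exists M' cf, (sJ G c.+2 * xx c.+2) ^+ M' = \sum_i cf i * s i.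
  by apply: (fin _ _ l2 E2) => p pl; rewrite mem_cat pl orbT.
have XX e M : (c <= e <= 2 * c)%N ->
    XS L xx R^o e.+1 ((sJ G e * xx e) ^+ M - xx e ^+ ((sJN G e).+1 * M)).
  move=> he; rewrite exprM [_ - _]subrXX; apply: idealMr.
  by rewrite exprSr -mulrBl; apply: idealMr; apply: (sJX G he).
have hq : poly_deg ((sJd G c.+2 + 1) *+ M2') ((sJ G c.+2 * xx c.+2) ^+ M2').
  by apply: poly_deg_exp; apply: poly_degM; [apply: (sJhom G)|apply: poly_degX].
have hL : (c.+2 < L)%N by lia.
have cL : (c <= L)%N by lia.
have L_gt : (2 * c < L)%N by lia.
have c0 : (0 < c)%N by lia.
have regs i : (c.+1 <= i < L)%N -> Reg L xx (rowW (Ph A) t m) i.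
  move=> hi; apply: (@rowW_Reg R L xx (Ph A) t (fun k r s _ => @xx_prime K n k r s) (@xx_notin K n)
    (fun p _ => @xx_top K n p.+1) (gR K n) c (sg G) (sgN G) cL (graded_IL hA) (sgI G) (sgX G)
    m (sJN G) (sJ G) c0 mE L_gt (sJI G) (sJX G) (gE K n b) (graded_ImL hA)); lia.
have cmpM r dr (w : 'rV[R]_m) d : poly_deg dr r -> cmp (gB K n a) d (r *: w) = r *: cmp (gB K n a) (d - dr) w.
  move=> hr; apply/rowP => k; rewrite !mxE /= (pcmpM _ _ hr).
  by congr (_ * pcmp _ _); ring.
have [h0 hh0] : exists h0, forall i, rowW (Ph A) t m (h i - s i *: h0).
  apply: (@glue R L xx _ (gB K n a) (rowW (Ph A) t m) c.+1 J s h _ _ cf2 cf1 _ _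
    ((sJd G c.+2 + 1) *+ M2') _ _ _ _ ecf2 ecf1 _ (XX _ M2' e2) (XX _ M1' e1)) => //.
  - exact: graded_rowW.
  - move=> i k; have := hN0 (k, i); rewrite /s /h /=; congr (rowW _ _ _ _).
    exact: cross_scale.
  - by move=> d w; apply: cmpM.
(* The congruences are homogeneous, so the part of h0 with entries of degree a_j' - a_j still
   satisfies them. *)
pose P0 := cmp (gB K n a) (- a j) h0.
have hP0 j' : poly_deg (a j' - a j) (P0 0 j').
  by rewrite /P0 mxE; have := pcmp_deg (- a j + a j') (h0 0 j'); rewrite addrC.
have hcomp i : rowW (Ph A) t m (Hf i ^+ N0 *: (P i - Hf i *: P0)).
  have [hH hPi _] := hP i; have hHN M := poly_deg_exp M hH.
  have := graded_rowW hA (dH i *+ N0.+1 - a j) (hh0 i).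
  rewrite cmpB /h /s (cmpM _ _ _ _ (hHN N0)) (cmpM _ _ _ _ (hHN N0.+1)).
  have -> : dH i *+ N0.+1 - a j - dH i *+ N0.+1 = - a j by ring.
  have -> : cmp (gB K n a) (dH i *+ N0.+1 - a j - dH i *+ N0) (P i) = P i.
    apply/rowP => j'; rewrite mxE; apply: pcmp_id; have := hPi j'.
    by congr (poly_deg _ _); rewrite mulrS; ring.
  by congr (rowW _ _ _ _); rewrite scalerBr scalerA -exprSr.
exists P0; split=> // dB H B hB.
have [N1 hN1] : exists N1, forall i, rowW (Ph A) t m ((H * Hf i) ^+ N1 *: (Hf i *: B - H *: P i)).
  apply: uniform_exp => [i N1 N2 le hh|i]; last exact: PolyVal_compare hB (hP _).
  by rewrite -(subnK le) exprD -scalerA; apply: submodZ.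
exists N1; pose Q := colon (rowW (Ph A) t m) (H ^+ N1 *: (B - H *: P0)).
have QH i : radical Q (Hf i).
  exists (N1 + N0).+1.
  have k1 := submodZ (s := rowW (Ph A) t m) (Hf i ^+ N0) (hN1 i).
  have k2 := submodZ (s := rowW (Ph A) t m) (H ^+ N1.+1 * Hf i ^+ N1) (hcomp i).
  by have := submodD k1 k2; rewrite cross_scale3.
have TQ r : T r -> radical Q r.
  by apply=> _ [i ->]; rewrite /s exprS; apply: idealMr.
have [M hM] : radical Q ((sJ G c.+1 * xx c.+1) ^+ M1').
  apply: TQ; rewrite ecf1; apply: (submod_sum (W := T)) => i _; apply: idealMl.
  by apply: span_gen; exists i.
have e1' : (c.+1 <= c.+1 <= 2 * c)%N by lia.
apply: (@B_regular_exp K n t c m a b A hA G c_gt1 t_gt0 mE n_ge c.+1 (M1' * M)%N _ e1').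
by rewrite exprM.
Qed.

Lemma Val_lift j dH H B : VAL j dH H B -> exists H' P,
  [/\ PolyVal j dH H' P, pr H' = H & forall j', pr (P 0 j') = B j'].
Proof.
move=> hV'; have [hH hB hV] := hV'.
have [H' [hH' eH]] := pr_deg_surj hH.
have [B' hB'] := choice (fun j' => pr_deg_surj (hB j')).
have eB j' : pr ((\row_k B' k) 0 j') = B j' by rewrite mxE; case: (hB' j').
exists H', (\row_j' B' j'); split=> //; split=> //.
  by move=> j'; rewrite mxE; case: (hB' j').
suff -> : (fun j' => pr ((\row_k B' k) 0 j')) = B by rewrite -eH.
exact: functional_extensionality_dep.
Qed.

Lemma I_positive r : I r -> XS L xx R^o 0 r.
Proof.
apply: (@I_ind K n t m A (XS L xx R^o 0)) => g; apply: pos_deg_X (det_deg hA g) _.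
rewrite -sumrB; case: (t) t_gt0 g b pos => // t' _ g b' pos'.
rewrite big_ord_recl; apply: ltr_wpDr => //.
by apply: sumr_ge0 => i _; apply: ltW.
Qed.

(** Entries of phi and elements of I have no constant term, so a combination of rows cannot have an
    entry congruent to 1. *)
Lemma rowW_delta j : ~ rowW (Ph A) t m (delta_mx 0 j).
Proof.
move=> [g /(_ j)]; rewrite mxE !eqxx => /IL_minors /I_positive h.
apply: (@xx_top K n 0); rewrite -[1](subrK (dot t g (Ph A j))); apply: submodD h _.
apply: (submod_sum (W := XS L xx R^o 0)) => k _; apply: idealMl.
by rewrite PhE; apply: pos_deg_X (hA _ _) _.
Qed.

Hypothesis t_gt1 : (1 < t)%N.
Hypothesis EN_lt : forall n1 n2 : int, EN_twist a b 1 n1 -> EN_twist a b 2 n2 -> n2 < 2 * n1.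

Lemma Theta_scalar_global : exists kap : K, forall U (eta : shmor FC HV U),
  Th Theta eta = oring_const U kap *: eta.
Proof.
have [P0 hP0] := choice PolyVal_global.
pose P := \matrix_(j < m, j' < m) P0 j 0 j'.
have rowP j : row j P = P0 j by apply/rowP => j'; rewrite !mxE.
have Pdeg j j' : poly_deg (a j' - a j) (P j j') by rewrite mxE; case: (hP0 j).
pose Pq j j' := pr (P j j').
have Pqdeg j j' : ga_deg (a j' - a j) (Pq j j') by apply: pr_deg.
have PVal j dH H B : VAL j dH H B -> forall i F,
    exists N0, H ^+ N0 * (gsum rho B i F - H * gsum rho (Pq j) i F) = 0.
  move=> /Val_lift [H' [B' [hV <- eB]]] i F; have [_ /(_ _ _ _ hV) [N0 hN]] := hP0 j.
  exists N0; have := row_pr hA G c_gt1 t_gt0 mE n_ge i F hN => <-.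
  rewrite mulrBr /gsum !mulr_sumr -sumrB; apply: eq_bigr => j' _.
  have -> : (H' ^+ N0 *: (B' - H' *: P0 j)) 0 j' = H' ^+ N0 * (B' 0 j' - H' * P j j').
    by rewrite !mxE.
  by rewrite prM prB prM prX -eB /Pq mulrBr mulrBl !mulrA.
(* The relation that row k of phi imposes on h_f is carried by Theta to the one given by row k of
   phi P; [van_row] with H = 1 puts it in [rowW]. *)
have relP k : rowW (Ph A) t m (\row_j' \sum_j A k j * P j j').
  have := @van_row K n t c m a b A hA G c_gt1 t_gt0 mE n_ge V LC (\row_j' \sum_j A k j * P j j')
    (- b k) 1 0 _ _ _.
  case.
  - exact: (poly_deg_scal n.+1 1).
  - move=> j'; rewrite mxE; apply: poly_deg_sum => j; have := poly_degM (hA k j) (Pdeg j j').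
    by congr (poly_deg _ _); ring.
  - move=> q l i e F q1 qu hF; have [r qx] := pt_var q.
    have [u [hu qu' eu]] := relation_P dum_shift ud rr kp fd (v0_deg LC) (v0_gen LC) (xx_deg1 _ r)
      Pqdeg PVal (be := fun j => pr (A k j)) (fun j => pr_deg _ (hA k j))
      (fun i F => phi_rho hA G c_gt1 t_gt0 mE n_ge k i F) qu qx hF.
    exists u; split; [exact: hu|exact: qu'|].
    have -> : rsum hA G c_gt1 t_gt0 mE n_ge (\row_j' \sum_j A k j * P j j') i F =
        gsum rho (fun j' => \sum_j pr (A k j) * Pq j j') i F.
      rewrite /rsum /gsum; apply: eq_bigr => j' _; congr (_ * _).
      by rewrite mxE rmorph_sum; apply: eq_bigr => j _; exact: prM.
    exact: eu.
  - by move=> N0; rewrite expr1n scale1r.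
have [kp0 hkap] := scalar_matrix hA G c_gt1 t_gt1 mE n_ge pos EN_lt Pdeg relP.
exists kp0.
have Pkap j i F : gsum rho (Pq j) i F = ga_scal gA kp0 * rh j i F.
  have := row_pr hA G c_gt1 t_gt0 mE n_ge i F (hkap j) => e.
  apply/eqP; rewrite -subr_eq0; apply/eqP; rewrite -[RHS]e.
  transitivity (\sum_j' pr (P j j') * rh j' i F - \sum_j' pr (kp0%:MP * (j' == j)%:R) * rh j' i F).
    congr (_ - _); rewrite (bigD1 j) //= eqxx mulr1 big1 ?addr0 // => j' /negbTE ->.
    by rewrite mulr0 rmorph0 mul0r.
  rewrite -sumrB; apply: eq_bigr => j' _; rewrite -mulrBl -prB; congr (pr _ * _).
  by rewrite !mxE.
apply: (Theta_global (us := fun l i => us l i) _ _) => [w d g _ [dg hg] q qg hw|].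
  have [f [hf ef]] := pr_deg_surj hg; have [r qx] := pt_var q.
  have [N0 hN] : exists N0, pr ((f * xx r) ^+ N0) *: w = 0.
    apply: (van_module hA c_gt1 t_gt0 mE n_ge TF hf) => p l i; rewrite -ef; exact: hw (xx_deg1 _ r).
  exists (pr ((f * xx r) ^+ N0)); split=> //.
    by apply: (@homog_pr _ _ _ ((dg + 1) *+ N0)); apply: poly_deg_exp; apply: poly_degM => //; apply: poly_degX.
  by rewrite prX prM; apply: not_pt_exp; apply: out_mul => //; rewrite -ef.
move=> U eta q l i0 x e F y hx qu qx.
exact: (Theta_scalar dum_shift ud rr kp fd (v0_deg LC) (v0_gen LC) hx Pqdeg PVal Pkap eta qu qx).
Qed.

(** If all morphisms vanished, the basis vector e_j would give zero germs and lie in [rowW] by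
    [van_row], against [rowW_delta]. *)
Lemma zero_sheaf : ~ (forall U (eta : shmor FC HV U), eta = 0).
Proof.
move=> h0; have m_gt0 : (0 < m)%N by lia.
pose j := Ordinal m_gt0; apply: (@rowW_delta j).
have := @van_row K n t c m a b A hA G c_gt1 t_gt0 mE n_ge V LC (delta_mx 0 j) (- a j) 1 0 _ _ _.
case.
- exact: (poly_deg_scal n.+1 1).
- move=> j'; rewrite mxE eqxx /=; case: (eqVneq j' j) => [->|_]; last exact: poly_deg0.
  by rewrite addNr; apply: (poly_deg_scal n.+1 1).
- move=> q l i e F q1 qu hF; have [r qx] := pt_var q.
  have [u [hu qu' eu]] := hmor_vanish rd (v0_deg LC) (xx_deg1 _ r) h0 l j i qx hF.
  exists u; split; [exact: hu|exact: qu'|].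
  have -> : rsum hA G c_gt1 t_gt0 mE n_ge (delta_mx 0 j) i F = rh j i F.
    rewrite /rsum (bigD1 j) //= mxE !eqxx rmorph1 mul1r big1 ?addr0 // => j' /negbTE ne.
    by rewrite mxE ne andbF rmorph0 mul0r.
  exact: eu.
by move=> N0; rewrite expr1n scale1r.
Qed.
End Main.

Section Conclusion.
Variables (K : fieldType) (n t c m : nat) (a : 'I_m -> int) (b : 'I_t -> int).
Variable A : 'M[{mpoly K[n.+1]}]_(t, m).
Hypotheses (hA : homogeneous_mx a b A) (G : generic c A).
Hypotheses (c_gt1 : (1 < c)%N) (t_gt1 : (1 < t)%N) (mE : m = (t + c.-1)%N) (n_ge : (2 * c <= n)%N).
Hypothesis pos : forall i j, 0 < a j - b i.
Hypothesis EN_lt : forall n1 n2 : int, EN_twist a b 1 n1 -> EN_twist a b 2 n2 -> n2 < 2 * n1.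
Local Notation gA := (coord_ring A).
Variables (V : grmod gA) (LC : locally_cyclic a b V).
Hypothesis TF : forall w : V, pr (det_ideal A) (sJ G (2 * c)) *: w = 0 -> w = 0.
Local Notation N := (sheaf_hom (tilde (conormal_mod A)) (tilde V)).

Theorem sheaf_line : line (sheaf_id N : global_hom N N).
Proof.
split.
  apply/eqP => e0; apply: (zero_sheaf hA G c_gt1 (ltnW t_gt1) mE n_ge pos LC t_gt1) => U eta.
  have := congr1 (fun f : shmor N N (whole gA) =>
    sm_fun f ((fun _ _ => Logic.I) : psub U (whole gA)) (eta : N U)) e0.
  by [].
move=> Theta.
have [kap hk] := Theta_scalar_global hA c_gt1 (ltnW t_gt1) mE n_ge pos LC TF Theta t_gt1 EN_lt.
exists kap; apply: shmor_ext => U h eta; transitivity (Th Theta eta); first exact: sm_irr.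
rewrite hk; congr (_ *: _); exact: sec_ext.
Qed.
End Conclusion.

(** * Symmetric powers: universal property and local cyclicity *)

Section FreeLift.
Variables (S : comPzRingType) (X : eqType) (N : lmodType S) (F : X -> N).

Lemma sum_support (f : X -> S) s s' : uniq s -> uniq s' ->
  (forall x, x \notin s -> f x = 0) -> (forall x, x \notin s' -> f x = 0) ->
  \sum_(x <- s) f x *: F x = \sum_(x <- s') f x *: F x.
Proof.
move=> us us' hs hs'.
rewrite [LHS](bigID (mem s')) /= [X in _ + X]big1 ?addr0; last by move=> x /hs' ->; rewrite scale0r.
rewrite [RHS](bigID (mem s)) /= [X in _ + X]big1 ?addr0; last by move=> x /hs ->; rewrite scale0r.
rewrite -[LHS]big_filter -[RHS]big_filter; apply/perm_big/uniq_perm; rewrite ?filter_uniq // => x.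
by rewrite !mem_filter andbC.
Qed.

Definition fm_sum (f : free_mod S X) : N :=
  \sum_(x <- undup (sval (cid (sm_valW f)))) (sm_val f x : S) *: F x.

Lemma fm_sumE (f : free_mod S X) s : uniq s -> (forall x, x \notin s -> sm_val f x = 0) ->
  fm_sum f = \sum_(x <- s) (sm_val f x : S) *: F x.
Proof.
move=> us hs; rewrite /fm_sum; case: (cid _) => r /= hr.
apply: sum_support => //; first exact: undup_uniq.
by move=> x; rewrite mem_undup; apply: hr.
Qed.

Lemma fm_sum_linear : linear fm_sum.
Proof.
move=> u f g; have [sf hf] := sm_valW f; have [sg hg] := sm_valW g.
pose s := undup (sf ++ sg); have us : uniq s by apply: undup_uniq.
have kf x : x \notin s -> sm_val f x = 0.
  by rewrite mem_undup mem_cat negb_or => /andP[/hf].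
have kg x : x \notin s -> sm_val g x = 0.
  by rewrite mem_undup mem_cat negb_or => /andP[_ /hg].
have ev x : sm_val (u *: f + g) x = u * sm_val f x + sm_val g x by [].
rewrite (fm_sumE us kf) (fm_sumE us kg) (@fm_sumE _ s) => [||x xs] //; last first.
  by rewrite ev (kf x xs) (kg x xs) mulr0 addr0.
rewrite scaler_sumr -big_split; apply: eq_bigr => x _.
by rewrite ev scalerDl scalerA.
Qed.

Lemma fm_sum_basis x : fm_sum (basis_elt S x) = F x.
Proof.
rewrite (@fm_sumE _ [:: x]) //; last by move=> y; rewrite inE => /negbTE /= ->.
by rewrite big_seq1 /= eqxx scale1r.
Qed.
End FreeLift.

Section Sym.
Variables (S : comPzRingType) (M : lmodType S) (i : nat).
Local Notation word := {ffun 'I_i -> M}.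

Section Multilinear.
Variables (N : lmodType S) (F : word -> N).
Hypothesis F_lin : forall v k a x y, F (put v k (a *: x + y)) = a *: F (put v k x) + F (put v k y).

Lemma multi0 v k : F (put v k 0) = 0.
Proof.
have := F_lin v k 1 0 0; rewrite !scale1r addr0 => e.
by apply: (addrI (F (put v k 0))); rewrite -e addr0.
Qed.
Lemma multiZ v k a x : F (put v k (a *: x)) = a *: F (put v k x).
Proof. by rewrite -[a *: x]addr0 F_lin multi0 addr0. Qed.
Lemma multiD v k x y : F (put v k (x + y)) = F (put v k x) + F (put v k y).
Proof. by rewrite -{1}[x]scale1r F_lin scale1r. Qed.
Lemma multi_sum v k (J : Type) (s : seq J) (f : J -> M) :
  F (put v k (\sum_(j <- s) f j)) = \sum_(j <- s) F (put v k (f j)).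
Proof. exact: (big_morph (fun x => F (put v k x)) (multiD v k) (multi0 v k)). Qed.

Lemma multi_scale (a : 'I_i -> S) (w : word) :
  F [ffun k => a k *: w k] = (\prod_k a k) *: F w.
Proof.
have H s : uniq s -> F [ffun k => if k \in s then a k *: w k else w k] = (\prod_(k <- s) a k) *: F w.
  elim: s => [|k s IH] /=.
    by move=> _; rewrite big_nil scale1r; congr F; apply/ffunP => k; rewrite ffunE.
  move=> /andP[ks us]; rewrite big_cons -scalerA -IH //.
  pose v' : word := [ffun k0 => if k0 \in s then a k0 *: w k0 else w k0].
  rewrite -/v'; have -> : [ffun k0 => if k0 \in k :: s then a k0 *: w k0 else w k0] = put v' k (a k *: w k).
    by apply/ffunP => k'; rewrite !ffunE inE; case: eqP => [->|].
  rewrite multiZ; congr (_ *: F _); apply/ffunP => k'; rewrite !ffunE.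
  by case: eqP => [->|//]; rewrite (negbTE ks).
have := H (enum 'I_i) (enum_uniq _); rewrite big_enum => <-.
by congr F; apply/ffunP => k; rewrite !ffunE mem_enum.
Qed.

Hypothesis F_sym : forall (v : word) (s : {perm 'I_i}), F [ffun k => v (s k)] = F v.

Definition sym_lift (q : sympow M i) : N := fm_sum F (repr q).

Lemma sym_liftE f : sym_lift (quot_pi (span (@sym_relator S M i)) f) = fm_sum F f.
Proof.
have lin := fm_sum_linear F.
have f0 : fm_sum F 0 = 0.
  by have := lin 1 0 0; rewrite !scale1r addr0 => e; apply: (addrI (fm_sum F 0)); rewrite -e addr0.
pose Q f := fm_sum F f = 0.
have QD x y : Q x -> Q y -> Q (x + y).
  by rewrite /Q => h1 h2; rewrite -[x]scale1r lin h1 h2 scaler0 addr0.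
have QZ u x : Q x -> Q (u *: x).
  by rewrite /Q => h1; rewrite -[u *: x]addr0 lin h1 scaler0 f0 addr0.
have sub x y : fm_sum F (x - y) = fm_sum F x - fm_sum F y.
  have -> : x - y = (-1) *: y + x by rewrite scaleN1r addrC.
  by rewrite lin scaleN1r addrC.
have h : forall g, span (@sym_relator S M i) g -> Q g.
  move=> g; move/(_ (Submod f0 QD QZ)); apply=> r [[v [k [a [x [y ->]]]]]|[v [s ->]]].
    by rewrite /= /Q sub lin !fm_sum_basis F_lin subrr.
  by rewrite /= /Q sub !fm_sum_basis F_sym subrr.
rewrite /sym_lift; apply/eqP; rewrite -subr_eq0 -sub; apply/eqP/h.
exact: quot_reprB.
Qed.

Lemma sym_lift_linear : linear sym_lift.
Proof.
move=> u; elim/quot_ind => f; elim/quot_ind => g.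
have <- : quot_pi (span (@sym_relator S M i)) (u *: f + g) =
  u *: quot_pi (span (@sym_relator S M i)) f + quot_pi (span (@sym_relator S M i)) g by exact: quot_pi_linear.
by rewrite !sym_liftE fm_sum_linear.
Qed.

Lemma sym_lift_mon v : sym_lift (sym_mon v) = F v.
Proof. by rewrite /sym_mon sym_liftE fm_sum_basis. Qed.
End Multilinear.

Lemma sym_mon_lin (v : word) k a x y :
  sym_mon (put v k (a *: x + y)) = a *: sym_mon (put v k x) + sym_mon (put v k y) :> sympow M i.
Proof.
rewrite /sym_mon -linearZ -linearD; apply/quot_piP; apply: span_gen; left.
by exists v, k, a, x, y.
Qed.

Lemma sym_mon_perm (v : word) (s : {perm 'I_i}) : sym_mon [ffun k => v (s k)] = sym_mon v :> sympow M i.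
Proof. by apply/quot_piP; apply: span_gen; right; exists v, s. Qed.

Lemma sympow_ind (Q : sympow M i -> Prop) :
  (forall a v, Q (a *: sym_mon v)) -> (forall x y, Q x -> Q y -> Q (x + y)) -> Q 0 -> forall w, Q w.
Proof.
move=> hm hD h0; elim/quot_ind => f; have [s hs] := sm_valW f.
have us := undup_uniq s; have hu x : x \notin undup s -> sm_val f x = 0.
  by rewrite mem_undup; apply: hs.
have -> : f = \sum_(x <- undup s) (sm_val f x : S) *: basis_elt S x.
  apply: val_inj => /=; apply: functional_extensionality_dep => y.
  have E (r : seq word) : sm_val (\sum_(x <- r) (sm_val f x : S) *: basis_elt S x) y =
      \sum_(x <- r) (sm_val f x : S) * (y == x)%:R.
    by elim: r => [|x r IH]; rewrite ?big_nil // !big_cons -IH.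
  rewrite E; case: (boolP (y \in undup s)) => hy.
    rewrite (bigD1_seq y) //= eqxx mulr1 big1 ?addr0 // => x; rewrite eq_sym => /negbTE ->.
    by rewrite mulr0.
  rewrite hu // big_seq big1 // => x hx; case: eqP hx => [<-|_ _]; last by rewrite mulr0.
  by rewrite (negbTE hy).
rewrite linear_sum; elim: (undup s) => [|x r IH]; rewrite ?big_nil // big_cons.
by apply: hD => //; rewrite linearZ; apply: hm.
Qed.
End Sym.

Section HomScale.
Variables (S : comPzRingType) (U V : lmodType S).
Lemma hom_funZl r (f : hom U V) w : hom_fun (r *: f) w = r *: hom_fun f w. Proof. by []. Qed.
Lemma hom_ext (f g : hom U V) : (forall w, hom_fun f w = hom_fun g w) -> f = g.
Proof. by move=> h; apply: val_inj; apply: functional_extensionality_dep. Qed.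
End HomScale.

Section Instances.
Variables (K : fieldType) (n t c m : nat) (a : 'I_m -> int) (b : 'I_t -> int).
Local Notation R := {mpoly K[n.+1]}.
Local Notation S := (poly_gralg K n.+1).
Local Notation L := n.+1.
Local Notation xx := (xx K n).
Variable A : 'M[R]_(t, m).
Hypotheses (hA : homogeneous_mx a b A).
Notation I := (det_ideal A).
Local Notation gA := (coord_ring A).
Local Notation pr := (pr I).
Local Notation mdat := ((t.-1).-tuple 'I_m).
Local Notation us l i := (pr (um A l i)).
Local Notation M := (cokernel_mod b A).

Definition zM (g : 'cV[R]_t) : M := quot_pi (mx_image A) g.

Lemma zMZ r g : zM (r *: g) = pr r *: zM g.
Proof.
rewrite /zM [RHS](descent_scaleE (cokernel_killed (b := b) (A := A))).
by rewrite -linearZ.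
Qed.
Lemma zMD g h : zM (g + h) = zM g + zM h.
Proof. exact: (raddfD (quot_pi (mx_image A))). Qed.
Lemma zM0 : zM 0 = 0. Proof. exact: (raddf0 (quot_pi (mx_image A))). Qed.
Lemma zM_sum (J : Type) (s : seq J) (f : J -> 'cV[R]_t) : zM (\sum_(j <- s) f j) = \sum_(j <- s) zM (f j).
Proof. exact: (big_morph zM zMD zM0). Qed.
Lemma zM_eq g h : zM g = zM h <-> mx_image A (g - h).
Proof. exact: quot_piP. Qed.
Lemma zM_surj (w : M) : exists g, w = zM g.
Proof. by exists (repr w); symmetry; apply: (quot_piE (W := mx_image A)). Qed.
Lemma zM_surj_deg d (w : M) : gm_deg d w ->
  exists g : 'cV[R]_t, (forall i, poly_deg (d - b i) (g i 0)) /\ w = zM g.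
Proof. by move=> [g [hg ->]]; exists g. Qed.
Lemma zM_deg d (g : 'cV[R]_t) : (forall i, poly_deg (d - b i) (g i 0)) -> gm_deg d (zM g).
Proof. by move=> h; exists g. Qed.

Definition ze i : M := zM (delta_mx i 0).
Lemma ze_deg i : gm_deg (b i) (ze i).
Proof.
apply: zM_deg => k; rewrite mxE andbT; case: eqP => [->|_]; last exact: poly_deg0.
rewrite subrr; exact: (poly_deg_scal n.+1 1).
Qed.
Lemma zM_coord g : zM g = \sum_i pr (g i 0) *: ze i.
Proof.
rewrite {1}[g]matrix_sum_delta; under eq_bigr do rewrite big_ord1.
by rewrite zM_sum; apply: eq_bigr => i _; rewrite zMZ.
Qed.

Lemma ze_rel l i0 i : us l i0 *: ze i = us l i *: ze i0.
Proof.
rewrite -!zMZ; apply/zM_eq; exists (\col_j kk A l i0 i j); apply/colP => k.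
rewrite !mxE; under [RHS]eq_bigr do rewrite mxE.
by rewrite kkP eqxx !andbT.
Qed.

(** The covector u_l on the cokernel. It does not depend on the representative, since u_l kills the
    columns modulo I. *)
Definition uM l (w : M) : gself gA := \sum_i us l i * pr ((repr w : 'cV[R]_t) i 0).
Lemma uME l g : uM l (zM g) = \sum_i us l i * pr (g i 0).
Proof.
rewrite /uM; have [y hy] : mx_image A ((repr (zM g) : 'cV[R]_t) - g) by exact: (quot_reprB (mx_image A) g).
apply/eqP; rewrite -subr_eq0 -sumrB; apply/eqP.
transitivity (pr (\sum_j (\sum_i um A l i * A i j) * y j 0)).
  under [in RHS]eq_bigr do rewrite mulr_suml.
  rewrite exchange_big rmorph_sum; apply: eq_bigr => i _ /=.
  rewrite -mulrBr -prB -prM; congr (pr _).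
  have := congr1 (fun v : 'cV[R]_t => v i 0) hy; rewrite !mxE => ->.
  by rewrite mulr_sumr; apply: eq_bigr => j _; rewrite mulrA.
by apply/pr_eq0; apply: (submod_sum (W := I)) => j _; apply: idealMr; apply: um_cov.
Qed.
Lemma uM_linear l : linear (uM l).
Proof.
move=> u v w; have [r ->] := pr_surj u; have [g ->] := zM_surj v; have [h ->] := zM_surj w.
rewrite -zMZ -zMD !uME [RHS](_ : _ = pr r * (\sum_i us l i * pr (g i 0)) + \sum_i us l i * pr (h i 0)) //.
rewrite mulr_sumr -big_split; apply: eq_bigr => i _ /=.
by rewrite !mxE prD prM; ring.
Qed.
Lemma uM_ze l i : uM l (ze i) = us l i.
Proof.
rewrite uME (bigD1 i) //= mxE !eqxx rmorph1 mulr1 big1 ?addr0 // => k /negbTE ki.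
by rewrite mxE ki rmorph0 mulr0.
Qed.
Lemma uM_deg l i0 e w : gm_deg e w -> ga_deg (dum a b l i0 - b i0 + e) (uM l w).
Proof.
move=> /zM_surj_deg [g [hg ->]]; rewrite uME.
have -> : \sum_i us l i * pr (g i 0) = pr (\sum_i um A l i * g i 0).
  by rewrite rmorph_sum; apply: eq_bigr => i _; rewrite -prM.
apply: pr_deg; apply: poly_deg_sum => i; have := poly_degM (um_deg hA l i) (hg i).
by congr (poly_deg _ _); rewrite /dum; ring.
Qed.
Lemma uM_gen l i0 w : us l i0 *: w = uM l w *: ze i0.
Proof.
have [g ->] := zM_surj w; rewrite uME zM_coord scaler_sumr scaler_suml; apply: eq_bigr => i _.
by rewrite scalerA mulrC -scalerA ze_rel scalerA mulrC.
Qed.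

Definition uH l : ghom M (gself gA) :=
  SubmodElt (introT (asboolP _) (uM_linear l) :
    (uM l : depfun (fun _ : M => gself gA)) \in subpred (hom_submod M (gself gA))).

Lemma gself_cyclic : locally_cyclic a b (gself gA).
Proof.
apply: (@LocallyCyclic _ _ _ _ a b _ _ (fun (_ : mdat) (_ : 'I_t) => (1 : gA) : gself gA) (fun _ _ => 0)).
- by move=> l i; apply: ga_deg1.
- move=> l i d w hw; exists 0%N, w; rewrite mulr0n addr0 subr0; split=> //.
  by rewrite expr0 scale1r -[RHS]/((w : gA) * 1) mulr1.
- by move=> l i x h; exists 0%N; rewrite mul1r -[x]mulr1; exact: h.
Qed.

(** A covector f satisfies u_l(e_i) f = f(e_i) u_l, so u_l generates the dual where u_l(e_i) is
    invertible. *)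
Lemma dual_cyclic : locally_cyclic a b (ghom M (gself gA)).
Proof.
apply: (@LocallyCyclic _ _ _ _ a b _ _ (fun l _ => uH l) (fun l i => dum a b l i - b i)).
- by move=> l i e w; apply: uM_deg.
- move=> l i d f hf; exists 1%N, (hom_fun f (ze i)); split.
    by apply: (ga_degE (hf _ _ (ze_deg i))); rewrite mulr1n; ring.
  rewrite expr1; apply: hom_ext => w; rewrite [LHS]hom_funZl [RHS]hom_funZl.
  have -> : us l i *: hom_fun f w = uM l w *: hom_fun f (ze i).
    by rewrite -(hom_funZ f) uM_gen (hom_funZ f).
  exact: mulrC.
- move=> l i x h; exists 1%N; rewrite expr1 mulrC -(uM_ze l i).
  exact: (congr1 (fun f : ghom M (gself gA) => hom_fun f (ze i)) h).
Qed.

Section SymCyclic.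
Variable k : nat.
Local Notation Mk := (gsympow M k).
Definition uprod l (v : {ffun 'I_k -> M}) : gself gA := (\prod_j (uM l (v j) : gA)).

Lemma uprod_lin l v j u x y :
  uprod l (put v j (u *: x + y)) = u *: uprod l (put v j x) + uprod l (put v j y).
Proof.
have e z : uprod l (put v j z) = (uM l z : gA) * \prod_(j' | j' != j) (uM l (v j') : gA).
  rewrite /uprod (bigD1 j) //= ffunE eqxx; congr (_ * _); apply: eq_bigr => j' /negbTE ne.
  by rewrite ffunE ne.
rewrite !e; have -> : (uM l (u *: x + y) : gA) = u * uM l x + uM l y by exact: uM_linear.
by rewrite mulrDl -mulrA.
Qed.
Lemma uprod_sym l (v : {ffun 'I_k -> M}) (s : {perm 'I_k}) : uprod l [ffun j => v (s j)] = uprod l v.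
Proof.
rewrite /uprod [RHS](reindex_inj (@perm_inj _ s)); apply: eq_bigr => j _.
by rewrite ffunE.
Qed.

(** Each factor satisfies u_l(e_i) w = u_l(w) e_i, so e_i^k is a local generator. The functional Π_j
    u_l(w_j) sends it to u_l(e_i)^k, which bounds its annihilator. *)
Lemma sym_cyclic : locally_cyclic a b Mk.
Proof.
pose w0 i : {ffun 'I_k -> M} := [ffun=> ze i].
apply: (@LocallyCyclic _ _ _ _ a b _ _ (fun _ i => sym_mon (w0 i) : Mk) (fun _ i => b i *+ k)).
- move=> l i; exists [:: sym_mon (w0 i)]; split; last by rewrite big_seq1.
  move=> x; rewrite inE => /eqP ->; exists 0, 1, (fun=> b i), (w0 i); split.
  + exact: ga_deg1.
  + by move=> j; rewrite ffunE; apply: ze_deg.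
  + by rewrite add0r sumr_const card_ord.
  + by rewrite scale1r.
- move=> l i d w [s [hs ->]]; exists k.
  have mon v : us l i ^+ k *: sym_mon v = uprod l v *: sym_mon (w0 i) :> sympow M k.
    have -> : us l i ^+ k = \prod_(j < k) us l i by rewrite prodr_const card_ord.
    rewrite -(multi_scale (@sym_mon_lin _ _ k)) -(multi_scale (@sym_mon_lin _ _ k) (fun j => uM l (v j))).
    by congr sym_mon; apply/ffunP => j; rewrite !ffunE uM_gen.
  elim: s hs => [|y s IH] hs.
    by exists 0; rewrite big_nil scale0r scaler0; split=> //; apply: ga_deg0.
  have [|x [hx ex]] := IH; first by move=> z zs; apply: hs; rewrite inE zs orbT.
  have [e [r [f [v [hr hv hd ey]]]]] := hs y (mem_head _ _).
  exists (r * uprod l v + x); split.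
    apply: (@gm_degD _ _ (gself gA)) => //; apply: (ga_degE (ga_degM hr _)).
      have : forall (J : seq 'I_k), ga_deg (\sum_(j <- J) (dum a b l i - b i + f j)) (\prod_(j <- J) (uM l (v j) : gA)).
        elim=> [|j J IHJ]; first by rewrite !big_nil; apply: ga_deg1.
        by rewrite !big_cons; apply: ga_degM => //; apply: uM_deg.
      by apply.
    by rewrite big_split /= sumr_const card_ord -hd mulrnBl; ring.
  by rewrite big_cons scalerDr ex ey scalerA mulrC -scalerA mon scalerA scalerDl.
- move=> l i x h; exists k.
  have lin := sym_lift_linear (uprod_lin l) (uprod_sym l).
  have := congr1 (sym_lift (uprod l)) h.
  have -> : sym_lift (uprod l) (0 : sympow M k) = 0.
    have := lin 1 0 0; rewrite !scale1r addr0 => e.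
    by apply: (addrI (sym_lift (uprod l) 0)); rewrite -e addr0.
  rewrite -[x *: _]addr0 lin.
  have -> : sym_lift (uprod l) (0 : sympow M k) = 0.
    have := lin 1 0 0; rewrite !scale1r addr0 => e.
    by apply: (addrI (sym_lift (uprod l) 0)); rewrite -e addr0.
  rewrite addr0 (sym_lift_mon (uprod_lin l) (uprod_sym l)) mulrC => e; rewrite -[RHS]e.
  rewrite -[_ *: _]/(x * _); congr (x * _).
  by rewrite /uprod; under eq_bigr do rewrite ffunE uM_ze; rewrite prodr_const card_ord.
Qed.
End SymCyclic.
End Instances.

(** * Coordinatewise predicates and maps on exterior algebras; evaluation of polynomials in degree
    d *)

Section AllExt.
Variables (C : comNzRingType) (P P' : C -> Prop).
Hypotheses (P0 : P 0) (PB : forall x y, P x -> P y -> P (x - y)).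
Hypotheses (P'0 : P' 0) (P'B : forall x y, P' x -> P' y -> P' (x - y)).

Lemma allextB s (y z : ext C s) : allext P y -> allext P z -> allext P (y - z).
Proof. by elim: s y z => [|s IH] y z /=; [exact: PB|move=> [h1 h2] [h3 h4]; split; apply: IH]. Qed.
Lemma allext0 s : allext P (0 : ext C s).
Proof. by elim: s => [|s IH] /=. Qed.
Lemma allextN s (z : ext C s) : allext P z -> allext P (- z).
Proof. by move=> h; rewrite -sub0r; apply: allextB => //; apply: allext0. Qed.
Lemma allextD s (y z : ext C s) : allext P y -> allext P z -> allext P (y + z).
Proof. by move=> h1 h2; rewrite -[z]opprK; apply: allextB => //; apply: allextN. Qed.
Lemma allext_sum s (J : Type) (l : seq J) (Q : pred J) (F : J -> ext C s) :
  (forall j, Q j -> allext P (F j)) -> allext P (\sum_(j <- l | Q j) F j).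
Proof.
by move=> h; elim/big_rec: _ => [|j z Qj hz]; [exact: allext0|apply: allextD => //; apply: h].
Qed.
Lemma allext_one1 s r : P r -> allext P (r *: one C s).
Proof.
move=> h; elim: s => [|s IH] /=; first by rewrite -[_ *: 1]/(_ * 1) mulr1.
by split=> //; rewrite scaler0; apply: allext0.
Qed.
End AllExt.

Lemma allextT (C : comNzRingType) s (z : ext C s) : allext (fun=> True) z.
Proof. by elim: s z => [|s IH] z /=. Qed.

Lemma allext_scale (C : comNzRingType) (P P' : C -> Prop) r s (z : ext C s) :
  (forall x, P x -> P' (r * x)) -> allext P z -> allext P' (r *: z).
Proof. by move=> h; elim: s z => [|s IH] z /=; [exact: h|case=> h1 h2; split; apply: IH]. Qed.

Lemma allext_contr (C : comNzRingType) (P P' : C -> Prop) (u : nat -> C) s (z : ext C s) :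
  P' 0 -> (forall x y, P' x -> P' y -> P' (x - y)) ->
  (forall i x, (i < s)%N -> P x -> P' (u i * x)) -> allext P z -> allext P' (contr u z).
Proof.
move=> P0 PB; elim: s z => [|s IH] z h //= [h1 h2].
have h' i y : (i < s)%N -> P y -> P' (u i * y) by move=> si; apply: h; apply: ltnW.
split; last by apply: allextN => //; apply: IH.
by apply: allextD => //; [exact: IH|apply: allext_scale h2 => y; apply: h].
Qed.

Lemma allext_wedge1 (C : comNzRingType) (P : C -> Prop) (v : nat -> C) s (z : ext C s) :
  P 0 -> (forall x y, P x -> P y -> P (x - y)) ->
  (forall i x, (i < s)%N -> P x -> P (v i * x)) -> allext P z -> allext P (wedge v z).
Proof.
move=> P0 PB; elim: s z => [|s IH] z h //= [h1 h2].
have h' i y : (i < s)%N -> P y -> P (v i * y) by move=> si; apply: h; apply: ltnW.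
split; first exact: IH.
by apply: allextB => //; [apply: allext_scale h1 => y; apply: h|exact: IH].
Qed.

Section Mape.
Variables (C D : comNzRingType).

Fixpoint mape (g : C -> D) s : ext C s -> ext D s :=
  match s with 0 => g | s'.+1 => fun z => (mape g (s := s') z.1, mape g (s := s') z.2) end.

Variable g : C -> D.
Hypothesis gB : {morph g : x y / x - y}.

Lemma mapeB s (y z : ext C s) : mape g (y - z) = mape g y - mape g z.
Proof. by elim: s y z => [|s IH] y z /=; [exact: gB|congr (_, _); apply: IH]. Qed.
Lemma mape0 s : mape g (0 : ext C s) = 0.
Proof. by have := mapeB (0 : ext C s) 0; rewrite !subrr. Qed.
Lemma mapeN s (z : ext C s) : mape g (- z) = - mape g z.
Proof. by rewrite -sub0r mapeB mape0 sub0r. Qed.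
Lemma mapeD s (y z : ext C s) : mape g (y + z) = mape g y + mape g z.
Proof. by rewrite -[z in LHS]opprK mapeB mapeN opprK. Qed.
Lemma mapeZ r r' s (z : ext C s) : (forall x, g (r * x) = r' * g x) ->
  mape g (r *: z) = r' *: mape g z.
Proof. by move=> h; elim: s z => [|s IH] z /=; [exact: h|congr (_, _); apply: IH]. Qed.
Lemma mape_allext (P : D -> Prop) s (z : ext C s) : allext P (mape g z) <-> allext (fun x => P (g x)) z.
Proof. by elim: s z => [|s IH] z //=; rewrite !IH. Qed.
Lemma mape_one s : g 1 = 1 -> mape g (one C s) = one D s.
Proof. by move=> h; elim: s => [|s IH] //=; rewrite IH mape0. Qed.
Lemma mape_wedge v s (z : ext C s) : (forall i x, g (v i * x) = g (v i) * g x) ->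
  wedge (fun i => g (v i)) (mape g z) = mape g (wedge v z).
Proof.
move=> h; elim: s z => [|s IH] z /=; first by have := gB 0 0; rewrite !subrr.
by rewrite !IH -(mapeZ z.1 (h s)) -mapeB.
Qed.
End Mape.

Lemma mapeZ2 (C D : comNzRingType) (g g' : C -> D) r r' s (z : ext C s) :
  (forall x, g' (r * x) = r' * g x) -> mape g' (r *: z) = r' *: mape g z.
Proof. by move=> h; elim: s z => [|s IH] z /=; [exact: h|congr (_, _); apply: IH]. Qed.

Lemma mape_contr (C D : comNzRingType) (g g' : C -> D) u v s (z : ext C s) :
  {morph g' : x y / x - y} -> (forall i x, (i < s)%N -> g' (u i * x) = v i * g x) ->
  contr v (mape g z) = mape g' (contr u z).
Proof.
move=> gB'; elim: s z => [|s IH] z h /=; first by have := gB' 0 0; rewrite !subrr.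
have h' i y : (i < s)%N -> g' (u i * y) = v i * g y by move=> si; apply: h; apply: ltnW.
rewrite !IH // -(mapeN gB') (mapeD gB'); congr (_ + _, _).
by rewrite (@mapeZ2 _ _ g g' _ (v s)) // => y; apply: h.
Qed.

Lemma mape_comp (C D E : comNzRingType) (g : C -> D) (g' : D -> E) s (z : ext C s) :
  mape g' (mape g z) = mape (g' \o g) z.
Proof. by elim: s z => [|s IH] z //=; rewrite !IH. Qed.
Lemma mape_id (C : comNzRingType) (g : C -> C) s (z : ext C s) : g =1 id -> mape g z = z.
Proof. by move=> h; elim: s z => [z|s IH [z1 z2]] /=; rewrite ?h ?IH. Qed.

Lemma mape_eq (C D : comNzRingType) (g g' : C -> D) s (z : ext C s) : g =1 g' -> mape g z = mape g' z.
Proof. by move=> h; elim: s z => [z|s IH [z1 z2]] /=; rewrite ?h ?IH. Qed.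

Lemma allext_pointwise (D : comNzRingType) (P : D -> Prop) (g : D -> D) (r Y : D) s (y : ext D s) :
  (forall p, P (r * p - Y * g p)) -> allext P (r *: y - Y *: mape g y).
Proof. by move=> h; elim: s y => [|s IH] y /=; [exact: h|split; apply: IH]. Qed.

Section MonomialTools.
Variables (C : comNzRingType) (t : nat).
Local Notation D := {mpoly C[t]}.

Lemma mpoly_term_ind (Q : D -> Prop) : (forall r be, Q (r%:MP * 'X_[be])) ->
  (forall p q, Q p -> Q q -> Q (p + q)) -> forall p, Q p.
Proof.
move=> hm hD p; rewrite [p]mpolyE; elim: (msupp p) => [|be l IH]; rewrite ?big_nil ?big_cons.
  by have := hm 0 0%MM; rewrite mpolyC0 mul0r.
by apply: hD => //; rewrite -mul_mpolyC.
Qed.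

Definition hcoef i (P : C -> Prop) (p : D) := forall al : 'X_{1..t}, mdeg al = i -> P p@_al.

Lemma hcoef_mulX i (P : ideal C) ga p : hcoef i P p -> hcoef (mdeg ga + i) P ('X_[ga] * p).
Proof.
move=> h al hal; rewrite {1}[p]mpolyE mulr_sumr raddf_sum /=; apply: (submod_sum (W := P)) => be _.
rewrite -scalerAr -mpolyXD mcoeffZ mcoeffX; case: eqP => [e|_]; last by rewrite mulr0; apply: submod0.
rewrite mulr1; apply: h; apply: (@addnI (mdeg ga)); rewrite -hal -e; exact/esym/mdegD.
Qed.

Lemma hcoef_Xneq i (P : ideal C) r be : mdeg be != i -> hcoef i P (r%:MP * 'X_[be]).
Proof.
move=> ne al hal; rewrite mcoeffCM mcoeffX; case: eqP => [e|_]; last by rewrite mulr0; apply: submod0.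
by rewrite e hal eqxx in ne.
Qed.

Variable u : 'I_t -> C.
Definition upow (al : 'X_{1..t}) : C := \prod_i u i ^+ al i.
(** The part of degree d of p evaluated at y = u. *)
Definition evu d (p : D) : C := \sum_(al : 'X_{1..t < d.+1} | mdeg al == d) p@_al * upow al.

Lemma evuB d : {morph evu d : p q / p - q}.
Proof. by move=> p q; rewrite /evu -sumrB; apply: eq_bigr => al _; rewrite mcoeffB mulrBl. Qed.
Lemma evuD d : {morph evu d : p q / p + q}.
Proof. by move=> p q; rewrite /evu -big_split; apply: eq_bigr => al _; rewrite mcoeffD mulrDl. Qed.
Lemma evuC d r p : evu d (r%:MP * p) = r * evu d p.
Proof. by rewrite /evu mulr_sumr; apply: eq_bigr => al _; rewrite mcoeffCM mulrA. Qed.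
Lemma evuX d be : evu d 'X_[be] = if mdeg be == d then upow be else 0.
Proof.
case: ifP => h; last first.
  rewrite /evu big1 // => al hal; rewrite mcoeffX; case: eqP => [e|_]; last by rewrite mul0r.
  by rewrite e hal in h.
have hb : (mdeg be < d.+1)%N by rewrite (eqP h).
rewrite /evu (bigD1 (BMultinom hb)) //= mcoeffX eqxx mul1r big1 ?addr0 // => al /andP[_ ne].
rewrite mcoeffX; case: eqP => [e|_]; last by rewrite mul0r.
by case/eqP: ne; apply/eqP; rewrite bmeqP /= e.
Qed.
Lemma upow_add al be : upow (al + be)%MM = upow al * upow be.
Proof. by rewrite /upow -big_split; apply: eq_bigr => i _; rewrite mnmDE exprD. Qed.
Lemma upow1 i : upow U_(i)%MM = u i.
Proof.
rewrite /upow (bigD1 i) //= mnm1E eqxx expr1 big1 ?mulr1 // => k ki.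
by rewrite mnm1E eq_sym (negbTE ki) expr0.
Qed.
Lemma evu_mulX d i p : evu d.+1 ('X_i * p) = u i * evu d p.
Proof.
elim/mpoly_term_ind: p => [r be|p q hp hq]; last by rewrite mulrDr !evuD hp hq mulrDr.
rewrite mulrCA !evuC -mpolyXD !evuX.
have -> : (mdeg (U_(i) + be)%MM == d.+1) = (mdeg be == d) by rewrite mdegD mdeg1.
by case: ifP => _; [rewrite upow_add upow1 mulrCA|rewrite !mulr0].
Qed.
Lemma evu0 p : evu 0 p = p@_0%MM.
Proof.
elim/mpoly_term_ind: p => [r be|p q hp hq]; last by rewrite evuD hp hq mcoeffD.
rewrite evuC evuX mcoeffCM mcoeffX mdeg_eq0; case: eqP => [->|_] //.
by congr (_ * _); rewrite /upow big1 // => i _; rewrite mnm0E expr0.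
Qed.
Lemma evu_hcoef d (P : ideal C) p : hcoef d P p -> P (evu d p).
Proof. by move=> h; apply: (submod_sum (W := P)) => al /eqP hal; apply/idealMr/h. Qed.
End MonomialTools.

(** * Torsion in the symmetric powers *)

Section SymAlg.
Variables (C : comNzRingType) (L : nat) (x : nat -> C) (Phi : nat -> nat -> C) (t m : nat).
Local Notation D := {mpoly C[t]}.
Local Notation I := (IL Phi t m).
Local Notation H := (restr (ext D t) (@mpolyC t C : {rmorphism C -> D})).
Local Notation lI k := (lv L x (I : submod C^o) k).
Implicit Types (p : D) (z : ext D t).

Definition yv (i : nat) : D := if insub i is Some i' then 'X_i' else 0.
Lemma yvE (i : 'I_t) : yv i = 'X_i. Proof. by rewrite /yv valK. Qed.
Definition ell (j : nat) : D := \sum_(i < t) (Phi j i)%:MP * 'X_i.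

(* Lid i k describes the degree i part of the ideal (ell_j) + (I + X_k) of C[y]:
   coefficients of the other degrees are ignored. *)
Definition Lid i k p : Prop := exists q : 'I_m -> D, hcoef i (lI k) (p - \sum_j q j * ell j).

Lemma Lid_hcoef i k p : hcoef i (lI k) p -> Lid i k p.
Proof. by exists (fun=> 0); rewrite big1 ?subr0 // => j _; rewrite mul0r. Qed.
Lemma Lid0 i k : Lid i k 0.
Proof. by apply: Lid_hcoef => al _; rewrite mcoeff0; apply: submod0. Qed.
Lemma LidB i k p q : Lid i k p -> Lid i k q -> Lid i k (p - q).
Proof.
move=> [f hf] [g hg]; exists (fun j => f j - g j) => al hal.
have -> : p - q - \sum_j (f j - g j) * ell j = (p - \sum_j f j * ell j) - (q - \sum_j g j * ell j).
  by under eq_bigr do rewrite mulrBl; rewrite sumrB; ring.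
by rewrite mcoeffB; apply: submodB; [apply: hf|apply: hg].
Qed.
Lemma LidD i k p q : Lid i k p -> Lid i k q -> Lid i k (p + q).
Proof. by move=> h1 h2; rewrite -[q]opprK; apply: LidB => //; rewrite -sub0r; apply: LidB => //; apply: Lid0. Qed.
Lemma Lid_sum i k (J : Type) (r : seq J) (F : J -> D) : (forall j, Lid i k (F j)) -> Lid i k (\sum_(j <- r) F j).
Proof. by move=> h; elim/big_rec: _ => [|j p _ hp]; [exact: Lid0|apply: LidD]. Qed.
Lemma LidX ga i k p : Lid i k p -> Lid (mdeg ga + i) k ('X_[ga] * p).
Proof.
move=> [f hf]; exists (fun j => 'X_[ga] * f j).
have -> : 'X_[ga] * p - \sum_j 'X_[ga] * f j * ell j = 'X_[ga] * (p - \sum_j f j * ell j).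
  by rewrite mulrBr mulr_sumr; congr (_ - _); apply: eq_bigr => j _; rewrite mulrA.
exact: (@hcoef_mulX C t i (lI k)).
Qed.
Lemma LidX1 a i k p : Lid i k p -> Lid i.+1 k ('X_a * p).
Proof. by move=> h; have := LidX U_(a)%MM h; rewrite mdeg1. Qed.
Lemma LidC i k r p : Lid i k p -> Lid i k (r%:MP * p).
Proof.
move=> [f hf]; exists (fun j => r%:MP * f j) => al hal.
have -> : r%:MP * p - \sum_j r%:MP * f j * ell j = r%:MP * (p - \sum_j f j * ell j).
  by rewrite mulrBr mulr_sumr; congr (_ - _); apply: eq_bigr => j _; rewrite mulrA.
by rewrite mcoeffCM; apply: idealMl; apply: hf.
Qed.
Lemma Lid_ell i k (j : 'I_m) q : Lid i k (q * ell j).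
Proof.
exists (fun k' => if k' == j then q else 0); rewrite (bigD1 j) //= eqxx big1 ?addr0 ?subrr.
  by move=> al _; rewrite mcoeff0; exact: (submod0 (lI k)).
by move=> k' /negbTE ->; rewrite mul0r.
Qed.
Lemma Lid_Xneq i k r be : mdeg be != i -> Lid i k (r%:MP * 'X_[be]).
Proof. by move=> h; apply: Lid_hcoef; exact: (@hcoef_Xneq C t i (lI k)). Qed.
Lemma Lid_le i k k' p : (k' <= k)%N -> Lid i k p -> Lid i k' p.
Proof. by move=> le [f hf]; exists f => al /hf; apply: lv_le. Qed.
Lemma Lid_XS i k r p : XS L x C^o k r -> Lid i k (r%:MP * p).
Proof. by move=> h; apply: Lid_hcoef => al _; rewrite mcoeffCM; apply/lvX/idealMr. Qed.
Lemma Lid_x i k j p : (k <= j < L)%N -> Lid i k ((x j)%:MP * p).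
Proof.
by move=> h; apply: Lid_XS; have := @XS_x _ L x C^o k j 1 h; rewrite -[_ *: _]/(_ * _) mulr1.
Qed.
Lemma Lid_I i k r p : I r -> Lid i k (r%:MP * p).
Proof. by move=> h; apply: Lid_hcoef => al _; rewrite mcoeffCM; apply/lvW/idealMr. Qed.

Lemma Lid_lift i k p : Lid i k p -> exists q, Lid i L q /\ XS L x (restr D^o (@mpolyC t C : {rmorphism C -> D})) k (p - q).
Proof.
move=> [f hf]; pose r := p - \sum_j f j * ell j.
have /choice [c hc] : forall al : 'X_{1..t}, exists c, mdeg al = i -> I c /\ XS L x C^o k (r@_al - c).
  move=> al; case: (eqVneq (mdeg al) i) => [e|ne]; last by exists 0 => /eqP; rewrite (negbTE ne).
  by have [c [h1 h2]] := hf al e; exists c.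
pose e := \sum_(al : 'X_{1..t < i.+1} | mdeg al == i) (r@_al - c al)%:MP * 'X_[al].
have ee al : mdeg al = i -> e@_al = r@_al - c al.
  move=> hal; have hb : (mdeg al < i.+1)%N by rewrite hal.
  rewrite /e raddf_sum /= (bigD1 (BMultinom hb)) /= ?hal //.
  rewrite mcoeffCM mcoeffX eqxx mulr1 big1 ?addr0 // => be /andP[_ ne].
  rewrite mcoeffCM mcoeffX; case: eqP => [e'|_]; last by rewrite mulr0.
  by case/eqP: ne; apply/eqP; rewrite bmeqP /= e'.
exists (p - e); split.
  exists f => al hal; have -> : p - e - \sum_j f j * ell j = r - e by rewrite /r; ring.
  rewrite mcoeffB (ee al hal) opprB addrCA subrr addr0; apply: lvW.
  by have [h _] := hc al hal.
rewrite opprB addrCA subrr addr0 /e.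
apply: (submod_sum (W := XS L x (restr D^o (@mpolyC t C : {rmorphism C -> D})) k)) => al /eqP hal.
have [_ h] := hc al hal.
exact: (@XS_scale _ L x (restr D^o (@mpolyC t C : {rmorphism C -> D})) k _ ('X_[al] : D) h).
Qed.

Lemma XS_pair s k (p q : ext D s) :
  XS L x (restr (ext D s) (@mpolyC t C : {rmorphism C -> D})) k p ->
  XS L x (restr (ext D s) (@mpolyC t C : {rmorphism C -> D})) k q ->
  XS L x (restr (ext D s.+1) (@mpolyC t C : {rmorphism C -> D})) k ((p, q) : ext D s.+1).
Proof.
move=> [c ->] [d ->]; exists (fun i => (c i, d i) : ext D s.+1).
rewrite [RHS](surjective_pairing); congr (_, _).
  by elim: (index_iota k L) => [|i r IH]; rewrite ?big_nil // !big_cons IH.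
by elim: (index_iota k L) => [|i r IH]; rewrite ?big_nil // !big_cons IH.
Qed.

Lemma allext_Lid_lift i k s (h : ext D s) : allext (Lid i k) h ->
  exists h', allext (Lid i L) h' /\ XS L x (restr (ext D s) (@mpolyC t C : {rmorphism C -> D})) k (h - h').
Proof.
elim: s h => [|s IH] h /=; first exact: Lid_lift.
move=> [/IH [a [h1 h2]] /IH [b [h3 h4]]]; exists (a, b); split=> //.
exact: (XS_pair h2 h4).
Qed.

Lemma XS_Lid i k (h : H) : XS L x H k h -> allext (Lid i k) (h : ext D t).
Proof.
move=> [c ->]; rewrite big_nat_cond.
elim/big_rec: _ => [|j z /andP[hj _] hz]; first exact: (allext0 (@Lid0 i k)).
apply: (allextD (@Lid0 i k) (@LidB i k)) => //.
apply: (@allext_scale _ (fun=> True) _ (x j)%:MP); first by move=> p _; apply: Lid_x.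
exact: allextT.
Qed.

Local Notation del := (contr yv : ext D t -> ext D t).

(** Start of the induction: only the part of degree 0 in y counts, taken modulo the subalgebra
    generated by the columns. *)
Definition W0 : submod H.
Proof.
exists (fun z : H => ImL Phi t m (mape (mcoeff 0%MM) (z : ext D t))).
- rewrite (mape0 (mcoeffB 0%MM)); exact: submod0.
- move=> y z h1 h2; rewrite (mapeD (mcoeffB 0%MM)); exact: submodD.
- move=> r z h; have -> : mape (mcoeff 0%MM) ((r *: z : H) : ext D t) = r *: mape (mcoeff 0%MM) (z : ext D t).
    by apply: (mapeZ (r := r%:MP)) => p; apply: mcoeffCM.
  exact: submodZ.
Defined.

(** [del], the contraction by the vector of variables y, is the Koszul differential, and [WS i]
    consists of its boundaries in y-degree i + 1 modulo [Lid]. The H/[WW d] are successive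
    cokernels: [del] maps H/[WW d] into the exterior algebra with coefficients in the degree d + 1
    part of the symmetric algebra, with cokernel H/[WW d.+1]. *)
Definition WS (i : nat) : submod H.
Proof.
exists (fun z : H => exists y, allext (Lid i.+1 L) ((z : ext D t) - del y)).
- by exists 0; rewrite raddf0 subrr; apply: (allext0 (@Lid0 _ _)).
- move=> z z' [y hy] [y' hy']; exists (y + y'); rewrite raddfD opprD addrACA.
  exact: (allextD (@Lid0 _ _) (@LidB _ _)).
- move=> r z [y hy]; exists (r%:MP *: y); rewrite contrZr -[(r *: z : H) : ext D t]/(r%:MP *: (z : ext D t)) -scalerBr.
  by apply: allext_scale hy => p; apply: LidC.
Defined.

Definition WW (i : nat) : submod H := if i is i'.+1 then WS i' else W0.

Lemma lvWS i k (z : H) : lv L x (WS i) k z <-> exists y, allext (Lid i.+1 k) ((z : ext D t) - del y).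
Proof.
split=> [[w [[y hy] hX]]|[y /allext_Lid_lift [h' [h1 h2]]]].
  exists y; have -> : (z : ext D t) - del y = ((w : ext D t) - del y) + ((z : ext D t) - (w : ext D t)).
    by rewrite [RHS]addrC addrA subrK.
  apply: (allextD (@Lid0 _ _) (@LidB _ _)); last exact: XS_Lid hX.
  case: (leqP k L) => kL; first by apply: allext_mono hy => p; apply: Lid_le.
  apply: allext_mono hy => p [f hf]; exists f => al /hf /lvL h; exact: lvW.
exists (h' + del y : ext D t); split; first by exists y; rewrite addrK.
by move: h2; rewrite opprD addrA [X in XS _ _ _ _ X -> _]addrAC.
Qed.

Lemma lvW0 k (z : H) : lv L x W0 k z <-> lv L x (ImL Phi t m) k (mape (mcoeff 0%MM) (z : ext D t)).
Proof.
have CB : {morph (@mpolyC t C : C -> D) : p q / p - q} := @mpolyCB t C.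
have scal (r : C) (y : H) : mape (mcoeff 0%MM) ((r *: y : H) : ext D t) = r *: mape (mcoeff 0%MM) (y : ext D t).
  by apply: (mapeZ (r := r%:MP)) => p; apply: mcoeffCM.
split=> [[w [hw [c hc]]]|[w [hw [c hc]]]].
  exists (mape (mcoeff 0%MM) (w : ext D t)); split=> //.
  exists (fun i => mape (mcoeff 0%MM) (c i : ext D t)).
  rewrite -(mapeB (mcoeffB 0%MM)); rewrite [X in mape _ X](_ : _ = ((z - w : H) : ext D t)) // hc.
  elim: (index_iota k L) => [|i r IH]; rewrite ?big_nil ?(mape0 (mcoeffB 0%MM)) // !big_cons.
  by rewrite -IH -scal -(mapeD (mcoeffB 0%MM)).
pose xi := mape (@mpolyC t C : C -> D) (\sum_(k <= i < L) x i *: c i).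
exists ((z : ext D t) - xi); split.
  rewrite /= (mapeB (mcoeffB 0%MM)) /xi mape_comp (mape_id _ (@mpolyCK t C)) -hc.
  by rewrite opprB addrCA subrr addr0.
exists (fun i => mape (@mpolyC t C : C -> D) (c i)).
rewrite [LHS](_ : _ = xi); last by rewrite -[LHS]/((z : ext D t) - ((z : ext D t) - xi)) opprB addrCA subrr addr0.
rewrite /xi; elim: (index_iota k L) => [|i r IH]; rewrite ?big_nil ?(mape0 CB) // !big_cons.
rewrite (mapeD CB) IH; congr (_ + _).
by apply: mapeZ => p; apply: mpolyCM.
Qed.

Section Local.
Variables (l : seq nat) (i0 : 'I_t).
Hypotheses (sl : size l = t.-1) (hl : all (ltn^~ m) l).
Local Notation uf := (fun i => uu Phi t l (delta C i)).
Local Notation u' := (fun i : 'I_t => uf i).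
Local Notation s := (uf i0).

Lemma uf_dot v : dot t uf v = uu Phi t l v.
Proof.
by rewrite [RHS]/uu wedge_coord top_sum; apply: eq_bigr => i _; rewrite topZ mulrC.
Qed.

Lemma cols_ImL : ImL Phi t m (cols Phi t l).
Proof.
elim: (l) hl => [|j r IH] /=; first by move=> _; apply: ImL_one.
by move=> /andP[jm /IH h]; apply: ImL_wedge.
Qed.

Lemma uf_Phi j : (j < m)%N -> I (dot t uf (Phi j)).
Proof. by move=> jm; rewrite uf_dot; apply: top_ImL; apply: ImL_wedge => //; apply: cols_ImL. Qed.

(** At y = u the forms [ell] take values in I, because u_l kills the columns modulo I. *)
Lemma evu_Lid d k p : Lid d.+1 k p -> lI k (evu u' d.+1 p).
Proof.
move=> [q hq]; rewrite -(subrK (\sum_j q j * ell j) p) evuD; apply: submodD.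
  exact: (@evu_hcoef C t u' d.+1 (lI k)).
have e0 : evu u' d.+1 0 = 0 by have := evuB u' d.+1 0 0; rewrite !subrr.
rewrite (big_morph (evu u' d.+1) (@evuD _ _ _ _) e0); apply: (submod_sum (W := lI k)) => j _.
have -> : q j * ell j = \sum_(i < t) (Phi j i)%:MP * ('X_i * q j).
  by rewrite /ell mulr_sumr; apply: eq_bigr => i _; ring.
rewrite (big_morph (evu u' d.+1) (@evuD _ _ _ _) e0); apply: lvW.
under eq_bigr do rewrite evuC evu_mulX mulrA [Phi _ _ * _]mulrC.
by rewrite -mulr_suml; apply: idealMr; apply: uf_Phi.
Qed.

Lemma kappa_ell i k p q : (i < t)%N -> Lid k q (((uf i)%:MP * 'X_i0 - s%:MP * yv i) * p).
Proof.
move=> it; pose i' := Ordinal it.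
have -> : (uf i)%:MP * 'X_i0 - s%:MP * yv i = - \sum_(j < m) (kappa Phi t l (delta C i0) (delta C i) j)%:MP * ell j.
  have e : \sum_(j < m) (kappa Phi t l (delta C i0) (delta C i) j)%:MP * ell j =
      \sum_(r < t) (s * delta C i r - uf i * delta C i0 r)%:MP * 'X_r.
    under eq_bigr do rewrite mulr_sumr; rewrite exchange_big; apply: eq_bigr => r _ /=.
    rewrite -(@kappaP C Phi t m l (delta C i0) (delta C i) r sl hl (ltn_ord r)).
    rewrite rmorph_sum mulr_suml; apply: eq_bigr => j _.
    by rewrite mulrA -mpolyCM mulrC [kappa _ _ _ _ _ _ * _]mulrC mulrC.
  rewrite e; under eq_bigr do rewrite mpolyCB !mpolyCM mulrBl.
  rewrite sumrB (bigD1 i') //= big1 ?addr0 => [|r ri]; last first.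
    by rewrite /delta -[i]/(val i') val_eqE (negbTE ri) mpolyC0 mulr0 mul0r.
  rewrite [X in - (_ - X)](bigD1 i0) //= big1 ?addr0 => [|r ri]; last first.
    by rewrite /delta val_eqE (negbTE ri) mpolyC0 mulr0 mul0r.
  by rewrite /delta !eqxx mpolyC1 !mulr1 opprB -[yv i]/(yv i') yvE.
rewrite mulNr -sub0r; apply: LidB; first exact: Lid0.
rewrite mulr_suml; apply: Lid_sum => j; rewrite mulrAC; exact: Lid_ell.
Qed.

Lemma loc_mon k be d : mdeg be = d ->
  Lid d k ((s ^+ d)%:MP * 'X_[be] - (upow u' be)%:MP * 'X_i0 ^+ d).
Proof.
elim: d be => [|d IH] be hd.
  have /eqP -> : be == 0%MM by rewrite -mdeg_eq0 hd.
  have -> : upow u' 0%MM = 1 by rewrite /upow big1 // => i _; rewrite mnm0E expr0.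
  by rewrite !expr0 mpolyC1 mpolyX0 subrr; apply: Lid0.
have [i hi] : exists i, (0 < be i)%N.
  apply: contrapT => h; have : mdeg be = 0%N.
    by rewrite mdegE big1 // => i _; apply/eqP; rewrite -leqn0 leqNgt; apply/negP => h'; apply: h; exists i.
  by rewrite hd.
have le : (U_(i) <= be)%MM by rewrite lep1mP -lt0n.
pose ga := (be - U_(i))%MM; have ebe : be = (U_(i) + ga)%MM by rewrite /ga addmC submK.
have hga : mdeg ga = d by move: hd; rewrite ebe mdegD mdeg1 => -[].
rewrite ebe mpolyXD upow_add upow1.
have -> : (s ^+ d.+1)%:MP * ('X_i * 'X_[ga]) - (uf i * upow u' ga)%:MP * 'X_i0 ^+ d.+1 =
   s%:MP * ('X_i * ((s ^+ d)%:MP * 'X_[ga] - (upow u' ga)%:MP * 'X_i0 ^+ d)) -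
   ((uf i)%:MP * 'X_i0 - s%:MP * yv i) * ((upow u' ga)%:MP * 'X_i0 ^+ d).
  by rewrite yvE !exprS !mpolyCM; ring.
apply: LidB; last exact: kappa_ell.
by apply: LidC; apply: LidX1; apply: IH.
Qed.

(** Where s is invertible the symmetric algebra is generated by y_{i0}, and the coefficient of a
    form of degree d is its value at u divided by s^d. *)
Lemma loc_gen d k p : Lid d k ((s ^+ d)%:MP * p - (evu u' d p)%:MP * 'X_i0 ^+ d).
Proof.
elim/mpoly_term_ind: p => [r be|p q hp hq]; last first.
  rewrite evuD mulrDr mpolyCD mulrDl opprD addrACA; exact: LidD.
rewrite evuC evuX; case: (eqVneq (mdeg be) d) => [e|ne]; last first.
  by rewrite mulr0 mpolyC0 mul0r subr0 mulrA -mpolyCM; apply: Lid_Xneq.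
have -> : (s ^+ d)%:MP * (r%:MP * 'X_[be]) - (r * upow u' be)%:MP * 'X_i0 ^+ d =
    r%:MP * ((s ^+ d)%:MP * 'X_[be] - (upow u' be)%:MP * 'X_i0 ^+ d) by rewrite mpolyCM; ring.
by apply: LidC; apply: loc_mon.
Qed.

Section Inj.
Variables (d k : nat) (z : ext D t).
Hypothesis hz : allext (Lid d.+1 k) (del z).
Let ze := mape (evu u' d) z.

Lemma contr_ze : allext (lI k) (contr uf ze).
Proof.
have h i p : (i < t)%N -> evu u' d.+1 (yv i * p) = uf i * evu u' d p.
  by move=> it; have := evu_mulX u' d (Ordinal it) p; rewrite -yvE.
rewrite /ze (mape_contr z (@evuB _ _ u' d.+1) h).
by apply/mape_allext; apply: allext_mono hz => p; apply: evu_Lid.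
Qed.

(** With e_{i0} adjoined as an extra column, s becomes a combination of maximal minors, so s z is al
    + e_{i0} ∧ be with al and be in the image of [Lam]. Contraction by u_l shows that s be has
    coordinates in I, whence the second factor s. *)
Lemma inj0 : d = 0%N -> lv L x W0 k ((s ^+ 2 *: (z : H)) : H).
Proof.
move=> d0; apply/lvW0.
have -> : mape (mcoeff 0%MM) ((s ^+ 2 *: (z : H) : H) : ext D t) = s ^+ 2 *: ze.
  rewrite /ze d0 (mapeZ (r' := s ^+ 2)) => [|p]; last exact: mcoeffCM.
  by congr (_ *: _); apply: mape_eq => p; rewrite evu0.
pose Phi' j := if j == m then delta C i0 else Phi j.
have LamE q (w : ext C q) : (q <= m)%N -> Lam Phi' t w = Lam Phi t w.
  elim: q w => [|q IH] w qm //=; rewrite !IH ?(ltnW qm) //; congr (_ + _).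
  by apply: wedge_eq => i _; rewrite /Phi' (ltn_eqF qm).
have sI : IL Phi' t m.+1 s.
  have hcol : ImL Phi' t m.+1 (wedge (delta C i0) (cols Phi t l)).
    have -> : wedge (delta C i0) (cols Phi t l) = wedge (Phi' m) (cols Phi t l).
      by apply: wedge_eq => i _; rewrite /Phi' eqxx.
    apply: ImL_wedge => //; apply: ImL_S; have [w ->] := cols_ImL.
    by exists w; rewrite LamE.
  exact: (top_ImL hcol).
have [w ew] := ImL_IL ze sI.
pose al := Lam Phi t (w.1 : ext C m); pose be := Lam Phi t (w.2 : ext C m).
have esz : s *: ze = al + wedge (delta C i0) be.
  by rewrite ew /= !LamE //; congr (_ + _); apply: wedge_eq => i _; rewrite /Phi' eqxx.
have allI (v : ext C m) : allext (lI k) (contr uf (Lam Phi t v)).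
  rewrite Lam_contr contr_coord Lam_sum; apply: (allext_sum (submod0 (lI k)) (@submodB _ _ (lI k))) => j _.
  by rewrite LamZ; apply: (allext_scale (P := fun=> True)) (allextT _) => r _; apply/lvW/idealMr/uf_Phi.
have sbe : allext (lI k) (s *: be).
  have e1 := contr_wedge uf (delta C i0) be.
  have e2 : s *: be = contr uf (s *: ze) - contr uf al + wedge (delta C i0) (contr uf be).
    rewrite esz linearD [_ + contr uf (wedge _ _)]addrC addrK e1 subrK; congr (_ *: _).
    by rewrite (dot_delta uf (ltn_ord i0)).
  rewrite e2; apply: (allextD (submod0 (lI k)) (@submodB _ _ (lI k))); last first.
    by apply: (@allext_wedge C t (lI k)); apply: allI.
  apply: (allextB (@submodB _ _ (lI k))); last exact: allI.
  rewrite contrZr; apply: (allext_scale (P := lI k)) contr_ze => r; exact: idealMl.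
rewrite exprS expr1 -scalerA esz scalerDr; apply: submodD.
  by apply: submodZ; apply: lvW; eexists.
rewrite -wedgeZr; apply: (@allext_sub C t (lI k) (lv L x (ImL Phi t m) k)); last first.
  exact: (@allext_wedge C t (lI k)).
by move=> r y hr; apply: lv_ImL_IL.
Qed.

(** A Koszul homotopy: contraction by u_l and multiplication by e_{i0} anticommute up to s, so a
    cycle times s is the boundary of e_{i0} ∧ z. Powers of s clear the denominators that appear when
    y is replaced by u y_{i0} / s. *)
Lemma injS e : d = e.+1 -> lv L x (WS e) k ((s ^+ d.+1 *: (z : H)) : H).
Proof.
move=> de; apply/lvWS; rewrite -de.
have CB : {morph (@mpolyC t C : C -> D) : p q / p - q} := @mpolyCB t C.
pose io := @mape C D (@mpolyC t C) t.
pose xi := wedge (delta C i0) ze; pose X0 : D := 'X_i0.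
(* [del] of this element is y_{i0}^e times the contraction of xi by s y, and s y_i is u_i y_{i0}
   modulo [Lid]. *)
exists ((s%:MP * X0 ^+ e) *: io xi).
have ioZ r w : io (r *: w) = r%:MP *: io w by apply: mapeZ => p; apply: mpolyCM.
have T1 : allext (Lid d k) ((s ^+ d)%:MP *: z - X0 ^+ d *: io ze).
  rewrite /io /ze mape_comp; apply: allext_pointwise => p.
  by have := loc_gen d k p; rewrite [_ * 'X_i0 ^+ d]mulrC.
have T2 : allext (Lid d k) (X0 ^+ d *: io (s *: ze - contr uf xi)).
  have -> : s *: ze - contr uf xi = wedge (delta C i0) (contr uf ze).
    rewrite /xi contr_wedge (dot_delta uf (ltn_ord i0)) opprB addrCA subrr addr0 //.
  apply: (@allext_scale _ (fun p => exists2 r, lI k r & p = r%:MP)).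
    move=> _ [r [y [h1 h2]] ->]; rewrite mulrC -[r](subrK y) mpolyCD mulrDl.
    by apply: LidD; [apply: Lid_XS|apply: Lid_I].
  apply/mape_allext; apply: allext_mono (@allext_wedge C t (lI k) _ _ contr_ze) => r hr.
  by exists r.
have T3 : allext (Lid d k) (X0 ^+ d *: io (contr uf xi) - del ((s%:MP * X0 ^+ e) *: io xi)).
  have -> : io (contr uf xi) = contr (fun i => (uf i)%:MP) (io xi).
    by rewrite /io (mape_contr (g' := @mpolyC t C : C -> D) (u := uf)) // => i r _; apply: mpolyCM.
  have -> : X0 ^+ d *: contr (fun i => (uf i)%:MP) (io xi) - del ((s%:MP * X0 ^+ e) *: io xi) =
      contr (fun i => X0 * (uf i)%:MP + (- s%:MP) * yv i) (X0 ^+ e *: io xi).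
    rewrite contrDl !contrZl !contrZr scaleNr !scalerA de exprS; congr (_ - _).
  apply: (allext_contr (P := fun=> True) (@Lid0 d k) (@LidB d k)) (allextT _) => i p it _.
  by have := kappa_ell d p k it; rewrite mulNr [X0 * _]mulrC.
have -> : ((s ^+ d.+1 *: (z : H) : H) : ext D t) - del ((s%:MP * X0 ^+ e) *: io xi) =
   s%:MP *: ((s ^+ d)%:MP *: z - X0 ^+ d *: io ze) + (X0 ^+ d *: io (s *: ze - contr uf xi)
   + (X0 ^+ d *: io (contr uf xi) - del ((s%:MP * X0 ^+ e) *: io xi))).
  have ioB w w' : io (w - w') = io w - io w' := mapeB CB w w'.
  transitivity ((s ^+ d.+1)%:MP *: z - del ((s%:MP * X0 ^+ e) *: io xi)); first by [].
  rewrite ioB ioZ !scalerBr !scalerA -mpolyCM -exprS [X0 ^+ d * _]mulrC.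
  by rewrite !subrKA.
apply: (allextD (@Lid0 _ _) (@LidB _ _)).
  by apply: allext_scale T1 => p; apply: LidC.
exact: (allextD (@Lid0 _ _) (@LidB _ _)).
Qed.
End Inj.
End Local.

Lemma contrK u n' (z : ext D n') : contr u (contr u z) = 0.
Proof.
elim: n' z => [|n' IH] z //=; apply: (@etrans _ _ ((0, 0) : ext D n'.+1)); last by [].
congr (_, _); first by rewrite linearD linearZ /= IH add0r scalerN subrr.
by rewrite -[- contr u z.2]scaleN1r contrZr IH scaler0 oppr0.
Qed.

Lemma del_Lid i k z : allext (Lid i k) z -> allext (Lid i.+1 k) (del z).
Proof.
apply: (allext_contr (@Lid0 _ _) (@LidB _ _)) => a p at_ hp.
by rewrite -[a]/(val (Ordinal at_)) yvE; apply: LidX1.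
Qed.

Lemma del_ImL k (w : ext C t) : ImL Phi t m w -> allext (Lid 1 k) (del (@mape C D (@mpolyC t C) t w)).
Proof.
have CB : {morph (@mpolyC t C : C -> D) : p q / p - q} := @mpolyCB t C.
have CZ r (y : ext C t) : @mape C D (@mpolyC t C) t (r *: y) = r%:MP *: @mape C D (@mpolyC t C) t y.
  by apply: mapeZ => p; apply: mpolyCM.
suff h q (v : ext C q) : (q <= m)%N -> allext (Lid 1 k) (del (@mape C D (@mpolyC t C) t (Lam Phi t v))).
  by move=> [v ->]; apply: h.
elim: q v => [|q IH] v qm.
  rewrite /= CZ contrZr; apply: (allext_scale (P := Lid 1 k)) => [p|]; first exact: LidC.
  rewrite (mape_one CB t (@mpolyC1 t C)).
  by rewrite contr_one; apply: (allext0 (@Lid0 _ _)).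
have delD (p1 p2 : ext D t) : del (p1 + p2) = del p1 + del p2 by apply: linearD.
rewrite /= (mapeD CB) delD; apply: (allextD (@Lid0 _ _) (@LidB _ _)); first by apply: IH; apply: ltnW.
rewrite -(mape_wedge (g := @mpolyC t C) CB) => [|i r]; last exact: mpolyCM.
rewrite contr_wedge; apply: (allextB (@LidB _ _)).
  have -> : dot t yv (fun i => (Phi q i)%:MP) = ell q.
    by apply: eq_bigr => i _; rewrite yvE mulrC.
  apply: (allext_scale (P := fun=> True)) (allextT _) => p _.
  by rewrite mulrC; exact: (@Lid_ell 1 k (Ordinal qm) p).
apply: (allext_wedge1 (@Lid0 _ _) (@LidB _ _)) => [i p _|]; first exact: LidC.
by apply: IH; apply: ltnW.
Qed.

(** For d > 0 this is [del] o [del] = 0. For d = 0 the contraction of column j by y is the form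
    [ell j]. *)
Lemma del_WW d k (z : H) : lv L x (WW d) k z -> allext (Lid d.+1 k) (del (z : ext D t)).
Proof.
case: d => [|d] /=; last first.
  move=> /lvWS [y /del_Lid]; by rewrite linearB /= contrK subr0.
have CB : {morph (@mpolyC t C : C -> D) : p q / p - q} := @mpolyCB t C.
move=> /lvW0; set ze := mape _ _ => -[w [hw /XS_ext hX]].
pose io := @mape C D (@mpolyC t C) t.
have hsum (q1 q2 q3 : ext D t) : allext (Lid 1 k) (del q1) -> allext (Lid 1 k) (del q2) ->
    allext (Lid 1 k) (del q3) -> allext (Lid 1 k) (del (q1 + (q2 + q3))).
  by move=> h1 h2 h3; rewrite !linearD; do 2![apply: (allextD (@Lid0 _ _) (@LidB _ _)) => //].
have -> : (z : ext D t) = ((z : ext D t) - io ze) + (io (ze - w) + io w).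
  by rewrite /io (mapeB CB) subrK subrK.
apply: hsum; last exact: del_ImL.
- have : allext (fun p => p@_0%MM = 0) ((z : ext D t) - io ze).
    apply/(mape_allext (mcoeff 0%MM) (fun r => r = 0)).
    rewrite (mapeB (mcoeffB 0%MM)) /io mape_comp (mape_id _ (@mpolyCK t C)) subrr.
    exact: allext0.
  apply: (allext_contr (P := fun p => p@_0%MM = 0) (@Lid0 _ _) (@LidB _ _)) => a p at_ hp.
  rewrite -[a]/(val (Ordinal at_)) yvE; apply: Lid_hcoef.
  have := @hcoef_mulX C t 0 (lI k) U_(Ordinal at_)%MM p; rewrite mdeg1; apply=> al /eqP.
  by rewrite mdeg_eq0 => /eqP ->; rewrite hp; exact: (submod0 (lI k)).
have : allext (fun p => exists2 r, XS L x C^o k r & p = r%:MP) (io (ze - w)).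
  by apply/mape_allext; apply: allext_mono hX => r hr; exists r.
apply: (allext_contr (P := fun p => exists2 r, XS L x C^o k r & p = r%:MP) (@Lid0 _ _) (@LidB _ _)) => a p _ [r hr ->].
by rewrite mulrC; apply: Lid_XS.
Qed.

Lemma split_var i p : exists w : 'I_t -> D, forall k, Lid i.+1 k (p - \sum_a 'X_a * w a).
Proof.
elim/mpoly_term_ind: p => [r be|p q [w hw] [w' hw']]; last first.
  exists (fun a => w a + w' a) => k; under eq_bigr do rewrite mulrDr.
  by rewrite big_split opprD addrACA; apply: LidD.
case: (eqVneq (mdeg be) i.+1) => [e|ne]; last first.
  exists (fun=> 0) => k; rewrite big1 ?subr0; first exact: Lid_Xneq.
  by move=> a _; rewrite mulr0.
have [a ha] : exists a, (0 < be a)%N.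
  apply: contrapT => h; have : mdeg be = 0%N.
    by rewrite mdegE big1 // => a _; apply/eqP; rewrite -leqn0 leqNgt; apply/negP => h'; apply: h; exists a.
  by rewrite e.
have le : (U_(a) <= be)%MM by rewrite lep1mP -lt0n.
exists (fun a' => if a' == a then r%:MP * 'X_[be - U_(a)] else 0) => k.
rewrite (bigD1 a) //= eqxx big1 ?addr0 => [|a' /negbTE ->]; last by rewrite mulr0.
by rewrite mulrCA -mpolyXD addmC submK // subrr; apply: Lid0.
Qed.

Section Induction.
Variables (c : nat) (sJ : nat -> C) (NJ : nat -> nat) (GH : grading L x H).
Hypotheses (L_gt : (2 * c < L)%N) (gW : forall d, graded GH (WW d))
  (regs0 : forall k, (c <= k < L)%N -> Reg L x (ImL Phi t m) k)
  (radJ : forall (T : ideal C) e, (c <= e <= 2 * c)%N ->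
    (forall l (i : 'I_t), size l = t.-1 -> all (ltn^~ m) l -> radical T (uu Phi t l (delta C i))) ->
    radical T (sJ e))
  (sJX : forall e, (c <= e <= 2 * c)%N -> XS L x C^o e.+1 (sJ e - x e ^+ NJ e)).

Definition RegW d := forall k, (c + d <= k < L)%N -> Reg L x (WW d) k.

(** Locally, where a minor is invertible, this is [inj0] or [injS]; the torsion left over vanishes
    because [sJ (c + d)] is regular on H/[WW d]. *)
Lemma del_inj d k (z : H) : RegW d -> (d <= c)%N -> (c + d < k <= L)%N ->
  allext (Lid d.+1 k) (del (z : ext D t)) -> lv L x (WW d) k z.
Proof.
move=> hR dc /andP[k1 k2] hz.
have he : (c <= c + d <= 2 * c)%N by lia.
have [|N hN] := radJ (T := colon (lv L x (WW d) k) z) he.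
  move=> l i sl hl; case: d hR dc k1 he hz => [|e] hR dc k1 he hz.
    by exists 2%N; first [exact: (inj0 i hl hz erefl)|exact: (inj0 i sl hl hz erefl)].
  by exists e.+2; first [exact: (injS i sl hl hz erefl)|exact: (injS i hl hz erefl)].
have hreg : forall i, (c + d <= i < k)%N -> Reg L x (WW d) i by move=> i hi; apply: hR; lia.
have hk : (c + d < k <= L)%N by rewrite k1.
by apply: (regular_exp (regular_like (@gW d) hk hreg (sJX he))); exact: hN.
Qed.

(** For p = Σ y_a w_a the element Σ w_a e_a has boundary p · 1. Injectivity of [del] transfers
    regularity of r from H/[WW d] to degree d + 1 of the symmetric algebra. *)
Lemma Lid_regular d (r : C) k p : RegW d -> (d <= c)%N -> (c + d < k <= L)%N ->
  (forall z : H, lv L x (WW d) k (r *: z) -> lv L x (WW d) k z) ->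
  Lid d.+1 k (r%:MP * p) -> Lid d.+1 k p.
Proof.
move=> hR dc hk hr hp; have [w hw] := split_var d p.
pose z : ext D t := \sum_a w a *: wedge (delta D a) (one D t).
have ez : del z = (\sum_a 'X_a * w a) *: one D t.
  rewrite /z contr_sum scaler_suml; apply: eq_bigr => a _.
  by rewrite contrZr contr_wedge contr_one raddf0 subr0 (dot_delta yv (ltn_ord a)) scalerA mulrC yvE.
have hs : Lid d.+1 k (r%:MP * \sum_a 'X_a * w a).
  have -> : r%:MP * (\sum_a 'X_a * w a) = r%:MP * p - r%:MP * (p - \sum_a 'X_a * w a) by ring.
  by apply: LidB => //; apply: LidC.
have : lv L x (WW d) k ((r *: (z : H)) : H).
  apply: (del_inj hR dc hk).
  have -> : del ((r *: (z : H) : H) : ext D t) = (r%:MP * \sum_a 'X_a * w a) *: one D t.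
    by rewrite [LHS](contrZr yv r%:MP z) ez scalerA.
  exact: (allext_one1 (@Lid0 _ _) t hs).
move=> /hr /del_WW; rewrite ez => /allext_one h.
by rewrite -(subrK (\sum_a 'X_a * w a) p); apply: LidD.
Qed.

(** Passing to the cokernel of [del] costs one variable. If x_k h is a boundary [del] y at level k +
    1, injectivity at level k makes y divisible by x_k modulo [WW d], and x_k is cancelled by
    [Lid_regular]. *)
Lemma RegW_all d : (d <= c)%N -> RegW d.
Proof.
elim: d => [_|d IH dc] k hk.
  move=> h /lvW0 hh; apply/lvW0; apply: regs0; first by rewrite -[X in (X <= _)%N]addn0.
  move: hh; congr (lv _ _ _ _ _); apply: (mapeZ (r := (x k)%:MP)) => p; exact: mcoeffCM.
have hR := IH (ltnW dc); have dc' := ltnW dc.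
have k2 : (c + d < k <= L)%N by lia.
have k3 : (c + d < k.+1 <= L)%N by lia.
have k4 : (k <= k < L)%N by lia.
move=> h /lvWS [y hy]; apply/lvWS.
have hyk : allext (Lid d.+1 k) (del y).
  have -> : del y = (x k)%:MP *: (h : ext D t) - ((x k)%:MP *: (h : ext D t) - del y).
    by rewrite opprB addrCA subrr addr0.
  apply: (allextB (@LidB _ _)).
    by apply: (allext_scale (P := fun=> True)) (allextT _) => p _; apply: Lid_x.
  by apply: allext_mono hy => p; apply: Lid_le.
have kL : (k < L)%N by lia.
have /(lv_step x (WW d) _ kL) [y' hy'] := @del_inj d k (y : H) hR dc' k2 hyk.
exists (y' : ext D t).
have : allext (Lid d.+1 k.+1) ((x k)%:MP *: ((h : ext D t) - del (y' : ext D t))).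
  have -> : (x k)%:MP *: ((h : ext D t) - del (y' : ext D t)) =
     ((x k)%:MP *: (h : ext D t) - del y) + del ((y - x k *: y' : H) : ext D t).
    rewrite [(y - x k *: y' : H) : ext D t](_ : _ = y - (x k)%:MP *: (y' : ext D t)) //.
    have -> : contr yv (y - (x k)%:MP *: (y' : ext D t)) = contr yv y - (x k)%:MP *: contr yv (y' : ext D t).
      by rewrite contrBr contrZr.
    by rewrite subrKA scalerBr.
  apply: (allextD (@Lid0 _ _) (@LidB _ _)); first exact: hy.
  exact: del_WW hy'.
have hreg (z : H) : lv L x (WW d) k.+1 (x k *: z) -> lv L x (WW d) k.+1 z by apply: hR; lia.
suff alls s (w : ext D s) : allext (Lid d.+1 k.+1) ((x k)%:MP *: w) -> allext (Lid d.+1 k.+1) w by apply: alls.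
elim: s w => [|s IHs] w /=; first exact: (Lid_regular hR dc' k3 hreg).
by move=> [h1 h2]; split; apply: IHs.
Qed.

Lemma sym_regular d p : (d < c)%N -> Lid d.+1 L ((sJ (2 * c))%:MP * p) -> Lid d.+1 L p.
Proof.
move=> dc; have hR := RegW_all (ltnW dc).
have h1 : (c + d < L <= L)%N by lia.
apply: (@Lid_regular d (sJ (2 * c)) L p hR (ltnW dc) h1) => z.
have he : (c <= 2 * c <= 2 * c)%N by lia.
have hk : (2 * c < L <= L)%N by rewrite L_gt leqnn.
have hreg : forall i, (2 * c <= i < L)%N -> Reg L x (WW d) i by move=> i hi; apply: hR; lia.
by have h2 := regular_like (@gW d) hk hreg (sJX he); apply: h2.
Qed.
End Induction.
End SymAlg.

Section GradedSym.
Variables (K : fieldType) (n t m : nat) (a : 'I_m -> int) (b : 'I_t -> int).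
Local Notation R := {mpoly K[n.+1]}.
Local Notation L := n.+1.
Local Notation xx := (xx K n).
Local Notation D := {mpoly R[t]}.
Local Notation rho := (@mpolyC t R : {rmorphism R -> D}).
Local Notation pcmp := (@pcmp K n).
Variable A : 'M[R]_(t, m).
Hypothesis hA : homogeneous_mx a b A.
Local Notation Phi := (Ph A).

(* Shifting all the b_i by B0 makes the weights of the variables nonnegative. *)
Definition B0 : int := \sum_i `|b i|.
Definition wt (al : 'X_{1..t}) : int := \sum_i (b i + B0) *+ al i.

Lemma wt_ge0 al : 0 <= wt al.
Proof.
apply: sumr_ge0 => i _; apply: mulrn_wge0; rewrite /B0 (bigD1 i) //= addrA.
apply: addr_ge0; last by apply: sumr_ge0.
by rewrite -lerBlDl sub0r; apply: ler_normlW; rewrite normrN.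
Qed.
Lemma wtD al be : wt (al + be) = wt al + wt be.
Proof. by rewrite /wt -big_split; apply: eq_bigr => i _; rewrite mnmDE mulrnDr. Qed.
Lemma wt0 : wt 0 = 0.
Proof. by rewrite /wt big1 // => i _; rewrite mnmE mulr0n. Qed.
Lemma wt1 i : wt U_(i) = b i + B0.
Proof.
rewrite /wt (bigD1 i) //= mnm1E eqxx mulr1n big1 ?addr0 // => j ne.
by rewrite mnm1E eq_sym (negbTE ne) mulr0n.
Qed.

Definition cmpS (d : int) (p : D) : D := \sum_(al <- msupp p) (pcmp (d - wt al) p@_al)%:MP * 'X_[al].

Lemma cmpSE d p be : (cmpS d p)@_be = pcmp (d - wt be) p@_be.
Proof.
have E al (r : R) : (r%:MP * 'X_[al] : D)@_be = if al == be then r else 0.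
  by rewrite mcoeffCM mcoeffX; case: eqP; rewrite ?mulr1 ?mulr0.
rewrite /cmpS (raddf_sum (mcoeff be)) /= (eq_bigr _ (fun al _ => E al _)).
case: (boolP (be \in msupp p)) => h.
  rewrite (bigD1_seq be) ?msupp_uniq //= eqxx big1 ?addr0 // => al ne.
  by rewrite (negbTE ne).
rewrite (memN_msupp_eq0 h) (pcmp0 K n) big_seq big1 // => al hal.
by case: eqP => // e; rewrite -e hal in h.
Qed.

Lemma cmpSB d p q : cmpS d (p - q) = cmpS d p - cmpS d q.
Proof. by apply/mpolyP => al; rewrite mcoeffB !cmpSE mcoeffB pcmpB. Qed.
Lemma cmpS0 d : cmpS d 0 = 0.
Proof. by have := cmpSB d 0 0; rewrite !subrr. Qed.
Lemma cmpSD d p q : cmpS d (p + q) = cmpS d p + cmpS d q.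
Proof. by apply/mpolyP => al; rewrite mcoeffD !cmpSE mcoeffD pcmpD. Qed.
Lemma cmpS_sum d (J : Type) (r : seq J) (F : J -> D) : cmpS d (\sum_(j <- r) F j) = \sum_(j <- r) cmpS d (F j).
Proof. exact: (big_morph (cmpS d) (cmpSD d) (cmpS0 d)). Qed.

Lemma cmpS_C d e (r : R) p : hom_elt (gR' K n) e r -> cmpS d (r%:MP * p) = r%:MP * cmpS (d - e) p.
Proof.
move=> hr; apply/mpolyP => al; rewrite mcoeffCM !cmpSE mcoeffCM.
have := hr (d - wt al) p@_al => /= ->; congr (_ * pcmp _ _); ring.
Qed.

Lemma cmpS_term d r be : cmpS d (r%:MP * 'X_[be]) = (pcmp (d - wt be) r)%:MP * 'X_[be].
Proof.
apply/mpolyP => al; rewrite cmpSE !mcoeffCM mcoeffX.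
by case: eqP => [->|_]; rewrite ?mulr1 // !mulr0 (pcmp0 K n).
Qed.

Lemma cmpS_X d ga p : cmpS d ('X_[ga] * p) = 'X_[ga] * cmpS (d - wt ga) p.
Proof.
elim/mpoly_term_ind: p => [r be|p q hp hq]; last by rewrite mulrDr !cmpSD hp hq mulrDr.
rewrite mulrCA -mpolyXD !cmpS_term wtD mpolyXD mulrCA; congr (_ * ((pcmp _ _)%:MP * _)); ring.
Qed.

Fact gS_x k d (h : restr D^o rho) : (k < L)%N -> cmpS d (xx k *: h) = xx k *: (cmpS (d - 1) h : restr D^o rho).
Proof. by move=> kL; apply: cmpS_C; apply/poly_hom_elt/poly_degX. Qed.
Fact gS_lo : exists B : int, forall d (h : restr D^o rho), d < B -> cmpS d h = 0.
Proof.
exists 0 => d h hd; apply/mpolyP => al; rewrite cmpSE mcoeff0.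
have h1 : d - wt al < 0 by have := wt_ge0 al; lia.
by case: (d - wt al) h1 => // k _.
Qed.
Fact gS_sum (h : restr D^o rho) : exists s : seq int,
  [/\ uniq s, forall d, d \notin s -> cmpS d h = 0 & h = \sum_(d <- s) (cmpS d h : restr D^o rho)].
Proof.
pose g al := gshift (gR' K n) (wt al).
have /choice [s hs] : forall al : 'X_{1..t}, exists s : seq int, forall d, d \notin s -> cmp (g al) d ((h : D)@_al : restr R^o idfun) = 0.
  by move=> al; have [s [_ h1 _]] := cmp_sum (g al) ((h : D)@_al : restr R^o idfun); exists s.
pose S := undup (flatten [seq s al | al <- msupp (h : D)]).
have hS al d : d \notin S -> pcmp (d - wt al) (h : D)@_al = 0.
  rewrite mem_undup => hd; case: (boolP (al \in msupp (h : D))) => hal; last first.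
    by rewrite (memN_msupp_eq0 hal) (pcmp0 K n).
  apply: (hs al d); apply: contra hd => hd; apply/flattenP; exists (s al) => //; exact: map_f.
exists S; split; first exact: undup_uniq.
  by move=> d hd; apply/mpolyP => al; rewrite cmpSE mcoeff0; apply: hS.
transitivity (\sum_(d <- S) cmpS d h : D); last by [].
apply/mpolyP => al; rewrite (raddf_sum (mcoeff al)) /=.
under eq_bigr do rewrite cmpSE.
exact: (@cmp_sumW _ _ _ _ (g al) ((h : D)@_al : restr R^o idfun) S (undup_uniq _) (hS al)).
Qed.
Definition gS : grading L xx (restr D^o rho) := @Grading R L xx (restr D^o rho) cmpS cmpSB gS_x gS_lo gS_sum.

Local Notation GH := (gext gS (nb b) t).

Lemma mape_gext s d (z : ext D s) : mape (mcoeff 0%MM) (cmp (gext gS (nb b) s) d z : ext D s) =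
  (cmp (gext (gR' K n) (nb b) s) d (mape (mcoeff 0%MM) z : ext R s) : ext R s).
Proof.
elim: s d z => [|s IH] d z /=; first by rewrite cmpSE wt0 subr0.
by congr (_, _); exact: IH.
Qed.

Lemma allext_gext (P : D -> Prop) s d (z : ext D s) : (forall d p, P p -> P (cmpS d p)) ->
  allext P z -> allext P (cmp (gext gS (nb b) s) d z : ext D s).
Proof.
move=> hP; elim: s d z => [|s IH] d z /=; first exact: hP.
by move=> [h1 h2]; split; apply: IH.
Qed.

Lemma cmpS_ell d (j : 'I_m) q : cmpS d (q * ell Phi t j) = cmpS (d - (a j + B0)) q * ell Phi t j.
Proof.
rewrite /ell !mulr_sumr cmpS_sum; apply: eq_bigr => i _.
rewrite mulrCA (@cmpS_C _ (na a j - nb b i)); last exact: (hom_Ph hA).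
rewrite [q * 'X_i]mulrC cmpS_X wt1 naE nbE [RHS]mulrC -mulrA.
by have -> : d - (a j - b i) - (b i + B0) = d - (a j + B0) by ring.
Qed.

Lemma cmpS_Lid i d p : Lid L xx Phi m i L p -> Lid L xx Phi m i L (cmpS d p).
Proof.
move=> [q hq]; exists (fun j => cmpS (d - (a j + B0)) (q j)) => al hal.
under eq_bigr do rewrite -cmpS_ell.
rewrite -cmpS_sum -cmpSB cmpSE; apply/(@lvL _ _ xx); apply: (graded_IL hA).
by apply/(@lvL _ _ xx); apply: hq.
Qed.

Lemma graded_WW d : graded GH (WW L xx Phi t m d).
Proof.
case: d => [|i] d z /=.
  by move=> h; rewrite mape_gext; apply: (graded_ImL hA).
move=> [y hy]; exists (cmp GH (d - B0) (y : restr (ext D t) rho) : ext D t).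
have hyv k : hom_elt gS (B0 + nb b k) (@yv R t k).
  rewrite /yv /nb; case: insubP => [k' _ _|_] e s; last by rewrite !mul0r; apply: cmpS0.
  have -> : e - (B0 + b k') = e - wt U_(k') by rewrite wt1 [B0 + _]addrC.
  exact: cmpS_X.
rewrite -(gext_contr d (y : ext D t) hyv).
have -> : (cmp GH d (z : restr (ext D t) rho) : ext D t) - cmp GH d (contr (@yv R t) y : restr (ext D t) rho)
   = (cmp GH d (((z : ext D t) - contr (@yv R t) y : ext D t) : restr (ext D t) rho) : ext D t).
  by symmetry; exact: (cmpB GH d (z : restr (ext D t) rho) (contr (@yv R t) y : restr (ext D t) rho)).
by apply: allext_gext hy => e p; apply: cmpS_Lid.
Qed.
End GradedSym.

(** * S_i M as the degree i part of R[y] modulo I and the forms [ell] *)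

Section TorsionFree.
Variables (K : fieldType) (n t c m : nat) (a : 'I_m -> int) (b : 'I_t -> int).
Local Notation R := {mpoly K[n.+1]}.
Local Notation S := (poly_gralg K n.+1).
Local Notation L := n.+1.
Local Notation xx := (xx K n).
Local Notation D := {mpoly R[t]}.
Local Notation rho := (@mpolyC t R : {rmorphism R -> D}).
Variable A : 'M[R]_(t, m).
Hypotheses (hA : homogeneous_mx a b A) (G : generic c A).
Hypotheses (c_gt0 : (0 < c)%N) (mE : m = (t + c.-1)%N) (n_ge : (2 * c <= n)%N).
Notation I := (det_ideal A).
Local Notation gA := (coord_ring A).
Local Notation pr := (pr I).
Local Notation Phi := (Ph A).
Local Notation M := (cokernel_mod b A).
Local Notation Lid := (Lid L xx Phi m).

Lemma radical_sJ (T : ideal R) e : (c <= e <= 2 * c)%N ->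
  (forall l (i : 'I_t), size l = t.-1 -> all (ltn^~ m) l -> radical T (uu Phi t l (delta R i))) ->
  radical T (sJ G e).
Proof.
move=> he h; have := sJI G he; rewrite /Jid; move/(_ (radical T)); apply.
by move=> _ [l [i [h1 h2 h3 ->]]]; apply: (h l (Ordinal h3)).
Qed.

Lemma gself_torsion_free (w : gself gA) : pr (sJ G (2 * c)) *: w = 0 -> w = 0.
Proof.
have [r ->] := pr_surj w; move=> h; apply/pr_eq0.
have {}h : I (sJ G (2 * c) * r) by apply/pr_eq0; rewrite prM.
have hk : (2 * c < L <= L)%N by rewrite leqnn ltnS n_ge.
have hreg k : (2 * c <= k < L)%N -> Reg L xx (IL Phi t m) k.
  by move=> hk'; apply: (I_Reg hA G c_gt0 mE n_ge); lia.
have he : (c <= 2 * c <= 2 * c)%N by lia.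
have h2 := regular_like (@graded_IL K n t m a b A hA m) hk hreg (sJX G he).
by apply/IL_minors/(@lvL R L xx); apply: h2; apply/lvL/IL_minors.
Qed.

Lemma dual_torsion_free (w : ghom M (gself gA)) : pr (sJ G (2 * c)) *: w = 0 -> w = 0.
Proof.
move=> h; apply: hom_ext => x; apply: gself_torsion_free.
rewrite -hom_funZl; transitivity (hom_fun (0 : hom M (gself gA)) x); last by [].
by congr (hom_fun _ x).
Qed.

Section Sym20.
Hypothesis t_gt0 : (0 < t)%N.
Variable d : nat.
Local Notation i := d.+1.
Local Notation word := {ffun 'I_i -> 'I_t}.
Local Notation Mi := (gsympow M i).
Local Notation ze := (@ze K n t m b A).

Definition mmon k (f : 'I_k -> 'I_t) : 'X_{1..t} := [multinom (\sum_(j < k) (f j == x))%N | x < t].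
Definition zmon (f : word) : Mi := sym_mon [ffun k => ze (f k) : M].

Lemma mdeg_mmon k (f : 'I_k -> 'I_t) : mdeg (mmon f) = k.
Proof.
rewrite mdegE; under eq_bigr do rewrite mnmE.
rewrite exchange_big /= (eq_bigr (fun=> 1%N)) ?sum_nat_const ?card_ord ?muln1 // => j _.
by rewrite (bigD1 (f j)) //= eqxx big1 ?addn0 // => x /negbTE; rewrite eq_sym => ->.
Qed.

Lemma mmon_cons k (f : 'I_k.+1 -> 'I_t) : mmon f = (U_(f ord0) + mmon (fun j => f (lift ord0 j)))%MM.
Proof. by apply/mnmP => x; rewrite mnmDE !mnmE big_ord_recl. Qed.

Lemma mmon_surj k be : mdeg be = k -> exists f : 'I_k -> 'I_t, mmon f = be.
Proof.
elim: k be => [|k IH] be hbe.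
  have f : 'I_0 -> 'I_t by case.
  exists f; apply/mnmP => x; rewrite mnmE big_ord0.
  by move/eqP: hbe; rewrite mdeg_eq0 => /eqP ->; rewrite mnm0E.
have [x hx] : exists x, (0 < be x)%N.
  apply: contrapT => h; have : mdeg be = 0%N.
    by rewrite mdegE big1 // => x _; apply/eqP; rewrite -leqn0 leqNgt; apply/negP => h'; apply: h; exists x.
  by rewrite hbe.
have le : (U_(x) <= be)%MM by rewrite lep1mP -lt0n.
have ebe : be = (U_(x) + (be - U_(x)))%MM by rewrite addmC submK.
have [|f hf] := IH (be - U_(x))%MM; first by move: hbe; rewrite {1}ebe mdegD mdeg1 => -[].
exists (fun j => if unlift ord0 j is Some j' then f j' else x).
rewrite mmon_cons unlift_none [RHS]ebe -hf; congr (_ + _)%MM.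
by apply/mnmP => y; rewrite !mnmE; apply: eq_bigr => j _; rewrite liftK.
Qed.

Lemma zmon_eq (f g : word) : mmon f = mmon g -> zmon f = zmon g.
Proof.
move=> e; have /tuple_permP [s hs] : perm_eq [tuple f k | k < i] [tuple g k | k < i].
  apply/allP => x _ /=; have := congr1 (fun al : 'X_{1..t} => al x) e; rewrite !mnmE => ex.
  have cnt (h : word) : count_mem x [seq h k | k <- enum 'I_i] = (\sum_(k < i) (h k == x))%N.
    by rewrite count_map -sum1_count big_enum_cond big_mkcond /=; apply: eq_bigr => k _; case: eqP.
  by rewrite !cnt ex.
have -> : f = [ffun k => g (s k)].
  apply/ffunP => k; rewrite ffunE; have := congr1 (fun r => nth (f k) r k) hs.
  by rewrite -!tnth_nth !tnth_mktuple.
rewrite /zmon -[RHS](sym_mon_perm _ s); congr sym_mon.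
by apply/ffunP => k; rewrite !ffunE.
Qed.

Lemma word_ex (al : 'X_{1..t}) : exists f : word, mdeg al = i -> mmon f = al.
Proof.
case: (eqVneq (mdeg al) i) => [h|ne]; last first.
  by exists [ffun=> Ordinal t_gt0] => h; rewrite h eqxx in ne.
have [f hf] := mmon_surj h; exists (finfun f) => _; rewrite -hf.
by apply/mnmP => x; rewrite !mnmE; apply: eq_bigr => k _; rewrite ffunE.
Qed.
Definition wd al : word := sval (cid (word_ex al)).
Lemma wdE al : mdeg al = i -> mmon (wd al) = al. Proof. exact: (svalP (cid (word_ex al))). Qed.

(** Sends a monomial of degree i to the product of classes of basis vectors. It is onto and kills
    [Lid i L], and [Psi] is a left inverse on the quotient, so torsion questions move to
    polynomials. *)
Definition Theta (p : D) : Mi := \sum_(al : 'X_{1..t < i.+1} | mdeg al == i) pr p@_al *: zmon (wd al).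

Lemma ThetaD p q : Theta (p + q) = Theta p + Theta q.
Proof. by rewrite /Theta -big_split; apply: eq_bigr => al _; rewrite mcoeffD prD scalerDl. Qed.
Lemma ThetaC r p : Theta (r%:MP * p) = pr r *: Theta p.
Proof. by rewrite /Theta scaler_sumr; apply: eq_bigr => al _; rewrite mcoeffCM prM scalerA. Qed.
Lemma Theta_I p : (forall al, mdeg al = i -> I p@_al) -> Theta p = 0.
Proof. by move=> h; rewrite /Theta big1 // => al /eqP /h /pr_eq0 ->; rewrite scale0r. Qed.
Lemma Theta0 : Theta 0 = 0.
Proof. by apply: Theta_I => al _; rewrite mcoeff0; apply: submod0. Qed.
Lemma Theta_sum (J : Type) (r : seq J) (F : J -> D) : Theta (\sum_(j <- r) F j) = \sum_(j <- r) Theta (F j).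
Proof. exact: (big_morph Theta ThetaD Theta0). Qed.

Lemma Theta_mmon f : Theta 'X_[mmon f] = zmon (finfun f).
Proof.
have E al : pr ('X_[mmon f])@_al *: zmon (wd al) = if mmon f == al then zmon (finfun f) else 0.
  rewrite mcoeffX; case: eqP => [<-|_]; last by rewrite (rmorph0 pr) scale0r.
  rewrite (rmorph1 pr) scale1r; apply: zmon_eq; rewrite wdE; last exact: mdeg_mmon.
  by apply/mnmP => x; rewrite !mnmE; apply: eq_bigr => k _; rewrite ffunE.
have hb : (mdeg (mmon f) < i.+1)%N by rewrite mdeg_mmon.
transitivity (\sum_(al : 'X_{1..t < i.+1} | mdeg al == i) if mmon f == al then zmon (finfun f) else 0).
  by apply: eq_bigr => al _; exact: E.
rewrite -big_mkcondr.
apply: (big_pred1 (BMultinom hb)) => al.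
apply/idP/idP => [/andP[_ /eqP e]|/eqP ->]; first by apply/eqP/val_inj.
by rewrite /= mdeg_mmon !eqxx.
Qed.

Lemma Theta_neq r be : mdeg be != i -> Theta (r%:MP * 'X_[be]) = 0.
Proof.
move=> ne; apply: Theta_I => al hal; rewrite mcoeffCM mcoeffX; case: eqP => [e|_].
  by rewrite e hal eqxx in ne.
by rewrite mulr0; apply: submod0.
Qed.

Lemma zM_col (j : 'I_m) : \sum_x pr (A x j) *: ze x = 0 :> M.
Proof.
transitivity (zM b A (col j A)); first by rewrite zM_coord; apply: eq_bigr => x _; rewrite mxE.
transitivity (zM b A (0 : 'cV[R]_t) : cokernel_mod b A); last exact: (raddf0 (quot_pi (mx_image A))).
by apply/zM_eq; exists (delta_mx j 0); rewrite subr0 colE.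
Qed.

(** By multilinearity one factor of the product becomes column j of phi, which is zero in M. *)
Lemma Theta_ell q (j : 'I_m) : Theta (q * ell Phi t j) = 0.
Proof.
elim/mpoly_term_ind: q => [r be|p q hp hq]; last by rewrite mulrDl ThetaD hp hq addr0.
rewrite -mulrA ThetaC /ell mulr_sumr Theta_sum.
have E (x : 'I_t) : Theta ('X_[be] * ((Phi j x)%:MP * 'X_x)) = pr (A x j) *: Theta 'X_[U_(x) + be].
  by rewrite mulrCA -mpolyXD ThetaC PhE addmC.
under eq_bigr do rewrite E.
case: (eqVneq (mdeg be) d) => [/mmon_surj [f hf]|ne]; last first.
  rewrite big1 ?scaler0 // => x _; have := @Theta_neq 1 (U_(x) + be)%MM.
  by rewrite mpolyC1 mul1r => ->; rewrite ?scaler0 // mdegD mdeg1 eqSS.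
pose w x : 'I_i -> 'I_t := fun k => if unlift ord0 k is Some k' then f k' else x.
pose v : {ffun 'I_i -> M} := [ffun k => ze (w (Ordinal t_gt0) k) : M].
have E2 (x : 'I_t) : Theta 'X_[U_(x) + be] = sym_mon (put v ord0 (ze x : M)) :> Mi.
  have -> : (U_(x) + be)%MM = mmon (w x).
    rewrite mmon_cons /w unlift_none -hf; congr (_ + _)%MM.
    by apply/mnmP => y; rewrite !mnmE; apply: eq_bigr => k _; rewrite liftK.
  rewrite Theta_mmon /zmon; congr sym_mon; apply/ffunP => k; rewrite !ffunE /w.
  by case: unliftP => [k' ->|->]; rewrite ?eqxx // eq_sym (negbTE (neq_lift _ _)).
transitivity (pr r *: sym_mon (put v ord0 (\sum_x pr (A x j) *: ze x : M)) : Mi).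
  rewrite (multi_sum (@sym_mon_lin gA M i)); congr (_ *: _); apply: eq_bigr => x _.
  by rewrite E2 (multiZ (@sym_mon_lin gA M i)).
by rewrite zM_col (multi0 (@sym_mon_lin gA M i)) scaler0.
Qed.

Lemma Theta_Lid p : Lid i L p -> Theta p = 0.
Proof.
move=> [q hq]; rewrite -(subrK (\sum_j q j * ell Phi t j) p) ThetaD Theta_sum.
rewrite [X in _ + X]big1 => [|j _]; last exact: Theta_ell.
by rewrite addr0; apply: Theta_I => al /hq h; apply/IL_minors/(@lvL R L xx).
Qed.

Lemma Theta_surj w : exists p, Theta p = w.
Proof.
have mon (s : seq 'I_i) : forall v : {ffun 'I_i -> M}, (forall k, k \notin s -> exists x, v k = ze x) ->
    exists p, Theta p = sym_mon v.
  elim: s => [|k s IH] v hv.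
    have /choice [f hf] : forall k, exists x, v k = ze x by move=> k; apply: hv.
    exists 'X_[mmon f]; rewrite Theta_mmon /zmon; congr sym_mon.
    by apply/ffunP => k; rewrite !ffunE hf.
  have [g hg] := zM_surj (v k).
  have /choice [p hp] : forall x, exists p, Theta p = sym_mon (put v k (ze x : M)).
    move=> x; apply: IH => k' hk'; rewrite ffunE; case: eqP => [_|/eqP ne]; first by exists x.
    by apply: hv; rewrite inE negb_or ne.
  exists (\sum_x (g x 0)%:MP * p x); rewrite Theta_sum.
  transitivity (sym_mon (put v k (\sum_x pr (g x 0) *: ze x : M)) : Mi).
    rewrite (multi_sum (@sym_mon_lin gA M i)); apply: eq_bigr => x _.
    by rewrite ThetaC hp (multiZ (@sym_mon_lin gA M i)).
  rewrite -zM_coord -hg; congr sym_mon; apply/ffunP => k'; rewrite ffunE.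
  by case: eqP => [->|].
elim/sympow_ind: w => [u v|x y [p <-] [q <-]|]; last by exists 0; rewrite Theta0.
  have [r ->] := pr_surj u; have [|p hp] := mon (enum 'I_i) v; first by move=> k; rewrite mem_enum.
  by exists (r%:MP * p); rewrite ThetaC hp.
by exists (p + q); rewrite ThetaD.
Qed.

Definition LidM : submod (restr D^o rho).
Proof.
exists (fun p : restr D^o rho => Lid i L (p : D)).
- exact: Lid0.
- exact: LidD.
- move=> r p; exact: LidC.
Defined.
Fact LidM_killed : killed_by I (quot LidM).
Proof.
move=> r v Ir; elim/quot_ind: v => p; rewrite -linearZ; apply: quot_pi0.
by apply: Lid_I; apply/IL_minors.
Qed.
Local Notation Q := (descent LidM_killed).
Definition cl (p : D) : Q := quot_pi LidM (p : restr D^o rho).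
Lemma clP p q : cl p = cl q <-> Lid i L (p - q). Proof. exact: quot_piP. Qed.
Lemma clD p q : cl (p + q) = cl p + cl q. Proof. exact: (raddfD (quot_pi LidM)). Qed.
Lemma clC r p : cl (r%:MP * p) = pr r *: cl p.
Proof.
transitivity ((r : R) *: quot_pi LidM (p : restr D^o rho)).
  have h := @quot_pi_linear _ _ LidM r (p : restr D^o rho) 0.
  by rewrite addr0 raddf0 addr0 in h; exact: h.
by symmetry; apply: (descent_scaleE LidM_killed).
Qed.

Definition linG (g : 'cV[R]_t) : D := \sum_x (g x 0)%:MP * 'X_x.
Definition lin (w : M) : D := linG (repr w : 'cV[R]_t).

Lemma linG_lin r g h : linG (r *: g + h) = r%:MP * linG g + linG h.
Proof.
rewrite /linG mulr_sumr -big_split; apply: eq_bigr => x _.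
by rewrite !mxE mpolyCD mpolyCM mulrDl mulrA.
Qed.
Lemma linG_delta x : linG (delta_mx x 0) = 'X_x.
Proof.
rewrite /linG (bigD1 x) //= !mxE !eqxx mpolyC1 mul1r big1 ?addr0 // => y /negbTE ne.
by rewrite !mxE ne mpolyC0 mul0r.
Qed.
Lemma lin_zM g : Lid 1 L (lin (zM b A g) - linG g).
Proof.
have [y hy] := @quot_reprB _ _ (mx_image A) g.
have -> : lin (zM b A g) - linG g = linG (A *m y).
  have -> : A *m y = (-1) *: g + (repr (zM b A g : cokernel_mod b A) : 'cV[R]_t).
    by rewrite -hy scaleN1r addrC.
  by rewrite linG_lin mpolyCN mulN1r addrC.
have -> : linG (A *m y) = \sum_(j < m) (y j 0)%:MP * ell Phi t j.
  rewrite /linG /ell; under eq_bigr do rewrite mxE raddf_sum mulr_suml.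
  rewrite exchange_big; apply: eq_bigr => j _; rewrite mulr_sumr; apply: eq_bigr => x _.
  by rewrite mulrA -mpolyCM PhE mulrC [y j 0 * _]mulrC mulrC.
by apply: Lid_sum => j; apply: Lid_ell.
Qed.
Lemma Lid_lin e w z : Lid e L z -> Lid e.+1 L (lin w * z).
Proof.
move=> h; rewrite /lin /linG mulr_suml; apply: Lid_sum => x; rewrite -mulrA.
by apply: LidC; apply: LidX1.
Qed.
Lemma Lid_prod (v : {ffun 'I_i -> M}) (s : seq 'I_i) z : Lid 1 L z ->
  Lid (size s).+1 L ((\prod_(k <- s) lin (v k)) * z).
Proof.
move=> h; elim: s => [|k s IH]; first by rewrite big_nil mul1r.
by rewrite big_cons -mulrA; apply: Lid_lin.
Qed.

Definition Ff (v : {ffun 'I_i -> M}) : Q := cl (\prod_k lin (v k)).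

Lemma Ff_lin v k u x y : Ff (put v k (u *: x + y)) = u *: Ff (put v k x) + Ff (put v k y).
Proof.
have [r ->] := pr_surj u; pose s := [seq k' <- index_enum 'I_i | k' != k].
have ss : size s = d.
  have h1 : (\sum_(k' < i) 1 = 1 + \sum_(k' <- s) 1)%N by rewrite (bigD1 k) //= -big_filter.
  by move: h1; rewrite sum_nat_const card_ord muln1 sum1_size add1n => -[].
have E z : Ff (put v k z) = cl (lin z * \prod_(k' <- s) lin (v k')).
  rewrite /Ff; congr cl; rewrite (bigD1 k isT) [in RHS]big_filter; congr (_ * _).
    by rewrite ffunE eqxx.
  apply: eq_bigr => k' hk'; have /negbTE ne : k' != k by exact: hk'.
  by rewrite ffunE ne.
rewrite !E -clC -clD; apply/clP.
have ez : pr r *: x + y = zM b A (r *: (repr x : 'cV[R]_t) + (repr y : 'cV[R]_t)) :> M.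
  have zr (w : M) : zM b A (repr w : 'cV[R]_t) = w by exact: (quot_piE (w : quot (mx_image A))).
  by rewrite zMD zMZ !zr.
have h := lin_zM (r *: (repr x : 'cV[R]_t) + (repr y : 'cV[R]_t)).
rewrite -ez linG_lin in h; have := Lid_prod v s h; rewrite ss.
congr (Lid _ _ _); rewrite /lin; ring.
Qed.
Lemma Ff_sym (v : {ffun 'I_i -> M}) (s : {perm 'I_i}) : Ff [ffun j => v (s j)] = Ff v.
Proof.
rewrite /Ff [in RHS](reindex_inj (@perm_inj _ s)); congr cl; apply: eq_bigr => j _.
by rewrite ffunE.
Qed.
Definition Psi (w : Mi) : Q := sym_lift Ff w.
Lemma PsiD x y : Psi (x + y) = Psi x + Psi y.
Proof. by have := sym_lift_linear Ff_lin Ff_sym 1 x y; rewrite !scale1r. Qed.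
Lemma PsiZ u x : Psi (u *: x) = u *: Psi x.
Proof.
have h0 : Psi 0 = 0.
  by have /eqP := PsiD 0 0; rewrite addr0 -[X in X == _]addr0 => /eqP /addrI ->.
by have := sym_lift_linear Ff_lin Ff_sym u x 0; rewrite addr0 -/(Psi 0) h0 addr0.
Qed.

Lemma lin_mmon k (f : 'I_k -> 'I_t) : Lid k L (\prod_(j < k) lin (ze (f j)) - 'X_[mmon f]).
Proof.
elim: k f => [|k IH] f.
  have -> : mmon f = 0%MM by apply/mnmP => x; rewrite mnmE big_ord0 mnm0E.
  by rewrite big_ord0 mpolyX0 subrr; apply: Lid0.
rewrite big_ord_recl mmon_cons mpolyXD; set P := \prod_(j < k) _; set X := 'X_[mmon _].
have -> : lin (ze (f ord0)) * P - 'X_(f ord0) * X =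
   lin (ze (f ord0)) * (P - X) + X * (lin (ze (f ord0)) - 'X_(f ord0)) by ring.
apply: LidD; first by apply: Lid_lin; apply: IH.
have := LidX (mmon (fun j => f (lift ord0 j))) (lin_zM (delta_mx (f ord0) 0)).
by rewrite mdeg_mmon addn1 linG_delta.
Qed.

Lemma Psi_Theta p : Psi (Theta p) = cl p.
Proof.
elim/mpoly_term_ind: p => [r be|p q hp hq]; last by rewrite ThetaD PsiD hp hq clD.
case: (eqVneq (mdeg be) i) => [/mmon_surj [f <-]|ne]; last first.
  rewrite Theta_neq //; transitivity (cl 0).
    by have := PsiZ 0 0; rewrite !scale0r => ->; symmetry; apply: (raddf0 (quot_pi LidM)).
  by apply/clP; rewrite sub0r -mulNr -mpolyCN; apply: Lid_Xneq.
rewrite ThetaC PsiZ clC; congr (_ *: _).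
rewrite Theta_mmon /zmon /Psi (sym_lift_mon Ff_lin Ff_sym); apply/clP.
under eq_bigr do rewrite !ffunE.
exact: lin_mmon.
Qed.

Lemma sym_torsion_free (w : Mi) : (d < c)%N -> pr (sJ G (2 * c)) *: w = 0 -> w = 0.
Proof.
move=> dc; have [p <-] := Theta_surj w => h.
have {}h : Lid i L ((sJ G (2 * c))%:MP * p).
  rewrite -[X in Lid _ _ X]subr0; apply/clP.
  by rewrite clC -Psi_Theta -PsiZ h -Theta0 Psi_Theta.
apply: Theta_Lid; have L_gt : (2 * c < L)%N by rewrite ltnS.
have h2 := @sym_regular R L xx Phi t m c (sJ G) (sJN G) (gext (@gS K n t b) (nb b) t) L_gt
  (fun e => @graded_WW K n t m a b A hA e) (ext_Reg_mG hA G c_gt0 mE n_ge) radical_sJ (sJX G) d p dc h.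
exact: h2.
Qed.
End Sym20.
End TorsionFree.

(** * General matrices *)

Section CoefPoly.
Variables (K : fieldType) (n t m : nat).
Local Notation R := {mpoly K[n.+1]}.
Local Notation MX := 'M[R]_(t, m).
Local Notation cpoly := (@coef_polynomial K n t m).

Lemma cpoly_const k : cpoly (fun=> k).
Proof.
have idx : 'I_0 -> 'I_t * 'I_m * 'X_{1..n.+1} by case.
by exists 0%N, idx, k%:MP => A; rewrite mevalC.
Qed.

Lemma cpoly_coef i j u : cpoly (fun A : MX => (A i j)@_u).
Proof. by exists 1%N, (fun=> (i, j, u)), 'X_ord0 => A; rewrite mevalXU. Qed.

Lemma cpoly_eq f g : (forall A : MX, f A = g A) -> cpoly f -> cpoly g.
Proof. by move=> e [N [idx [h hh]]]; exists N, idx, h => A; rewrite -e. Qed.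

Lemma cpoly_pair f g : cpoly f -> cpoly g -> exists N (idx : 'I_N -> 'I_t * 'I_m * 'X_{1..n.+1}) (p q : {mpoly K[N]}),
  forall A : MX, let v := fun k => (A (idx k).1.1 (idx k).1.2)@_((idx k).2) in f A = p.@[v] /\ g A = q.@[v].
Proof.
move=> [N [idx [p hp]]] [N' [idx' [q hq]]].
exists (N + N')%N, (fun k => match split k with inl i => idx i | inr i => idx' i end).
exists (p \mPo [tuple 'X_(lshift N' i) | i < N]), (q \mPo [tuple 'X_(rshift N i) | i < N']).
move=> A v; rewrite hp hq !comp_mpoly_meval; split; apply: meval_eq => i.
  rewrite tnth_map tnth_ord_tuple mevalXU /v; have := unsplitK (inl i : 'I_N + 'I_N') => /= ->; done.
rewrite tnth_map tnth_ord_tuple mevalXU /v; have := unsplitK (inr i : 'I_N + 'I_N') => /= ->; done.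
Qed.

Lemma cpolyD f g : cpoly f -> cpoly g -> cpoly (fun A => f A + g A).
Proof.
move=> hf hg; have [N [idx [p [q h]]]] := cpoly_pair hf hg.
by exists N, idx, (p + q) => A; have [-> ->] := h A; rewrite mevalD.
Qed.
Lemma cpolyM f g : cpoly f -> cpoly g -> cpoly (fun A => f A * g A).
Proof.
move=> hf hg; have [N [idx [p [q h]]]] := cpoly_pair hf hg.
by exists N, idx, (p * q) => A; have [-> ->] := h A; rewrite mevalM.
Qed.
Lemma cpoly_sum (J : Type) (r : seq J) (P : pred J) (F : J -> MX -> K) :
  (forall j, cpoly (F j)) -> cpoly (fun A => \sum_(j <- r | P j) F j A).
Proof.
move=> h; elim: r => [|j r IH].
  by apply: cpoly_eq (cpoly_const 0) => A; rewrite big_nil.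
case e: (P j); last by apply: cpoly_eq IH => A; rewrite big_cons e.
by apply: cpoly_eq (cpolyD (h j) IH) => A; rewrite big_cons e.
Qed.
Lemma cpoly_prod (J : Type) (r : seq J) (F : J -> MX -> K) :
  (forall j, cpoly (F j)) -> cpoly (fun A => \prod_(j <- r) F j A).
Proof.
move=> h; elim: r => [|j r IH].
  by apply: cpoly_eq (cpoly_const 1) => A; rewrite big_nil.
by apply: cpoly_eq (cpolyM (h j) IH) => A; rewrite big_cons.
Qed.
Lemma cpoly_det s (F : MX -> 'M[K]_s) : (forall i j, cpoly (fun A => F A i j)) -> cpoly (fun A => \det (F A)).
Proof.
by move=> h; apply: cpoly_sum => e; apply: cpolyM; [exact: cpoly_const|exact: cpoly_prod].
Qed.

Definition ppoly (F : MX -> R) := forall u, cpoly (fun A => (F A)@_u).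
Lemma ppoly_eq F G : (forall A, F A = G A) -> ppoly F -> ppoly G.
Proof. by move=> e h u; apply: cpoly_eq (h u) => A; rewrite e. Qed.
Lemma ppoly_const r : ppoly (fun=> r).
Proof. by move=> u; apply: cpoly_const. Qed.
Lemma ppolyD F G : ppoly F -> ppoly G -> ppoly (fun A => F A + G A).
Proof. by move=> h h' u; apply: cpoly_eq (cpolyD (h u) (h' u)) => A; rewrite mcoeffD. Qed.
Lemma ppolyM F G : ppoly F -> ppoly G -> ppoly (fun A => F A * G A).
Proof.
move=> h h' u; apply: cpoly_eq (cpoly_sum (index_enum _) (fun k : 'X_{1..n.+1 < (mdeg u).+1, (mdeg u).+1} => u == (k.1 + k.2)%MM)
  (F := fun k A => (F A)@_k.1 * (G A)@_k.2) _) => [A|k]; first by rewrite mcoeffM.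
exact: cpolyM.
Qed.
Lemma ppolyB F G : ppoly F -> ppoly G -> ppoly (fun A => F A - G A).
Proof.
move=> h h'; apply: ppoly_eq (ppolyD h (ppolyM (ppoly_const (-1)) h')) => A.
by rewrite mulN1r.
Qed.
Lemma ppoly_sum (J : Type) (r : seq J) (F : J -> MX -> R) :
  (forall j, ppoly (F j)) -> ppoly (fun A => \sum_(j <- r) F j A).
Proof.
move=> h; elim: r => [|j r IH].
  by apply: ppoly_eq (ppoly_const 0) => A; rewrite big_nil.
by apply: ppoly_eq (ppolyD (h j) IH) => A; rewrite big_cons.
Qed.
Lemma ppoly_Ph j i : ppoly (fun A => Ph A j i).
Proof.
rewrite /Ph; case: insubP => [j' _ _|_]; last exact: ppoly_const.
by case: insubP => [i' _ _|_]; [move=> u; apply: cpoly_coef|exact: ppoly_const].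
Qed.

Fixpoint epoly s : (MX -> ext R s) -> Prop :=
  match s with
  | 0 => fun F => ppoly F
  | s'.+1 => fun F => epoly (s := s') (fun A => (F A).1) /\ epoly (s := s') (fun A => (F A).2)
  end.
Lemma epoly0 s : epoly (fun=> 0 : ext R s).
Proof. by elim: s => [|s IH]; [exact: ppoly_const|split]. Qed.
Lemma epolyB s (F G : MX -> ext R s) : epoly F -> epoly G -> epoly (fun A => F A - G A).
Proof.
elim: s F G => [|s IH] F G /=; first exact: ppolyB.
by move=> [h1 h2] [h3 h4]; split; apply: IH.
Qed.
Lemma epolyZ s r (F : MX -> ext R s) : ppoly r -> epoly F -> epoly (fun A => r A *: F A).
Proof.
move=> hr; elim: s F => [|s IH] F /=; first exact: ppolyM.
by move=> [h1 h2]; split; apply: IH.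
Qed.
Lemma epoly_wedge s v (F : MX -> ext R s) : (forall i, ppoly (fun A => v A i)) -> epoly F -> epoly (fun A => wedge (v A) (F A)).
Proof.
move=> hv; elim: s F => [|s IH] F /=; first by move=> _; exact: ppoly_const.
move=> [h1 h2]; split; first exact: IH.
by apply: epolyB; [apply: epolyZ|apply: IH].
Qed.
Lemma epoly_top s (F : MX -> ext R s) : epoly F -> ppoly (fun A => top (F A)).
Proof. by elim: s F => [|s IH] F //= [_ h]; apply: IH. Qed.
Lemma epoly_one s : epoly (fun=> one R s).
Proof. by elim: s => [|s IH]; [exact: ppoly_const|split=> //; exact: epoly0]. Qed.
Lemma epoly_cols l : epoly (fun A => cols (Ph A) t l).
Proof.
elim: l => [|j l IH]; first exact: epoly_one.
by apply: epoly_wedge => // i; apply: ppoly_Ph.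
Qed.
Lemma ppoly_top_cols l : ppoly (fun A => top (cols (Ph A) t l)).
Proof. exact/epoly_top/epoly_cols. Qed.
Lemma ppoly_uu l i : ppoly (fun A => uu (Ph A) t l (delta R i)).
Proof. by apply: epoly_top; apply: epoly_wedge; [move=> k; exact: ppoly_const|exact: epoly_cols]. Qed.
End CoefPoly.

Lemma xxE (K : fieldType) n k : xx K n k = 'X_(inord k). Proof. by []. Qed.

Section Open.
Variables (K : fieldType) (n t m : nat).
Local Notation R := {mpoly K[n.+1]}.
Local Notation xx := (xx K n).
Local Notation X k := (XS n.+1 xx R^o k).

Definition low p (u : 'X_{1..n.+1}) : bool := [forall j : 'I_n.+1, (p < j)%N ==> (u j == 0%N)].

Lemma lowP p (u : 'X_{1..n.+1}) : reflect (forall j : 'I_n.+1, (p < j)%N -> u j = 0%N) (low p u).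
Proof.
apply: (iffP forallP) => h j; first by move=> pj; apply/eqP; apply: (implyP (h j)).
by apply/implyP => pj; apply/eqP/h.
Qed.

Lemma X_low p r u : X p.+1 r -> low p u -> r@_u = 0.
Proof.
move=> [g ->] /lowP hu; rewrite (raddf_sum (mcoeff u)) big_nat big1 // => i /andP[pi iL].
suff E (h : R) : (xx i * h)@_u = 0 by exact: E.
elim/mpoly_term_ind: h => [k be|h h' e e']; last by rewrite mulrDr mcoeffD e e' addr0.
rewrite mulrCA mcoeffCM -mpolyXD mcoeffX; case: eqP => [e|_]; last by rewrite mulr0.
have := hu (inord i); rewrite inordK // => /(_ pi).
by rewrite -e mnmDE mnm1E eqxx.
Qed.

Lemma low_X p r : (forall u, low p u -> r@_u = 0) -> X p.+1 r.
Proof.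
move=> h; rewrite (mpolyE r); elim: (msupp r) => [|u s IH]; first by rewrite big_nil; apply: submod0.
rewrite big_cons; apply: submodD IH.
case: (boolP (low p u)) => [/h ->|]; first by rewrite scale0r; apply: submod0.
rewrite negb_forall => /existsP[j]; rewrite negb_imply => /andP[pj uj].
have le : (U_(j) <= u)%MM by rewrite lep1mP.
have -> : r@_u *: 'X_[u] = (xx j *: ((r@_u *: 'X_[u - U_(j)] : R) : R^o)) :> R.
  transitivity (r@_u *: (xx j * 'X_[u - U_(j)])); last exact: scalerAr.
  by congr (_ *: _); rewrite xxE inord_val -mpolyXD addmC submK.
by apply: XS_x; rewrite pj ltn_ord.
Qed.

Variables (Lam : finType) (M : Lam -> 'M[R]_(t, m) -> R) (A0 : 'M[R]_(t, m)) (p N : nat).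
Hypothesis hM : forall l, ppoly (M l).
Hypothesis pn : (p <= n)%N.
Hypothesis h0 : forall u : 'X_{1..n.+1}, mdeg u = N -> low p u ->
  exists q : Lam -> R, X p.+1 ('X_[u] - \sum_l q l * M l A0).

(* A surjectivity condition on a matrix of coefficients is open: it is the
   non-vanishing of the determinant of B, which is 1 at A0. *)
Lemma open_condition : exists phi, [/\ @coef_polynomial K n t m phi, phi A0 != 0
  & forall A, phi A != 0 -> exists q : Lam -> R,
     X p.+1 (pcmp (Posz N) (\sum_l q l * M l A) - xx p ^+ N)].
Proof.
pose T : finType := 'X_{1..n.+1 < N.+1}; pose good (u : T) := (mdeg u == N) && low p u.
have /choice [Q hQ] : forall u : 'X_{1..n.+1}, exists q : Lam -> R, mdeg u = N -> low p u ->
    X p.+1 ('X_[u] - \sum_l q l * M l A0).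
  move=> u; case: (pselect (mdeg u = N /\ low p u)) => [[h1 h2]|h]; last by exists (fun=> 0) => h1 h2; case: h.
  by have [q hq] := h0 h1 h2; exists q.
pose g u A := \sum_l Q u l * M l A.
(* Outside the good monomials, those of degree N in x_0, .., x_p, the matrix is filled with the
   identity; this gives a square matrix without reindexing. *)
pose B A : 'M[K]_#|T| := \matrix_(i, j) let u := enum_val i in let v := enum_val j in
  if good u && good v then (g u A)@_v else (i == j)%:R.
exists (fun A => \det (B A)); split.
- apply: cpoly_det => i j.
  case e : (good (enum_val i) && good (enum_val j)).
    apply: cpoly_eq ((_ : ppoly (g (enum_val i))) (enum_val j)) => [A|]; first by rewrite mxE /= e.
    by apply: ppoly_sum => l; apply: ppolyM => //; exact: ppoly_const.
  by apply: cpoly_eq (cpoly_const _ _ _ ((i == j)%:R)) => A; rewrite mxE /= e.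
- suff -> : B A0 = 1%:M by rewrite det1 oner_neq0.
  apply/matrixP => i j; rewrite !mxE /=.
  case e: (good (enum_val i) && good (enum_val j)) => //.
  case/andP: e => /andP[/eqP h1 h2] /andP[_ h3].
  have := X_low (hQ _ h1 h2) h3; rewrite mcoeffB => /eqP; rewrite subr_eq0 => /eqP <-.
  by rewrite mcoeffX -(inj_eq enum_val_inj) -val_eqE.
move=> A hA.
have hb : (mdeg (U_(inord p) *+ N : 'X_{1..n.+1}) < N.+1)%N by rewrite mdegMn mdeg1 mul1n.
pose u0 : T := BMultinom hb.
have gu0 : good u0.
  rewrite /good /= mdegMn mdeg1 mul1n eqxx; apply/lowP => j pj.
  rewrite mulmnE mnm1E; case: eqP => // e; move: pj; by rewrite -e inordK ?ltnn.
(* The combination of rows of B A that yields the single monomial x_p^N. *)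
pose y : 'rV[K]_#|T| := delta_mx 0 (enum_rank u0) *m invmx (B A).
have hy : y *m B A = delta_mx 0 (enum_rank u0) by rewrite mulmxKV // unitmxE unitfE.
have hv (v : T) : \sum_(i < #|T|) y 0 i * B A i (enum_rank v) = (v == u0)%:R.
  have := congr1 (fun w : 'rV[K]_#|T| => w 0 (enum_rank v)) hy; rewrite !mxE eqxx => ->.
  by rewrite (inj_eq enum_rank_inj).
have ybad i : ~~ good (enum_val i) -> y 0 i = 0.
  move=> bad; have Bi j : B A j i = (j == i)%:R by rewrite mxE /= (negbTE bad) andbF.
  have := hv (enum_val i); rewrite enum_valK (bigD1 i) //= Bi eqxx mulr1 big1 ?addr0 => [->|j ji].
    by case: eqP => [e|_]; [rewrite e gu0 in bad|].
  by rewrite Bi (negbTE ji) mulr0.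
exists (fun l => \sum_(i < #|T|) (y 0 i)%:MP * Q (enum_val i) l).
have eg : \sum_l (\sum_(i < #|T|) (y 0 i)%:MP * Q (enum_val i) l) * M l A =
    \sum_(i < #|T|) (y 0 i)%:MP * g (enum_val i) A.
  under eq_bigr do rewrite mulr_suml.
  rewrite exchange_big; apply: eq_bigr => i _; rewrite mulr_sumr.
  by apply: eq_bigr => l _; rewrite mulrA.
rewrite eg; apply: low_X => u hu; rewrite mcoeffB.
have -> : (xx p ^+ N)@_u = (U_(inord p) *+ N == u)%MM%:R by rewrite xxE mpolyXn mcoeffX.
case: (eqVneq (mdeg u) N) => [e|ne]; last first.
  have -> : (U_(inord p) *+ N == u)%MM = false.
    by apply/eqP => e; case/eqP: ne; rewrite -e mdegMn mdeg1 mul1n.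
  rewrite subr0; have := @pcmp_deg K n (Posz N) (\sum_(i < #|T|) (y 0 i)%:MP * g (enum_val i) A).
  by move=> /dhomog_nemf_coeff; apply.
have hu' : (mdeg u < N.+1)%N by rewrite e.
pose v : T := BMultinom hu'.
have gv : good v by rewrite /good /= e eqxx.
have -> r : (pcmp (Posz N) r)@_u = r@_u.
  rewrite /pcmp /= pihomogE (raddf_sum (mcoeff u)) /= big_mkcond /=.
  case: (boolP (u \in msupp r)) => h.
    rewrite (bigD1_seq u) ?msupp_uniq //= e eqxx mcoeffZ mcoeffX eqxx mulr1 big1 ?addr0 // => i /negbTE ne.
    by rewrite mcoeffZ mcoeffX ne mulr0 if_same.
  rewrite (memN_msupp_eq0 h) big_seq big1 // => i hi; case: ifP => // _.
  rewrite mcoeffZ mcoeffX; case: eqP => [e'|_]; last by rewrite mulr0.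
  by rewrite -e' hi in h.
rewrite (raddf_sum (mcoeff u)) /=.
have := hv v; rewrite -val_eqE /= [u == _]eq_sym => <-; apply/eqP; rewrite subr_eq0; apply/eqP.
apply: eq_bigr => i _; rewrite mcoeffCM.
have -> : B A i (enum_rank v) = if good (enum_val i) then (g (enum_val i) A)@_u else (i == enum_rank v)%:R.
  by rewrite mxE /= enum_rankK gv andbT.
by case: (boolP (good (enum_val i))) => // /ybad ->; rewrite !mul0r.
Qed.
End Open.

Section WedgeList.
Variables (C : comNzRingType) (t : nat).
Definition wl (s : seq (nat -> C)) : ext C t := foldr (fun v => wedge v) (one C t) s.

Lemma wed_wl s (V : 'I_s -> nat -> C) : wed t V = wl [seq V k | k <- enum 'I_s].
Proof.
elim: s V => [|s IH] V /=; first by rewrite enum_ord0.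
by rewrite enum_ordSl /= IH -map_comp.
Qed.
Lemma wl_ins s1 v s2 : wl (s1 ++ v :: s2) = (-1) ^+ size s1 *: wedge v (wl (s1 ++ s2)).
Proof.
elim: s1 => [|w s1 IH]; first by rewrite expr0 scale1r.
by rewrite /= IH wedgeZr wedgeC scalerN exprS mulN1r scaleNr.
Qed.
Lemma cols_wl Phi l : cols Phi t l = wl [seq Phi j | j <- l].
Proof. by rewrite /wl foldr_map. Qed.
End WedgeList.

Lemma ImL_wed (C : comNzRingType) (Phi : nat -> nat -> C) t q s (f : 'I_s -> nat) :
  (forall k, (f k < q)%N) -> ImL Phi t q (wed t (fun k => Phi (f k))).
Proof.
elim: s f => [|s IH] f h /=; first exact: ImL_one.
by apply: ImL_wedge => //; apply: IH.
Qed.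

Section RadicalIdeal.
Variables (R : comNzRingType) (Q : ideal R).
Hypothesis Qrad : forall r N, Q (r ^+ N) -> Q r.

Lemma qring_pi_eq0 r : qring_pi Q r = 0 <-> Q r.
Proof.
rewrite -(rmorph0 (qring_pi Q)); split=> [/quot_piP|h]; first by rewrite subr0.
by apply/quot_piP; rewrite subr0.
Qed.

Lemma ideal_exp r N : (0 < N)%N -> Q r -> Q (r ^+ N).
Proof. by case: N => // N _ h; rewrite exprS; apply: idealMr. Qed.

Lemma wed_trig t (V : 'I_t -> nat -> R) : (forall i k : 'I_t, (k < i)%N -> Q (V k i)) ->
  Q (top (wed t V)) -> Q (\prod_i V i i).
Proof.
move=> hV hQ; pose N : 'M[R]_t := \matrix_(i, k) V k i.
have hN : Q (\det N).
  have -> : \det N = wsgn R t * top (wed t V) by rewrite wed_det mulrA wsgn_sqr mul1r.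
  exact: idealMl.
apply/qring_pi_eq0; have /qring_pi_eq0 <- := hN.
rewrite -det_map_mx -det_tr det_trig; last first.
  by apply/is_trig_mxP => i j ij; rewrite !mxE; apply/qring_pi_eq0/hV.
by rewrite rmorph_prod; apply: eq_bigr => i _; rewrite !mxE.
Qed.

Lemma prod_pow_in t y (P : 'I_t -> R) (d : 'I_t -> nat) :
  (forall i, Q (P i - y)) -> Q (\prod_i P i ^+ d i) -> Q y.
Proof.
move=> hP hQ; apply: (@Qrad _ (\sum_i d i)%N); apply/qring_pi_eq0; have /qring_pi_eq0 <- := hQ.
rewrite rmorphXn -prodrXr rmorph_prod; apply: eq_bigr => i _; rewrite rmorphXn; congr (_ ^+ _).
by symmetry; apply/quot_piP.
Qed.

Lemma prod_radical (T : finType) (S : pred T) (P : T -> R) (d : T -> nat) :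
  Q (\prod_(i | S i) P i ^+ d i) -> Q (\prod_(i | S i) P i).
Proof.
move=> hQ; pose D := (\sum_i d i)%N; apply: (@Qrad _ D); rewrite -prodrXl.
have -> : \prod_(i | S i) P i ^+ D = \prod_(i | S i) P i ^+ d i * \prod_(i | S i) P i ^+ (D - d i).
  rewrite -big_split; apply: eq_bigr => i _; rewrite /= -exprD subnKC //.
  by rewrite /D (bigD1 i) //= leq_addr.
exact: idealMr.
Qed.
End RadicalIdeal.

Section PowerBound.
Variables (K : fieldType) (n : nat).
Local Notation R := {mpoly K[n.+1]}.
Local Notation xx := (xx K n).
(** Pigeonhole: a monomial of degree (n + 1) N1 in x_0, .., x_p is divisible by some x_j^N1. *)
Lemma power_bound (T : ideal R) p : (forall o, (o <= p)%N -> (o <= n)%N -> exists N, T (xx o ^+ N)) ->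
  exists N, forall u : 'X_{1..n.+1}, mdeg u = N -> low p u -> T 'X_[u].
Proof.
move=> h; have /choice [N hN] : forall o : 'I_n.+1, exists N, (o <= p)%N -> T (xx o ^+ N).
  move=> o; case: (leqP o p) => [op|po]; last by exists 0%N.
  by have [N hN] := h o op (ltn_ord o); exists N.
pose N1 := (\max_o N o).+1; exists (n.+1 * N1)%N => u hu lu.
have [j hj] : exists j, (N1 <= u j)%N.
  apply: contrapT => hh; have lt j : (u j <= N1.-1)%N.
    by rewrite -ltnS leqNgt; apply/negP => h'; apply: hh; exists j.
  have : (mdeg u <= n.+1 * N1.-1)%N.
    apply: (@leq_trans (\sum_(j < n.+1) N1.-1)%N); last by rewrite sum_nat_const card_ord.
    by rewrite mdegE; apply: leq_sum => j _; apply: lt.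
  by rewrite hu leq_mul2l /= ltnn.
have jp : (j <= p)%N.
  rewrite leqNgt; apply/negP => pj; move/lowP: lu => /(_ j pj) e; by rewrite e in hj.
have le : (U_(j) *+ N1 <= u)%MM.
  by apply/mnm_lepP => i; rewrite mulmnE mnm1E; case: eqP => [<-|_]; rewrite ?mul1n ?mul0n.
have -> : 'X_[u] = 'X_[u - U_(j) *+ N1] * xx j ^+ N1 by rewrite xxE inord_val mpolyXn -mpolyXD submK.
apply: idealMl; have hle : (N j <= N1)%N by apply: leqW; exact: leq_bigmax.
by rewrite -(subnK hle) exprD; apply: idealMl; apply: hN.
Qed.
End PowerBound.

(** * The explicit matrix [A0] and the openness of genericity *)

Section Phi0.
Variables (K : fieldType) (n c t m : nat) (a : 'I_m -> int) (b : 'I_t -> int).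
Local Notation R := {mpoly K[n.+1]}.
Local Notation L := n.+1.
Local Notation xx := (xx K n).
Hypotheses (charK0 : [pchar K] =i pred0) (c_gt0 : (0 < c)%N) (t_gt1 : (1 < t)%N)
  (mE : m = (t + c.-1)%N) (n_ge : (2 * c <= n)%N).
Hypothesis pos : forall i j, 0 < a j - b i.

Definition dg (i : 'I_t) (j : 'I_m) : nat := absz (a j - b i).
Definition lf (o i : nat) : R := xx o + (i%:R : K)%:MP * xx (c + o).
(* Modulo x_{2c} and the pairs x_o, x_{c+o} with o < e, the determinants used
   below become triangular, with diagonal entries powers of x_e + i x_{c+e};
   characteristic 0 makes these forms pairwise independent. *)
Definition A0 : 'M[R]_(t, m) := \matrix_(i, j)
  if (i <= j < i + c)%N then lf (j - i) i ^+ dg i j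
  else if (i == j.+1 :> nat) then xx (2 * c) ^+ dg i j else 0.
Local Notation Phi := (Ph A0).

Lemma dg_gt0 i j : (0 < dg i j)%N.
Proof. by rewrite /dg absz_gt0 gt_eqF. Qed.

Lemma lin_exp_deg (f : R) k : poly_deg 1 f -> poly_deg (Posz k) (f ^+ k).
Proof.
move=> hf; elim: k => [|k IH]; first by rewrite expr0; apply: (@dhomog1 n.+1 K).
by rewrite exprS; exact: (poly_degM hf IH).
Qed.

Lemma lf_deg o i : poly_deg 1 (lf o i).
Proof.
apply: rpredD; first exact: poly_degX.
rewrite mul_mpolyC; apply: rpredZ; exact: (@poly_degX K n (c + o)).
Qed.

Lemma A0_hom : homogeneous_mx a b A0.
Proof.
move=> i j; have -> : a j - b i = Posz (dg i j) by rewrite /dg gez0_abs // ltW.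
rewrite mxE; case: ifP => _; first exact/lin_exp_deg/lf_deg.
by case: ifP => _; [exact/lin_exp_deg/poly_degX|exact: poly_deg0].
Qed.

Lemma PhA0 (j : nat) (hj : (j < m)%N) (i : 'I_t) : Phi j i =
  if (i <= j < i + c)%N then lf (j - i) i ^+ dg i (Ordinal hj)
  else if (i == j.+1 :> nat) then xx (2 * c) ^+ dg i (Ordinal hj) else 0.
Proof. by have := PhE A0 (Ordinal hj) i; rewrite mxE. Qed.

Section Radical22.
Variable Q : ideal R.
Hypothesis Qrad : forall r N, Q (r ^+ N) -> Q r.

Lemma entry_in e (i : 'I_t) j : (forall o, (o < e)%N -> Q (xx o) /\ Q (xx (c + o))) ->
  Q (xx (2 * c)) -> (j < i + e)%N -> (j < m)%N -> Q (Phi j i).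
Proof.
move=> h h2 ji jm; rewrite (PhA0 jm); case: ifP => [/andP[h3 h4]|_].
  have [h5 h6] : Q (xx (j - i)) /\ Q (xx (c + (j - i))) by apply: h; lia.
  by apply: ideal_exp; [exact: dg_gt0|apply: submodD => //; apply: idealMl].
by case: ifP => _; [apply: ideal_exp => //; exact: dg_gt0|exact: submod0].
Qed.

(** Once x_o is in Q for o < e, the square block of columns e, .., e + t - 1 is triangular modulo Q,
    and its diagonal entries are powers of x_e because x_{c+e} is in Q. *)
Lemma low_vars p : (p < c)%N -> (forall o, (p < o <= n)%N -> Q (xx o)) ->
  (forall r, IL Phi t (t + p) r -> Q r) -> forall e, (e <= p)%N -> Q (xx e).
Proof.
move=> pc Hx HI; elim/ltn_ind => e IH ep.
have hj (i : 'I_t) : (e + i < m)%N by have := ltn_ord i; lia.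
have hc o : (o < c)%N -> Q (xx (c + o)) by move=> oc; apply: Hx; lia.
apply: (@prod_pow_in _ _ Qrad t _ (fun i => lf e i) (fun i => dg i (Ordinal (hj i)))).
  move=> i; rewrite /lf addrC addKr; apply: idealMl; apply: hc; lia.
have -> : \prod_(i < t) lf e i ^+ dg i (Ordinal (hj i)) = \prod_(i < t) Phi (e + i) i.
  apply: eq_bigr => i _; rewrite (PhA0 (hj i)) addnK ifT //; apply/andP; lia.
apply: (wed_trig (V := fun k : 'I_t => Phi (e + k))).
  move=> i k ki; apply: (@entry_in e); [|by apply: Hx; lia|lia|exact: hj].
  by move=> o oe; split; [apply: IH => //; lia|apply: hc; lia].
apply: HI; apply: top_ImL; apply: ImL_wed => k; have := ltn_ord k; lia.
Qed.

Hypothesis HJ : forall r, Jid Phi t m r -> Q r.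

(** With the basis vector e_r in place of one column, the determinant is a (t-1)-minor up to
    sign. *)
Lemma wed_J (r : 'I_t) (g : 'I_t -> nat) : (forall k, k != r -> (g k < m)%N) ->
  Q (top (wed t (fun k => if k == r then delta R r else Phi (g k)))).
Proof.
move=> hg; rewrite wed_wl; have := enum_uniq 'I_t; have := size_enum_ord t.
have rs : r \in enum 'I_t by rewrite mem_enum.
case/splitPr: rs => s1 s2 hsz; rewrite -cat_rcons cat_uniq rcons_uniq => hu.
have ns (s : seq 'I_t) : r \notin s ->
    [seq (if k == r then delta R r else Phi (g k)) | k <- s] = [seq Phi j | j <- [seq g k | k <- s]].
  rewrite -map_comp => hr; apply/eq_in_map => k ks /=; case: eqP => // e.
  by rewrite e (negbTE hr) in ks.
have [h1 h2] : r \notin s1 /\ r \notin s2.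
  case/and3P: hu => /andP[h1 _] h2 _; split=> //.
  by apply: contra h2 => h; apply/hasP; exists r => //; rewrite mem_rcons inE eqxx.
rewrite cat_rcons map_cat /= eqxx wl_ins topZ; apply: idealMl.
rewrite (ns _ h1) (ns _ h2) -!map_cat -cols_wl; apply: HJ; apply: span_gen.
exists [seq g k | k <- s1 ++ s2], r; split=> //.
  have hs : (size s1 + size s2).+1 = t by move: hsz; rewrite size_cat /= addnS.
  by rewrite size_map size_cat; exact: (congr1 predn hs).
apply/allP => _ /mapP[k hk ->]; apply: hg; apply: contraL hk => /eqP ->.
by rewrite mem_cat negb_or h1.
Qed.

(** Rows 1, .., t - 1 against columns 0, .., t - 2: the diagonal of this minor is the lower band of
    [A0], made of powers of x_{2c}, and the other side of it is zero. *)
Lemma var_2c : Q (xx (2 * c)).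
Proof.
have t0 : (0 < t)%N by lia.
pose r := Ordinal t0; have hj (i : 'I_t) : (i.-1 < m)%N by have := ltn_ord i; lia.
have ne (i : 'I_t) : i != r -> (0 < i)%N by rewrite -val_eqE lt0n.
apply: (@prod_pow_in _ _ Qrad t _ (fun=> xx (2 * c)) (fun i => if i == r then 0%N else dg i (Ordinal (hj i)))).
  by move=> i; rewrite subrr; apply: submod0.
pose V (k : 'I_t) := if k == r then delta R r else Phi k.-1.
have -> : \prod_(i < t) xx (2 * c) ^+ (if i == r then 0%N else dg i (Ordinal (hj i))) = \prod_(i < t) V i i.
  apply: eq_bigr => i _; rewrite /V; case: eqP => [->|/eqP /ne i0]; first by rewrite expr0 /delta eqxx.
  by rewrite (PhA0 (hj i)) prednK // eqxx leqNgt ltn_predL i0.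
apply: wed_trig; last by apply: wed_J.
move=> i k ki; rewrite /V; case: eqP => [ek|/eqP /ne k0].
  rewrite /delta; have -> : (i == r :> nat) = false by apply/eqP => e; move: ki; rewrite ek e ltnn.
  exact: submod0.
rewrite (PhA0 (hj k)) ifF; last by apply/negbTE/negP => /andP[]; lia.
by rewrite prednK // ifF ?gtn_eqF //; apply: submod0.
Qed.

(** In characteristic 0 the number r - r' is invertible, so the two linear forms span x_e and
    x_{c+e}. *)
Lemma pair_in e r r' z : r != r' -> Q (z * lf e r) -> Q (z * lf e r') -> Q (z * xx e) /\ Q (z * xx (c + e)).
Proof.
move=> ne h h'; pose ka : K := r%:R - r'%:R.
have ka0 : ka != 0.
  have ch := (pcharf0P _).1 charK0; rewrite /ka; case: (leqP r r') => rr.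
    by rewrite -oppr_eq0 opprB -natrB // ch subn_eq0 -ltnNge ltn_neqAle ne.
  by rewrite -natrB ?(ltnW rr) // ch subn_eq0 -ltnNge.
have e1 : z * xx (c + e) = (ka^-1)%:MP * (z * lf e r - z * lf e r').
  have -> : z * lf e r - z * lf e r' = ka%:MP * (z * xx (c + e)).
    by rewrite /lf /ka mpolyCB; ring.
  transitivity (((ka^-1)%:MP * ka%:MP) * (z * xx (c + e))); last by rewrite -mulrA.
  by rewrite -mpolyCM mulVf // mpolyC1 mul1r.
have h1 : Q (z * xx (c + e)) by rewrite e1; apply: idealMl; apply: submodB.
split=> //; have -> : z * xx e = z * lf e r - (r%:R : K)%:MP * (z * xx (c + e)) by rewrite /lf; ring.
by apply: submodB => //; apply: idealMl.
Qed.

(** Omitting row and column r gives a triangular minor, hence the product of the forms [lf e i] with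
    i != r. In [claim] factors are dropped one by one: if z times two different forms is in Q, then
    so are z x_e and z x_{c+e}, hence z times each of its own factors, hence z^2 and z. *)
Lemma var_step e : (e < c)%N -> (forall o, (o < e)%N -> Q (xx o) /\ Q (xx (c + o))) ->
  Q (xx e) /\ Q (xx (c + e)).
Proof.
move=> ec IH; have hj (i : 'I_t) : (e + i < m)%N by have := ltn_ord i; lia.
have claim k : forall S : {set 'I_t}, #|~: S| = k.+1 -> (k.+1 < t)%N -> Q (\prod_(i in S) lf e i).
  elim: k => [|k IHk] S hS kt.
    have /cards1P [r er] : #|~: S| == 1%N by rewrite hS.
    apply: (prod_radical Qrad (d := fun i => dg i (Ordinal (hj i)))).
    pose V (k : 'I_t) := if k == r then delta R r else Phi (e + k).
    have -> : \prod_(i in S) lf e i ^+ dg i (Ordinal (hj i)) = \prod_(i < t) V i i.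
      rewrite [RHS](bigD1 r) //= /V eqxx {1}/delta eqxx mul1r; apply: eq_big => [i|i hi].
        by rewrite -[S]setCK er !inE.
      have /negbTE -> : i != r by move: hi; rewrite -[S]setCK er !inE.
      by rewrite (PhA0 (hj i)) addnK ifT //; apply/andP; lia.
    apply: wed_trig; last by apply: wed_J.
    move=> i k ki; rewrite /V; case: eqP => [ek|_].
      rewrite /delta; case: eqP => [er'|_]; last exact: submod0.
      by move: ki; rewrite ek er' ltnn.
    by apply: (@entry_in e) => //; [exact: var_2c|lia].
  have /card_gt1P [r [r' [hr hr' ne]]] : (1 < #|~: S|)%N by rewrite hS.
  rewrite !inE in hr hr'.
  have [hz hz'] : Q ((\prod_(i in S) lf e i) * xx e) /\ Q ((\prod_(i in S) lf e i) * xx (c + e)).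
    have ins x : x \notin S -> Q ((\prod_(i in S) lf e i) * lf e x).
      move=> hx; have := IHk (x |: S); rewrite big_setU1 // mulrC; apply; last by lia.
      have := cardsD1 x (~: S); rewrite hS !inE hx add1n => -[->]; congr #|pred_of_set _|.
      by apply/setP => y; rewrite !inE negb_or.
    by apply: (pair_in (r := r) (r' := r')); [exact: ne|exact: ins|exact: ins].
  have /set0Pn [i iS] : S != set0.
    by apply/eqP => e0; move: hS kt; rewrite e0 setC0 cardsT card_ord => ->; rewrite ltnn.
  apply: (@Qrad _ 2); rewrite expr2 {2}(big_setD1 i) //= mulrA; apply: idealMr.
  by rewrite /lf mulrDr; apply: submodD => //; rewrite mulrCA; apply: idealMl.
have t0 : (0 < t)%N by lia.
have one (r : 'I_t) : Q (1 * lf e r).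
  have := @claim (t - 2)%N [set r]; rewrite big_set1 mul1r; apply; last by lia.
  by rewrite cardsC1 card_ord; lia.
have [] := pair_in (r := 0%N) (r' := 1%N) isT (one (Ordinal t0)) (one (Ordinal t_gt1)).
by rewrite !mul1r.
Qed.

Lemma all_vars o : (o <= 2 * c)%N -> Q (xx o).
Proof.
have h e : (e < c)%N -> Q (xx e) /\ Q (xx (c + e)).
  by elim/ltn_ind: e => e IH ec; apply: var_step => // o' oe; apply: IH => //; lia.
move=> ho; case: (ltnP o c) => [/h []//|co].
case: (eqVneq o (2 * c)%N) => [->|ne]; first exact: var_2c.
have : (o - c < c)%N by lia.
by move/h => [_]; rewrite subnKC.
Qed.
End Radical22.

Lemma radical_idem (T : ideal R) r N : radical T (r ^+ N) -> radical T r.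
Proof. by move=> [M]; rewrite -exprM => h; exists (N * M)%N. Qed.

Lemma IL_comb (A : 'M[R]_(t, m)) q r : IL (Ph A) t q r ->
  exists f : t.-tuple 'I_q -> R, r = \sum_l f l * top (cols (Ph A) t [seq val k | k <- l]).
Proof.
move=> [w ->].
have P0 : exists f : t.-tuple 'I_q -> R, top (0 : ext R t) = \sum_l f l * top (cols (Ph A) t [seq val k | k <- l]).
  by exists (fun=> 0); rewrite raddf0 big1 // => l _; rewrite mul0r.
have PD (x y : ext R t) : (exists f : t.-tuple 'I_q -> R, top x = \sum_l f l * top (cols (Ph A) t [seq val k | k <- l])) ->
    (exists f : t.-tuple 'I_q -> R, top y = \sum_l f l * top (cols (Ph A) t [seq val k | k <- l])) ->
    exists f : t.-tuple 'I_q -> R, top (x + y) = \sum_l f l * top (cols (Ph A) t [seq val k | k <- l]).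
  move=> [f hf] [g hg]; exists (fun l => f l + g l); have -> : top (x + y) = top x + top y by exact: raddfD.
  rewrite hf hg -big_split.
  by apply: eq_bigr => l _; rewrite /= mulrDl.
have PZ (u : R) (x : ext R t) : (exists f : t.-tuple 'I_q -> R, top x = \sum_l f l * top (cols (Ph A) t [seq val k | k <- l])) ->
    exists f : t.-tuple 'I_q -> R, top (u *: x) = \sum_l f l * top (cols (Ph A) t [seq val k | k <- l]).
  move=> [f hf]; exists (fun l => u * f l); rewrite topZ hf mulr_sumr.
  by apply: eq_bigr => l _; rewrite mulrA.
apply: (@ImL_span _ _ t q (Submod P0 PD PZ)) => /= [l hl|]; last by exists w.
case: (eqVneq (size l) t) => [e|ne]; last first.
  exists (fun=> 0); rewrite big1 => [|l' _]; last by rewrite mul0r.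
  by rewrite -top_gr gr_cols_neq 1?eq_sym // raddf0.
have [l0 hl0] : exists l0 : t.-tuple 'I_q, [seq val k | k <- l0] = l.
  have hs : size (pmap insub l : seq 'I_q) == t by rewrite size_pmap_sub (eqP (etrans (esym (all_count _ _)) hl)) e.
  exists (Tuple hs) => /=; rewrite (pmap_filter (insubK _)); apply/all_filterP.
  by apply: sub_all hl => k hk; rewrite insubT.
exists (fun l' => (l' == l0)%:R); rewrite (bigD1 l0) //= eqxx mul1r hl0 big1 ?addr0 // => l' /negbTE ->.
by rewrite mul0r.
Qed.

Local Notation X k := (XS L xx R^o k).

(** At [A0] powers of x_0, .., x_p lie in the ideal modulo the later variables, hence so do all
    their monomials of some degree N, and [open_condition] applies. *)
Lemma open_ideal (Lam : finType) (M : Lam -> 'M[R]_(t, m) -> R) p (W : ideal R) : (p <= n)%N ->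
  (forall l, ppoly (M l)) -> (forall r, W r -> exists q : Lam -> R, r = \sum_l q l * M l A0) ->
  (forall o, (o <= p)%N -> radical (lv L xx W p.+1) (xx o)) ->
  exists N phi, [/\ @coef_polynomial K n t m phi, phi A0 != 0
  & forall A, phi A != 0 -> exists q : Lam -> R,
     X p.+1 (pcmp (Posz N) (\sum_l q l * M l A) - xx p ^+ N)].
Proof.
move=> pn hM hW hx.
have [N hN] := @power_bound K n (lv L xx W p.+1) p (fun o op _ => hx o op).
exists N; apply: (open_condition hM pn) => u e lu.
have [w [/hW [q ->] hw]] := hN u e lu; by exists q.
Qed.

Lemma sigma_open p : (p < c)%N -> exists N phi, [/\ @coef_polynomial K n t m phi, phi A0 != 0
  & forall A, homogeneous_mx a b A -> phi A != 0 -> exists r,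
    [/\ IL (Ph A) t (t + p) r, X p.+1 (r - xx p ^+ N) & poly_deg (Posz N) r]].
Proof.
move=> pc; have pn : (p <= n)%N by lia.
pose W : ideal R := IL Phi t (t + p).
have [|||N [phi [h1 h2 h3]]] := @open_ideal (t.-tuple 'I_(t + p) : finType)
  (fun l A => top (cols (Ph A) t [seq val k | k <- l])) p W pn.
- by move=> l; apply: ppoly_top_cols.
- by move=> r /IL_comb.
- apply: (low_vars (@radical_idem _) pc) => [o ho|r hr].
    exists 1%N; rewrite expr1; apply: lvX.
    have h1 : X p.+1 (xx o *: (1 : R^o)) by apply: XS_x; lia.
    have e1 : xx o *: (1 : R^o) = xx o by exact: mulr1.
    by rewrite e1 in h1.
  by exists 1%N; rewrite expr1; apply: lvW.
exists N, phi; split=> // A hA /h3 [q hq].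
exists (pcmp (Posz N) (\sum_l q l * top (cols (Ph A) t [seq val k | k <- l]))); split=> //; last exact: pcmp_deg.
apply: (@graded_IL K n t m a b A hA (t + p) (Posz N)); apply: submod_sum => l _; apply: idealMl; apply: top_ImL; apply: ImL_cols.
by apply/allP => _ /mapP[k _ ->]; apply: ltn_ord.
Qed.

Lemma J_open e : (c <= e <= 2 * c)%N -> exists N phi, [/\ @coef_polynomial K n t m phi, phi A0 != 0
  & forall A, homogeneous_mx a b A -> phi A != 0 -> exists r,
    [/\ Jid (Ph A) t m r, X e.+1 (r - xx e ^+ N) & poly_deg (Posz N) r]].
Proof.
move=> he; have en : (e <= n)%N by lia.
pose W : ideal R := Jid Phi t m.
have [|||N [phi [h1 h2 h3]]] := @open_ideal (((t.-1).-tuple 'I_m * 'I_t)%type : finType)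
  (fun l A => um A l.1 l.2) e W en.
- by move=> l; apply: ppoly_uu.
- by move=> r /Jid_comb.
- move=> o oe; apply: (all_vars (@radical_idem _)); last lia.
  by move=> r hr; exists 1%N; rewrite expr1; apply: lvW.
exists N, phi; split=> // A hA /h3 [q hq].
exists (pcmp (Posz N) (\sum_l q l * um A l.1 l.2)); split=> //; last exact: pcmp_deg.
rewrite (big_morph (pcmp (Posz N)) (@pcmpD K n (Posz N)) (pcmp0 K n (Posz N))).
apply: submod_sum => l _; rewrite mulrC (pcmpM _ _ (um_deg hA l.1 l.2)).
apply: idealMr; apply: span_gen; exists (ls l.1), l.2.
by split=> //; [exact: ls_size|exact: ls_all].
Qed.

(** Genericity asks for c forms [sg] and c + 1 forms [sJ], so a finite product of polynomials in the
    coefficients suffices. *)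
Theorem generic_open : exists phi, [/\ @coef_polynomial K n t m phi, phi A0 != 0
  & forall A, homogeneous_mx a b A -> phi A != 0 -> exists G : generic c A, True].
Proof.
have /choice [sN hs1] : forall p : 'I_c, _ := fun p => sigma_open (ltn_ord p).
have {hs1}/choice [sp hs] := hs1.
have he (e : 'I_c.+1) : (c <= c + e <= 2 * c)%N by have := ltn_ord e; lia.
have /choice [jN hj1] : forall e : 'I_c.+1, _ := fun e => J_open (he e).
have {hj1}/choice [jp hj] := hj1.
exists (fun A => (\prod_(p < c) sp p A) * \prod_(e < c.+1) jp e A); split.
- by apply: cpolyM; apply: cpoly_prod => p; [case: (hs p)|case: (hj p)].
- by rewrite mulf_neq0 //; apply/prodf_neq0 => p _; [case: (hs p)|case: (hj p)].
move=> A hA; rewrite mulf_eq0 negb_or => /andP[/prodf_neq0 h1 /prodf_neq0 h2].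
have /choice [sg hsg] : forall p : nat, exists r : R * nat, (p < c)%N ->
    [/\ IL (Ph A) t (t + p) r.1, X p.+1 (r.1 - xx p ^+ r.2) & poly_deg (Posz r.2) r.1].
  move=> p; case: (ltnP p c) => [pc|_]; last by exists (0, 0%N).
  by have [_ _ /(_ A hA (h1 (Ordinal pc) isT)) [r hr]] := hs (Ordinal pc); exists (r, sN (Ordinal pc)).
have /choice [sJ hsJ] : forall e : nat, exists r : R * nat, (c <= e <= 2 * c)%N ->
    [/\ Jid (Ph A) t m r.1, X e.+1 (r.1 - xx e ^+ r.2) & poly_deg (Posz r.2) r.1].
  move=> e; case he' : (c <= e <= 2 * c)%N; last by exists (0, 0%N).
  have ec : (e - c < c.+1)%N by lia.
  have [_ _ /(_ A hA (h2 (Ordinal ec) isT)) [r hr]] := hj (Ordinal ec); exists (r, jN (Ordinal ec)) => _.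
  by move: hr; rewrite /= subnKC //; lia.
unshelve eexists.
  exists (fun p => (sg p).1) (fun p => (sg p).2) (fun p => Posz (sg p).2)
    (fun e => (sJ e).1) (fun e => (sJ e).2) (fun e => Posz (sJ e).2) => e he'.
  - by case: (hsg e he').
  - by case: (hsg e he').
  - by case: (hsg e he').
  - by case: (hsJ e he').
  - by case: (hsJ e he').
  - by case: (hsJ e he').
by [].
Qed.
End Phi0.

(** * From scalar endomorphisms to simplicity and indecomposability; conclusion *)

Section Indecomposable.
Variables (K : fieldType) (S : gralg K) (F : sheaf S).

(* The projection onto a direct summand is a scalar, hence 0 or invertible. *)
Lemma line_indecomposable : line (sheaf_id F : global_hom F F) -> indecomposable F.
Proof.
move=> [id0 hk]; split.
  move=> z; case/eqP: id0; apply: shmor_ext => V h x; exact: etrans (z V _) (esym (z V _)).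
move=> E G [f hf].
have inv V (h : psub V (whole S)) : exists g, cancel (sm_fun f h) g /\ cancel g (sm_fun f h).
  by case: (hf V h) => g; exists g.
pose g V (h : psub V (whole S)) := sval (cid (inv V h)).
have gK V (h : psub V (whole S)) x : g V h (sm_fun f h x) = x := (svalP (cid (inv V h))).1 x.
have fK V (h : psub V (whole S)) y : sm_fun f h (g V h y) = y := (svalP (cid (inv V h))).2 y.
have inj V (h : psub V (whole S)) x y : sm_fun f h x = sm_fun f h y -> x = y.
  by move=> e; rewrite -(gK V h x) e gK.
pose e V (h : psub V (whole S)) (x : F V) : F V := g V h ((sm_fun f h x).1, 0).
have fe V (h : psub V (whole S)) x : sm_fun f h (e V h x) = ((sm_fun f h x).1, 0) by exact: fK.
have e_lin V (h : psub V (whole S)) : linear (e V h).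
  move=> u x y; apply: (inj V h); rewrite fe [RHS]sm_lin !fe sm_lin.
  transitivity (u *: (sm_fun f h x).1 + (sm_fun f h y).1, u *: (0 : G V) + 0); last by [].
  by rewrite scaler0 addr0.
have e_nat V W (h : psub V (whole S)) (k : psub W V) (x : F V) :
    sh_res k (e V h x) = e W (psub_trans k h) (sh_res k x).
  apply: (inj W (psub_trans k h)); rewrite fe -!sm_nat fe.
  by congr (_, _); apply: sh_res0.
have [kap hkap] := hk (@Shmor K S F F (whole S) e e_lin e_nat).
pose s V (h : psub V (whole S)) := oring_res h (oring_const (whole S) kap).
have es V (h : psub V (whole S)) x : e V h x = s V h *: x.
  exact: (congr1 (fun q : shmor F F (whole S) => sm_fun q h x) hkap).
have key V (h : psub V (whole S)) (y1 : E V) (y2 : G V) : y1 = s V h *: y1 /\ s V h *: y2 = 0.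
  have h1 := fe V h (g V h (y1, y2)); rewrite es fK in h1.
  have sf : sm_fun f h (s V h *: g V h (y1, y2)) = s V h *: (y1, y2) :> dsum E G V.
    have := sm_lin f h (s V h) (g V h (y1, y2)) 0; rewrite addr0 fK => ->.
    have -> : sm_fun f h 0 = 0.
      by have := sm_lin f h (-1) 0 0; rewrite scaler0 addr0 scaleN1r addNr.
    by rewrite addr0.
  rewrite sf in h1; split; first exact: (esym (congr1 fst h1)).
  exact: (congr1 snd h1).
pose hV V : psub V (whole S) := fun _ _ => Logic.I.
case: (eqVneq kap 0) => [k0|k0]; [left=> V y|right=> V y].
  have [-> _] := key V (hV V) y 0.
  have -> : s V (hV V) = 0.
    rewrite /s k0 rmorph0; have := oring_resB (hV V) 0 0.
    by rewrite !subrr.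
  by rewrite scale0r.
have [_ h2] := key V (hV V) 0 y.
have e1 : oring_res (hV V) (oring_const (whole S) kap^-1) * s V (hV V) = 1.
  by rewrite /s -oring_resM -rmorphM mulVf // rmorph1 oring_res1.
by rewrite -[y]scale1r -e1 -scalerA h2 scaler0.
Qed.

Lemma line_simple : line (sheaf_id F : global_hom F F) -> simple_sheaf F.
Proof. by move=> l; exact: (line_Kiso l (line_K K)). Qed.
End Indecomposable.

Theorem theorem4p3 (K : closedFieldType) (charK0 : [pchar K] =i pred0)
    (n c t : nat) (c_ge2 : (2 <= c)%N) (t_ge2 : (2 <= t)%N)
    (n_ge : (2 * c <= n)%N)
    (a : 'I_(t + c - 1) -> int) (b : 'I_t -> int)
    (pos_deg : forall i j, 0 < a j - b i)
    (max_n2_lt : forall n1 n2 : int,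
       EN_twist a b 1 n1 -> EN_twist a b 2 n2 -> n2 < 2 * n1) :
  @general_mx K n t (t + c - 1) a b (fun A =>
    standard_determinantal A c ->
    let N := normal_sheaf_sym b A in
    let CN := conormal_mod A in
    [/\ forall i : int, -1 <= i <= c%:Z - 1 ->
          Kiso (global_hom (N i) (N i)) (hom0 CN CN) /\ Kiso (hom0 CN CN) K^o,
        simple_sheaf (normal_sheaf A) /\ indecomposable (normal_sheaf A)
      & forall i : int, -1 <= i <= c%:Z - 1 ->
          simple_sheaf (N i) /\ indecomposable (N i)]).
Proof.
have mE : (t + c - 1 = t + c.-1)%N by clear -c_ge2; lia.
have c_gt0 : (0 < c)%N by apply: ltnW.
have t_gt0 : (0 < t)%N by apply: ltnW.
have [phi [phi_poly phi_A0 phi_gen]] := @generic_open K n c t _ a b charK0 c_gt0 t_ge2 mE n_ge pos_deg.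
exists (fun A => phi A != 0); split.
- exists (fun f => f = phi); split=> [f ->//|A _].
  by split=> [h|[_ [->]]] //; exists phi.
- by exists (A0 K n c a b); split=> //; apply: A0_hom.
move=> A hA phiA _ N CN; have [G _] := phi_gen A hA phiA.
have sline V LC TF := @sheaf_line K n t c _ a b A hA G c_ge2 t_ge2 mE n_ge pos_deg max_n2_lt V LC TF.
have l0 := sline _ (gself_cyclic a b A) (gself_torsion_free hA c_gt0 mE n_ge).
(* Three shapes of S_i M: the ring for i = 0, a genuine symmetric power for i = k + 1, where k < c
   gives torsion-freeness, and the dual for i = -1. *)
have lN i : -1 <= i <= c%:Z - 1 -> line (sheaf_id (N i) : global_hom (N i) (N i)).
  case: i => [[_|k hk]|k _]; first exact: l0.
    apply: (sline _ (sym_cyclic hA k.+1)) => w; apply: (sym_torsion_free hA c_gt0 mE n_ge t_gt0).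
    clear -hk; lia.
  exact: (sline _ (dual_cyclic hA) (dual_torsion_free hA c_gt0 mE n_ge)).
have lH : line (id_hom0 CN) := hom0_line hA G c_ge2 t_gt0 mE n_ge pos_deg max_n2_lt.
split=> [i hi||i hi].
- by split; [exact: (line_Kiso (lN i hi) lH)|exact: (line_Kiso lH (line_K K))].
- exact: (conj (line_simple l0) (line_indecomposable l0)).
exact: (conj (line_simple (lN i hi)) (line_indecomposable (lN i hi))).
Qed.
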